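(* Let $\varepsilon\ge0$. Then there exists a unique weak solution $w$ of the limit problem $$w_t=\mathcal{D}(w)_{xx}\ \text{in }S_T,\qquad w(x,0)=w_0(x):=-V_0\ \text{for }x>0,\qquad w(0,t)=U_0\ \text{for }t\in(0,T).$$
   Context: Fix $T>0$ and constants $U_0,V_0>0$. Write $\mathbb{R}^+=[0,\infty)$ and $S_T=(0,\infty)\times(0,T)$. The function $\phi\in C^2(\mathbb{R})$ is strictly increasing, $\phi'$ is strictly increasing on $[0,\infty)$, $\phi(s)>0$ for $s>0$, and $\phi(0)=\phi'(0)=0$. Define $\mathcal{D}(s)=\phi(s)$ for $s\ge0$ and $\mathcal{D}(s)=-\varepsilon\phi(-s)$ for $s<0$. Let $\mathcal{F}_T$ be the set of $\xi\in C^1([0,\infty)\times[0,T])$ with $\xi(0,t)=0$ for $t\in(0,T)$, $\xi(\cdot,T)=0$, and $\mathrm{supp}\,\xi\subset[0,J]\times[0,T]$ for some $J>0$. A function $w$ is a weak solution of the limit problem if (i) $w\in L^\infty(S_T)$; (ii) $\mathcal{D}(w)\in\mathcal{D}(\hat w)+L^2(0,T;W^{1,2}_0(\mathbb{R}^+))$, where $\hat w\in C^\infty(\mathbb{R}^+)$ is a smooth function with $\hat w(0)=U_0$ and $\hat w(x)=-V_0$ for $x>1$; (iii) $\int_{\mathbb{R}^+}w_0(x)\xi(x,0)\,dx+\iint_{S_T}w\xi_t\,dx\,dt=\iint_{S_T}\mathcal{D}(w)_x\xi_x\,dx\,dt$ for all $\xi\in\mathcal{F}_T$. *)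

(* Defs.v *)
From HB Require Import structures.
From mathcomp Require Import all_boot all_order all_algebra.
From mathcomp Require Import all_classical all_reals all_analysis.

Set Implicit Arguments.
Unset Strict Implicit.
Unset Printing Implicit Defensive.

Import Order.TTheory GRing.Theory Num.Theory.
Import numFieldNormedType.Exports.

Local Open Scope ring_scope.
Local Open Scope classical_set_scope.

Section limit_problem.
Context {R : realType}.

Local Notation mu := (@lebesgue_measure R).
Local Notation mu2 := (lebesgue_measure \x lebesgue_measure)%E.

(* Points of the plane are written (x, t), space variable first. *)

Definition halfline : set R := [set x | 0 < x].
Definition strip (T : R) : set (R * R) := [set p | 0 < p.1 /\ 0 < p.2 < T].
Definition closed_strip (T : R) : set (R * R) :=
  [set p | 0 <= p.1 /\ 0 <= p.2 <= T].

Definition dx (f : R * R -> R) (p : R * R) : R := 'D_(1, 0) f p.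
Definition dt (f : R * R -> R) (p : R * R) : R := 'D_(0, 1) f p.

Definition slice (u : R * R -> R) (t : R) : R -> R := fun x => u (x, t).

Definition admissible (phi : R -> R) : Prop :=
  [/\ [/\ forall s, derivable phi s 1,
          forall s, derivable phi^`() s 1 &
          continuous phi^`(2)],
      {homo phi : r s / r < s},
      {in `[0, +oo[%R &, {homo phi^`() : r s / r < s}},
      forall s, 0 < s -> 0 < phi s &
      phi 0 = 0 /\ phi^`() 0 = 0].

Definition Dfun (eps : R) (phi : R -> R) (s : R) : R :=
  if 0 <= s then phi s else - eps * phi (- s).

(* Smoothness up to the endpoint: every derivative on (0, +oo) has a finite
   limit at 0+, and f itself is right-continuous at 0. *)
Definition smooth_halfline (f : R -> R) : Prop :=
  [/\ forall n x, 0 < x -> derivable f^`(n) x 1,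
      forall n, exists l : R, f^`(n) x @[x --> 0^'+] --> l &
      f x @[x --> 0^'+] --> f 0].

(* C_c^oo((0, +oo)) *)
Definition test_halfline (psi : R -> R) : Prop :=
  [/\ forall n x, derivable psi^`(n) x 1,
      compact (closure [set x | psi x != 0]) &
      closure [set x | psi x != 0] `<=` halfline].

Definition weak_derivative (f g : R -> R) : Prop :=
  [/\ locally_integrable halfline f,
      locally_integrable halfline g &
      forall psi, test_halfline psi ->
        \int[mu]_(x in halfline) (f x * derive1 psi x) =
        - \int[mu]_(x in halfline) (g x * psi x)].

Definition L2_halfline (f : R -> R) : Prop := f \_ halfline \in Lfun mu 2%:E.

Definition W12 (f : R -> R) : Prop :=
  L2_halfline f /\ exists2 g, weak_derivative f g & L2_halfline g.

(* A representative of the weak derivative; it is meaningful only if a weak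
   derivative exists, and is then unique up to null sets. *)
Definition weakD (f : R -> R) : R -> R :=
  xget (cst 0) [set g | weak_derivative f g].

(* Meaningful only for f in W12. *)
Definition W12_norm (f : R -> R) : R :=
  Num.sqrt (\int[mu]_(x in halfline) (f x ^+ 2 + weakD f x ^+ 2)).

(* The closure of C_c^oo((0, +oo)) in W^{1,2}. *)
Definition W12_0 (f : R -> R) : Prop :=
  W12 f /\ exists psi : nat -> R -> R,
    (forall n, test_halfline (psi n)) /\
    W12_norm (f \- psi n) @[n --> \oo] --> (0 : R).

Definition simple_W12_0 (s : R -> R -> R) : Prop :=
  exists (k : nat) (A : 'I_k -> set R) (f : 'I_k -> R -> R),
    [/\ forall i, measurable (A i), forall i, W12_0 (f i) &
        forall t x, s t x = \sum_(i < k) \1_(A i) t * f i x].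

(* The Bochner space L^2(0, T; W^{1,2}_0): the map t |-> u(., t) is an a.e.
   limit of simple functions and its norm is square integrable. *)
Definition L2_W12_0 (T : R) (u : R * R -> R) : Prop :=
  [/\ {ae mu, forall t, 0 < t < T -> W12_0 (slice u t)},
      exists s : nat -> R -> R -> R, (forall n, simple_W12_0 (s n)) /\
        {ae mu, forall t, 0 < t < T ->
          W12_norm (slice u t \- s n t) @[n --> \oo] --> (0 : R)} &
      (\int[mu]_(t in `]0%R, T[) ((W12_norm (slice u t)) ^+ 2)%:E < +oo)%E].

(* g represents u_x on the strip. The representative has to be jointly
   measurable, which a choice of weak derivative for each t does not ensure. *)
Definition weak_dx (T : R) (u g : R * R -> R) : Prop :=
  measurable_fun (strip T) g /\
  {ae mu, forall t, 0 < t < T -> weak_derivative (slice u t) (slice g t)}.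

(* C^1 on the closed strip: the partial derivatives on the open strip extend
   continuously to the closed one. *)
Definition C1_closed_strip (T : R) (xi : R * R -> R) : Prop :=
  {within closed_strip T, continuous xi} /\
  exists gx gt : R * R -> R,
    [/\ {within closed_strip T, continuous gx},
        {within closed_strip T, continuous gt} &
        forall p, strip T p ->
          is_derive p (1, 0) xi (gx p) /\ is_derive p (0, 1) xi (gt p)].

Definition test_strip (T : R) (xi : R * R -> R) : Prop :=
  [/\ C1_closed_strip T xi,
      forall t, 0 < t < T -> xi (0, t) = 0,
      forall x, 0 <= x -> xi (x, T) = 0 &
      exists2 J, 0 < J &
        closure [set p | closed_strip T p /\ xi p != 0] `<=`
        [set p | 0 <= p.1 <= J /\ 0 <= p.2 <= T]].

Definition weak_solution (T : R) (D w0 what : R -> R) (w : R * R -> R) : Prop :=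
  [/\ w \_ (strip T) \in Lfun mu2 +oo%E,
      L2_W12_0 T (fun p => D (w p) - D (what p.1)) &
      exists2 Dwx, weak_dx T (D \o w) Dwx &
        forall xi, test_strip T xi ->
          \int[mu]_(x in halfline) (w0 x * xi (x, 0)) +
          \int[mu2]_(p in strip T) (w p * dt xi p) =
          \int[mu2]_(p in strip T) (Dwx p * dx xi p)].

End limit_problem.

(* Main.v *)
(** Existence. Write [D' = 2 k] and look for [w (x, t) = f (x / sqrt t)] with [f]
    nonincreasing from [U0] to [- V0]. Taking the value [s = f y] as the independent
    variable, the flux [- (D o f)' y = q (f y)] satisfies [q'' = - k / q] on [(- V0, U0)]
    with [q (- V0) = q' U0 = 0], and [f] is the generalised inverse of [2 q']. The function
    [q] is the limit, as [d -> 0], of fixed points of the order-reversing map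
    [q |-> d + int_a^s int_r^b k / q]; no regularity of [f] is needed, because the level
    sets of [w] are the parabolas [x = 2 q' s sqrt t], on which the weak identity is
    verified by a change of variables before integrating over [s] (layer cake).

    Uniqueness. Let [z] be the difference of two solutions, [d] that of their images
    under [D] and [g = d_x]. Testing with products [psi x * theta t] shows that
    [G (x, t) = int_0^t g (x, .)] equals [c t + int_0^x z (., t)]. Since [d] is the
    primitive of [g], integrating [((c + int_0^x z) d)_x = z d + G g] twice in [x] and
    once in [t] gives
    [iint (N - x)^+ z d + 1/2 int (N - x)^+ G (x, T)^2 dx = iint_(x < N) G d],
    whose right-hand side is bounded independently of [N]. As [z d >= 0], letting
    [N -> oo] gives [z d = 0], hence [d = 0], [g = 0], [G = 0] and finally [z = 0]. *)
Require Import Defs.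
From HB Require Import structures.
From mathcomp Require Import all_boot all_order all_algebra.
From mathcomp Require Import all_classical all_reals all_analysis.
From mathcomp Require Import measurable_realfun ess_sup_inf.
From mathcomp Require Import ring lra.

Set Implicit Arguments.
Unset Strict Implicit.
Unset Printing Implicit Defensive.

Import Order.TTheory GRing.Theory Num.Theory.
Import numFieldNormedType.Exports.

Local Open Scope ring_scope.
Local Open Scope classical_set_scope.

(** * Integration on the line and in the plane *)

(** With [y = x / sqrt t] the equation reads [(D o f)'' = - y f' / 2]. Since [q = - (D o f)'] is
    regarded as a function of [s = f y], this gives [q' (f y) = y / 2], and [q = - 2 k f'] becomes
    [q q'' = - k]: hence the factors [2].

    The obstacle is degeneracy. [D'] vanishes at [0] and, when [eps = 0], on all of [[- V0, 0]],
    where [q] is affine and [f] jumps. The profile is therefore a generalised inverse only, and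
    [1 / q] is singular at [- V0]; a positive boundary value [d] removes the singularity.

    [W12_0] is a closure of test functions, so it has to be entered and left by hand: a member is
    the primitive of its derivative, and a square integrable primitive of a bounded square
    integrable function is a limit of test functions.

    For uniqueness the natural test function, the integral of [d] over later times, is neither [C1]
    nor compactly supported. Smooth products are used instead, and the weight [N - x] localises the
    argument; the price is the flux term on the right, controlled by the [L2] bounds. *)

Section measure_kit.
Context d (T : measurableType d) (R : realType).
Variable m : {measure set T -> \bar R}.
Implicit Types (D : set T) (f g : T -> R).

Lemma integrable_dom D f g : measurable D -> measurable_fun D f ->
  m.-integrable D (EFin \o g) -> (forall x, D x -> `|f x| <= g x) ->
  m.-integrable D (EFin \o f).
Proof.
move=> mD mf ig fg; apply: (le_integrable mD _ _ ig); first exact/measurable_EFinP.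
move=> x Dx /=; rewrite lee_fin (le_trans (fg _ Dx))// ler_norm//.
Qed.

Lemma integrable_bnd D f (M : R) : measurable D -> (m D < +oo)%E ->
  measurable_fun D f -> (forall x, D x -> `|f x| <= M) ->
  m.-integrable D (EFin \o f).
Proof.
move=> mD Doo mf fM; apply: measurable_bounded_integrable => //.
exists M; split; first exact: num_real.
by move=> x Mx y Dy; rewrite /= (le_trans (fM _ Dy))// ltW.
Qed.

Lemma integrable_add D f g : measurable D ->
  m.-integrable D (EFin \o f) -> m.-integrable D (EFin \o g) ->
  m.-integrable D (EFin \o (fun x => f x + g x)).
Proof. by move=> mD fi gi; apply: eq_integrable (integrableD mD fi gi). Qed.

Lemma integrable_sub D f g : measurable D ->
  m.-integrable D (EFin \o f) -> m.-integrable D (EFin \o g) ->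
  m.-integrable D (EFin \o (fun x => f x - g x)).
Proof. by move=> mD fi gi; apply: eq_integrable (integrableB mD fi gi). Qed.

Lemma integrable_scale D (k : R) f : measurable D ->
  m.-integrable D (EFin \o f) -> m.-integrable D (EFin \o (fun x => k * f x)).
Proof. by move=> mD fi; apply: eq_integrable (integrableZl mD k fi). Qed.

Lemma Rintegral_0 D : \int[m]_(x in D) (0 : R) = 0.
Proof. by rewrite /Rintegral integral0. Qed.

Lemma RintegralN D f : measurable D -> m.-integrable D (EFin \o f) ->
  \int[m]_(x in D) (- f x) = - \int[m]_(x in D) f x.
Proof.
move=> mD fi; rewrite -[RHS]mulN1r -RintegralZl//.
by apply: eq_Rintegral => x _; rewrite mulN1r.
Qed.

Lemma EFin_Rintegral D f : m.-integrable D (EFin \o f) -> measurable D ->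
  (\int[m]_(x in D) f x)%:E = (\int[m]_(x in D) (f x)%:E)%E.
Proof. by move=> fi mD; rewrite /Rintegral fineK//; exact: integrable_fin_num. Qed.

Lemma ae_eq_Rintegral D f g : measurable D ->
  measurable_fun D f -> measurable_fun D g ->
  ae_eq m D f g -> \int[m]_(x in D) f x = \int[m]_(x in D) g x.
Proof.
move=> mD mf mg fg; congr fine; apply: ae_eq_integral => //; try exact/measurable_EFinP.
by apply: filterS fg => x /= /[apply] ->.
Qed.

Lemma Rintegral0_ae_eq0 D f : measurable D -> m.-integrable D (EFin \o f) ->
  (forall x, D x -> 0 <= f x) -> \int[m]_(x in D) f x = 0 -> ae_eq m D f (cst 0).
Proof.
move=> mD fi f0 If; have mf := measurable_int m fi.
have : (\int[m]_(x in D) `|(EFin \o f) x|)%E = 0%E.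
  rewrite -(@EFin_Rintegral _ (fun x => `|f x|))//; last exact: integrable_norm.
  congr EFin; rewrite -[RHS]If; apply: eq_Rintegral => x /set_mem Dx.
  by rewrite ger0_norm// f0.
move/(ae_eq_integral_abs m mD mf); apply: filterS => x /= /[apply] [[]].
exact.
Qed.

End measure_kit.

Section fubini_kit.
Context d1 d2 (T1 : measurableType d1) (T2 : measurableType d2) (R : realType).
Variables (m1 : {sigma_finite_measure set T1 -> \bar R})
          (m2 : {sigma_finite_measure set T2 -> \bar R}).
Implicit Type f : T1 * T2 -> R.

(** Inner integrals are finite only for almost every [x]. On the exceptional null set [fine] returns
    a meaningless number, which the outer integral does not see. *)
Lemma Rfubini1 f : (m1 \x m2)%E.-integrable setT (EFin \o f) ->
  \int[m1]_x \int[m2]_y f (x, y) = \int[(m1 \x m2)%E]_p f p.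
Proof.
move=> fi; rewrite /Rintegral -integral12_prod_meas1//; congr fine.
apply: ae_eq_integral => //.
- have := measurable_fubini_F fi => mF.
  by apply/measurable_EFinP; apply: measurableT_comp mF.
- exact: (measurable_fubini_F fi).
- apply: filterS (ae_integrable1 fi) => x /= fxi _.
  by rewrite fineK//; exact: (integrable_fin_num measurableT fxi).
Qed.

Lemma Rfubini2 f : (m1 \x m2)%E.-integrable setT (EFin \o f) ->
  \int[m2]_y \int[m1]_x f (x, y) = \int[(m1 \x m2)%E]_p f p.
Proof.
move=> fi; rewrite /Rintegral -integral21_prod_meas1//; congr fine.
apply: ae_eq_integral => //.
- have := measurable_fubini_G fi => mF.
  by apply/measurable_EFinP; apply: measurableT_comp mF.
- exact: (measurable_fubini_G fi).
- apply: filterS (ae_integrable2 fi) => x /= fxi _.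
  by rewrite fineK//; exact: (integrable_fin_num measurableT fxi).
Qed.

Lemma integrable_tensor (f : T1 -> R) (g : T2 -> R) :
  m1.-integrable setT (EFin \o f) -> m2.-integrable setT (EFin \o g) ->
  (m1 \x m2)%E.-integrable setT (EFin \o (fun p => f p.1 * g p.2)).
Proof.
move=> fi gi.
have mf : measurable_fun setT f by apply/measurable_EFinP; exact: measurable_int fi.
have mg : measurable_fun setT g by apply/measurable_EFinP; exact: measurable_int gi.
apply/integrable12ltyP.
  apply/measurable_EFinP/measurable_funM; exact: measurableT_comp.
under eq_integral => x _.
  under eq_integral => y _ do rewrite /= normrM EFinM.
  rewrite ge0_integralZl_EFin//; last first.
    by apply/measurable_EFinP; exact: measurableT_comp.
  over.
rewrite ge0_integralZr//=.
- move/integrableP: fi => [_ fi]; move/integrableP: gi => [_ gi].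
  apply: lte_mul_pinfty => //; first exact: integral_ge0.
  by rewrite ge0_fin_numE//; exact: integral_ge0.
- by apply/measurable_EFinP; exact: measurableT_comp.
- exact: integral_ge0.
Qed.

End fubini_kit.

(** * Primitives from the origin and integration by parts *)

Section line_kit.
Context {R : realType}.
Local Notation mu := (@lebesgue_measure R).
Implicit Types (f g : R -> R).

(** For [x < 0] the interval is empty and the value is [0], so this is a primitive on the half-line
    only. *)
Definition prim f (x : R) : R := \int[mu]_(y in `[0, x]) f y.

Lemma prim_restrict J f x : x <= J -> prim (f \_ `[0, J]) x = prim f x.
Proof.
move=> xJ; apply: eq_Rintegral => y /set_mem/=; rewrite in_itv/= => /andP[y0 yx].
by rewrite patchE mem_set//= in_itv/= y0 (le_trans yx).
Qed.

Lemma prim_restrict0 J f x : J <= x -> prim (f \_ `[0, J]) x = prim f J.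
Proof.
move=> Jx; rewrite /prim -Rintegral_mkcondr; congr Rintegral.
rewrite seteqP; split => y /=; rewrite !in_itv/=; last by move=> /andP[-> /[dup] h ->]; rewrite (le_trans h).
by move=> [] /andP[-> _] /andP[_ ->].
Qed.

Lemma integrable_restrictT (D : set R) f : measurable D ->
  mu.-integrable D (EFin \o f) -> mu.-integrable setT (EFin \o (f \_ D)).
Proof. by move=> mD; rewrite -restrict_EFin => /integrable_mkcond; exact. Qed.

(** Fubini for [f x * g y] on the square [[0, J]^2], cut along the diagonal: the part below gives
    the left-hand integral, the part above the subtracted one. Only integrability of [f] and [g]
    enters, which is what makes it usable for weak derivatives. *)
Lemma prim_ibp J f g :
  mu.-integrable `[0, J] (EFin \o f) -> mu.-integrable `[0, J] (EFin \o g) ->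
  \int[mu]_(x in `[0, J]) (f x * prim g x) =
  prim f J * prim g J - \int[mu]_(x in `[0, J]) (prim f x * g x).
Proof.
move=> fi gi.
set f' := f \_ `[0, J]; set g' := g \_ `[0, J].
have fi' : mu.-integrable setT (EFin \o f') by exact: integrable_restrictT.
have gi' : mu.-integrable setT (EFin \o g') by exact: integrable_restrictT.
have fgi := integrable_tensor fi' gi'.
have mle : measurable_fun setT (fun p : R * R => p.2 <= p.1).
  by apply: measurable_fun_ler.
have mF : measurable_fun setT (fun p : R * R => f' p.1 * g' p.2).
  by apply/measurable_EFinP; exact: measurable_int fgi.
pose A : set (R * R) := [set p | p.2 <= p.1].
have mA : measurable A by rewrite -[A]setTI; exact: mle.
have iA : (mu \x mu)%E.-integrable setT (EFin \o ((fun p => f' p.1 * g' p.2) \_ A)).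
  by rewrite -restrict_EFin; apply/integrable_restrict => //; rewrite setTI; exact: integrableS fgi.
have iB : (mu \x mu)%E.-integrable setT (EFin \o ((fun p => f' p.1 * g' p.2) \_ (~` A))).
  by rewrite -restrict_EFin; apply/integrable_restrict => //; [exact: measurableC|rewrite setTI; apply: integrableS fgi => //; exact: measurableC].
have E1 : \int[(mu \x mu)%E]_p ((fun p => f' p.1 * g' p.2) \_ A) p
   = \int[mu]_(x in `[0, J]) (f x * prim g x).
  rewrite -Rfubini1// [RHS]Rintegral_mkcond; apply: eq_Rintegral => x _.
  rewrite patchE; case: ifPn => [/set_mem/= xJ|xJ]; last first.
    rewrite -[RHS](Rintegral_0 mu setT).
    apply: eq_Rintegral => y _; rewrite patchE; case: ifP => // _.
    by rewrite /f' /= patchE (negbTE xJ) mul0r.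
  move: (xJ); rewrite in_itv/= => /andP[x0 xJ'].
  have -> : prim g x = \int[mu]_y (g' \_ `]-oo, x]) y.
    rewrite -Rintegral_mkcond -Rintegral_mkcondr; congr Rintegral.
    rewrite seteqP; split => y /=; rewrite !in_itv/=.
      by move=> /andP[y0 yx]; rewrite y0 yx (le_trans yx).
    by move=> [-> /andP[->]].
  rewrite -RintegralZl//; last first.
    by rewrite -restrict_EFin; apply/integrable_restrict => //; rewrite setTI; exact: integrableS gi'.
  apply: eq_Rintegral => y _; rewrite !patchE.
  have -> : ((x, y) \in A) = (y \in `]-oo, x]%classic).
    by apply/idP/idP => /set_mem h; apply/mem_set; move: h; rewrite /A/= in_itv.
  by case: ifP => _; rewrite ?mulr0//= /f' patchE mem_set.
have E2 : \int[(mu \x mu)%E]_p ((fun p => f' p.1 * g' p.2) \_ (~` A)) p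
   = \int[mu]_(x in `[0, J]) (prim f x * g x).
  rewrite -Rfubini2// [RHS]Rintegral_mkcond; apply: eq_Rintegral => x _.
  rewrite patchE; case: ifPn => [/set_mem/= xJ|xJ]; last first.
    rewrite -[RHS](Rintegral_0 mu setT).
    apply: eq_Rintegral => y _; rewrite patchE; case: ifP => // _.
    by rewrite /g' /= patchE (negbTE xJ) mulr0.
  move: (xJ); rewrite in_itv/= => /andP[x0 xJ'].
  have -> : prim f x = \int[mu]_y (f' \_ `]-oo, x[) y.
    rewrite -Rintegral_mkcond -[LHS]Rintegral_itv_bndo_bndc; last first.
      apply: integrableS fi => //; apply: subset_itv; rewrite bnd_simp//.
    rewrite -Rintegral_mkcondr; congr Rintegral.
    rewrite seteqP; split => y /=; rewrite !in_itv/=.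
      by move=> /andP[y0 yx]; rewrite y0 yx (le_trans (ltW yx)).
    by move=> [-> /andP[->]].
  rewrite -RintegralZr//; last first.
    by rewrite -restrict_EFin; apply/integrable_restrict => //; rewrite setTI; exact: integrableS fi'.
  apply: eq_Rintegral => y _; rewrite !patchE.
  have -> : ((y, x) \in ~` A) = (y \in `]-oo, x[%classic).
    by apply/idP/idP; rewrite !inE /A /= in_itv/= ltNge => /negP.
  by case: ifP => _; rewrite ?mul0r//= /g' patchE mem_set.
rewrite -E1 -E2; apply/esym/eqP; rewrite subr_eq; apply/eqP.
rewrite -RintegralD//.
have -> : \int[(mu \x mu)%E]_p (((fun p => f' p.1 * g' p.2) \_ A) p + ((fun p => f' p.1 * g' p.2) \_ (~` A)) p)
   = \int[(mu \x mu)%E]_p (f' p.1 * g' p.2).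
  apply: eq_Rintegral => p _; rewrite !patchE in_setC.
  by case: (p \in A); rewrite /= ?addr0 ?add0r.
rewrite -Rfubini1//= /prim !(Rintegral_mkcond mu `[0, J]) -/f' -/g'.
rewrite -RintegralZr//; apply: eq_Rintegral => x _.
by rewrite RintegralZl.
Qed.

End line_kit.

(** * Smooth cut-off functions *)

Section derive_kit.
Context {R : realType}.
Local Notation mu := (@lebesgue_measure R).
Implicit Types (f g F : R -> R) (x c a b k : R).

Lemma isdD f g x a b : is_derive x 1 f a -> is_derive x 1 g b ->
  is_derive x 1 (fun y => f y + g y) (a + b).
Proof. by move=> fa gb; exact: is_deriveD. Qed.

Lemma isdB f g x a b : is_derive x 1 f a -> is_derive x 1 g b ->
  is_derive x 1 (fun y => f y - g y) (a - b).
Proof. by move=> fa gb; exact: is_deriveB. Qed.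

Lemma isdM f g x a b : is_derive x 1 f a -> is_derive x 1 g b ->
  is_derive x 1 (fun y => f y * g y) (a * g x + f x * b).
Proof.
move=> fa gb; apply: is_derive_eq; rewrite /GRing.scale /=; ring.
Qed.

Lemma isdZ f x k a : is_derive x 1 f a -> is_derive x 1 (fun y => k * f y) (k * a).
Proof. by move=> fa; exact: (is_deriveZ (f := f)). Qed.

Lemma isd_cst x k : is_derive x 1 (fun=> k : R) (0 : R).
Proof. exact: is_derive_cst. Qed.

Lemma isd_comp f g x a b : is_derive (g x) 1 f a -> is_derive x 1 g b ->
  is_derive x 1 (fun y => f (g y)) (a * b).
Proof. by move=> fa gb; exact: is_derive1_comp. Qed.

Lemma isd_affine f x k c a : is_derive (k * x + c) 1 f a ->
  is_derive x 1 (fun y => f (k * y + c)) (a * k).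
Proof.
move=> fa; have kd : is_derive x 1 (fun y => k * y + c) k.
  apply: is_derive_eq (isdD (isdZ k (is_derive_id x 1)) (isd_cst x c)) _.
  by rewrite mulr1 addr0.
exact: (isd_comp (g := fun y => k * y + c) fa kd).
Qed.

Lemma isd_derive1 f x a : is_derive x 1 f a -> (derive1 f) x = a.
Proof. by move=> fa; rewrite derive1E; exact: derive_val. Qed.

Lemma isd_derivable f x a : is_derive x 1 f a -> derivable f x 1.
Proof. by case. Qed.

Lemma isd_cont f x a : is_derive x 1 f a -> {for x, continuous f}.
Proof.
by case=> /derivable1_diffP/differentiable_continuous.
Qed.

(** Expansion form of the derivative, without division by [h]. It serves where a function is glued
    at a point and where difference quotients between neighbouring points are averaged. *)
Lemma isd_epsP f x a : (forall e, 0 < e -> exists2 d, 0 < d &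
    forall h, `|h| < d -> `|f (x + h) - f x - a * h| <= e * `|h|) <->
  is_derive x 1 f a.
Proof.
split=> [H|fa e e0].
  have C : (fun h => h^-1 *: (f (h *: 1 + x) - f x)) @ 0^' --> a.
    apply/cvgrPdist_le => e e0; have [d d0 Hd] := H _ e0.
    near=> h; have h0 : h != 0 by near: h; exact: nbhs_dnbhs_neq.
    rewrite distrC -(ler_pM2r (_ : 0 < `|h|)) ?normr_gt0// -normrM.
    rewrite (_ : _ * h = f (x + h) - f x - a * h); last first.
      by rewrite /GRing.scale/= mulr1 [h + x]addrC; field.
    by apply: Hd; near: h; exact: dnbhs0_lt.
  by apply: DeriveDef; [apply/cvg_ex; exists a|exact: cvg_lim].
have : derivable f x 1 by case: fa.
move=> /cvg_ex[l Cl]; have El : l = a.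
  by have := fa => -[_ <-]; apply/esym/cvg_lim.
move: Cl; rewrite El => /cvgrPdist_le/(_ _ e0).
move=> /nbhs_ballP [d /= d0 Hd]; exists d => // h hd.
have [->|h0] := eqVneq h 0; first by rewrite addr0 subrr mulr0 subrr normr0 mulr0.
have := Hd h; rewrite /ball /= sub0r normrN => /(_ hd h0).
rewrite distrC -(ler_pM2r (_ : 0 < `|h|)) ?normr_gt0// -normrM.
rewrite (_ : (_ - a) * h = f (x + h) - f x - a * h)//.
by rewrite /GRing.scale/= mulr1 [h + x]addrC; field.
Unshelve. all: by end_near. Qed.

Lemma MVT_cc f (df : R -> R) a b : a < b ->
  (forall x, a < x < b -> is_derive x 1 f (df x)) ->
  {within `[a, b], continuous f} ->
  exists2 c, a < c < b & f b - f a = df c * (b - a).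
Proof.
move=> ab fd fc; have fd' x : x \in `]a, b[%R -> is_derive x 1 f (df x).
  by rewrite in_itv/=; exact: fd.
have [c cab ->] := MVT ab fd' fc.
by exists c => //; move: cab; rewrite in_itv.
Qed.

Lemma MVT_all f (df : R -> R) a b : a < b -> (forall x, is_derive x 1 f (df x)) ->
  exists2 c, a < c < b & f b - f a = df c * (b - a).
Proof.
move=> ab fd; apply: MVT_cc => //.
by apply: continuous_subspaceT => x; exact: isd_cont (fd x).
Qed.

Lemma continuous_integrable_cc f a b : {within `[a, b], continuous f} ->
  mu.-integrable `[a, b] (EFin \o f).
Proof. by move=> fc; apply: continuous_compact_integrable => //; exact: segment_compact. Qed.

Lemma is_derive_primitive f c x : continuous f -> c < x ->
  is_derive x 1 (fun y => \int[mu]_(z in `[c, y]) f z) (f x).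
Proof.
move=> fc cx.
have fi : mu.-integrable `[c, x + 1] (EFin \o f).
  by apply: continuous_integrable_cc; exact: continuous_subspaceT.
have xx1 : x < x + 1 by rewrite ltrDl.
have [d e] := continuous_FTC1_closed xx1 fi cx (fc x).
by rewrite -e derive1E; apply: derivableP; exact: d.
Qed.

(* Starting the integral strictly left of the support makes the primitive
   differentiable on the whole line. *)
Lemma is_derive_primitive_left0 f c e x : continuous f -> c < e ->
  (forall y, y < e -> f y = 0) ->
  is_derive x 1 (fun y => \int[mu]_(z in `[c, y]) f z) (f x).
Proof.
move=> fc ce f0; have [cx|xc] := ltP c x; first exact: is_derive_primitive.
rewrite f0; last exact: le_lt_trans ce.
apply: near_eq_is_derive (isd_cst x 0).
near=> y; apply/esym; rewrite -[RHS](Rintegral_0 mu `[c, y]); apply: eq_Rintegral.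
move=> z /set_mem/=; rewrite in_itv/= => /andP[_ zy]; rewrite f0//.
apply: le_lt_trans zy _.
by near: y; apply: lt_nbhsl; exact: le_lt_trans ce.
Unshelve. all: by end_near. Qed.

End derive_kit.

(** * Smooth functions, bumps and smooth steps *)

Section smooth.
Context {R : realType}.
Local Notation mu := (@lebesgue_measure R).
Implicit Types (f g F : R -> R) (x c k : R).

Variant smooth f : Prop := Smooth of forall n x, derivable f^`(n) x 1.

(** Spares all formulas for higher derivatives: it suffices to exhibit a class of functions that is
    stable under differentiation. *)
Lemma smooth_coind (P : (R -> R) -> Prop) :
  (forall f, P f -> exists2 g, P g & forall x, is_derive x 1 f (g x)) ->
  forall f, P f -> smooth f.
Proof.
move=> H f Pf; split=> n x; suff : P f^`(n) by move=> /H[g _ gd]; exact: isd_derivable (gd x).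
elim: n f Pf => [//|n IH] f Pf; rewrite derive1Sn; apply: IH.
have [g Pg gd] := H _ Pf; suff -> : (derive1 f) = g by [].
by apply/funext => y; exact: isd_derive1.
Qed.

Lemma smooth_is_derive f x : smooth f -> is_derive x 1 f ((derive1 f) x).
Proof. by case=> sf; rewrite derive1E; apply: derivableP; exact: (sf 0%N). Qed.

Lemma smooth_derive1 f : smooth f -> smooth (derive1 f).
Proof. by case=> sf; split=> n x; rewrite -derive1Sn; exact: sf. Qed.

Lemma smooth_continuous f : smooth f -> continuous f.
Proof. by move=> sf x; exact: isd_cont (smooth_is_derive x sf). Qed.

Lemma smooth_primitive f F : smooth f -> (forall x, is_derive x 1 F (f x)) -> smooth F.
Proof.
move=> sf Ff; apply: (smooth_coind (P := fun h => smooth h \/ h = F)); last by right.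
move=> h [sh|->]; last by exists f => //; left.
by exists (derive1 h); [left; exact: smooth_derive1|move=> x; exact: smooth_is_derive].
Qed.

Lemma smooth_cst k : smooth (fun=> k).
Proof.
apply: (smooth_coind (P := fun h => exists k, h = fun=> k)); last by exists k.
by move=> h [k' ->]; exists (fun=> 0); [exists 0|move=> x; exact: isd_cst].
Qed.

Lemma smoothD f g : smooth f -> smooth g -> smooth (fun x => f x + g x).
Proof.
move=> sf sg.
apply: (smooth_coind (P := fun h => exists f g, [/\ smooth f, smooth g & h = fun x => f x + g x])); last by exists f, g.
move=> h [f' [g' [sf' sg' ->]]]; exists (fun x => (derive1 f') x + (derive1 g') x).
  by exists (derive1 f'), (derive1 g'); split=> //; exact: smooth_derive1.
by move=> x; apply: isdD; exact: smooth_is_derive.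
Qed.

Lemma smoothZ k f : smooth f -> smooth (fun x => k * f x).
Proof.
move=> sf.
apply: (smooth_coind (P := fun h => exists2 f, smooth f & h = fun x => k * f x)); last by exists f.
move=> h [f' sf' ->]; exists (fun x => k * (derive1 f') x).
  by exists (derive1 f') => //; exact: smooth_derive1.
by move=> x; apply: isdZ; exact: smooth_is_derive.
Qed.

Lemma smoothB f g : smooth f -> smooth g -> smooth (fun x => f x - g x).
Proof.
move=> sf sg; rewrite (_ : (fun x => f x - g x) = (fun x => f x + (-1) * g x)).
  by apply: smoothD => //; exact: smoothZ.
by apply/funext => x; rewrite mulN1r.
Qed.

Lemma smooth_affine k c f : smooth f -> smooth (fun x => f (k * x + c)).
Proof.
move=> sf.
apply: (smooth_coind (P := fun h => exists2 f, smooth f & h = fun x => f (k * x + c))); last by exists f.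
move=> h [f' sf' ->]; exists (fun x => (derive1 f') (k * x + c) * k).
  exists (fun x => k * (derive1 f') x); last by apply/funext => x; rewrite mulrC.
  by apply: smoothZ; exact: smooth_derive1.
by move=> x; apply: isd_affine; exact: smooth_is_derive.
Qed.

(** Products alone are not stable under differentiation; by the Leibniz rule their finite sums are,
    so this is the class to feed to [smooth_coind]. *)
Inductive smooth_prodspan : (R -> R) -> Prop :=
| smooth_prodspanM f g : smooth f -> smooth g -> smooth_prodspan (fun x => f x * g x)
| smooth_prodspanD f g : smooth_prodspan f -> smooth_prodspan g ->
    smooth_prodspan (fun x => f x + g x).

Lemma smoothM f g : smooth f -> smooth g -> smooth (fun x => f x * g x).
Proof.
move=> sf sg; apply: (smooth_coind (P := smooth_prodspan)); last exact: smooth_prodspanM.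
move=> h; elim=> {f g sf sg} [f g sf sg|f g _ [f' Pf f'd] _ [g' Pg g'd]].
  exists (fun x => (derive1 f) x * g x + f x * (derive1 g) x).
    by apply: smooth_prodspanD; apply: smooth_prodspanM => //; exact: smooth_derive1.
  by move=> x; apply: isdM; exact: smooth_is_derive.
exists (fun x => f' x + g' x); first exact: smooth_prodspanD.
by move=> x; exact: isdD.
Qed.

Lemma smooth_sum (I : Type) (s : seq I) (f : I -> R -> R) :
  (forall i, smooth (f i)) -> smooth (fun x => \sum_(i <- s) f i x).
Proof.
move=> sf; elim: s => [|i s IH].
  by under eq_fun do rewrite big_nil; exact: smooth_cst.
by under eq_fun do rewrite big_cons; exact: smoothD.
Qed.

(** Used to see that [p(1/x) exp(- 1/x)] is flat at the origin. The induction spends half of the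
    rate [d] on the polynomial of lower degree and half on the factor [y], through
    [y <= (2 / d) exp(d y / 2)]. *)
Lemma horner_expR_bound (p : {poly R}) d : 0 < d ->
  exists2 C, 0 <= C & forall y, 0 <= y -> `|p.[y]| <= C * expR (d * y).
Proof.
elim/poly_ind: p d => [|p c IH] d d0.
  by exists 0 => // y _; rewrite horner0 normr0 mul0r.
have d20 : 0 < d / 2 by rewrite divr_gt0.
have [C C0 HC] := IH _ d20; exists (C * (2 / d) + `|c|).
  by rewrite addr_ge0// mulr_ge0// divr_ge0// ltW.
move=> y y0; rewrite hornerMXaddC (le_trans (ler_normD _ _))// mulrDl lerD//.
  rewrite normrM (ger0_norm y0).
  have yE : y <= 2 / d * expR (d / 2 * y).
    have := expR_ge1Dx (d / 2 * y) => h.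
    rewrite [leLHS](_ : y = 2 / d * (d / 2 * y)); last by field; rewrite gt_eqF.
    by rewrite ler_pM2l ?divr_gt0//; lra.
  have -> : expR (d * y) = expR (d / 2 * y) * expR (d / 2 * y).
    by rewrite -expRD; congr expR; field.
  rewrite [leRHS](_ : _ = (C * expR (d / 2 * y)) * (2 / d * expR (d / 2 * y))); last by ring.
  by apply: ler_pM => //; exact: HC.
rewrite -[leLHS]mulr1 ler_wpM2l// -(@expR0 R) ler_expR mulr_ge0// ltW//.
Qed.

(** The family generated by the flat function [exp(- 1/x)] under differentiation: every derivative
    is again of this form, with another polynomial. *)
Definition flat_poly (p : {poly R}) x : R := if 0 < x then p.[x^-1] * expR (- x^-1) else 0.

(** With [u = 1/x] the derivative of [p(u) exp(- u)] in [u] is [(p' - p) exp(- u)], and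
    [du/dx = - u^2]. Only the origin needs an estimate. *)
Lemma flat_poly_derive p x :
  is_derive x 1 (flat_poly p) (flat_poly ('X^2 * (p - p^`())) x).
Proof.
have [x0|x0|->] := ltgtP x 0.
- rewrite /flat_poly ltNge (ltW x0)/=; apply: near_eq_is_derive (isd_cst x 0).
  near=> y; rewrite ltNge ltW//=.
  by near: y; exact: lt_nbhsl.
- have xN0 : x != 0 by rewrite gt_eqF.
  have iV : is_derive x 1 (fun y => y^-1) (- x ^- 2).
    apply: is_derive_eq; first by apply: is_deriveV => //.
    by rewrite /= /GRing.scale/= mulr1.
  have : is_derive x 1 (fun y => p.[y^-1] * expR (- y^-1)) (flat_poly ('X^2 * (p - p^`())) x).
    apply: is_derive_eq.
    rewrite /flat_poly x0 !hornerE /GRing.scale /= exprVn; ring.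
  apply: near_eq_is_derive; near=> y; rewrite /flat_poly ifT//.
  by near: y; exact: lt_nbhsr.
- rewrite {2}/flat_poly ltxx; apply/isd_epsP => e e0.
  have h20 : 0 < 2^-1 :> R by rewrite invr_gt0.
  have [C C0 HC] := horner_expR_bound (p * 'X) h20.
  (* Pulling one factor [h] out of [p(1/h) exp(- 1/h)] leaves a quotient bounded by [2 C h]; this
     radius makes it at most [e]. *)
  exists (e / (2 * C + 1)); first by rewrite divr_gt0// ltr_wpDl// mulr_ge0.
  move=> h hd; rewrite add0r mul0r subr0 {2}/flat_poly ltxx subr0 /flat_poly.
  case: ifPn => h0; last by rewrite normr0 mulr_ge0// ltW.
  have i0 : 0 < h^-1 by rewrite invr_gt0.
  have h1 : `|(p * 'X).[h^-1] * expR (- h^-1)| <= C * (2 * h).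
    rewrite normrM (ger0_norm (expR_ge0 _)).
    apply: (@le_trans _ _ (C * expR (- (2^-1 * h^-1)))).
      rewrite [in leRHS](_ : - (2^-1 * h^-1) = 2^-1 * h^-1 - h^-1); last by field; rewrite gt_eqF.
      by rewrite expRD mulrA ler_wpM2r ?expR_ge0// HC// ltW.
    rewrite ler_wpM2l// expRN -[2 * h]invrK lef_pV2 ?posrE ?expR_gt0// ?invr_gt0 ?mulr_gt0//.
    have := expR_ge1Dx (2^-1 * h^-1); rewrite invfM; lra.
  have -> : p.[h^-1] * expR (- h^-1) = h * ((p * 'X).[h^-1] * expR (- h^-1)).
    by rewrite hornerMX mulrA mulrCA divff ?mulr1// gt_eqF.
  rewrite normrM mulrC ler_wpM2r// (le_trans h1)//.
  move: hd; rewrite gtr0_norm// ltr_pdivlMr ?ltr_wpDl ?mulr_ge0//; nra.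
Unshelve. all: by end_near. Qed.

Lemma smooth_flat_poly p : smooth (flat_poly p).
Proof.
apply: (smooth_coind (P := fun h => exists p, h = flat_poly p)); last by exists p.
move=> h [q ->]; exists (flat_poly ('X^2 * (q - q^`()))); first by eexists.
by move=> x; exact: flat_poly_derive.
Qed.

Definition bump x := flat_poly 1 x * flat_poly 1 (-1 * x + 1).

Lemma smooth_bump : smooth bump.
Proof.
by apply: smoothM; [|apply: smooth_affine]; exact: smooth_flat_poly.
Qed.

Lemma bump_ge0 x : 0 <= bump x.
Proof.
by rewrite /bump /flat_poly !hornerE mulr_ge0//; case: ifP => // _; rewrite ?mul1r expR_ge0.
Qed.

Lemma bump_gt0 x : 0 < x < 1 -> 0 < bump x.
Proof.
move=> /andP[x0 x1]; rewrite /bump /flat_poly !hornerE x0 ifT; last by lra.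
by rewrite ?mul1r mulr_gt0// expR_gt0.
Qed.

Lemma bump_eq0 x : x <= 0 \/ 1 <= x -> bump x = 0.
Proof.
rewrite /bump /flat_poly => -[x0|x1].
  by rewrite ltNge x0/= mul0r.
by rewrite [X in _ * X]ifF ?mulr0//; apply/negbTE; rewrite -leNgt; lra.
Qed.

Definition bump_int x := \int[mu]_(z in `[-1, x]) bump z.

Lemma bump_int_derive x : is_derive x 1 bump_int (bump x).
Proof.
apply: (@is_derive_primitive_left0 _ _ _ 0); [|lra|].
- exact: smooth_continuous smooth_bump.
- by move=> y y0; rewrite bump_eq0//; left; exact: ltW.
Qed.

Lemma bump_int_le0 x : x <= 0 -> bump_int x = 0.
Proof.
move=> x0; rewrite /bump_int -[RHS](Rintegral_0 mu `[-1, x]); apply: eq_Rintegral.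
move=> z /set_mem/=; rewrite in_itv/= => /andP[_ zx]; rewrite bump_eq0//.
by left; exact: le_trans x0.
Qed.

Lemma bump_int_homo x y : x <= y -> bump_int x <= bump_int y.
Proof.
rewrite le_eqVlt => /predU1P[->//|xy]; rewrite -subr_ge0.
have [c _ ->] := MVT_all xy bump_int_derive.
by rewrite mulr_ge0 ?bump_ge0// subr_ge0 ltW.
Qed.

Lemma bump_int_ge1 x : 1 <= x -> bump_int x = bump_int 1.
Proof.
rewrite le_eqVlt => /predU1P[<-//|x1]; apply/eqP; rewrite -subr_eq0.
have [c /andP[c1 _] ->] := MVT_all x1 bump_int_derive.
by rewrite bump_eq0 ?mul0r//; right; exact: ltW.
Qed.

Lemma bump_int1_gt0 : 0 < bump_int 1.
Proof.
rewrite -(bump_int_le0 (lexx 0)).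
have [c c01] := MVT_all ltr01 bump_int_derive.
by rewrite -subr_gt0 => ->; rewrite subr0 mulr1 bump_gt0.
Qed.

Definition step x := (bump_int 1)^-1 * bump_int x.

Lemma smooth_step : smooth step.
Proof.
by apply: smoothZ; apply: smooth_primitive smooth_bump _; exact: bump_int_derive.
Qed.

Lemma step_le0 x : x <= 0 -> step x = 0.
Proof. by move=> x0; rewrite /step (bump_int_le0 x0) mulr0. Qed.

Lemma step_ge1 x : 1 <= x -> step x = 1.
Proof. by move=> x0; rewrite /step (bump_int_ge1 x0) mulVf// gt_eqF// bump_int1_gt0. Qed.

Lemma step_homo x y : x <= y -> step x <= step y.
Proof. by move=> xy; rewrite ler_wpM2l ?bump_int_homo// invr_ge0 ltW// bump_int1_gt0. Qed.

Lemma step_ge0 x : 0 <= step x.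
Proof.
have [x0|x0] := leP x 0; first by rewrite step_le0.
by rewrite -(step_le0 (lexx 0)); apply: step_homo; exact: ltW.
Qed.

Lemma step_le1 x : step x <= 1.
Proof.
have [x0|x0] := leP 1 x; first by rewrite step_ge1.
by rewrite -(step_ge1 (lexx 1)); apply: step_homo; exact: ltW.
Qed.

(** Both steps rise just to the right of their endpoint [a] or [b]. Hence the limit is the indicator
    of []a, b]], and all the supports lie in [[a, b + 1]]. *)
Definition step_itv (n : nat) a b x := step (n.+1%:R * x + - (n.+1%:R * a)) - step (n.+1%:R * x + - (n.+1%:R * b)).

Lemma smooth_step_itv n a b : smooth (step_itv n a b).
Proof. by apply: smoothB; apply: smooth_affine; exact: smooth_step. Qed.

Lemma step_itv_bound n a b x : `|step_itv n a b x| <= 1.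
Proof.
rewrite /step_itv; set u := step _; set v := step (_ - _ * b).
have : 0 <= u <= 1 by rewrite step_ge0 step_le1.
have : 0 <= v <= 1 by rewrite step_ge0 step_le1.
by move=> /andP[? ?] /andP[? ?]; rewrite ler_norml; apply/andP; split; lra.
Qed.

Lemma step_itv_eq0 n a b x : a <= b -> x <= a \/ b + 1 <= x -> step_itv n a b x = 0.
Proof.
move=> ab; have n0 : (0 : R) <= n%:R by []; rewrite /step_itv -natr1 => -[xa|bx].
  by rewrite !step_le0 ?subrr//; nra.
by rewrite !step_ge1 ?subrr//; nra.
Qed.

Lemma step_itv_cvg a b x : a <= b ->
  step_itv n a b x @[n --> \oo] --> (\1_(`]a, b]) x : R).
Proof.
move=> ab; rewrite indicE mem_setE.
have big c : 0 < c -> \forall n \near \oo, 1 <= (n : nat).+1%:R * c.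
  move=> c0; near=> n; rewrite -ler_pdivrMr// mul1r -natr1.
  rewrite (le_trans _ (_ : n%:R <= _)) ?lerDl//.
  by near: n; exact: nbhs_infty_ger.
have [xa|ax] := leP x a.
  rewrite in_itv/= ltNge xa/=; apply: cvg_near_cst; near=> n.
  by apply: step_itv_eq0 => //; left.
have [xb|bx] := leP x b.
  rewrite in_itv/= ax xb/=; apply: cvg_near_cst; near=> n.
  rewrite /step_itv step_ge1; last first.
    by rewrite -mulrBr; near: n; apply: big; rewrite subr_gt0.
  by rewrite step_le0 ?subr0// -mulrBr mulr_ge0_le0// subr_le0.
rewrite in_itv/= (leNgt x) bx andbF; apply: cvg_near_cst; near=> n.
rewrite /step_itv !step_ge1 ?subrr// -mulrBr; near: n; apply: big; rewrite subr_gt0//.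
Unshelve. all: by end_near. Qed.

End smooth.

(** * Weak derivatives and the space W12_0 *)

Section dct.
Context d (T : measurableType d) (R : realType).
Variable m : {measure set T -> \bar R}.

Lemma Rintegral_dct D (F : nat -> T -> R) (f g : T -> R) : measurable D ->
  (forall n, measurable_fun D (F n)) -> measurable_fun D f ->
  m.-integrable D (EFin \o g) ->
  {ae m, forall x, D x -> F n x @[n --> \oo] --> f x} ->
  (forall n x, D x -> `|F n x| <= g x) ->
  \int[m]_(x in D) F n x @[n --> \oo] --> \int[m]_(x in D) f x.
Proof.
move=> mD mF mf ig Ff Fg.
have [] := @dominated_convergence _ _ _ m D mD (fun n x => (F n x)%:E) (EFin \o f)
  (EFin \o g) _ _ _ ig.
- by move=> n; exact/measurable_EFinP.
- exact/measurable_EFinP.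
- apply: filterS Ff => x /= /[apply] Ffx.
  by apply/fine_cvgP; split; [exact: nearW|exact: Ffx].
- by apply: aeW => x n Dx; rewrite lee_fin Fg.
- move=> fi _; rewrite /= -EFin_Rintegral//; exact: fine_cvg.
Qed.

End dct.

(** * Test functions and uniqueness of weak derivatives *)

Section one_dim.
Context {R : realType}.
Local Notation mu := (@lebesgue_measure R).
Implicit Types (f g h psi : R -> R) (a b c J x : R).

Lemma mu_integrable_dom (D : set R) f g : measurable D -> measurable_fun D f ->
  mu.-integrable D (EFin \o g) -> (forall x, D x -> `|f x| <= g x) ->
  mu.-integrable D (EFin \o f).
Proof. by move=> mD mf gi fg; exact: (@integrable_dom _ _ R mu D f g mD mf gi fg). Qed.

Lemma mu_dct (D : set R) (F : nat -> R -> R) f g : measurable D ->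
  (forall n, measurable_fun D (F n)) -> measurable_fun D f ->
  mu.-integrable D (EFin \o g) ->
  {ae mu, forall x, D x -> F n x @[n --> \oo] --> f x} ->
  (forall n x, D x -> `|F n x| <= g x) ->
  \int[mu]_(x in D) F n x @[n --> \oo] --> \int[mu]_(x in D) f x.
Proof. by move=> mD mF mf gi Ff Fg; exact: (@Rintegral_dct _ _ R mu D F f g mD mF mf gi Ff Fg). Qed.

Lemma mu_integrable_scale (D : set R) c f : measurable D ->
  mu.-integrable D (EFin \o f) -> mu.-integrable D (EFin \o (fun x => c * f x)).
Proof. by move=> mD fi; exact: (@integrable_scale _ _ R mu D c f mD fi). Qed.

Lemma mu_integrable_scaler (D : set R) c f : measurable D ->
  mu.-integrable D (EFin \o f) -> mu.-integrable D (EFin \o (fun x => f x * c)).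
Proof.
move=> mD fi; rewrite (_ : (fun x => f x * c) = (fun x => c * f x)).
  exact: mu_integrable_scale.
by apply/funext => x; rewrite mulrC.
Qed.

Lemma mu_Rintegral0_ae (D : set R) f : measurable D -> mu.-integrable D (EFin \o f) ->
  (forall x, D x -> 0 <= f x) -> \int[mu]_(x in D) f x = 0 ->
  {ae mu, forall x, D x -> f x = 0}.
Proof. by move=> mD fi f0 If; exact: (@Rintegral0_ae_eq0 _ _ R mu D f mD fi f0 If). Qed.

Lemma mu_integrable_mkcond (D : set R) f : measurable D ->
  mu.-integrable D (EFin \o f) <-> mu.-integrable setT (EFin \o (f \_ D)).
Proof. by move=> mD; rewrite -restrict_EFin; exact: integrable_mkcond. Qed.

Lemma mu_ae_imp (P Q : R -> Prop) : (forall x, P x -> Q x) ->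
  {ae mu, forall x, P x} -> {ae mu, forall x, Q x}.
Proof. by move=> PQ; apply: filterS => //; exact: (ae_filter_ringOfSetsType mu). Qed.

Lemma mu_ae_imp2 (P1 P2 Q : R -> Prop) : (forall x, P1 x -> P2 x -> Q x) ->
  {ae mu, forall x, P1 x} -> {ae mu, forall x, P2 x} -> {ae mu, forall x, Q x}.
Proof. by move=> PQ; apply: filterS2 => //; exact: (ae_filter_ringOfSetsType mu). Qed.

Lemma continuous_bounded_cc f a b : {within `[a, b], continuous f} ->
  exists2 M : R, 0 <= M & forall x, a <= x <= b -> `|f x| <= M.
Proof.
move=> cf; have cK := continuous_compact cf (@segment_compact _ a b).
have [M [_ HM]] := compact_bounded cK; exists (`|M| + 1); first by rewrite addr_ge0.
move=> x xJ; apply: (HM (`|M| + 1)); last by exists x => //=; rewrite in_itv.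
by rewrite (le_lt_trans (ler_norm M))// ltrDl.
Qed.

Lemma lebesgue_itv_lty a b : (mu `[a, b]%classic < +oo)%E.
Proof. by rewrite lebesgue_measure_itv/=; case: ifP => // _; rewrite -EFinB ltry. Qed.

Lemma integrable_ccS f a b c e : a <= c -> e <= b ->
  mu.-integrable `[a, b] (EFin \o f) -> mu.-integrable `[c, e] (EFin \o f).
Proof.
by move=> ac eb; apply: integrableS => //; apply: subset_itv; rewrite bnd_simp.
Qed.

(** Lebesgue differentiation: almost everywhere [f] is the derivative of its primitive, and that
    primitive vanishes on the interval. *)
Lemma ae0_itv f a b :
  mu.-integrable `[a, b] (EFin \o f) ->
  (forall x, a < x <= b -> \int[mu]_(y in `[a, x]) f y = 0) ->
  {ae mu, forall x, a <= x <= b -> f x = 0}.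
Proof.
move=> fi f0; have [ba|ab] := leP b a.
  have : mu.-negligible [set a].
    by exists [set a]; split => //; exact: lebesgue_measure_set1.
  apply: negligibleS => x /= /not_implyP[/andP[ax xb] _].
  by apply/eqP; rewrite eq_le ax (le_trans xb).
set f' := f \_ `[a, b].
have f'i : mu.-integrable setT (EFin \o f') by exact: integrable_restrictT.
have H := @FTC1 R f' (BLeft a) _ _.
have {}H := H (fun y => ltac:(by apply: integrableS f'i)).
have /H{H} : locally_integrable [set: R] f'.
  by apply: open_integrable_locally => //; exact: openT.
have F0 x : a < x -> \int[mu]_(t in `[a, x]) f' t = 0.
  move=> ax; rewrite /f' -Rintegral_mkcondr.
  have [xb|bx] := leP x b.
    rewrite (_ : `[a, x] `&` `[a, b] = `[a, x]%classic) ?f0 ?ax//.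
    by apply: setIidl; apply: subset_itvl; rewrite bnd_simp.
  rewrite (_ : `[a, x] `&` `[a, b] = `[a, b]%classic) ?f0 ?ab ?lexx//.
  by apply: setIidr; apply: subset_itvl; rewrite bnd_simp ltW.
have a0 : {ae mu, forall x, x != a}.
  exists [set a]; split => //; first exact: lebesgue_measure_set1.
  by move=> x /= /negP; rewrite negbK => /eqP.
apply: mu_ae_imp2 a0 => x xa H /andP[ax xb].
have {}ax : a < x by rewrite lt_neqAle eq_sym xa.
have ax' : (BLeft a < BRight x)%E by rewrite lte_fin.
have [_] := H ax'.
rewrite /f' patchE mem_set/= ?in_itv/= ?(ltW ax)// => <-.
apply/isd_derive1; apply: near_eq_is_derive (isd_cst x 0).
by near=> y; rewrite F0//; near: y; exact: lt_nbhsr.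
Unshelve. all: by end_near. Qed.

Lemma measurable_step_itv n a b D : measurable_fun D (step_itv n a b : R -> R).
Proof.
apply: (@measurable_funS _ _ _ _ setT) => //; apply: continuous_measurable_fun.
exact: smooth_continuous (smooth_step_itv n a b).
Qed.

Lemma integrable_mul_step_itv n a b D f : measurable D ->
  mu.-integrable D (EFin \o f) -> mu.-integrable D (EFin \o (fun x => f x * step_itv n a b x)).
Proof.
move=> mD fi; have mf : measurable_fun D f by apply/measurable_EFinP; exact: measurable_int fi.
apply: (@mu_integrable_dom _ _ (fun x => `|f x|)) => //.
- by apply: measurable_funM => //; exact: measurable_step_itv.
- by have := integrable_norm fi; apply: eq_integrable.
- by move=> x Dx; rewrite normrM ler_piMr// step_itv_bound.
Qed.

Lemma step_itv_integral_cvg a b D f : a <= b -> measurable D -> `[a, b] `<=` D ->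
  mu.-integrable D (EFin \o f) ->
  \int[mu]_(x in D) (f x * step_itv n a b x) @[n --> \oo] --> \int[mu]_(x in `[a, b]) f x.
Proof.
move=> ab mD abD fi.
have mf : measurable_fun D f by apply/measurable_EFinP; exact: measurable_int fi.
have -> : \int[mu]_(x in `[a, b]) f x = \int[mu]_(x in D) (f x * \1_(`]a, b]) x).
  rewrite -Rintegral_itv_obnd_cbnd; last first.
    apply: integrableS fi => //; apply: subset_trans abD.
    by apply: subset_itvr; rewrite bnd_simp.
  rewrite [in LHS](_ : `]a, b]%classic = D `&` `]a, b]).
    rewrite Rintegral_mkcondr; apply: eq_Rintegral => x _.
    by rewrite patchE indicE; case: ifP => _; rewrite ?mulr1 ?mulr0.
  apply/esym/setIidr; apply: subset_trans abD.
  by apply: subset_itvr; rewrite bnd_simp.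
apply: (@mu_dct _ _ _ (fun x => `|f x|)) => //.
- by move=> n; apply: measurable_funM => //; exact: measurable_step_itv.
- by apply: measurable_funM => //; apply: measurable_indic.
- by have := integrable_norm fi; apply: eq_integrable.
- by apply: aeW => x Dx; apply: cvgM; [exact: cvg_cst|exact: step_itv_cvg].
- by move=> n x Dx; rewrite normrM ler_piMr// step_itv_bound.
Qed.

Lemma measurable_halfline : measurable (halfline : set R).
Proof.
by rewrite (_ : halfline = `]0, +oo[%classic)//; apply/seteqP; split => x /=; rewrite in_itv/= andbT.
Qed.

Lemma open_halfline : open (halfline : set R).
Proof.
rewrite (_ : halfline = `]0, +oo[%classic); first exact: interval_open.
by apply/seteqP; split => x /=; rewrite in_itv/= andbT.
Qed.

Lemma halfline_cc a b : 0 < a -> `[a, b] `<=` (halfline : set R).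
Proof. by move=> a0 x /=; rewrite in_itv/= => /andP[ax _]; exact: lt_le_trans ax. Qed.

Lemma locally_integrable_cc f a b : 0 < a -> locally_integrable halfline f ->
  mu.-integrable `[a, b] (EFin \o f).
Proof.
move=> a0 [mf _ fK]; apply/integrableP; split.
  by apply/measurable_EFinP; apply: measurable_funS mf => //;
    [exact: measurable_halfline|exact: halfline_cc].
by apply: fK; [exact: halfline_cc|exact: segment_compact].
Qed.

(** A compact subset of the open half-line keeps a positive distance from [0]. The bounds [a] and
    [J] replace the topological support in all later computations. *)
Lemma test_halfline_supp psi : test_halfline psi ->
  exists a J, [/\ 0 < a, a < J & forall x, x <= a \/ J <= x -> psi x = 0].
Proof.
move=> [_ cK Khalf]; set K := closure _ in cK Khalf.
have [M [_ HM]] := compact_bounded cK.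
have cl : closed K by exact: closed_closure.
have : open (~` K) by rewrite openC.
rewrite openE => /(_ 0) [].
  by move=> K0; have := Khalf _ K0; rewrite /halfline/= ltxx.
move=> e /= e0 He.
have z x : ~ K x -> psi x = 0.
  by move=> nK; apply: contrapT => /eqP px; apply: nK; exact: subset_closure.
exists (e / 2), (`|M| + 1 + e); split; first by rewrite divr_gt0.
  by have := normr_ge0 M; lra.
move=> x [xe|Mx]; apply: z.
  have [x0|x0] := leP x 0; first by move=> /Khalf; rewrite /halfline/= ltNge x0.
  by apply: He; rewrite /ball/= sub0r normrN gtr0_norm//; lra.
have h : M < `|M| + 1 by rewrite (le_lt_trans (ler_norm M))// ltrDl.
by move=> /(HM _ h) /=; have := ler_norm x; lra.
Qed.

Lemma test_halfline_smooth psi : test_halfline psi -> smooth psi.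
Proof. by case=> s _ _; split. Qed.

Lemma smooth_test_halfline psi a J : 0 < a -> smooth psi ->
  (forall x, x <= a \/ J <= x -> psi x = 0) -> test_halfline psi.
Proof.
move=> a0 [s] z; have sub : closure [set x | psi x != 0] `<=` `[a, J].
  have cE : `[a, J]%classic = closure `[a, J] by apply/closure_id; exact: interval_closed.
  rewrite [X in _ `<=` X]cE; apply: closureS => x /= px; rewrite in_itv/=; apply/andP; split.
    by rewrite leNgt; apply: contra px => xa; rewrite z//; left; exact: ltW.
  by rewrite leNgt; apply: contra px => xa; rewrite z//; right; exact: ltW.
split => //; last by apply: subset_trans sub _; exact: halfline_cc.
apply: subclosed_compact sub; first exact: closed_closure.
exact: segment_compact.
Qed.

(** The difference of two weak derivatives is orthogonal to the test functions [step_itv]; in the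
    limit its integral over every [[a, b]] with [a > 0] is [0], and [ae0_itv] concludes on the
    intervals [[1/n, n]], which exhaust the half-line. *)
Lemma weak_derivative_unique f g1 g2 : weak_derivative f g1 -> weak_derivative f g2 ->
  ae_eq mu halfline g1 g2.
Proof.
move=> [_ lg1 w1] [_ lg2 w2].
pose h x := g1 x - g2 x.
have hi a b : 0 < a -> mu.-integrable `[a, b] (EFin \o h).
  by move=> a0; apply: integrable_sub => //; exact: locally_integrable_cc.
have H a b : 0 < a -> a < b -> \int[mu]_(x in `[a, b]) h x = 0.
  move=> a0 ab.
  have sD : `[a, b] `<=` `[a, b + 1] by apply: subset_itvl; rewrite bnd_simp; lra.
  have := step_itv_integral_cvg (ltW ab) (measurable_itv _) sD (hi a (b + 1) a0).
  suff -> : (fun n => \int[mu]_(x in `[a, b + 1]) (h x * step_itv n a b x)) = (fun=> 0).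
    by move=> /cvg_lim <-//; rewrite lim_cst.
  apply/funext => n.
  have z x : x <= a \/ b + 1 <= x -> step_itv n a b x = 0 by apply: step_itv_eq0; exact: ltW.
  have tt := smooth_test_halfline a0 (smooth_step_itv n a b) z.
  have e g : locally_integrable halfline g ->
      \int[mu]_(x in halfline) (g x * step_itv n a b x) =
      \int[mu]_(x in `[a, b + 1]) (g x * step_itv n a b x).
    move=> lg; rewrite (_ : `[a, b + 1]%classic = halfline `&` `[a, b + 1]); last first.
      by apply/esym/setIidr; exact: halfline_cc.
    rewrite Rintegral_mkcondr; apply: eq_Rintegral => x _; rewrite patchE.
    case: ifPn => //; rewrite notin_setE/= in_itv/= => /negP; rewrite negb_and -!ltNge => /orP[xa|bx].
      by rewrite z ?mulr0//; left; exact: ltW.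
    by rewrite z ?mulr0//; right; exact: ltW.
  transitivity (\int[mu]_(x in `[a, b + 1]) (g1 x * step_itv n a b x) -
                \int[mu]_(x in `[a, b + 1]) (g2 x * step_itv n a b x)).
    rewrite -RintegralB//; last 2 first.
    - by apply: integrable_mul_step_itv => //; exact: locally_integrable_cc.
    - by apply: integrable_mul_step_itv => //; exact: locally_integrable_cc.
    by apply: eq_Rintegral => x _; rewrite /h mulrBl.
  rewrite -!e//; apply/eqP; rewrite subr_eq0; apply/eqP.
  by apply: oppr_inj; rewrite -w1// w2.
have : {ae mu, forall x, forall n : nat, n.+1%:R^-1 <= x <= n.+1%:R -> h x = 0}.
  apply/ae_foralln => n; apply: ae0_itv; first by apply: hi; rewrite invr_gt0.
  by move=> x /andP[ax xb]; apply: H => //; rewrite invr_gt0.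
apply: mu_ae_imp => x hx x0; apply/eqP; rewrite -subr_eq0; apply/eqP.
rewrite /halfline/= in x0.
near \oo => n; apply: (hx n); apply/andP; split.
  rewrite -[leRHS]invrK lef_pV2 ?posrE ?invr_gt0// -natr1.
  by apply: (@le_trans _ _ n%:R); rewrite ?lerDl//; near: n; exact: nbhs_infty_ger.
rewrite -natr1; apply: (@le_trans _ _ n%:R); rewrite ?lerDl//; near: n; exact: nbhs_infty_ger.
Unshelve. all: by end_near. Qed.

(** Functions that are only locally integrable do not let the integrals over the half-line split;
    these are first cut down to the support [[a, J]] of the test function. *)
Lemma weak_derivativeB f1 f2 g1 g2 : weak_derivative f1 g1 -> weak_derivative f2 g2 ->
  weak_derivative (fun x => f1 x - f2 x) (fun x => g1 x - g2 x).
Proof.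
move=> [lf1 lg1 w1] [lf2 lg2 w2]; split; [exact: locally_integrableB..|].
move=> psi tp; have [a [J [a0 aJ z]]] := test_halfline_supp tp.
have sp := test_halfline_smooth tp.
have z' x : x < a \/ J < x -> derive1 psi x = 0.
  move=> h; apply: isd_derive1; apply: near_eq_is_derive (isd_cst x 0).
  case: h => [xa|Jx]; near=> y; rewrite z//.
    by left; apply: ltW; near: y; exact: lt_nbhsl.
  by right; apply: ltW; near: y; exact: lt_nbhsr.
have e (k f : R -> R) : (forall x, x < a \/ J < x -> k x = 0) ->
   \int[mu]_(x in halfline) (f x * k x) = \int[mu]_(x in `[a, J]) (f x * k x).
  move=> kz; rewrite (_ : `[a, J]%classic = halfline `&` `[a, J]); last first.
    by apply/esym/setIidr; exact: halfline_cc.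
  rewrite Rintegral_mkcondr; apply: eq_Rintegral => x _; rewrite patchE.
  case: ifPn => //; rewrite notin_setE/= in_itv/= => /negP; rewrite negb_and -!ltNge => /orP[xa|bx].
    by rewrite kz ?mulr0//; left.
  by rewrite kz ?mulr0//; right.
have z1 x : x < a \/ J < x -> psi x = 0 by move=> [/ltW|/ltW] h; apply: z; [left|right].
have ii (k f : R -> R) : continuous k -> locally_integrable halfline f ->
    mu.-integrable `[a, J] (EFin \o (fun x => f x * k x)).
  move=> ck lf; have [M _ HM] := continuous_bounded_cc (@continuous_subspaceT _ _ `[a, J] _ ck).
  have fi := locally_integrable_cc J a0 lf.
  apply: (@mu_integrable_dom _ _ (fun x => M * `|f x|)) => //.
  - apply: measurable_funM; first by apply/measurable_EFinP; exact: measurable_int fi.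
    by apply: measurable_funTS; exact: continuous_measurable_fun.
  - apply: integrable_scale => //; exact: integrable_norm fi.
  - by move=> x xJ; rewrite normrM mulrC ler_wpM2r// HM//; move: xJ; rewrite /= in_itv.
have cp := smooth_continuous sp; have cdp := smooth_continuous (smooth_derive1 sp).
have := w1 _ tp; have := w2 _ tp; rewrite !e// => E2 E1.
under eq_Rintegral do rewrite mulrBl.
under [in RHS]eq_Rintegral do rewrite mulrBl.
by rewrite !RintegralB//; [rewrite E1 E2; ring|exact: ii..].
Unshelve. all: by end_near. Qed.

Lemma L2_halflineP f : L2_halfline f <->
  measurable_fun halfline f /\ mu.-integrable halfline (EFin \o (fun x => f x ^+ 2)).
Proof.
have mH := measurable_halfline.
split => [Lf|[mf fi]].
  split.
    by apply/(measurable_restrictT _ mH); move: Lf => /andP[]; rewrite inE.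
  apply/(mu_integrable_mkcond _ mH); have := Lfun2_integrable_sqr Lf.
  apply: eq_integrable => // x _ /=; rewrite !patchE; case: ifP => // _.
  by rewrite expr0n.
apply/andP; split; rewrite inE/=; first by apply/(measurable_restrictT _ mH).
rewrite /finite_norm unlock; apply: poweR_lty.
move/(mu_integrable_mkcond _ mH)/integrableP : fi => [_].
apply: le_lt_trans; rewrite le_eqVlt; apply/orP; left; apply/eqP.
apply: eq_integral => x _; rewrite /= !patchE; case: ifP => _ /=.
  by rewrite powR_mulrn// normrX.
by rewrite !normr0 powR0.
Qed.

(** [W12_norm] is defined through an arbitrarily chosen weak derivative; by uniqueness up to null
    sets any other one may be used in its place. *)
Lemma W12_norm_eq f g : weak_derivative f g ->
  W12_norm f = Num.sqrt (\int[mu]_(x in halfline) (f x ^+ 2 + g x ^+ 2)).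
Proof.
move=> fg; have wd : weak_derivative f (weakD f) by rewrite /weakD; case: xgetP => [_ ->//|/(_ g)].
congr Num.sqrt; have [[mf _ _] [mg _ _] _] := fg; have [_ [mg' _ _] _] := wd.
apply: ae_eq_Rintegral.
- exact: measurable_halfline.
- by apply: measurable_funD; exact: measurable_funX.
- by apply: measurable_funD; exact: measurable_funX.
- by apply: mu_ae_imp (weak_derivative_unique wd fg) => x /= /[apply] ->.
Qed.

End one_dim.

(** * Primitives as weak derivatives, and the zero trace of [W12_0] *)

Section W12_line.
Context {R : realType}.
Local Notation mu := (@lebesgue_measure R).
Implicit Types (f g h psi : R -> R) (a b c J x : R).

Lemma lebesgue_oc_lty a b : (mu `]a, b]%classic < +oo)%E.
Proof. by rewrite lebesgue_measure_itv/=; case: ifP => // _; rewrite -EFinB ltry. Qed.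

Lemma prim_continuous g J : 0 <= J -> mu.-integrable `[0, J] (EFin \o g) ->
  {within `[0, J], continuous (prim g)}.
Proof. by move=> J0 gi; exact: parameterized_integral_continuous. Qed.

Lemma prim_continuous_at g x : (forall J, mu.-integrable `[0, J] (EFin \o g)) ->
  0 < x -> {for x, continuous (prim g)}.
Proof.
move=> gi x0; have x1 : 0 < x + 1 by rewrite addr_gt0.
have [H _ _] := (continuous_within_itvP _ x1).1 (prim_continuous (ltW x1) (gi _)).
by apply: H; rewrite in_itv/= x0 ltrDl ltr01.
Qed.

Lemma prim_bound g x : 0 <= x -> mu.-integrable `[0, x] (EFin \o g) ->
  `|prim g x| <= prim (fun y => `|g y|) x.
Proof. by move=> x0 gi; exact: le_normr_Rintegral. Qed.

Lemma prim_homo g x y : x <= y -> mu.-integrable `[0, y] (EFin \o g) ->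
  (forall z, 0 <= g z) -> prim g x <= prim g y.
Proof.
move=> xy gi g0; rewrite /prim [leLHS]Rintegral_mkcond [leRHS]Rintegral_mkcond.
have s : `[0, x]%classic `<=` `[0, y] by apply: subset_itvl; rewrite bnd_simp.
apply: le_Rintegral => //.
- by apply: integrable_restrictT => //; apply: integrableS gi.
- exact: integrable_restrictT.
- move=> z _; rewrite !patchE; case: ifPn => zx; case: ifPn => zy //.
  by move: zy; rewrite (mem_set (s _ (set_mem zx))).
Qed.

Lemma primB f g x : mu.-integrable `[0, x] (EFin \o f) -> mu.-integrable `[0, x] (EFin \o g) ->
  prim (fun y => f y - g y) x = prim f x - prim g x.
Proof. by move=> fi gi; exact: RintegralB. Qed.

Lemma prim_le0 g x : x <= 0 -> prim g x = 0.
Proof.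
rewrite le_eqVlt => /predU1P[->|x0]; rewrite /prim; first by rewrite set_itv1 Rintegral_set1.
by rewrite set_itv_ge ?Rintegral_set0// bnd_simp -ltNge.
Qed.

Lemma prim_derive psi x : smooth psi -> 0 <= x -> prim (derive1 psi) x = psi x - psi 0.
Proof.
move=> sp; rewrite le_eqVlt => /predU1P[<-|x0]; first by rewrite prim_le0// subrr.
have cp := smooth_continuous sp; have cd := smooth_continuous (smooth_derive1 sp).
rewrite /prim /Rintegral (@continuous_FTC2 R (derive1 psi) psi 0 x x0).
- by rewrite -EFinB.
- exact: continuous_subspaceT.
- split.
  + by move=> y _; exact: isd_derivable (smooth_is_derive y sp).
  + by apply: cvg_at_right_filter; exact: cp.
  + by apply: cvg_at_left_filter; exact: cp.
- by [].
Qed.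

Lemma compact_sub_cc (K : set R) : compact K -> exists2 M : R, 0 < M & K `<=` `[- M, M].
Proof.
move=> /compact_bounded [M [_ HM]]; exists (`|M| + 1); first by rewrite ltr_wpDl.
have h : M < `|M| + 1 by rewrite (le_lt_trans (ler_norm M))// ltrDl.
by move=> x Kx; have := HM _ h _ Kx; rewrite /= in_itv/= ler_norml.
Qed.

(** Integration by parts between [prim g] and [psi']; the boundary terms vanish since [psi] is [0]
    at the origin and at [J]. Weak derivatives of concrete functions are obtained in this way. *)
Lemma weak_derivative_prim g h c : measurable_fun halfline g ->
  (forall J, mu.-integrable `[0, J] (EFin \o g)) ->
  (forall x, 0 < x -> h x = c + prim g x) -> weak_derivative h g.
Proof.
move=> mg gi hE; have mH := @measurable_halfline R.
have sub K : compact K -> K `<=` halfline -> exists2 M : R, 0 < M & K `<=` `]0, M].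
  move=> cK KH; have [M M0 KM] := compact_sub_cc cK; exists M => // x Kx.
  by have := KM _ Kx; have := KH _ Kx; rewrite /= !in_itv/= /halfline/= => -> /andP[].
have mh : measurable_fun halfline h.
  apply: (eq_measurable_fun (fun x => c + prim g x)).
    by move=> x /set_mem; rewrite /halfline/= => /hE.
  apply: open_continuous_measurable_fun; first exact: open_halfline.
  move=> x /set_mem; rewrite /halfline/= => x0.
  by apply: cvgD; [exact: cvg_cst|exact: prim_continuous_at].
split.
- split; [by []|exact: open_halfline|move=> K KH cK].
  have [M M0 KM] := sub _ cK KH.
  have [C C0 HC] := continuous_bounded_cc (prim_continuous (ltW M0) (gi M)).
  suff : mu.-integrable K (EFin \o h) by case/integrableP.
  have mK : measurable K by exact: compact_measurable.
  apply: (@integrable_bnd _ _ R mu K h (`|c| + C) mK).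
  + apply: (@le_lt_trans _ _ (mu `]0, M]%classic)); first by apply: le_measure => //; rewrite inE.
    by rewrite lebesgue_measure_itv/= lte_fin M0 -EFinB ltry.
  + exact: measurable_funS mh.
  + move=> x Kx; rewrite hE//; last exact: KH.
    rewrite (le_trans (ler_normD _ _))// lerD// HC//.
    by have := KM _ Kx; rewrite /= in_itv/= => /andP[/ltW -> ->].
- split; [by []|exact: open_halfline|move=> K KH cK].
  have [M M0 KM] := sub _ cK KH.
  suff : mu.-integrable K (EFin \o g) by case/integrableP.
  apply: integrableS (gi M) => //; first exact: compact_measurable.
  by apply: subset_trans KM _; apply: subset_itvr; rewrite bnd_simp.
move=> psi tp; have [a [J [a0 aJ z]]] := test_halfline_supp tp.
have J0 : 0 < J by exact: lt_trans aJ.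
have sp := test_halfline_smooth tp.
have cp := smooth_continuous sp; have cd := smooth_continuous (smooth_derive1 sp).
have z' x : J < x -> derive1 psi x = 0.
  move=> Jx; apply: isd_derive1; apply: near_eq_is_derive (isd_cst x 0).
  by near=> y; rewrite z//; right; apply: ltW; near: y; exact: lt_nbhsr.
have e (k f : R -> R) : (forall x, J < x -> k x = 0) -> mu.-integrable `[0, J] (EFin \o (fun x => f x * k x)) ->
   \int[mu]_(x in halfline) (f x * k x) = \int[mu]_(x in `[0, J]) (f x * k x).
  move=> kz fki; rewrite -Rintegral_itv_obnd_cbnd; last first.
    by apply: integrableS fki => //; apply: subset_itvr; rewrite bnd_simp.
  rewrite (_ : `]0, J]%classic = halfline `&` `]0, J]); last first.
    by apply/esym/setIidr => x /=; rewrite in_itv/= => /andP[].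
  rewrite Rintegral_mkcondr; apply: eq_Rintegral => x /set_mem; rewrite /halfline/= => x0.
  rewrite patchE; case: ifPn => //; rewrite notin_setE/= in_itv/= x0/= => /negP.
  by rewrite -ltNge => Jx; rewrite kz ?mulr0.
have dpi : mu.-integrable `[0, J] (EFin \o derive1 psi).
  by apply: continuous_integrable_cc; exact: continuous_subspaceT.
have cc : {within `[0, J], continuous (fun x => (c + prim g x) * derive1 psi x)}.
  move=> x; apply: cvgM; last exact: (continuous_subspaceT cd).
  by apply: cvgD; [exact: cvg_cst|exact: (prim_continuous (ltW J0) (gi J))].
have [C C0 HC] := continuous_bounded_cc (@continuous_subspaceT _ _ `[0, J] _ cp).
have gpi : mu.-integrable `[0, J] (EFin \o (fun x => g x * psi x)).
  apply: (@mu_integrable_dom _ _ _ (fun x => C * `|g x|)) => //.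
  - apply: measurable_funM; first by apply/measurable_EFinP; exact: measurable_int (gi J).
    by apply: measurable_funTS; exact: continuous_measurable_fun.
  - by apply: integrable_scale => //; exact: integrable_norm (gi J).
  - by move=> x xJ; rewrite normrM mulrC ler_wpM2r// HC//; move: xJ; rewrite /= in_itv.
transitivity (\int[mu]_(x in halfline) ((c + prim g x) * derive1 psi x)).
  by apply: eq_Rintegral => x /set_mem; rewrite /halfline/= => x0; rewrite hE.
rewrite !e//; [|by move=> x Jx; rewrite z//; right; exact: ltW|exact: continuous_integrable_cc].
under eq_Rintegral do rewrite mulrDl mulrC [_ * derive1 psi _]mulrC.
have cpi : mu.-integrable `[0, J] (EFin \o (fun x => derive1 psi x * prim g x)).
  apply: continuous_integrable_cc => x; apply: cvgM; first exact: (continuous_subspaceT cd).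
  exact: (prim_continuous (ltW J0) (gi J)).
rewrite RintegralD//; last first.
  exact: mu_integrable_scaler.
rewrite prim_ibp// RintegralZr// -/(prim (derive1 psi) J) !prim_derive ?(ltW J0)//.
rewrite z; last by right.
rewrite [psi 0]z; last by left; exact: ltW.
rewrite subrr !mul0r add0r sub0r; congr (- _).
apply: eq_Rintegral => x /set_mem/=; rewrite in_itv/= => /andP[x0 xJ].
by rewrite prim_derive// [psi 0]z ?subr0 1?mulrC//; left; exact: ltW.
Unshelve. all: by end_near. Qed.

Lemma weak_derivative_smooth psi : smooth psi -> weak_derivative psi (derive1 psi).
Proof.
move=> sp; have cd := smooth_continuous (smooth_derive1 sp).
apply: (@weak_derivative_prim _ _ (psi 0)).
- by apply: measurable_funTS; exact: continuous_measurable_fun.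
- by move=> J; apply: continuous_integrable_cc; exact: continuous_subspaceT.
- by move=> x /ltW x0; rewrite prim_derive// addrC subrK.
Qed.

Lemma test_halfline_derive0 psi a J : (forall x, x <= a \/ J <= x -> psi x = 0) ->
  forall x, x < a \/ J < x -> derive1 psi x = 0.
Proof.
move=> z x h; apply: isd_derive1; apply: near_eq_is_derive (isd_cst x 0).
case: h => [xa|Jx]; near=> y; rewrite z//.
  by left; apply: ltW; near: y; exact: lt_nbhsl.
by right; apply: ltW; near: y; exact: lt_nbhsr.
Unshelve. all: by end_near. Qed.

Lemma L2_halfline_bounded f J M : measurable_fun halfline f ->
  (forall x, 0 < x -> J < x -> f x = 0) -> (forall x, 0 < x -> `|f x| <= M) -> L2_halfline f.
Proof.
move=> mf fz fM; apply/L2_halflineP; split=> //.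
apply: (@mu_integrable_dom _ _ _ (fun x => M ^+ 2 * \1_(`]0, J]) x)).
- exact: measurable_halfline.
- exact: measurable_funX.
- apply: integrable_scale; first exact: measurable_halfline.
  by apply: integrableS (@integrable_indic_itv R 0 J false false) => //; exact: measurable_halfline.
- move=> x; rewrite /halfline/= => x0; rewrite indicE mem_setE in_itv/= x0/=.
  have M0 := le_trans (normr_ge0 _) (fM _ x0).
  have [xJ|Jx] := leP x J; last by rewrite fz// expr0n normr0 mulr0.
  by rewrite mulr1 normrX ler_pXn2r ?nnegrE// fM.
Qed.

Lemma L2_halfline_test psi : test_halfline psi ->
  L2_halfline psi /\ L2_halfline (derive1 psi).
Proof.
move=> tp; have sp := test_halfline_smooth tp.
have [a [J [a0 aJ z]]] := test_halfline_supp tp.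
have zd := test_halfline_derive0 z.
have aux f : continuous f -> (forall x, x < a \/ J < x -> f x = 0) -> L2_halfline f.
  move=> cf fz; have [C C0 HC] := continuous_bounded_cc (@continuous_subspaceT _ _ `[a, J] _ cf).
  apply: (@L2_halfline_bounded f J C).
  - by apply: measurable_funTS; exact: continuous_measurable_fun.
  - by move=> x _ Jx; rewrite fz//; right.
  - move=> x _; have [xa|ax] := ltP x a; first by rewrite fz ?normr0//; left.
    have [Jx|xJ] := ltP J x; first by rewrite fz ?normr0//; right.
    by rewrite HC// ax.
split; apply: aux.
- exact: smooth_continuous.
- by move=> x [/ltW|/ltW] h; rewrite z//; [left|right].
- exact: smooth_continuous (smooth_derive1 sp).
- exact: zd.
Qed.

Lemma L2_halflineD f g : L2_halfline f -> L2_halfline g -> L2_halfline (fun x => f x + g x).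
Proof.
move=> /L2_halflineP[mf fi] /L2_halflineP[mg gi]; apply/L2_halflineP.
have mH := @measurable_halfline R.
split; first exact: measurable_funD.
apply: (@mu_integrable_dom _ _ _ (fun x => 2 * f x ^+ 2 + 2 * g x ^+ 2)) => //.
- by apply: measurable_funX; exact: measurable_funD.
- by apply: integrable_add => //; exact: integrable_scale.
- move=> x _; rewrite ger0_norm ?sqr_ge0//.
  by have := sqr_ge0 (f x - g x); rewrite sqrrB sqrrD; lra.
Qed.

Lemma L2_halflineN f : L2_halfline f -> L2_halfline (fun x => - f x).
Proof.
move=> /L2_halflineP[mf fi]; apply/L2_halflineP; split; first exact: measurable_funN.
by apply: eq_integrable fi; [exact: measurable_halfline|move=> x _; rewrite /= sqrrN].
Qed.

Lemma L2_halflineB f g : L2_halfline f -> L2_halfline g -> L2_halfline (fun x => f x - g x).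
Proof. by move=> Lf Lg; apply: L2_halflineD => //; exact: L2_halflineN. Qed.

Lemma L2_integrable_oc f J : L2_halfline f -> mu.-integrable `]0, J] (EFin \o f).
Proof.
move=> /L2_halflineP[mf fi]; have mH := @measurable_halfline R.
have s : `]0, J]%classic `<=` (halfline : set R) by move=> x /=; rewrite in_itv/= => /andP[].
apply: (@mu_integrable_dom _ _ _ (fun x => 1 + f x ^+ 2)) => //.
- exact: measurable_funS mf.
- apply: integrable_add => //; last exact: integrableS fi.
  apply: (@integrable_bnd _ _ R mu _ (fun=> 1) 1) => //; last by move=> *; rewrite normr1.
  exact: lebesgue_oc_lty.
- move=> x _; rewrite ler_norml; apply/andP; split; nra.
Qed.

Lemma integrable_oc_cc f a b : mu.-integrable `]a, b] (EFin \o f) ->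
  mu.-integrable `[a, b] (EFin \o f).
Proof.
have [ab|ba] := leP a b; last first.
  by move=> _; rewrite set_itv_ge ?bnd_simp -?ltNge//; exact: integrable_set0.
move=> /integrableP[mf fi]; apply/integrableP; split.
  by apply/emeasurable_fun_itv_obnd_cbndP.
rewrite -integral_itv_obnd_cbnd//.
by apply: measurableT_comp => //.
Qed.

Lemma L2_integrable_cc f J : L2_halfline f -> mu.-integrable `[0, J] (EFin \o f).
Proof. by move=> Lf; apply: integrable_oc_cc; exact: L2_integrable_oc. Qed.

(** Young's inequality [|f| <= e + f^2 / e]. The free parameter [e] takes the place of the
    Cauchy-Schwarz inequality. *)
Lemma L2_int_abs_le f J e : 0 <= J -> 0 < e -> L2_halfline f ->
  prim (fun x => `|f x|) J <= e * J + e^-1 * \int[mu]_(x in halfline) (f x ^+ 2).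
Proof.
move=> J0 e0 Lf; have [mf fi] := (L2_halflineP _).1 Lf.
have mH := @measurable_halfline R.
have s : `]0, J]%classic `<=` (halfline : set R) by move=> x /=; rewrite in_itv/= => /andP[].
have fi' := integrable_norm (L2_integrable_cc J Lf).
have ci : mu.-integrable `]0, J] (EFin \o (fun=> e : R)).
  apply: (@integrable_bnd _ _ R mu _ (fun=> e) `|e|) => //.
  exact: lebesgue_oc_lty.
have f2i : mu.-integrable `]0, J] (EFin \o (fun x => e^-1 * f x ^+ 2)).
  by apply: integrable_scale => //; exact: integrableS fi.
rewrite /prim -Rintegral_itv_obnd_cbnd; last first.
  by apply: integrableS fi' => //; apply: subset_itvr; rewrite bnd_simp.
apply: (@le_trans _ _ (\int[mu]_(x in `]0, J]) (e + e^-1 * f x ^+ 2))).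
  apply: le_Rintegral => //.
  - by apply: integrableS fi' => //; apply: subset_itvr; rewrite bnd_simp.
  - exact: integrable_add.
  - move=> x _; rewrite -(ler_pM2l e0) mulrDr mulrA divff ?gt_eqF// mul1r.
    rewrite -(real_normK (num_real (f x))).
    by have := normr_ge0 (f x); have := sqr_ge0 (e - `|f x|); rewrite sqrrB; nra.
rewrite RintegralD// Rintegral_cst//= lebesgue_measure_itv/=; apply: lerD.
  by case: ifP => _ /=; rewrite ?oppr0 ?addr0 // mulr0 mulr_ge0// ltW.
rewrite RintegralZl//; last exact: integrableS fi.
rewrite ler_wpM2l ?invr_ge0 ?(ltW e0)//.
rewrite [leLHS]Rintegral_mkcond [leRHS]Rintegral_mkcond; apply: le_Rintegral => //.
- by apply: integrable_restrictT => //; exact: integrableS fi.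
- exact: integrable_restrictT.
- move=> x _; rewrite !patchE; case: ifPn => h1; case: ifPn => h2 //.
    by move: h2; rewrite (mem_set (s _ (set_mem h1))).
  exact: sqr_ge0.
Qed.

(** The zero trace. Test functions are the primitives of their derivatives; convergence in [W12]
    implies [L1] convergence of functions and derivatives on each [[0, J]], and there a primitive
    depends continuously on its density. So the relation passes to the limit. *)
Lemma W12_0_prim h g : W12_0 h -> weak_derivative h g ->
  [/\ L2_halfline h, L2_halfline g & {ae mu, forall x, 0 < x -> h x = prim g x}].
Proof.
move=> [[Lh [g0 w0 Lg0]] [psi [tp cv]]] wg; have mH := @measurable_halfline R.
have Lg : L2_halfline g.
  apply/L2_halflineP; have [_ [mg _ _] _] := wg; split => //.
  have [mg0 g0i] := (L2_halflineP _).1 Lg0.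
  have /integrableP[_ fin] := g0i; apply/integrableP; split.
    by apply/measurable_EFinP; exact: measurable_funX.
  apply: le_lt_trans fin; rewrite le_eqVlt; apply/orP; left; apply/eqP.
  apply: ae_eq_integral => //.
  - by apply: measurableT_comp => //; apply/measurable_EFinP; exact: measurable_funX.
  - by apply: measurableT_comp => //; apply/measurable_EFinP; exact: measurable_funX.
  - by apply: mu_ae_imp (weak_derivative_unique wg w0) => x /= /[apply] ->.
split => //.
pose u n x := h x - psi n x; pose v n x := g x - derive1 (psi n) x.
have Lu n : L2_halfline (u n) by apply: L2_halflineB => //; have [] := L2_halfline_test (tp n).
have Lv n : L2_halfline (v n) by apply: L2_halflineB => //; have [] := L2_halfline_test (tp n).
have uv n : weak_derivative (u n) (v n).
  by apply: weak_derivativeB => //; apply: weak_derivative_smooth; exact: test_halfline_smooth.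
pose N n := \int[mu]_(x in halfline) (u n x ^+ 2 + v n x ^+ 2).
have N0 n : 0 <= N n by apply: Rintegral_ge0 => x _; rewrite addr_ge0// sqr_ge0.
have u2 n : mu.-integrable halfline (EFin \o (fun x => u n x ^+ 2)) by have [] := (L2_halflineP _).1 (Lu n).
have v2 n : mu.-integrable halfline (EFin \o (fun x => v n x ^+ 2)) by have [] := (L2_halflineP _).1 (Lv n).
have uN n : \int[mu]_(x in halfline) (u n x ^+ 2) <= N n.
  by apply: le_Rintegral => //; [exact: integrable_add|move=> x _; rewrite lerDl sqr_ge0].
have vN n : \int[mu]_(x in halfline) (v n x ^+ 2) <= N n.
  by apply: le_Rintegral => //; [exact: integrable_add|move=> x _; rewrite lerDr sqr_ge0].
have Nsmall e : 0 < e -> exists n, N n <= e ^+ 2.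
  move=> e0; move/cvgrPdist_le : cv => /(_ _ e0) [n _ /(_ n (leqnn n))].
  rewrite /= (W12_norm_eq (uv n)) -/(N n) sub0r normrN ger0_norm ?sqrtr_ge0// => H.
  by exists n; rewrite -(sqr_sqrtr (N0 n)) ler_pXn2r ?nnegrE ?sqrtr_ge0// ltW.
have gi J := L2_integrable_cc J Lg; have hi J := L2_integrable_cc J Lh.
suff H : {ae mu, forall x, forall n : nat, 0 <= x <= n%:R -> `|h x - prim g x| = 0}.
  apply: mu_ae_imp H => x H x0; apply/eqP; rewrite -subr_eq0 -normr_eq0; apply/eqP.
  by apply: (H (Num.truncn x).+1); rewrite (ltW x0) ltW// truncnS_gt.
apply/ae_foralln => n; set J : R := n%:R.
have J0 : 0 <= J by [].
pose k x := `|h x - prim g x|.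
have mk : measurable_fun `[0, J] k.
  apply: measurableT_comp => //; apply: measurable_funB.
    by apply/measurable_EFinP; exact: measurable_int (hi J).
  by apply: subspace_continuous_measurable_fun => //; exact: prim_continuous.
have pgi : mu.-integrable `[0, J] (EFin \o prim g).
  by apply: continuous_integrable_cc; exact: prim_continuous.
have ki : mu.-integrable `[0, J] (EFin \o k).
  apply: integrable_norm; exact: integrable_sub.
suff : \int[mu]_(x in `[0, J]) k x = 0.
  move=> k0; have := mu_Rintegral0_ae (measurable_itv _) ki (fun x _ => normr_ge0 _) k0.
  by apply: mu_ae_imp => x /=; rewrite in_itv.
(* The same [e] measures the approximation, [N p <= e^2], and serves as parameter in Young's
   inequality. Each of the two [L1] errors is then at most [e (J + 1)], and integrating the second
   one over [[0, J]] gives [e (J + 1)^2] in all. *)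
have B e : 0 < e -> \int[mu]_(x in `[0, J]) k x <= e * (J + 1) ^+ 2.
  move=> e0; have [p Np] := Nsmall _ e0.
  have ub := L2_int_abs_le J0 e0 (Lu p); have vb := L2_int_abs_le J0 e0 (Lv p).
  have {}ub : prim (fun x => `|u p x|) J <= e * (J + 1).
    apply: le_trans ub _; rewrite mulrDr mulr1 lerD2l ler_pdivrMl// -expr2.
    exact: le_trans (uN p) Np.
  have {}vb : prim (fun x => `|v p x|) J <= e * (J + 1).
    apply: le_trans vb _; rewrite mulrDr mulr1 lerD2l ler_pdivrMl// -expr2.
    exact: le_trans (vN p) Np.
  have ui := integrable_norm (L2_integrable_cc J (Lu p)).
  have vi := integrable_norm (L2_integrable_cc J (Lv p)).
  have ci : mu.-integrable `[0, J] (EFin \o (fun=> e * (J + 1))).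
    apply: (@integrable_bnd _ _ R mu _ (fun=> e * (J + 1)) `|e * (J + 1)|) => //.
    exact: lebesgue_itv_lty.
  apply: (@le_trans _ _ (\int[mu]_(x in `[0, J]) (`|u p x| + e * (J + 1)))).
    apply: le_Rintegral => //; first exact: integrable_add.
    move=> x /=; rewrite in_itv/= => /andP[x0 xJ].
    have -> : k x = `|u p x - prim (v p) x|.
      rewrite /k /v primB//.
      - rewrite prim_derive//; last exact: test_halfline_smooth.
        have [a [J' [a0 aJ' z]]] := test_halfline_supp (tp p).
        by rewrite [psi p 0]z; [rewrite /u; congr `|_|; ring|left; exact: ltW].
      - apply: continuous_integrable_cc; apply: continuous_subspaceT.
        exact: smooth_continuous (smooth_derive1 (test_halfline_smooth (tp p))).
    rewrite (le_trans (ler_normB _ _))// lerD2l (le_trans _ vb)//.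
    apply: (@le_trans _ _ (prim (fun x => `|v p x|) x)).
      by apply: prim_bound => //; exact: L2_integrable_cc.
    by apply: prim_homo => //.
  rewrite RintegralD// Rintegral_cst//= lebesgue_measure_itv/=.
  have -> : fine (if (0%:E < J%:E)%E then (J%:E - 0%:E)%E else 0%E) = J.
    by case: ifPn => /=; rewrite ?subr0// lte_fin -leNgt => JJ; apply/eqP; rewrite eq_le J0 JJ.
  rewrite -/(prim (fun x => `|u p x|) J) (le_trans (lerD ub (lexx _)))// expr2; nra.
apply/eqP; rewrite eq_le; apply/andP; split; last by apply: Rintegral_ge0 => x _; exact: normr_ge0.
apply/ler_addgt0Pr => e e0; rewrite add0r.
have J1 : 0 < (J + 1) ^+ 2 by rewrite exprn_gt0// ltr_wpDl.
by have := B (e / (J + 1) ^+ 2) (divr_gt0 e0 J1); rewrite divfK// gt_eqF.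
Qed.

End W12_line.

(** * Approximation of compactly supported primitives by test functions *)

Section W12_0_density.
Context {R : realType}.
Local Notation mu := (@lebesgue_measure R).
Implicit Types (f g h psi : R -> R) (a b c J x : R).

(** Squared [W12] distance between pairs of a function and its derivative. Carrying the derivative
    along keeps the choice made in [weakD] out of the estimates. *)
Definition dist2 h g h' g' : R :=
  \int[mu]_(x in halfline) ((h x - h' x) ^+ 2 + (g x - g' x) ^+ 2).

Lemma dist2_triangle h1 g1 h2 g2 h3 g3 :
  L2_halfline h1 -> L2_halfline g1 -> L2_halfline h2 -> L2_halfline g2 ->
  L2_halfline h3 -> L2_halfline g3 ->
  dist2 h1 g1 h3 g3 <= 2 * dist2 h1 g1 h2 g2 + 2 * dist2 h2 g2 h3 g3.
Proof.
move=> Lh1 Lg1 Lh2 Lg2 Lh3 Lg3; have mH := @measurable_halfline R.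
have i f1 f2 f3 f4 : L2_halfline f1 -> L2_halfline f2 -> L2_halfline f3 -> L2_halfline f4 ->
    mu.-integrable halfline (EFin \o (fun x => (f1 x - f2 x) ^+ 2 + (f3 x - f4 x) ^+ 2)).
  move=> L1 L2 L3 L4; apply: integrable_add => //.
    by have [] := (L2_halflineP _).1 (L2_halflineB L1 L2).
  by have [] := (L2_halflineP _).1 (L2_halflineB L3 L4).
rewrite /dist2 -!RintegralZl//; try exact: i.
rewrite -RintegralD//; try by apply: mu_integrable_scale => //; exact: i.
apply: le_Rintegral => //; first exact: i.
  by apply: integrable_add => //; apply: mu_integrable_scale => //; exact: i.
move=> x _; have := sqr_ge0 ((h1 x - h2 x) - (h2 x - h3 x)).
have := sqr_ge0 ((g1 x - g2 x) - (g2 x - g3 x)); nra.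
Qed.

Lemma W12_0_approx h g : weak_derivative h g -> L2_halfline h -> L2_halfline g ->
  (forall e, 0 < e -> exists2 psi, test_halfline psi & dist2 h g psi (derive1 psi) <= e) ->
  W12_0 h.
Proof.
move=> wh Lh Lg H; split; first by split => //; exists g.
have H' n : exists psi, test_halfline psi /\ dist2 h g psi (derive1 psi) <= (n.+1%:R^-1) ^+ 2.
  by have [|psi tp d] := H ((n.+1%:R^-1) ^+ 2); [rewrite exprn_gt0// invr_gt0|exists psi].
have [psi Hpsi] := choice H'; exists psi; split; first by move=> n; have [] := Hpsi n.
apply/cvgrPdist_le => e e0; near=> n.
have [tp d] := Hpsi n.
have w : weak_derivative (h \- psi n) (fun x => g x - derive1 (psi n) x).
  apply: weak_derivativeB => //; apply: weak_derivative_smooth; exact: test_halfline_smooth.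
rewrite sub0r normrN (W12_norm_eq w) ger0_norm ?sqrtr_ge0//.
apply: (@le_trans _ _ (n.+1%:R^-1)).
  rewrite -[leRHS]ger0_norm ?invr_ge0// -sqrtr_sqr ler_sqrt//; exact: exprn_ge0.
rewrite -[leRHS]invrK lef_pV2 ?posrE ?invr_gt0// -natr1.
by apply: (@le_trans _ _ n%:R); rewrite ?lerDl//; near: n; exact: nbhs_infty_ger.
Unshelve. all: by end_near. Qed.

(** Sums of integer translates of [hat] telescope to a difference of two steps: the translates form
    a smooth partition of unity with supports of length [2]. *)
Definition hat x : R := step (1 * x + 1) - step x.

Lemma smooth_hat : smooth hat.
Proof. by apply: smoothB; [apply: smooth_affine|]; exact: smooth_step. Qed.

Lemma hat_ge0 x : 0 <= hat x.
Proof. by rewrite subr_ge0 step_homo// mul1r lerDl. Qed.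

Lemma hat_eq0 x : x <= -1 \/ 1 <= x -> hat x = 0.
Proof.
rewrite /hat mul1r => -[h|h]; first by rewrite !step_le0 ?subrr//; lra.
by rewrite !step_ge1 ?subrr//; lra.
Qed.

Definition hat_int x := \int[mu]_(z in `[-2, x]) hat z.

Lemma hat_int_derive x : is_derive x 1 hat_int (hat x).
Proof.
apply: (@is_derive_primitive_left0 _ _ _ (-1)); [|lra|].
- exact: smooth_continuous smooth_hat.
- by move=> y y0; rewrite hat_eq0//; left; exact: ltW.
Qed.

Lemma smooth_hat_int : smooth hat_int.
Proof. exact: smooth_primitive smooth_hat hat_int_derive. Qed.

Lemma hat_int_le x : x <= -1 -> hat_int x = 0.
Proof.
move=> x0; rewrite /hat_int -[RHS](Rintegral_0 mu `[-2, x]); apply: eq_Rintegral.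
move=> z /set_mem/=; rewrite in_itv/= => /andP[_ zx]; rewrite hat_eq0//.
by left; exact: le_trans x0.
Qed.

Lemma hat_int_ge x : 1 <= x -> hat_int x = hat_int 1.
Proof.
rewrite le_eqVlt => /predU1P[<-//|x1]; apply/eqP; rewrite -subr_eq0.
have [c /andP[c1 _] ->] := MVT_all x1 hat_int_derive.
by rewrite hat_eq0 ?mul0r//; right; exact: ltW.
Qed.

Section compact_support.
Variables (g : R -> R) (C : R) (K : nat).
Hypotheses (mg : measurable_fun setT g) (gC : forall x, `|g x| <= C)
  (gK : forall x, K%:R <= x -> g x = 0)
  (hK : prim g K%:R = 0).
Let h := prim g.

Let C0 : 0 <= C. Proof. exact: le_trans (normr_ge0 _) (gC 0). Qed.

Let gi a b : mu.-integrable `[a, b] (EFin \o g).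
Proof.
apply: (@integrable_bnd _ _ R mu _ g C) => //; first exact: lebesgue_itv_lty.
exact: measurable_funTS.
Qed.

Lemma prim_sub x y : 0 <= x -> x <= y -> prim g y - prim g x = \int[mu]_(z in `[x, y]) g z.
Proof.
move=> x0 xy; rewrite /prim Rintegral_itvB ?bnd_simp//.
by rewrite Rintegral_itv_obnd_cbnd//; apply: integrableS (gi x y) => //; apply: subset_itvr; rewrite bnd_simp.
Qed.

Lemma prim_lipschitz x y : 0 <= x -> x <= y -> `|prim g y - prim g x| <= C * (y - x).
Proof.
move=> x0 xy; rewrite prim_sub// (le_trans (le_normr_Rintegral _ _))//.
apply: (@le_trans _ _ (\int[mu]_(z in `[x, y]) C)).
  apply: le_Rintegral => //; first exact: integrable_norm (gi x y).
  by apply: (@integrable_bnd _ _ R mu _ (fun=> C) `|C|) => //; exact: lebesgue_itv_lty.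
rewrite Rintegral_cst//= lebesgue_measure_itv/= lte_fin.
by case: ifPn => /=; rewrite ?EFinB//; rewrite -leNgt => yx; rewrite mulr0 mulr_ge0// subr_ge0.
Qed.

Let hK' x : K%:R <= x -> h x = 0.
Proof.
move=> Kx; have := prim_sub (ler0n _ K) Kx; rewrite hK subr0 -/h => ->.
rewrite -[RHS](Rintegral_0 mu `[K%:R, x]); apply: eq_Rintegral => z /set_mem/=.
by rewrite in_itv/= => /andP[Kz _]; exact: gK.
Qed.

(** Room for the shift by [2] and for the half-width [1] of [hat]: beyond [M] every term with a
    nonzero increment has reached its final value, so the sum telescopes to a multiple of
    [h M - h 0 = 0]. *)
Let M := (K + 3)%N.
Let incr (n j : nat) : R := h (j.+1%:R / n.+1%:R) - h (j%:R / n.+1%:R).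

(** The increments of [h = prim g] on the grid of mesh [1 / (n + 1)], each smeared by a smooth step.
    The shift by [2] moves the supports to [x >= 1 / (n + 1)], away from the origin. The derivative
    [mollify'] combines difference quotients of [h] with the weights [hat], of sum at most [1],
    hence is bounded by the Lipschitz constant [C]. *)
Definition mollify n x := \sum_(0 <= j < n.+1 * M) incr n j * hat_int (n.+1%:R * x + - (j%:R + 2)).
Definition mollify' n x := \sum_(0 <= j < n.+1 * M) (incr n j * n.+1%:R) * hat (n.+1%:R * x + - (j%:R + 2)).

Let hat_sum n x (N : nat) :
  \sum_(0 <= j < N) hat (n.+1%:R * x + - (j%:R + 2)) =
  step (n.+1%:R * x - 1) - step (n.+1%:R * x - N%:R - 1).
Proof.
rewrite (telescope_sumr_eq (fun j => - step (n.+1%:R * x - j%:R - 1)))//.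
  by rewrite subr0 opprK addrC.
move=> j _; rewrite /hat opprK [RHS]addrC -natr1; congr (step _ - step _); ring.
Qed.

Let hat_sum_le n x (N : nat) : \sum_(0 <= j < N) hat (n.+1%:R * x + - (j%:R + 2)) <= 1.
Proof. by rewrite hat_sum; have := step_le1 (n.+1%:R * x - 1); have := step_ge0 (n.+1%:R * x - N%:R - 1); lra. Qed.

Let mollify_derive n x : is_derive x 1 (mollify n) (mollify' n x).
Proof.
rewrite /mollify /mollify'; elim: (n.+1 * M)%N => [|N IH].
  by under eq_fun do rewrite big_nil; rewrite big_nil; exact: isd_cst.
have d2 : is_derive x 1 (fun y => incr n N * hat_int (n.+1%:R * y + - (N%:R + 2)))
    (incr n N * (hat (n.+1%:R * x + - (N%:R + 2)) * n.+1%:R)).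
  by apply: isdZ; apply: isd_affine; exact: hat_int_derive.
under eq_fun do rewrite big_nat_recr//=.
rewrite [X in is_derive _ _ _ X]big_nat_recr//= -[_ * _ * hat _]mulrA [n.+1%:R * hat _]mulrC.
exact: isdD IH d2.
Qed.

Let incr_bound n j : `|incr n j * n.+1%:R| <= C.
Proof.
rewrite normrM (ger0_norm (ler0n _ _)) -ler_pdivlMr//.
apply: le_trans (prim_lipschitz _ _) _.
- by rewrite divr_ge0.
- by rewrite ler_pM2r ?invr_gt0// ler_nat.
- by rewrite -mulrBl -natr1 addrAC subrr add0r mul1r.
Qed.

Let mollify'_bound n x : `|mollify' n x| <= C.
Proof.
rewrite /mollify' (le_trans (ler_norm_sum _ _ _))//.
apply: (@le_trans _ _ (\sum_(0 <= j < n.+1 * M) C * hat (n.+1%:R * x + - (j%:R + 2)))).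
  by apply: ler_sum => j _; rewrite normrM (ger0_norm (hat_ge0 _)) ler_wpM2r ?hat_ge0.
by rewrite -mulr_sumr -[leRHS]mulr1 ler_wpM2l// hat_sum_le.
Qed.

Let smooth_mollify n : smooth (mollify n).
Proof.
rewrite /mollify; apply: smooth_sum => j; apply: smoothZ.
apply: smooth_affine; exact: smooth_hat_int.
Qed.

Let derive1_mollify n : derive1 (mollify n) = mollify' n.
Proof. by apply/funext => x; exact: isd_derive1. Qed.

Let incr0 n j : (n.+1 * K <= j)%N -> incr n j = 0.
Proof.
move=> Kj; have Kn : K%:R <= j%:R / n.+1%:R :> R.
  by rewrite ler_pdivlMr// -natrM ler_nat mulnC.
rewrite /incr !hK' ?subrr// (le_trans Kn)// ler_pM2r ?invr_gt0// ler_nat//.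
Qed.

Let mollify0 n x : x <= n.+1%:R^-1 \/ M%:R <= x -> mollify n x = 0.
Proof.
move=> [xn|Mx].
  rewrite /mollify big1// => j _; rewrite hat_int_le ?mulr0//.
  have : n.+1%:R * x <= 1 by rewrite -ler_pdivlMl// mulr1.
  by have : 0 <= j%:R :> R by []; lra.
transitivity (\sum_(0 <= j < n.+1 * M) incr n j * hat_int 1).
  apply: eq_big_nat => j /andP[_ jM].
  have [Kj|jK] := leqP (n.+1 * K) j; first by rewrite incr0// !mul0r.
  congr (_ * _); apply: hat_int_ge.
  have jK' : j%:R + 1 <= n.+1%:R * K%:R :> R by rewrite natr1 -natrM ler_nat.
  have : n.+1%:R * (K%:R + 3) <= n.+1%:R * x :> R by rewrite ler_wpM2l// -natrD.
  have : 1 <= n.+1%:R :> R by rewrite ler1n.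
  by rewrite mulrDr; lra.
rewrite -mulr_suml (telescope_sumr (fun j => h (j%:R / n.+1%:R)))//.
rewrite hK'; last first.
  by rewrite natrM mulrAC divff// mul1r ler_nat leq_addr.
by rewrite mul0r /h prim_le0// subrr mul0r.
Qed.

Let mollify'0 n x : x < n.+1%:R^-1 \/ M%:R < x -> mollify' n x = 0.
Proof. by move=> H; rewrite -derive1_mollify; apply: test_halfline_derive0 H; exact: mollify0. Qed.

Let mollify_test n : test_halfline (mollify n).
Proof.
apply: smooth_test_halfline (mollify0 (n := n)) => //; by rewrite invr_gt0.
Qed.

(** At a point of differentiability of [h] the difference quotients between nearby grid points tend
    to the derivative, and [mollify'] averages them with weights of sum [1]. *)
Let mollify'_cvg x a : 0 < x < M%:R -> is_derive x 1 h a -> mollify' n x @[n --> \oo] --> a.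
Proof.
move=> /andP[x0 xM] /isd_epsP ha; apply/cvgrPdist_le => e e0.
(* The grid points that matter lie within [3 / (n + 1)] of [x]; two expansion errors of size
   [(e / 6) (3 / (n + 1))], divided by the mesh, add up to [e]. *)
have [d d0 Hd] := ha (e / 6) (divr_gt0 e0 (ltr0Sn _ 5)).
near=> n.
have n0 : 0 < n.+1%:R :> R by [].
have n1 : 1 <= n.+1%:R * x - 1.
  rewrite lerBrDr -ler_pdivrMr//; apply: (@le_trans _ _ n%:R); last by rewrite ler_nat.
  by near: n; exact: nbhs_infty_ger.
have nd : 3 / n.+1%:R < d.
  rewrite ltr_pdivrMr// mulrC -ltr_pdivrMr//.
  apply: (@lt_le_trans _ _ (n%:R)); last by rewrite ler_nat.
  by near: n; exact: nbhs_infty_gtr.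
have S1 : \sum_(0 <= j < n.+1 * M) hat (n.+1%:R * x + - (j%:R + 2)) = 1.
  rewrite hat_sum step_ge1// step_le0 ?subr0//.
  rewrite natrM -mulrBr; have : n.+1%:R * (x - M%:R) <= 0 by rewrite mulr_ge0_le0// subr_le0 ltW.
  by lra.
rewrite -[a]mulr1 -S1 mulr_sumr /mollify' -sumrB (le_trans (ler_norm_sum _ _ _))//.
apply: (@le_trans _ _ (\sum_(0 <= j < n.+1 * M) e * hat (n.+1%:R * x + - (j%:R + 2)))); last first.
  by rewrite -mulr_sumr S1 mulr1.
apply: ler_sum => j _; rewrite -mulrBl normrM (ger0_norm (hat_ge0 _)).
set y := (n.+1%:R * x + - _); have [yl|yl] := leP y (-1); first by rewrite hat_eq0 ?mulr0//; left.
have [yr|yr] := leP 1 y; first by rewrite hat_eq0 ?mulr0//; right.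
rewrite ler_wpM2r ?hat_ge0//.
have B (k : nat) : (k == j) || (k == j.+1) -> `|k%:R / n.+1%:R - x| <= 3 / n.+1%:R.
  move=> kj; rewrite -[x in _ - x](mulfK (lt0r_neq0 n0)) -mulrBl normrM.
  rewrite (ger0_norm (_ : 0 <= n.+1%:R^-1))// ler_pM2r ?invr_gt0//.
  move: yl yr; rewrite /y => yl yr.
  have : k%:R = j%:R :> R \/ k%:R = j%:R + 1 :> R.
    by case/orP: kj => /eqP ->; [left|right; rewrite -natr1].
  by move=> hk; rewrite ler_norml mulrC; apply/andP; split; case: hk => ->; lra.
have key k : (k == j) || (k == j.+1) -> `|h (k%:R / n.+1%:R) - h x - a * (k%:R / n.+1%:R - x)| <= e / (2 * n.+1%:R).
  move=> kj; have := Hd _ (le_lt_trans (B _ kj) nd); rewrite [x + _]addrC subrK => /le_trans; apply.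
  have -> : e / (2 * n.+1%:R) = e / 6 * (3 / n.+1%:R) by field; rewrite gt_eqF.
  by rewrite ler_wpM2l ?B// divr_ge0// ltW.
have k1 := key j.+1 ltac:(by rewrite eqxx orbT); have k2 := key j ltac:(by rewrite eqxx).
rewrite (_ : a - _ = ((h (j%:R / n.+1%:R) - h x - a * (j%:R / n.+1%:R - x)) -
   (h (j.+1%:R / n.+1%:R) - h x - a * (j.+1%:R / n.+1%:R - x))) * n.+1%:R); last first.
  by rewrite /incr -[j.+1%:R]natr1; field; rewrite gt_eqF.
rewrite normrM (ger0_norm (ltW n0)) -ler_pdivlMr//.
apply: le_trans (ler_normB _ _) _; apply: le_trans (lerD k2 k1) _.
by rewrite le_eqVlt; apply/orP; left; apply/eqP; field; rewrite gt_eqF.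
Unshelve. all: by end_near. Qed.

Let h_derive : {ae mu, forall x, 0 < x -> is_derive x 1 h (g x)}.
Proof.
have := @FTC1 R g (BLeft 0) (fun y => gi 0 y) _.
have lg : locally_integrable [set: R] g.
  split; [by []|exact: openT|move=> L _ cL].
  have [m m0 Lm] := compact_sub_cc cL.
  suff : mu.-integrable L (EFin \o g) by case/integrableP.
  by apply: integrableS (gi (- m) m) => //; exact: compact_measurable.
move=> /(_ lg); apply: mu_ae_imp => x H x0.
have x0' : (BLeft 0%R < BRight x)%E by rewrite lte_fin.
have [dx <-] := H x0'.
by rewrite derive1E; apply: derivableP.
Qed.

(** Dominated convergence makes the [L1] distance [I] of the derivatives small. It bounds the
    distance of the functions uniformly, both being primitives, and [2 C I] bounds the squared [L2]
    distance of the derivatives, each of which is at most [C]. *)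
Lemma compact_support_approx e : 0 < e ->
  exists2 psi, test_halfline psi & dist2 (prim g) g psi (derive1 psi) <= e.
Proof.
move=> e0.
have mm n : measurable_fun setT (mollify' n).
  apply: continuous_measurable_fun; rewrite -derive1_mollify.
  exact: smooth_continuous (smooth_derive1 (smooth_mollify n)).
have mmi n (D : set R) : measurable_fun D (mollify' n) by apply: measurable_funTS; exact: mm.
have E : \int[mu]_(x in `[0, M%:R]) `|g x - mollify' n x| @[n --> \oo] --> (0 : R).
  rewrite -[X in _ --> X](Rintegral_0 mu `[0, M%:R]).
  have i2 : mu.-integrable `[0, M%:R] (EFin \o (fun=> C + C)).
    by apply: (@integrable_bnd _ _ R mu _ (fun=> C + C) `|C + C|) => //; exact: lebesgue_itv_lty.
  apply: mu_dct i2 _ _ => //.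
  - move=> n; apply: measurableT_comp => //; apply: measurable_funB; [exact: measurable_funTS|exact: mmi].
  - have nM : {ae mu, forall x, x != M%:R}.
      exists [set M%:R]; split => //; first exact: lebesgue_measure_set1.
      by move=> x /= /negP; rewrite negbK => /eqP.
    have n0 : {ae mu, forall x, x != 0}.
      exists [set 0]; split => //; first exact: lebesgue_measure_set1.
      by move=> x /= /negP; rewrite negbK => /eqP.
    apply: mu_ae_imp2 nM (_ : {ae mu, forall x, x != 0 /\ (0 < x -> is_derive x 1 h (g x))}).
      move=> x xM [xn0 hx] /=; rewrite in_itv/= => /andP[x0 xM'].
      have x00 : 0 < x by rewrite lt_neqAle eq_sym xn0.
      rewrite -(normr0 R) -(subrr (g x)); apply: cvg_norm; apply: cvgB; first exact: cvg_cst.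
      by apply: mollify'_cvg; [rewrite x00 lt_neqAle xM|exact: hx].
    by apply: mu_ae_imp2 n0 h_derive.
  - move=> n x _; rewrite normr_id (le_trans (ler_normB _ _))//.
    by apply: lerD; [exact: gC|exact: mollify'_bound].
have M0 : 0 < M%:R :> R by rewrite ltr0n addn_gt0 orbT.
(* The bound [1] turns [I^2] into [I]; the total [I^2 M + 2 C I] is then at most
   [I (M + 2 C + 1) <= e]. *)
pose d := Num.min 1 (e / (M%:R + 2 * C + 1)).
have D0 : 0 < M%:R + 2 * C + 1 by rewrite ltr_wpDl// addr_ge0// mulr_ge0.
have d0 : 0 < d by rewrite lt_min ltr01 divr_gt0.
move/cvgrPdist_le : E => /(_ _ d0) [n _ /(_ n (leqnn n))].
rewrite sub0r normrN ger0_norm; last by apply: Rintegral_ge0 => x _.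
set I := \int[mu]_(x in _) _ => Id; exists (mollify n); first exact: mollify_test.
have di : mu.-integrable `[0, M%:R] (EFin \o (fun x => `|g x - mollify' n x|)).
  apply: integrable_norm; apply: integrable_sub => //.
  apply: (@integrable_bnd _ _ R mu _ _ C) => //; first exact: lebesgue_itv_lty.
  exact: mmi.
have I0 : 0 <= I by apply: Rintegral_ge0 => x _.
have hm x : 0 <= x <= M%:R -> `|prim g x - mollify n x| <= I.
  move=> /andP[x0 xM].
  have mi : mu.-integrable `[0, x] (EFin \o mollify' n).
    apply: (@integrable_bnd _ _ R mu _ _ C) => //; first exact: lebesgue_itv_lty.
    exact: mmi.
  have -> : mollify n x = prim (mollify' n) x.
    rewrite -derive1_mollify prim_derive// [mollify n 0]mollify0 ?subr0//.
    by left; rewrite invr_ge0.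
  rewrite -primB// (le_trans (prim_bound x0 _))//; first exact: integrable_sub.
  by apply: prim_homo.
rewrite /dist2 derive1_mollify.
have mH := @measurable_halfline R.
have mh : measurable_fun (`](0 : R), M%:R]%classic) (prim g).
  apply: (@measurable_funS _ _ _ _ (`[(0 : R), M%:R]%classic)) => //; first by apply: subset_itvr; rewrite bnd_simp.
  by apply: subspace_continuous_measurable_fun => //; apply: prim_continuous => //; exact: ltW.
rewrite (_ : \int[mu]_(x in halfline) _ = \int[mu]_(x in `]0, M%:R])
   ((prim g x - mollify n x) ^+ 2 + (g x - mollify' n x) ^+ 2)); last first.
  rewrite [in RHS](_ : `]0, M%:R]%classic = halfline `&` `]0, M%:R]); last first.
    by apply/esym/setIidr => x /=; rewrite in_itv/= => /andP[].
  rewrite Rintegral_mkcondr; apply: eq_Rintegral => x /set_mem; rewrite /halfline/= => x0.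
  rewrite patchE; case: ifPn => //; rewrite notin_setE/= in_itv/= x0/= => /negP.
  rewrite -ltNge => Mx; have KM : K%:R <= x by rewrite (le_trans _ (ltW Mx))// ler_nat leq_addr.
  rewrite -/h hK'// gK// mollify0; last by right; exact: ltW.
  by rewrite mollify'0 ?subr0 ?expr0n ?addr0//; right.
have sc : `](0 : R), M%:R]%classic `<=` `[(0 : R), M%:R]%classic by apply: subset_itvr; rewrite bnd_simp.
have di' : mu.-integrable `]0, M%:R] (EFin \o (fun x => 2 * C * `|g x - mollify' n x|)).
  by apply: mu_integrable_scale => //; apply: integrableS di.
have ci : mu.-integrable `]0, M%:R] (EFin \o (fun=> I ^+ 2)).
  by apply: (@integrable_bnd _ _ R mu _ (fun=> I ^+ 2) `|I ^+ 2|) => //; exact: lebesgue_oc_lty.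
have bd x : `](0 : R), M%:R]%classic x ->
   (prim g x - mollify n x) ^+ 2 + (g x - mollify' n x) ^+ 2 <= I ^+ 2 + 2 * C * `|g x - mollify' n x|.
  rewrite /= in_itv/= => /andP[/ltW x0 xM]; apply: lerD.
    by rewrite -(real_normK (num_real (_ - _))) ler_pXn2r ?nnegrE// hm// x0.
  rewrite -(real_normK (num_real (_ - _))) expr2 ler_wpM2r//.
  rewrite (le_trans (ler_normB _ _))// mulr_natl mulr2n lerD//; exact: mollify'_bound.
apply: (@le_trans _ _ (\int[mu]_(x in `]0, M%:R]) (I ^+ 2 + 2 * C * `|g x - mollify' n x|))).
  apply: le_Rintegral => //; last exact: integrable_add.
  apply: (@mu_integrable_dom _ _ _ (fun x => I ^+ 2 + 2 * C * `|g x - mollify' n x|)) => //.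
  - apply: measurable_funD; apply: measurable_funX; apply: measurable_funB.
    + exact: mh.
    + apply: measurable_funTS; apply: continuous_measurable_fun.
      exact: smooth_continuous (smooth_mollify n).
    + exact: measurable_funTS.
    + exact: mmi.
  - exact: integrable_add.
  - by move=> x xM; rewrite ger0_norm ?addr_ge0 ?sqr_ge0// bd.
rewrite RintegralD// Rintegral_cst//= lebesgue_measure_itv/= lte_fin M0 -EFinB subr0/=.
rewrite RintegralZl//; last exact: integrableS di.
rewrite Rintegral_itv_obnd_cbnd; last exact: integrableS di.
rewrite -/I.
have d1 : I <= 1 by rewrite (le_trans Id)// ge_min lexx.
have d2 : I * (M%:R + 2 * C + 1) <= e.
  by rewrite -ler_pdivlMr// (le_trans Id)// ge_min lexx orbT.
have : I ^+ 2 * M%:R <= I * M%:R.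
  by rewrite ler_wpM2r// expr2 ler_piMr.
nra.
Qed.

End compact_support.
End W12_0_density.

(** * Square integrable primitives belong to [W12_0] *)

Section W12_0_primitive.
Context {R : realType}.
Local Notation mu := (@lebesgue_measure R).
Implicit Types (f g h psi : R -> R) (a b c J x : R).

Lemma prim_eq f g x : (forall y, 0 < y -> y <= x -> f y = g y) ->
  mu.-integrable `[0, x] (EFin \o f) -> mu.-integrable `[0, x] (EFin \o g) ->
  prim f x = prim g x.
Proof.
move=> fg fi gi; rewrite /prim -!Rintegral_itv_obnd_cbnd.
- by apply: eq_Rintegral => y /set_mem/=; rewrite in_itv/= => /andP[]; exact: fg.
- by apply: integrableS gi => //; apply: subset_itvr; rewrite bnd_simp.
- by apply: integrableS fi => //; apply: subset_itvr; rewrite bnd_simp.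
Qed.

Lemma fine_mu_oc a b : a <= b -> fine (mu `]a, b]%classic) = b - a.
Proof.
rewrite lebesgue_measure_itv/= lte_fin; case: ifPn; first by rewrite -EFinB.
by rewrite -leNgt => ba ab; rewrite (le_anti (introT andP (conj ab ba)))/= subrr.
Qed.

(** This primitive is the linear transition between [N] and [N + 1] used to cut functions off. *)
Lemma prim_indic N x : 0 <= N -> 0 <= prim (\1_(`]N, (N + 1)])) x <= 1 /\
  (x <= N -> prim (\1_(`]N, (N + 1)])) x = 0) /\ (N + 1 <= x -> prim (\1_(`]N, (N + 1)])) x = 1).
Proof.
move=> N0; rewrite /prim /Rintegral.
rewrite (@integral_indic _ _ R mu `[0, x]%classic _ `]N, (N + 1)]%classic)//.
have [xN|Nx] := leP x N.
  rewrite (_ : _ `&` _ = set0) ?measure0/=; last first.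
    rewrite -subset0 => y [] /=; rewrite !in_itv/= => /andP[Ny _] /andP[_ yx].
    by have := lt_le_trans Ny (le_trans yx xN); rewrite ltxx.
  by rewrite lexx ler01; split=> //; split=> // h; exfalso; have := le_trans h xN; lra.
have [xN1|N1x] := leP (N + 1) x.
  rewrite (_ : _ `&` _ = `]N, (N + 1)]%classic); last first.
    apply: setIidl => y /=; rewrite !in_itv/= => /andP[Ny yN]; apply/andP; split; lra.
  rewrite (_ : fine _ = 1); last first.
    by apply: etrans (fine_mu_oc _) _; rewrite ?lerDl// addrAC subrr add0r.
  by rewrite ler01 lexx; split=> //; split=> //; lra.
rewrite (_ : _ `&` _ = `]N, x]%classic); last first.
  apply/seteqP; split => y /=; rewrite !in_itv/=; first by move=> [/andP[-> _] /andP[_ ->]].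
  by move=> /andP[Ny yx]; split; apply/andP; split; lra.
rewrite (_ : fine _ = x - N); last by apply: (fine_mu_oc (ltW Nx)).
by split; [apply/andP; split; lra|split=> h; lra].
Qed.

Lemma tail_cvg f : mu.-integrable halfline (EFin \o f) ->
  \int[mu]_(x in halfline) (f \_ `]n%:R, +oo[) x @[n --> \oo] --> (0 : R).
Proof.
move=> fi; have mH := @measurable_halfline R.
rewrite -[X in _ --> X](Rintegral_0 mu halfline).
have mf : measurable_fun halfline f by apply/measurable_EFinP; exact: measurable_int fi.
apply: (@mu_dct _ _ _ _ (fun x => `|f x|)) => //.
- move=> n; apply/(measurable_restrict f _ mH) => //.
  by apply: measurable_funS mf.
- by have := integrable_norm fi; apply: eq_integrable.
- apply: aeW => x x0; apply: cvg_near_cst; near=> n.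
  rewrite patchE ifF//; apply/negP => /set_mem/=; rewrite in_itv/= andbT ltNge.
  move/negP; apply; near: n; exact: nbhs_infty_ger.
- by move=> n x x0; rewrite patchE; case: ifP => // _; rewrite normr0.
Unshelve. all: by end_near. Qed.

(** Cut-off: at a far point [N] where [h] is small, [h] is brought down to [0] linearly on
    [[N, N + 1]] by giving it the slope [- h N] there. The result has compact support and bounded
    derivative, so [compact_support_approx] applies. *)
Lemma W12_0_of_prim g h C : measurable_fun halfline g -> (forall x, 0 < x -> `|g x| <= C) ->
  (forall x, 0 < x -> h x = prim g x) -> L2_halfline h -> L2_halfline g -> W12_0 h.
Proof.
move=> mg gC hE Lh Lg; have mH := @measurable_halfline R.
have gi J := L2_integrable_cc J Lg.
apply: (@W12_0_approx _ _ g) => //.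
  by apply: (@weak_derivative_prim _ _ _ 0) => // x x0; rewrite hE// add0r.
(* [14 = 2 * 6 + 2]: the triangle inequality doubles the cut-off error [6 e1] and the smoothing
   error [e1]. *)
move=> e e0; pose e1 := e / 14; have e10 : 0 < e1 by rewrite divr_gt0.
have [mh h2i] := (L2_halflineP _).1 Lh; have [_ g2i] := (L2_halflineP _).1 Lg.
pose f x := h x ^+ 2 + g x ^+ 2.
have fi : mu.-integrable halfline (EFin \o f) by exact: integrable_add.
have f0 x : 0 <= f x by rewrite addr_ge0// sqr_ge0.
have mf : measurable_fun halfline f by apply/measurable_EFinP; exact: measurable_int fi.
have fri N : mu.-integrable halfline (EFin \o (f \_ `]N, +oo[)).
  apply: (@mu_integrable_dom _ _ _ f) => //.
    by apply/(measurable_restrict f _ mH) => //; apply: measurable_funS mf.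
  by move=> x _; rewrite patchE; case: ifP => _; rewrite ?normr0// ger0_norm.
move/cvgrPdist_lt : (tail_cvg fi) => /(_ _ e10) [n' _ /(_ _ (leqnSn n'))]; set n := n'.+1.
rewrite sub0r normrN ger0_norm; last by apply: Rintegral_ge0 => x _; rewrite patchE; case: ifP.
move=> Tn.
(* If [h^2] exceeded [e1] at every point from [n] on, its integral over []n, n + 1]] alone would
   reach [e1], against the choice of [n]. *)
have [N [nN hN]] : exists N, n%:R <= N /\ h N ^+ 2 <= e1.
  apply: contrapT => H; move: Tn; apply/negP; rewrite -leNgt.
  have i1 : mu.-integrable halfline (EFin \o (fun x => e1 * \1_(`]n%:R, (n%:R + 1)]) x)).
    apply: mu_integrable_scale => //.
    by apply: integrableS (@integrable_indic_itv R n%:R (n%:R + 1) false false).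
  apply: (@le_trans _ _ (\int[mu]_(x in halfline) (e1 * \1_(`]n%:R, (n%:R + 1)]) x))).
    rewrite RintegralZl//; last first.
      by apply: integrableS (@integrable_indic_itv R n%:R (n%:R + 1) false false).
    rewrite /Rintegral integral_indic// (_ : _ `&` _ = `]n%:R, (n%:R + 1)]%classic).
      rewrite (_ : fine _ = 1) ?mulr1//.
      by apply: etrans (fine_mu_oc _) _; rewrite ?lerDl// addrAC subrr add0r.
    apply: setIidl => y /=; rewrite in_itv/= => /andP[ny _].
    by rewrite /halfline/= (le_lt_trans _ ny).
  apply: le_Rintegral => // x x0; rewrite patchE indicE.
  case: ifPn => xn; last first.
    case: (boolP (x \in _)) => xn1; last by rewrite mulr0.
    by move: xn xn1; rewrite notin_setE mem_setE/= !in_itv/= andbT => /negP/negbTE ->.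
  case: (boolP (x \in _)) => xn1; last by rewrite mulr0.
  rewrite mulr1 /f -[leLHS]addr0 lerD ?sqr_ge0// leNgt; apply/negP => hx.
  by apply: H; exists x; split; [move: xn => /set_mem/=; rewrite in_itv/= andbT => /ltW|exact: ltW].
have N00 : 0 < N by rewrite (lt_le_trans _ nN)// ltr0n.
have N0 := ltW N00.
pose g' := g \_ halfline.
have C0 : 0 <= C by exact: le_trans (normr_ge0 _) (gC 1 ltr01).
have mg' : measurable_fun setT g' by apply/(measurable_restrictT _ mH).
have g'C x : `|g' x| <= C.
  by rewrite /g' patchE; case: ifPn => [/set_mem/gC//|_]; rewrite normr0.
have g'E x : 0 < x -> g' x = g x by move=> x0; rewrite /g' patchE mem_set.
have g'0 x : x <= 0 -> g' x = 0.
  by move=> x0; rewrite /g' patchE ifF//; apply/negP => /set_mem; rewrite /halfline/= ltNge x0.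
have g'i a b : mu.-integrable `[a, b] (EFin \o g').
  apply: (@integrable_bnd _ _ R mu _ g' C) => //; first exact: lebesgue_itv_lty.
  exact: measurable_funTS.
have pg' x : prim g' x = prim g x by apply: prim_eq => // y y0 _; rewrite g'E.
pose k := \1_(`]N, (N + 1)]) : R -> R.
have kE x : k x = (N < x <= N + 1)%R%:R.
  by rewrite /k indicE; congr (nat_of_bool _)%:R; apply/idP/idP; rewrite inE/= in_itv.
pose gt x := (g' \_ `[0, N]) x + (- h N) * k x.
have mgr : measurable_fun setT (g' \_ `[0, N]).
  by apply/(measurable_restrictT _ (measurable_itv _)); exact: measurable_funTS.
have mk : measurable_fun setT k by exact: measurable_indic.
have mgt : measurable_fun setT gt.
  by apply: measurable_funD => //; apply: measurable_funM.
have k01 x : 0 <= k x <= 1 by rewrite /k indicE; case: (_ \in _); rewrite ?lexx ?ler01.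
have gtC x : `|gt x| <= C + `|h N|.
  rewrite (le_trans (ler_normD _ _))// lerD//.
    by rewrite patchE; case: ifP => // _; rewrite normr0.
  rewrite normrM normrN ler_piMr//; have /andP[k0 k1] := k01 x.
  by rewrite ger0_norm.
pose K := (Num.truncn N).+2.
have NK : N + 1 <= K%:R by rewrite /K -natr1 lerD2r ltW// truncnS_gt.
have ki x : mu.-integrable `[0, x] (EFin \o (fun y => (- h N) * k y)).
  apply: mu_integrable_scale => //.
  apply: (@integrable_bnd _ _ R mu _ k 1) => //; first exact: lebesgue_itv_lty.
    exact: measurable_funTS.
  by move=> y _; have /andP[k0 k1] := k01 y; rewrite ger0_norm.
have gri x : mu.-integrable `[0, x] (EFin \o (g' \_ `[0, N])).
  apply: (@integrable_bnd _ _ R mu _ _ C) => //; first exact: lebesgue_itv_lty.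
    exact: measurable_funTS.
  by move=> y _; rewrite patchE; case: ifP => // _; rewrite normr0.
have hN' : prim g N = h N by rewrite hE.
have pgt x : prim gt x = prim (g' \_ `[0, N]) x - h N * prim k x.
  rewrite /prim RintegralD//.
  rewrite RintegralZl//; first by rewrite mulNr.
  apply: (@integrable_bnd _ _ R mu _ k 1) => //; first exact: lebesgue_itv_lty.
    exact: measurable_funTS.
  by move=> y _; have /andP[k0 k1] := k01 y; rewrite ger0_norm.
have pgt1 x : x <= N -> prim gt x = prim g x.
  move=> xN; have [_ [/(_ xN) E _]] := @prim_indic N x N0.
  by rewrite pgt E mulr0 subr0 prim_restrict.
have pgt2 x : N <= x -> prim gt x = h N - h N * prim k x.
  by move=> Nx; rewrite pgt prim_restrict0// pg' hN'.
have pgt3 x : N + 1 <= x -> prim gt x = 0.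
  move=> xN; have [_ [_ /(_ xN) E]] := @prim_indic N x N0.
  by rewrite pgt2; [rewrite E mulr1 subrr|lra].
have gtN1 x : N + 1 < x -> gt x = 0.
  move=> xN; rewrite /gt kE [x <= _]leNgt xN andbF mulr0 addr0.
  rewrite patchE ifF//; apply/negP => /set_mem/=; rewrite in_itv/= => /andP[_ xN'].
  by have := lt_le_trans xN xN'; lra.
have gtK x : K%:R <= x -> gt x = 0.
  rewrite le_eqVlt => /predU1P[xK|Kx]; last by apply: gtN1; exact: le_lt_trans Kx.
  apply: gtN1; rewrite -xK /K -[X in _ < X]natr1 ltrD2r; exact: truncnS_gt.
have [psi tp dpsi] := compact_support_approx mgt gtC gtK (pgt3 _ NK) e10.
exists psi => //.
have [Lp Lp'] := L2_halfline_test tp.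
have hbd x : N <= x -> `|prim gt x| <= `|h N|.
  move=> Nx; rewrite pgt2// -[X in X - _]mulr1 -mulrBr normrM ler_piMr//.
  by have [/andP[p0 p1] _] := @prim_indic N x N0; rewrite ger0_norm; lra.
have Lgt : L2_halfline gt.
  apply: (@L2_halfline_bounded _ _ (N + 1) (C + `|h N|)) => //; first exact: measurable_funTS.
  by move=> x _; exact: gtN1.
have gti J : mu.-integrable `[0, J] (EFin \o gt) by exact: L2_integrable_cc.
have Lpgt : L2_halfline (prim gt).
  have N1 : 0 <= N + 1 by rewrite addr_ge0.
  have [B B0 HB] := continuous_bounded_cc (prim_continuous N1 (gti _)).
  apply: (@L2_halfline_bounded _ _ (N + 1) B) => //.
  - apply: open_continuous_measurable_fun; first exact: open_halfline.
    by move=> x /set_mem; rewrite /halfline/= => x0; exact: prim_continuous_at.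
  - by move=> x _ /ltW; exact: pgt3.
  - move=> x x0; have [xN|Nx] := leP x (N + 1); first by rewrite HB// (ltW x0).
    by rewrite pgt3 ?normr0// ltW.
apply: le_trans (dist2_triangle Lh Lg Lpgt Lgt Lp Lp') _.
suff : dist2 h g (prim gt) gt <= 6 * e1 by move: dpsi; rewrite /e1; lra.
have i1 : mu.-integrable halfline (EFin \o (fun x => 2 * (f \_ `]n%:R, +oo[) x)).
  exact: mu_integrable_scale.
have i2 : mu.-integrable halfline (EFin \o k).
  by apply: integrableS (@integrable_indic_itv R N (N + 1) false false).
have i2' : mu.-integrable halfline (EFin \o (fun x => 4 * h N ^+ 2 * k x)).
  exact: mu_integrable_scale.
(* The square of a difference is at most twice the sum of the squares. This costs [2 (h^2 + g^2)] on
   the tail and [4 (h N)^2] on []N, N + 1]], in total [2 e1 + 4 e1]. *)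
apply: (@le_trans _ _ (\int[mu]_(x in halfline) (2 * (f \_ `]n%:R, +oo[) x + 4 * h N ^+ 2 * k x))).
  apply: le_Rintegral => //.
  - apply: integrable_add => //.
      by have [] := (L2_halflineP _).1 (L2_halflineB Lh Lpgt).
    by have [] := (L2_halflineP _).1 (L2_halflineB Lg Lgt).
  - exact: integrable_add.
  - move=> x; rewrite {1}/halfline/= => x0.
    have [xN|Nx] := leP x N.
      rewrite pgt1// hE// subrr expr0n add0r.
      have -> : gt x = g x.
        rewrite /gt kE ltNge xN/= mulr0 addr0 patchE mem_set ?g'E//=.
        by rewrite in_itv/= (ltW x0).
      rewrite subrr expr0n/= addr_ge0//.
        by rewrite mulr_ge0// patchE; case: ifP.
      by have /andP[? _] := k01 x; apply: mulr_ge0 => //; apply: mulr_ge0 => //; exact: sqr_ge0.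
    have -> : (f \_ `]n%:R, +oo[) x = f x.
      by rewrite patchE mem_set//= in_itv/= andbT (le_lt_trans nN).
    have g0 : (g' \_ `[0, N]) x = 0.
      by rewrite patchE ifF//; apply/negP => /set_mem/=; rewrite in_itv/= => /andP[_]; rewrite leNgt Nx.
    have [xN1|N1x] := leP x (N + 1).
      have kx : k x = 1 by rewrite /k indicE mem_set//= in_itv/= Nx.
      have gx : gt x = - h N by rewrite /gt g0 kx add0r mulr1.
      have hx : (prim gt x) ^+ 2 <= h N ^+ 2.
        by rewrite -(real_normK (num_real (prim _ _))) -(real_normK (num_real (h N))) ler_pXn2r ?nnegrE// hbd// ltW.
      rewrite gx kx mulr1 /f; have := sqr_ge0 (h x + prim gt x); have := sqr_ge0 (g x - h N).
      by move: hx; nra.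
    rewrite pgt3 ?(ltW N1x)// gtN1// !subr0 /f.
    have /andP[kx _] := k01 x; have : 0 <= 4 * h N ^+ 2 * k x by apply: mulr_ge0 => //; apply: mulr_ge0 => //; exact: sqr_ge0.
    have := f0 x; rewrite /f; lra.
rewrite RintegralD// RintegralZl// RintegralZl//.
have -> : \int[mu]_(x in halfline) k x = 1.
  rewrite /Rintegral integral_indic// (_ : _ `&` _ = `]N, (N + 1)]%classic).
    by apply: etrans (fine_mu_oc _) _; rewrite ?lerDl// addrAC subrr add0r.
  apply: setIidl => y /=; rewrite in_itv/= => /andP[ny _].
  by rewrite /halfline/= (le_lt_trans _ ny).
by move: Tn hN; lra.
Qed.

End W12_0_primitive.

(** * The boundary value problem q'' = - k / q, q(a) = q'(b) = 0 *)

Section tail_integral.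
Context {R : realType}.
Local Notation mu := (@lebesgue_measure R).
Implicit Types (f g q : R -> R) (a b c r s x : R).

Lemma mu_mct (D : set R) (F : nat -> R -> R) f (L : R) : measurable D ->
  (forall n, mu.-integrable D (EFin \o F n)) ->
  (forall n x, D x -> 0 <= F n x) ->
  (forall x n m, D x -> (n <= m)%N -> F n x <= F m x) ->
  (forall x, D x -> F n x @[n --> \oo] --> f x) ->
  \int[mu]_(x in D) F n x @[n --> \oo] --> L ->
  mu.-integrable D (EFin \o f) /\ \int[mu]_(x in D) f x = L.
Proof.
move=> mD Fi F0 Fm Ff FL.
have mF n : measurable_fun D (F n) by apply/measurable_EFinP; exact: measurable_int (Fi n).
have mf : measurable_fun D f by apply: measurable_fun_cvg mF Ff.
have f0 x : D x -> 0 <= f x.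
  move=> Dx; have /cvg_lim <- // := Ff _ Dx; apply: limr_ge.
    by apply/cvg_ex; exists (f x); exact: Ff.
  by apply: nearW => n; exact: F0.
have E : (\int[mu]_(x in D) (f x)%:E)%E = L%:E.
  have H := @monotone_convergence _ _ R mu D mD (fun n x => (F n x)%:E) (fun n => (measurable_EFinP _ _).2 (mF n)).
  transitivity (\int[mu]_(x in D) limn (fun n => (F n x)%:E))%E.
    apply: eq_integral => x /set_mem Dx; apply/esym/cvg_lim => //.
    by apply/fine_cvgP; split; [exact: nearW|exact: Ff].
  rewrite H.
  - apply/cvg_lim => //.
    under eq_fun do rewrite -EFin_Rintegral//.
    by apply/fine_cvgP; split; [exact: nearW|].
  - by move=> n x Dx; rewrite lee_fin F0.
  - by move=> x Dx n m nm; rewrite lee_fin Fm.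
have fi : mu.-integrable D (EFin \o f).
  apply/integrableP; split; first exact/measurable_EFinP.
  under eq_integral => x /set_mem Dx do rewrite /= ger0_norm ?f0//.
  by rewrite E ltry.
by split => //; rewrite /Rintegral E.
Qed.

Lemma is_derive_integral f a b x : mu.-integrable `[a, b] (EFin \o f) -> a < x < b ->
  {for x, continuous f} -> is_derive x 1 (fun y => \int[mu]_(z in `[a, y]) f z) (f x).
Proof.
move=> fi /andP[ax xb] fc.
have [d <-] := continuous_FTC1_closed xb fi ax fc.
by rewrite derive1E; apply: derivableP; exact: d.
Qed.

Lemma integral_continuous f a b : a <= b -> mu.-integrable `[a, b] (EFin \o f) ->
  {within `[a, b], continuous (fun y => \int[mu]_(z in `[a, y]) f z)}.
Proof. by move=> ab fi; exact: parameterized_integral_continuous. Qed.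

Lemma tail_int f a b r : mu.-integrable `[a, b] (EFin \o f) -> a <= r <= b ->
  \int[mu]_(z in `[r, b]) f z = \int[mu]_(z in `[a, b]) f z - \int[mu]_(z in `[a, r]) f z.
Proof.
move=> fi /andP[ar rb]; rewrite Rintegral_itvB ?bnd_simp// Rintegral_itv_obnd_cbnd//.
by apply: integrableS fi => //; apply: subset_itv; rewrite bnd_simp.
Qed.

Lemma is_derive_tail f a b x : mu.-integrable `[a, b] (EFin \o f) -> a < x < b ->
  {for x, continuous f} -> is_derive x 1 (fun y => \int[mu]_(z in `[y, b]) f z) (- f x).
Proof.
move=> fi axb fc; have /andP[ax xb] := axb; have d := is_derive_integral fi axb fc.
have {}d := isdB (isd_cst x (\int[mu]_(z in `[a, b]) f z)) d; rewrite sub0r in d.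
apply: near_eq_is_derive d; near=> y; apply/esym/tail_int => //.
by apply/andP; split; apply: ltW; near: y; [exact: lt_nbhsr|exact: lt_nbhsl].
Unshelve. all: by end_near. Qed.

Lemma tail_continuous f a b : a <= b -> mu.-integrable `[a, b] (EFin \o f) ->
  {within `[a, b], continuous (fun y => \int[mu]_(z in `[y, b]) f z)}.
Proof.
move=> ab fi.
apply: (@subspace_eq_continuous _ _ _ (fun y => \int[mu]_(z in `[a, b]) f z - \int[mu]_(z in `[a, y]) f z)).
  by move=> y /set_mem/=; rewrite in_itv/= => yab; exact/esym/tail_int.
by move=> x; apply: cvgB; [exact: cvg_cst|exact: integral_continuous].
Qed.

Lemma within_cc_interior f a b x : {within `[a, b], continuous f} -> a < x < b ->
  {for x, continuous f}.
Proof.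
move=> cf /andP[ax xb]; have ab := lt_trans ax xb.
have [H _ _] := (continuous_within_itvP _ ab).1 cf.
by apply: H; rewrite in_itv/= ax.
Qed.

Lemma within_cc_sub f a b c e : {within `[a, b], continuous f} -> a <= c -> e <= b ->
  {within `[c, e], continuous f}.
Proof.
move=> cf ac eb; apply: continuous_subspaceW cf.
by apply: subset_itv; rewrite bnd_simp.
Qed.

(** The supremum of the points where [f <= 0]. To its right [f] is positive, and that is where the
    maximum principle is run. *)
Lemma last_nonpos f a b : {within `[a, b], continuous f} -> a <= b -> f a <= 0 -> 0 < f b ->
  exists c, [/\ a <= c, c < b, f c <= 0 & forall x, c < x <= b -> 0 < f x].
Proof.
move=> cf ab fa fb; pose S := [set s | a <= s <= b /\ f s <= 0].
have Sa : S a by split=> //; rewrite lexx.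
have Sub : ubound S b by move=> s [/andP[_ sb] _].
have hS : has_sup S by split; [exists a|exists b].
have aS : a <= sup S by apply: ub_le_sup => //; exists b.
have Sb : sup S <= b by apply: ge_sup => //; exists a.
have fS : f (sup S) <= 0.
  rewrite leNgt; apply/negP => fS.
  have SI : `[a, b]%classic (sup S) by rewrite /= in_itv/= aS.
  have C : f @ (within `[a, b]%classic (nbhs (sup S))) --> f (sup S).
    by rewrite nbhs_subspace_in//; exact: cf.
  have H : nbhs (sup S) (fun x => `[a, b]%classic x -> 0 < f x) .
    by apply: (cvgr_gt _ C _ fS).
  case/nbhs_ballP: H => d /= d0 Hd.
  have [s [/andP[as_ sb] fs] ss] := sup_adherent d0 hS.
  have sS : s <= sup S by apply: ub_le_sup; [exists b|split=> //; rewrite as_].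
  have := Hd s; rewrite /ball/= ger0_norm ?subr_ge0// => /(_ ltac:(lra)).
  by rewrite in_itv/= as_ sb => /(_ isT); rewrite ltNge fs.
exists (sup S); split=> //.
  rewrite lt_neqAle Sb andbT; apply/eqP => E; move: fS; rewrite E; lra.
move=> x /andP[Sx xb]; rewrite ltNge; apply/negP => fx.
have : x <= sup S by apply: ub_le_sup; [exists b|split=> //; rewrite xb (le_trans aS)// ltW].
by rewrite leNgt Sx.
Qed.

End tail_integral.

(** * The integral operator of the boundary value problem *)

Section ode.
Context {R : realType}.
Local Notation mu := (@lebesgue_measure R).
Implicit Types (q p : R -> R) (r s x d : R).
Variables (a b : R) (k : R -> R).
Hypotheses (ab : a < b) (kc : continuous k) (k0 : forall s, 0 <= k s).

(** For a solution [q] of the boundary value problem this is [q']: it vanishes at [b] and its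
    derivative is [- k / q]. *)
Definition flux q r := \int[mu]_(y in `[r, b]) (k y / q y).
(** A fixed point solves [q'' = - k / q] with [q a = d] and [q' b = 0]; taking [d > 0] keeps the
    quotient away from its singularity. *)
Definition green d q s := d + \int[mu]_(r in `[a, s]) flux q r.

(** The class on which [green d] acts: measurability and the lower bound [d] suffice to integrate
    [k / q], and [green d q] inherits both. *)
Definition above d q := measurable_fun `[a, b] q /\ forall s, a <= s <= b -> d <= q s.

Let M : R := sval (cid2 (continuous_bounded_cc (@continuous_subspaceT _ _ `[a, b] _ kc))).
Let M0 : 0 <= M. Proof. by rewrite /M; case: cid2. Qed.
Let kM s : a <= s <= b -> k s <= M.
Proof. by rewrite /M; case: cid2 => m /= m0 H /H; exact: le_trans (ler_norm _). Qed.

Let sub_ab c : a <= c -> `[c, b]%classic `<=` `[a, b].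
Proof. by move=> ac; apply: subset_itvr; rewrite bnd_simp. Qed.

Let ab_le : a <= b. Proof. exact: ltW. Qed.

Lemma kq_integrable d c q : 0 < d -> a <= c -> measurable_fun `[c, b] q ->
  (forall s, c <= s <= b -> d <= q s) ->
  mu.-integrable `[c, b] (EFin \o (fun y => k y / q y)).
Proof.
move=> d0 ac mq dq; apply: (@integrable_bnd _ _ R mu _ _ (M / d)) => //.
- exact: lebesgue_itv_lty.
- apply: measurable_funM; first by apply: measurable_funTS; exact: continuous_measurable_fun.
  apply: (@measurable_comp _ _ _ _ _ _ [set x : R | x != 0]).
  + by apply: open_measurable; exact: open_neq.
  + move=> x [y /=]; rewrite in_itv/= => ycb <-; rewrite gt_eqF//.
    by apply: lt_le_trans d0 _; exact: dq.
  + apply: open_continuous_measurable_fun; first exact: open_neq.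
    by move=> x /set_mem/= x0; exact: inv_continuous.
  + exact: mq.
- move=> s /=; rewrite in_itv/= => scb; have /andP[cs sb] := scb.
  have q0 := lt_le_trans d0 (dq _ scb).
  rewrite ger0_norm; last by rewrite divr_ge0// ltW.
  apply: ler_pM => //; first by rewrite invr_ge0 ltW.
    by apply: kM; rewrite (le_trans ac cs).
  by rewrite lef_pV2 ?posrE// dq.
Qed.

Lemma flux_ge0 q r : (forall s, r <= s <= b -> 0 <= q s) -> 0 <= flux q r.
Proof.
by move=> q0; apply: Rintegral_ge0 => y /=; rewrite in_itv/= => /q0 qy; rewrite divr_ge0.
Qed.

Section fixed_delta.
Variables (d : R) (d0 : 0 < d).

Let ki q : above d q -> mu.-integrable `[a, b] (EFin \o (fun y => k y / q y)).
Proof. by case=> mq dq; exact: (kq_integrable d0). Qed.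

Let ki' q r : above d q -> a <= r -> mu.-integrable `[r, b] (EFin \o (fun y => k y / q y)).
Proof. by move=> aq ar; apply: integrableS (ki aq) => //; exact: sub_ab. Qed.

Lemma flux_continuous q : above d q -> {within `[a, b], continuous (flux q)}.
Proof. by move=> aq; apply: tail_continuous => //; exact: ki. Qed.

Let fi q : above d q -> mu.-integrable `[a, b] (EFin \o flux q).
Proof. by move=> aq; apply: continuous_integrable_cc; exact: flux_continuous. Qed.

Let fi' q s : above d q -> s <= b -> mu.-integrable `[a, s] (EFin \o flux q).
Proof. by move=> aq sb; apply: integrable_ccS (fi aq). Qed.

Let aq0 q r s : above d q -> a <= r -> r <= s <= b -> 0 <= q s.
Proof.
move=> [_ dq] ar /andP[rs sb]; rewrite (le_trans (ltW d0))// dq// sb andbT.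
exact: le_trans rs.
Qed.

Lemma green_above q : above d q -> above d (green d q).
Proof.
move=> aq; split.
  apply: subspace_continuous_measurable_fun => // x; apply: cvgD; first exact: cvg_cst.
  by apply: integral_continuous => //; exact: fi.
move=> s /andP[as_ sb]; rewrite lerDl; apply: Rintegral_ge0 => r /=; rewrite in_itv/=.
by move=> /andP[ar _]; apply: flux_ge0 => t; exact: aq0.
Qed.

Lemma green_continuous q : above d q -> {within `[a, b], continuous (green d q)}.
Proof.
move=> aq x; apply: cvgD; first exact: cvg_cst.
by apply: integral_continuous => //; exact: fi.
Qed.

Lemma flux_anti q p r : above d q -> above d p -> (forall s, a <= s <= b -> q s <= p s) ->
  a <= r -> flux p r <= flux q r.
Proof.
move=> aq ap qp ar; apply: le_Rintegral => //; [exact: ki'|exact: ki'|].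
move=> y /=; rewrite in_itv/= => /andP[ry yb].
have yab : a <= y <= b by rewrite yb (le_trans ar).
have q0 : 0 < q y by apply: lt_le_trans d0 _; exact: aq.2.
by rewrite ler_wpM2l// lef_pV2 ?posrE ?qp// (lt_le_trans q0)// qp.
Qed.

Lemma green_anti q p s : above d q -> above d p -> (forall s, a <= s <= b -> q s <= p s) ->
  s <= b -> green d p s <= green d q s.
Proof.
move=> aq ap qp sb; rewrite lerD2l; apply: le_Rintegral => //; [exact: fi'|exact: fi'|].
by move=> r /=; rewrite in_itv/= => /andP[ar _]; exact: flux_anti.
Qed.

(** The constant [d] is the least element of the class and the flux is decreasing in [q], so this
    constant provides the dominating functions of all the limits below. *)
Lemma flux_le q r : above d q -> a <= r -> flux q r <= flux (cst d) a.
Proof.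
move=> aq ar; have ac : above d (cst d) by split => // s _.
apply: (@le_trans _ _ (flux (cst d) r)); first by apply: flux_anti => //; exact: aq.2.
rewrite /flux; have [rb|br] := leP r b; last first.
  rewrite set_itv_ge ?bnd_simp -?ltNge// Rintegral_set0; apply: Rintegral_ge0 => y _.
  by rewrite divr_ge0// ltW.
rewrite (@tail_int _ _ a b r) ?ar//; last exact: (ki ac).
rewrite lerBlDr lerDl; apply: Rintegral_ge0 => y _.
by rewrite divr_ge0// ltW.
Qed.

Lemma green_le q s : above d q -> a <= s <= b -> green d q s <= d + flux (cst d) a * (b - a).
Proof.
move=> aq /andP[as_ sb]; rewrite lerD2l.
have ac : above d (cst d) by split => // t _.
have F0 : 0 <= flux (cst d) a by apply: flux_ge0 => t _; exact: ltW.
apply: (@le_trans _ _ (\int[mu]_(r in `[a, s]) (flux (cst d) a))).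
  apply: le_Rintegral => //; first exact: fi'.
    apply: (@integrable_bnd _ _ R mu _ (fun=> flux (cst d) a) (flux (cst d) a)) => //.
      exact: lebesgue_itv_lty.
    by move=> ? _; rewrite ger0_norm.
  by move=> r /=; rewrite in_itv/= => /andP[ar _]; exact: flux_le.
rewrite Rintegral_cst// ler_wpM2l//= lebesgue_measure_itv/= lte_fin.
by case: ifPn => _ /=; rewrite ?subr_ge0// lerD2r.
Qed.

Lemma flux_cvg (q_ : nat -> R -> R) q r : (forall n, above d (q_ n)) -> above d q ->
  (forall s, a <= s <= b -> q_ n s @[n --> \oo] --> q s) -> a <= r ->
  flux (q_ n) r @[n --> \oo] --> flux q r.
Proof.
move=> aq_ aq qq ar.
have mkq p : above d p -> measurable_fun `[r, b] (fun y => k y / p y).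
  by move=> ap; apply/measurable_EFinP; exact: measurable_int (ki' ap ar).
have ac : above d (cst d) by split => // t _.
apply: mu_dct (ki' ac ar) _ _ => //.
- by move=> n; exact: mkq.
- exact: mkq.
- apply: aeW => y /=; rewrite in_itv/= => /andP[ry yb].
  have yab : a <= y <= b by rewrite yb (le_trans ar).
  apply: cvgM; first exact: cvg_cst.
  by apply: cvgV; [rewrite gt_eqF// (lt_le_trans d0)// aq.2|exact: qq].
- move=> n y /=; rewrite in_itv/= => /andP[ry yb].
  have yab : a <= y <= b by rewrite yb (le_trans ar).
  have q0 := (aq_ n).2 _ yab; rewrite ger0_norm; last by rewrite divr_ge0// (le_trans (ltW d0)).
  by rewrite ler_wpM2l// lef_pV2 ?posrE// (lt_le_trans d0).
Qed.

Lemma green_cvg (q_ : nat -> R -> R) q s : (forall n, above d (q_ n)) -> above d q ->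
  (forall s, a <= s <= b -> q_ n s @[n --> \oo] --> q s) -> a <= s <= b ->
  green d (q_ n) s @[n --> \oo] --> green d q s.
Proof.
move=> aq_ aq qq /andP[as_ sb]; apply: cvgD; first exact: cvg_cst.
have ci : mu.-integrable `[a, s] (EFin \o (fun=> flux (cst d) a)).
  apply: (@integrable_bnd _ _ R mu _ (fun=> flux (cst d) a) `|flux (cst d) a|) => //.
  exact: lebesgue_itv_lty.
apply: mu_dct ci _ _ => //.
- by move=> n; apply/measurable_EFinP; exact: measurable_int (fi' (aq_ n) sb).
- by apply/measurable_EFinP; exact: measurable_int (fi' aq sb).
- apply: aeW => r /=; rewrite in_itv/= => /andP[ar _]; exact: flux_cvg.
- move=> n r /=; rewrite in_itv/= => /andP[ar _].
  rewrite ger0_norm; first exact: flux_le.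
  by apply: flux_ge0 => t; exact: (aq0 (aq_ n)).
Qed.

Lemma flux_derive q x : above d q -> a < x < b -> {for x, continuous q} ->
  is_derive x 1 (flux q) (- (k x / q x)).
Proof.
move=> aq axb cq; have /andP[ax xb] := axb.
apply: (is_derive_tail (ki aq) axb).
apply: continuousM; first exact: kc.
apply: continuousV => //; rewrite gt_eqF// (lt_le_trans d0)// aq.2//.
by rewrite !ltW.
Qed.

Lemma green_derive q x : above d q -> a < x < b -> is_derive x 1 (green d q) (flux q x).
Proof.
move=> aq axb; rewrite -[flux q x]add0r; apply: isdD (isd_cst x d) _.
apply: (is_derive_integral (fi aq) axb).
exact: within_cc_interior (flux_continuous aq) axb.
Qed.

End fixed_delta.

End ode.

(** * Fixed points for a positive boundary value, and their comparison *)

Section ode_existence.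
Context {R : realType}.
Local Notation mu := (@lebesgue_measure R).
Implicit Types (q p r : R -> R) (s x d : R).
Variables (a b : R) (k : R -> R).
Hypotheses (ab : a < b) (kc : continuous k) (k0 : forall s, 0 <= k s).

Local Notation above := (above a b).
Local Notation flux := (flux b k).
Local Notation green := (green a b k).

Let ab_le : a <= b. Proof. exact: ltW. Qed.

Lemma flux_b q x : b <= x -> flux q x = 0.
Proof.
rewrite le_eqVlt => /predU1P[<-|bx]; rewrite /flux; first by rewrite set_itv1 Rintegral_set1.
by rewrite set_itv_ge ?Rintegral_set0// bnd_simp -ltNge.
Qed.

Lemma green_a d q : green d q a = d.
Proof. by rewrite /green set_itv1 Rintegral_set1 addr0. Qed.

Section fixed_delta.
Variables (d : R) (d0 : 0 < d).

Lemma fixed_continuous p r : above d r -> (forall s, a <= s <= b -> p s = green d r s) ->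
  {within `[a, b], continuous p}.
Proof.
move=> ar pr; apply: (@subspace_eq_continuous _ _ _ (green d r)).
  by move=> y /set_mem/=; rewrite in_itv/= => yab; exact/esym/pr.
exact: green_continuous.
Qed.

Lemma fixed_derive p r x : above d r -> (forall s, a <= s <= b -> p s = green d r s) ->
  a < x < b -> is_derive x 1 p (flux r x).
Proof.
move=> ar pr axb; apply: near_eq_is_derive (green_derive ab kc k0 d0 ar axb).
have /andP[ax xb] := axb; near=> y; rewrite pr//; apply/andP; split; apply: ltW; near: y.
  exact: lt_nbhsr.
exact: lt_nbhsl.
Unshelve. all: by end_near. Qed.

(* A two-cycle of the decreasing operator [green d] is a fixed point: the
   Wronskian [p' r - r' p] is constant and vanishes at [b], so [p / r] is
   constant, and both functions equal [d] at [a]. *)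
Lemma two_cycle_fixed p r : above d p -> above d r ->
  (forall s, a <= s <= b -> p s = green d r s) ->
  (forall s, a <= s <= b -> r s = green d p s) ->
  forall s, a <= s <= b -> p s = r s.
Proof.
move=> ap ar pr rp.
have cp := fixed_continuous ar pr; have cr := fixed_continuous ap rp.
have dp x := fixed_derive ar pr (x := x); have dr x := fixed_derive ap rp (x := x).
have p0 s : a <= s <= b -> 0 < p s by move=> h; rewrite (lt_le_trans d0)// ap.2.
have r0 s : a <= s <= b -> 0 < r s by move=> h; rewrite (lt_le_trans d0)// ar.2.
have ww x : a < x < b -> a <= x <= b by move=> /andP[/ltW -> /ltW ->].
pose w x := flux r x * r x - flux p x * p x.
have dw x : a < x < b -> is_derive x 1 w 0.
  move=> axb.
  have d1 := isdM (flux_derive kc k0 d0 ar axb (within_cc_interior cr axb)) (dr _ axb).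
  have d2 := isdM (flux_derive kc k0 d0 ap axb (within_cc_interior cp axb)) (dp _ axb).
  have := isdB d1 d2; rewrite (_ : _ - _ = 0 :> R)//.
  by have := p0 _ (ww _ axb); have := r0 _ (ww _ axb) => r1 p1; field; rewrite !gt_eqF.
have cw : {within `[a, b], continuous w}.
  have cfr := flux_continuous ab kc k0 d0 ar; have cfp := flux_continuous ab kc k0 d0 ap.
  by move=> x; apply: cvgB; apply: cvgM; [exact: cfr|exact: cr|exact: cfp|exact: cp].
have wb : w b = 0 by rewrite /w !flux_b// !mul0r subrr.
have w0 x : a <= x <= b -> w x = 0.
  move=> /andP[ax]; rewrite le_eqVlt => /predU1P[->//|xb].
  have [||c _] := @MVT_cc _ w (fun=> 0) x b xb.
  - by move=> y /andP[xy yb]; apply: dw; rewrite yb (le_lt_trans ax).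
  - exact: within_cc_sub cw _ _.
  - by rewrite mul0r wb sub0r => /eqP; rewrite oppr_eq0 => /eqP.
pose t x := p x * (r x)^-1.
have dt x : a < x < b -> is_derive x 1 t 0.
  move=> axb; have r1 := r0 _ (ww _ axb).
  have rN0 : r x != 0 by rewrite gt_eqF.
  have dV : is_derive x 1 (fun y => (r y)^-1) (- (r x) ^- 2 * flux p x).
    exact: (@is_deriveV _ r x _ 1 rN0 (dr _ axb)).
  have := isdM (dp _ axb) dV; rewrite (_ : _ + _ = w x / (r x) ^+ 2).
    by rewrite w0 ?mul0r//; exact: ww.
  by rewrite /w; field.
have ct : {within `[a, b], continuous t}.
  have [_ ap' bp] := (continuous_within_itvP _ ab).1 cp.
  have [_ ar' br] := (continuous_within_itvP _ ab).1 cr.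
  apply/(continuous_within_itvP _ ab); split.
  - by move=> x; rewrite in_itv/= => xab; exact: isd_cont (dt x xab).
  - by apply: cvgM => //; apply: cvgV => //; rewrite gt_eqF// r0// lexx.
  - by apply: cvgM => //; apply: cvgV => //; rewrite gt_eqF// r0// lexx andbT.
have aab : a <= a <= b by rewrite lexx ltW.
have pa : p a = d by apply: etrans (pr _ aab) _; exact: green_a.
have ra : r a = d by apply: etrans (rp _ aab) _; exact: green_a.
move=> s /andP[].
rewrite le_eqVlt => /predU1P[<- _|as_ sb]; first by rewrite pa ra.
have [||c _] := @MVT_cc _ t (fun=> 0) a s as_.
- by move=> y /andP[ay ys]; apply: dt; rewrite ay (lt_le_trans ys).
- exact: within_cc_sub ct _ _.
rewrite mul0r /t pa ra mulfV ?gt_eqF// => /eqP.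
rewrite subr_eq0 => /eqP h; have r1 : 0 < r s by rewrite r0// sb ltW.
by rewrite -[LHS](divfK (lt0r_neq0 r1)) h mul1r.
Qed.

(** [green d] is decreasing and the starting point [d] is minimal, so the even iterates increase,
    the odd ones decrease, and both converge because they are bounded. The two limits are exchanged
    by [green d]; [two_cycle_fixed] identifies them. *)
Lemma fixed_exists : exists2 q, above d q & forall s, a <= s <= b -> q s = green d q s.
Proof.
have [X [X0 XS]] : exists X : nat -> R -> R, X 0%N = cst d /\ forall n, X n.+1 = green d (X n).
  by exists (fun n => iter n (green d) (cst d)).
have aX n : above d (X n).
  elim: n => [|n IH]; last by rewrite XS; exact: (green_above ab kc k0 d0).
  by rewrite X0; split => [|s _]; [exact: measurable_cst|exact: lexx].
have X_anti n m : (forall s, a <= s <= b -> X n s <= X m s) ->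
    forall s, a <= s <= b -> X m.+1 s <= X n.+1 s.
  move=> H s /andP[as_ sb]; rewrite !XS.
  exact: (green_anti ab kc k0 d0 (aX n) (aX m) H sb).
have X_even n : (forall s, a <= s <= b -> X n.*2 s <= X n.*2.+2 s) /\
    (forall s, a <= s <= b -> X n.*2.+3 s <= X n.*2.+1 s).
  elim: n => [|n [IH1 IH2]].
    have H s : a <= s <= b -> X 0%N s <= X 2%N s by rewrite X0; exact: (aX 2%N).2.
    by split; [exact: H|exact: X_anti H].
  have H := X_anti _ _ IH2; rewrite doubleS.
  by split; [exact: H|exact: X_anti H].
have X_le n s : a <= s <= b -> X n s <= d + flux (cst d) a * (b - a).
  move=> sab; case: n => [|n]; last by rewrite XS; exact: (green_le ab kc k0 d0 (aX n) sab).
  rewrite X0 -[leLHS]addr0 lerD2l mulr_ge0 ?subr_ge0//; apply: flux_ge0 => // t _; exact: ltW.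
pose p s := limn (fun n => X n.*2 s); pose r s := limn (fun n => X n.*2.+1 s).
have cp s : a <= s <= b -> X n.*2 s @[n --> \oo] --> p s.
  move=> sab; apply: nondecreasing_is_cvgn.
    by apply/nondecreasing_seqP => n; rewrite doubleS; exact: (X_even n).1.
  by exists (d + flux (cst d) a * (b - a)) => _ [n _ <-]; exact: X_le.
have cr s : a <= s <= b -> X n.*2.+1 s @[n --> \oo] --> r s.
  move=> sab; apply: nonincreasing_is_cvgn.
    by apply/nonincreasing_seqP => n; rewrite doubleS; exact: (X_even n).2.
  by exists d => _ [n _ <-]; exact: (aX _).2.
have ap : above d p.
  split; first by apply: (measurable_fun_cvg (fun n => (aX n.*2).1)) => s /=; rewrite in_itv/= => /cp.
  move=> s sab; apply: limr_ge; first by apply/cvg_ex; exists (p s); exact: cp.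
  by apply: nearW => n; exact: (aX _).2.
have ar : above d r.
  split; first by apply: (measurable_fun_cvg (fun n => (aX n.*2.+1).1)) => s /=; rewrite in_itv/= => /cr.
  move=> s sab; apply: limr_ge; first by apply/cvg_ex; exists (r s); exact: cr.
  by apply: nearW => n; exact: (aX _).2.
have rp s : a <= s <= b -> r s = green d p s.
  move=> sab; apply: (cvg_unique _ (cr _ sab)) => //.
  have := green_cvg ab kc k0 d0 (fun n => aX n.*2) ap cp sab.
  by under eq_fun do rewrite -XS.
have pr s : a <= s <= b -> p s = green d r s.
  move=> sab; have H := green_cvg ab kc k0 d0 (fun n => aX n.*2.+1) ar cr sab.
  have H' : X n.+1.*2 s @[n --> \oo] --> p s by rewrite (cvg_shiftS (fun n => X n.*2 s)); exact: cp.
  apply: (cvg_unique _ H') => //.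
  by move: H; under eq_fun do rewrite -XS; under [in X in _ -> X]eq_fun do rewrite doubleS.
exists p; first exact: ap.
by move=> s sab; exact: etrans (two_cycle_fixed ap ar pr rp sab) (rp s sab).
Qed.

End fixed_delta.

Lemma above_le d d' q : d <= d' -> above d' q -> above d q.
Proof. by move=> dd [mq dq]; split => // s sab; rewrite (le_trans dd)// dq. Qed.

(* Maximum principle: [(q1 - q2)'' = k (q1 - q2) / (q1 q2)]. *)
Lemma fixed_compare d1 d2 q1 q2 : 0 < d1 -> d1 <= d2 -> above d1 q1 -> above d2 q2 ->
  (forall s, a <= s <= b -> q1 s = green d1 q1 s) ->
  (forall s, a <= s <= b -> q2 s = green d2 q2 s) ->
  forall s, a <= s <= b -> q1 s <= q2 s.
Proof.
move=> d10 d12 a1 a2 e1 e2; have d20 := lt_le_trans d10 d12.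
pose e x := q1 x - q2 x; pose E x := flux q1 x - flux q2 x.
have c1 := fixed_continuous d10 a1 e1; have c2 := fixed_continuous d20 a2 e2.
have ce : {within `[a, b], continuous e} by move=> x; apply: cvgB; [exact: c1|exact: c2].
have cE : {within `[a, b], continuous E}.
  have cf1 := flux_continuous ab kc k0 d10 a1; have cf2 := flux_continuous ab kc k0 d20 a2.
  by move=> x; apply: cvgB; [exact: cf1|exact: cf2].
have de x : a < x < b -> is_derive x 1 e (E x).
  by move=> axb; exact: isdB (fixed_derive d10 a1 e1 axb) (fixed_derive d20 a2 e2 axb).
have dE x : a < x < b -> is_derive x 1 E (- (k x / q1 x) - - (k x / q2 x)).
  move=> axb; have k1 := within_cc_interior c1 axb; have k2 := within_cc_interior c2 axb.
  exact: isdB (flux_derive kc k0 d10 a1 axb k1) (flux_derive kc k0 d20 a2 axb k2).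
have [m] := EVT_max ab_le ce; rewrite in_itv/= => /andP[am mb] Hm.
suff em : e m <= 0.
  by move=> s sab; rewrite -subr_le0 (le_trans _ em)//; apply: Hm; rewrite in_itv.
rewrite leNgt; apply/negP => em.
have ea : e a <= 0 by rewrite /e e1 ?lexx// e2 ?lexx// !green_a subr_le0.
(* Between [c] and the maximum point [m] the difference is positive, hence convex; its slope is
   positive somewhere there, so it cannot be nonpositive at [m]. When [m = b] the slope at [m]
   vanishes by the boundary condition. *)
have [c [ac cm ec Hc]] := last_nonpos (within_cc_sub ce (lexx a) mb) am ea em.
have Em : E m <= 0.
  move: mb; rewrite le_eqVlt => /predU1P[->|mb]; first by rewrite /E !flux_b// subrr.
  have amb : a < m < b by rewrite mb (le_lt_trans ac).
  have := @derive1_at_max _ e a b m ab_le _ _ _ => -[].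
  - by move=> t; rewrite in_itv/= => tab; exact: isd_derivable (de _ tab).
  - by rewrite in_itv.
  - by move=> t; rewrite in_itv/= => /andP[/ltW at_ /ltW tb]; apply: Hm; rewrite in_itv/= at_.
  - by have [_ <-] := de _ amb => _ ->.
have [||c' /andP[cc' c'm] h1] := @MVT_cc _ e E c m cm.
- by move=> y /andP[cy ym]; apply: de; rewrite (le_lt_trans ac cy) (lt_le_trans ym mb).
- exact: within_cc_sub ce _ _.
have Ec' : 0 < E c'.
  have : 0 < E c' * (m - c) by rewrite -h1; lra.
  by rewrite pmulr_lgt0// subr_gt0.
have [||c'' /andP[c'c'' c''m] h2] := @MVT_cc _ E (fun x => - (k x / q1 x) - - (k x / q2 x)) c' m c'm.
- move=> y /andP[cy ym]; apply: dE; rewrite (lt_le_trans ym mb) andbT.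
  exact: le_lt_trans ac (lt_trans cc' cy).
- apply: within_cc_sub cE _ _ => //; exact: le_trans ac (ltW cc').
have cc'' := lt_trans cc' c'c''.
have abc : a <= c'' <= b by rewrite (le_trans ac (ltW cc''))/= (le_trans (ltW c''m)).
have e0 : 0 < e c'' by apply: Hc; rewrite cc'' ltW.
have q20 : 0 < q2 c'' by rewrite (lt_le_trans d20)// a2.2.
have q10 : 0 < q1 c'' by rewrite (lt_le_trans d10)// a1.2.
have : 0 <= - (k c'' / q1 c'') - - (k c'' / q2 c'').
  rewrite opprK addrC subr_ge0 ler_wpM2l// lef_pV2 ?posrE//; move: e0; rewrite /e; lra.
have mc : 0 <= m - c' by rewrite subr_ge0 ltW.
by move=> h3; have := mulr_ge0 h3 mc; rewrite -h2; lra.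
Qed.

End ode_existence.

(** * Vanishing boundary value *)

Section ode_limit.
Context {R : realType}.
Local Notation mu := (@lebesgue_measure R).
Implicit Types (q : R -> R) (r s x d : R).
Variables (a b : R) (k : R -> R).
Hypotheses (ab : a < b) (kc : continuous k) (k0 : forall s, 0 <= k s).
Hypothesis kp : exists2 c, a < c < b & 0 < \int[mu]_(y in `[c, b]) k y.

Local Notation flux := (flux b k).
Local Notation green := (green a b k).

Let ab_le : a <= b. Proof. exact: ltW. Qed.

(* The limit [delta -> 0] of the solutions of [q = green delta q]. *)
Lemma ode_profile : exists q h : R -> R,
  [/\ forall s, a < s <= b -> 0 < q s,
      mu.-integrable `[a, b] (EFin \o h) /\
        (forall s, a <= s <= b -> q s = \int[mu]_(y in `[a, s]) h y),
      forall r, a < r -> 0 <= h r,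
      forall r, a < r < b -> is_derive r 1 h (- (k r / q r)) &
      (forall r, b <= r -> h r = 0) /\ (forall r, a < r -> {for r, continuous h})].
Proof.
have dn (n : nat) : 0 < n.+1%:R^-1 :> R by rewrite invr_gt0.
have H n : exists q, above a b n.+1%:R^-1 q /\ forall s, a <= s <= b -> q s = green n.+1%:R^-1 q s.
  by have [q aq eq] := fixed_exists ab kc k0 (dn n); exists q.
have [q_ /all_and2 [aq_ eq_]] := choice H.
have q_anti n m s : (n <= m)%N -> a <= s <= b -> q_ m s <= q_ n s.
  move=> nm sab; apply: (fixed_compare ab kc k0 (dn m) _ (aq_ m) (aq_ n) (eq_ m) (eq_ n)) => //.
  by rewrite lef_pV2 ?posrE// ler_nat.
have q_0 n s : a <= s <= b -> 0 < q_ n s by move=> sab; rewrite (lt_le_trans (dn n))// (aq_ n).2.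
pose q s := limn (fun n => q_ n s).
have cq s : a <= s <= b -> q_ n s @[n --> \oo] --> q s.
  move=> sab; apply: nonincreasing_is_cvgn; first by move=> n m nm; exact: q_anti.
  by exists 0 => _ [n _ <-]; exact: ltW (q_0 _ _ sab).
have qle n s : a <= s <= b -> q s <= q_ n s.
  move=> sab; apply: (nonincreasing_cvgn_ge (u_ := fun n => q_ n s)).
    by move=> i j ij; exact: q_anti.
  by apply/cvg_ex; exists (q s); exact: cq.
have fi n := flux_continuous ab kc k0 (dn n) (aq_ n).
have fii n s : s <= b -> mu.-integrable `[a, s] (EFin \o flux (q_ n)).
  by move=> sb; apply: integrable_ccS (continuous_integrable_cc (fi n)).
have f0 n r : a <= r -> 0 <= flux (q_ n) r.
  move=> ar; apply: flux_ge0 => // s /andP[rs sb]; apply: ltW; apply: q_0.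
  by rewrite sb (le_trans ar).
have fmono n m r : (n <= m)%N -> a <= r -> flux (q_ n) r <= flux (q_ m) r.
  move=> nm ar; apply: (flux_anti kc k0 (dn m) (aq_ m)) => //.
    by apply: above_le (aq_ n); rewrite lef_pV2 ?posrE// ler_nat.
  by move=> s sab; exact: q_anti.
(* A lower barrier common to all [n]: the fluxes increase with [n], so every [q_ n] dominates the
   primitive of the very first flux. *)
pose l s := \int[mu]_(r in `[a, s]) flux (q_ 0%N) r.
have lq n s : a <= s <= b -> l s <= q_ n s.
  move=> /andP[as_ sb]; rewrite eq_ ?as_// /green -[leLHS]add0r; apply: lerD; first exact: ltW (dn n).
  apply: le_Rintegral => //; [exact: fii|exact: fii|].
  by move=> r /=; rewrite in_itv/= => /andP[ar _]; exact: fmono.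
have lq' s : a <= s <= b -> l s <= q s.
  move=> sab; apply: limr_ge; first by apply/cvg_ex; exists (q s); exact: cq.
  by apply: nearW => n; exact: lq.
have l_le s t : a <= s -> s <= t -> t <= b -> l s <= l t.
  move=> as_ st tb; rewrite -subr_ge0 /l Rintegral_itvB ?bnd_simp//; last exact: fii.
  apply: Rintegral_ge0 => r /=; rewrite in_itv/= => /andP[sr _]; apply: f0.
  by rewrite (le_trans as_)// ltW.
(* Positivity of the barrier comes from [kp]: at [c] the first flux is at least a positive multiple
   of the integral of [k] over [[c, b]], and this bound persists on [[a, c]]. *)
have l0 s : a < s <= b -> 0 < l s.
  have [c /andP[ac cb] Ic] := kp.
  pose kap := flux (q_ 0%N) c.
  have kap0 : 0 < kap.
    have [M M0 HM] := continuous_bounded_cc (fixed_continuous ab kc k0 (dn 0%N) (aq_ 0%N) (eq_ 0%N)).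
    have M1 : 0 < M + 1 by rewrite ltr_wpDl.
    apply: (@lt_le_trans _ _ ((M + 1)^-1 * \int[mu]_(y in `[c, b]) k y)).
      by rewrite mulr_gt0// invr_gt0.
    have ki : mu.-integrable `[c, b] (EFin \o k).
      by apply: continuous_integrable_cc; exact: continuous_subspaceT.
    rewrite -RintegralZl//; apply: le_Rintegral => //.
    - exact: mu_integrable_scale.
    - apply: (kq_integrable kc k0 (dn 0%N) (ltW ac)).
        by apply: measurable_funS (aq_ 0%N).1 => //; apply: subset_itvr; rewrite bnd_simp ltW.
      by move=> s' /andP[cs sb]; apply: (aq_ 0%N).2; rewrite sb (le_trans (ltW ac)).
    - move=> y /=; rewrite in_itv/= => /andP[cy yb].
      have yab : a <= y <= b by rewrite yb (le_trans (ltW ac)).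
      rewrite mulrC ler_wpM2l// lef_pV2 ?posrE ?q_0//.
      have := HM _ yab; rewrite ger0_norm ?(ltW (q_0 _ _ yab))//; lra.
  have anti r : a <= r <= c -> kap <= flux (q_ 0%N) r.
    move=> /andP[ar rc]; rewrite /kap /flux.
    have ii : mu.-integrable `[r, b] (EFin \o (fun y => k y / q_ 0%N y)).
      apply: (kq_integrable kc k0 (dn 0%N) ar).
        by apply: measurable_funS (aq_ 0%N).1 => //; apply: subset_itvr; rewrite bnd_simp.
      by move=> s' /andP[cs sb]; apply: (aq_ 0%N).2; rewrite sb (le_trans ar).
    rewrite (tail_int ii) ?rc ?(ltW cb)// lerBlDr lerDl; apply: Rintegral_ge0 => y /=.
    rewrite in_itv/= => /andP[ry yc]; rewrite divr_ge0// ltW// q_0//.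
    by rewrite (le_trans ar ry) (le_trans yc (ltW cb)).
  move=> /andP[as_ sb].
  have key t : a < t -> t <= c -> 0 < l t.
    move=> at_ tc; apply: (@lt_le_trans _ _ (\int[mu]_(r in `[a, t]) kap)).
      rewrite Rintegral_cst//= lebesgue_measure_itv/= lte_fin at_ -EFinB/=.
      by rewrite mulr_gt0// subr_gt0.
    apply: le_Rintegral => //.
    - apply: (@integrable_bnd _ _ R mu _ (fun=> kap) `|kap|) => //.
      exact: lebesgue_itv_lty.
    - by apply: fii; rewrite (le_trans tc)// ltW.
    - by move=> r /=; rewrite in_itv/= => /andP[ar rt]; apply: anti; rewrite ar (le_trans rt).
  have [sc|cs] := leP s c; first exact: key.
  by apply: lt_le_trans (key _ ac (lexx _)) _; apply: l_le => //; exact: ltW.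
have mq : measurable_fun `[a, b] q.
  by apply: (measurable_fun_cvg (fun n => (aq_ n).1)) => s /=; rewrite in_itv/=; exact: cq.
(* On [[r, b]] with [r > a] the barrier value [l r] plays the role of [d], so what is proved for
   positive [d] applies there to the limit [q]. *)
have aboveq r : a < r -> r <= b -> above r b (l r) q.
  move=> ar rb; split.
    by apply: measurable_funS mq => //; apply: subset_itvr; rewrite bnd_simp ltW.
  move=> s /andP[rs sb]; apply: le_trans (lq' _ _); first by apply: l_le => //; exact: ltW.
  by rewrite sb (le_trans (ltW ar)).
have aboveqn n r : a < r -> r <= b -> above r b (l r) (q_ n).
  move=> ar rb; split.
    by apply: measurable_funS (aq_ n).1 => //; apply: subset_itvr; rewrite bnd_simp ltW.
  move=> s /andP[rs sb]; apply: le_trans (lq n _ _); first by apply: l_le => //; exact: ltW.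
  by rewrite sb (le_trans (ltW ar)).
pose h := flux q.
have ch r : a < r -> flux (q_ n) r @[n --> \oo] --> h r.
  move=> ar; have [rb|br] := leP r b; last first.
    rewrite /h flux_b ?(ltW br)//; under eq_fun do rewrite flux_b ?(ltW br)//.
    exact: cvg_cst.
  have lr0 : 0 < l r by rewrite l0 ?ar.
  apply: (flux_cvg kc k0 lr0 (fun n => aboveqn n r ar rb) (aboveq r ar rb)) => //.
  by move=> s /andP[rs sb]; apply: cq; rewrite sb (le_trans (ltW ar)).
have q0 s : a < s <= b -> 0 < q s.
  by move=> sab; rewrite (lt_le_trans (l0 _ sab))// lq'//; case/andP: sab => /ltW -> ->.
(* [q] vanishes at [a], so [h] may be unbounded there; monotone convergence of the fluxes on []a,
   s]] still makes it integrable up to [a]. *)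
have hq s : a <= s <= b -> mu.-integrable `[a, s] (EFin \o h) /\ \int[mu]_(y in `[a, s]) h y = q s.
  move=> sab; have /andP[as_ sb] := sab.
  have [||||||hi hE] := @mu_mct _ `]a, s] (fun n => flux (q_ n)) h (q s).
  - exact: measurable_itv.
  - by move=> n; apply: integrableS (fii n s sb) => //; apply: subset_itvr; rewrite bnd_simp.
  - by move=> n x /=; rewrite in_itv/= => /andP[/ltW ax _]; exact: f0.
  - by move=> x n m /=; rewrite in_itv/= => /andP[/ltW ax _] nm; exact: fmono.
  - by move=> x /=; rewrite in_itv/= => /andP[ax _]; exact: ch.
  - have E n : \int[mu]_(x in `]a, s]) flux (q_ n) x = q_ n s - n.+1%:R^-1.
      rewrite Rintegral_itv_obnd_cbnd; last first.
        by apply: integrableS (fii n s sb) => //; apply: subset_itvr; rewrite bnd_simp.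
      by rewrite eq_// /green addrAC subrr add0r.
    under eq_fun do rewrite E; rewrite -[q s]subr0; apply: cvgB; first exact: cq.
    exact: cvg_harmonic.
  split; first exact: integrable_oc_cc.
  by rewrite -hE Rintegral_itv_obnd_cbnd.
have cqw : {within `[a, b], continuous q}.
  apply: (@subspace_eq_continuous _ _ _ (fun s => \int[mu]_(y in `[a, s]) h y)).
    by move=> y /set_mem/=; rewrite in_itv/= => yab; exact: (hq _ yab).2.
  by apply: integral_continuous => //; apply: (hq b _).1; rewrite ab_le lexx.
have dh r : a < r < b -> is_derive r 1 h (- (k r / q r)).
  move=> /andP[ar rb]; pose r' := (a + r) / 2.
  have ar' : a < r' by rewrite /r'; lra.
  have r'r : r' < r by rewrite /r'; lra.
  have r'b : r' <= b by rewrite (le_trans (ltW r'r))// ltW.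
  have lr0 : 0 < l r' by rewrite l0 ?ar'.
  apply: (flux_derive kc k0 lr0 (aboveq _ ar' r'b)); first by rewrite r'r.
  by apply: within_cc_interior cqw _; rewrite ar.
have h0 r : a < r -> 0 <= h r.
  move=> ar; apply: flux_ge0 => // s /andP[rs sb]; apply: ltW; apply: q0.
  by rewrite sb (lt_le_trans ar).
have hb r : b <= r -> h r = 0 by exact: flux_b.
exists q, h; split => //.
  split; first by apply: (hq b _).1; rewrite ab_le lexx.
  by move=> s sab; rewrite (hq s sab).2.
split=> // r ar; have [rb|br|rb] := ltgtP r b.
- by apply: isd_cont (dh r _); rewrite ar.
- apply: (isd_cont (a := 0)); apply: near_eq_is_derive (isd_cst r 0).
  by near=> y; rewrite hb//; apply: ltW; near: y; exact: lt_nbhsr.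
- rewrite rb; pose r' := (a + b) / 2.
  have ar' : a < r' by rewrite /r'; lra.
  have r'b : r' < b by rewrite /r'; lra.
  have lr0 : 0 < l r' by rewrite l0 ?ar' ?(ltW r'b).
  have [_ _ H1] := (continuous_within_itvP _ r'b).1 (flux_continuous r'b kc k0 lr0 (aboveq _ ar' (ltW r'b))).
  apply/left_right_continuousP; split; first exact: H1.
  apply: cvg_near_cst; near=> y; rewrite -/(h b) !hb//; apply: ltW; near: y; exact: nbhs_right_gt.
Unshelve. all: by end_near. Qed.

End ode_limit.

(** * The self-similar profile *)

Lemma within_M {R : realType} (A : set R) (f g : R -> R) :
  {within A, continuous f} -> {within A, continuous g} -> {within A, continuous (fun x => f x * g x)}.
Proof. by move=> fc gc x; apply: cvgM; [exact: fc|exact: gc]. Qed.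

Lemma within_Z {R : realType} (A : set R) (f : R -> R) c :
  {within A, continuous f} -> {within A, continuous (fun x => c * f x)}.
Proof. by move=> fc; apply: within_M => //; apply: continuous_subspaceT => x; exact: cst_continuous. Qed.

Lemma within_B {R : realType} (A : set R) (f g : R -> R) :
  {within A, continuous f} -> {within A, continuous g} -> {within A, continuous (fun x => f x - g x)}.
Proof. by move=> fc gc x; apply: cvgB; [exact: fc|exact: gc]. Qed.

Lemma measurable_lt_set d (T : measurableType d) {R : realType} (f g : T -> R) :
  measurable_fun setT f -> measurable_fun setT g -> measurable [set x | f x < g x].
Proof.
move=> mf mg; rewrite (_ : [set _ | _] = setT `&` [set x | (0 < (g \- f) x)%R]).
  have m := measurable_funB mg mf.
  rewrite (_ : [set x | _] = (g \- f) @^-1` `]0, +oo[%classic); first exact: m.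
  by apply/seteqP; split => x /=; rewrite in_itv/= andbT.
by apply/seteqP; split => x /=; rewrite subr_gt0 // => -[].
Qed.

Lemma integrable_halfline_bound {R : realType} (g : R -> R) (C : R) :
  measurable_fun halfline g -> (forall y, 0 < y -> 0 <= g y) ->
  (forall n : nat, (@lebesgue_measure R).-integrable `]0, n%:R] (EFin \o g)) ->
  (forall n : nat, \int[@lebesgue_measure R]_(y in `]0, n%:R]) g y <= C) ->
  (@lebesgue_measure R).-integrable halfline (EFin \o g).
Proof.
move=> mg g0 gi gC; have mH := @measurable_halfline R.
pose F (n : nat) := g \_ `]0, n%:R].
have FE n : \int[@lebesgue_measure R]_(y in halfline) F n y = \int[@lebesgue_measure R]_(y in `]0, n%:R]) g y.
  rewrite /F -Rintegral_mkcondr; congr (Rintegral _ _ _); apply: setIidr => y /=.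
  by rewrite in_itv/= => /andP[].
have F0 n x : halfline x -> 0 <= F n x.
  by move=> x0; rewrite /F patchE; case: ifP => // _; exact: g0.
have Fi n : (@lebesgue_measure R).-integrable halfline (EFin \o F n).
  by apply: (@integrableS _ _ _ _ setT) => //; apply: integrable_restrictT.
have Fm n m x : halfline x -> (n <= m)%N -> F n x <= F m x.
  move=> x0 nm; rewrite /F !patchE; case: ifPn => [/set_mem/=|_]; last first.
    by case: ifP => // _; exact: g0.
  rewrite in_itv/= => /andP[_ xn]; rewrite mem_set//= in_itv/= x0 (le_trans xn)// ler_nat//.
have cv : cvgn (fun n => \int[@lebesgue_measure R]_(y in halfline) F n y).
  apply: nondecreasing_is_cvgn.
    by move=> n m nm; apply: le_Rintegral => // x x0; exact: Fm.
  by exists C => _ [n _ <-]; rewrite FE.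
apply: (proj1 (@mu_mct R halfline F g _ mH Fi F0 _ _ cv)).
  by move=> x n m; exact: Fm.
move=> x x0; apply: cvg_near_cst; near=> n; rewrite /F patchE mem_set//= in_itv/= x0/=.
near: n; exists (Num.truncn x).+1 => // n /= xn; rewrite ltW// (lt_le_trans (truncnS_gt _))// ler_nat//.
Unshelve. all: by end_near. Qed.

Section profile.
Context {R : realType}.
Local Notation mu := (@lebesgue_measure R).
Implicit Types (r s x y z : R).
Variables (a b : R) (k D q h : R -> R).
Hypotheses (ab : a < b) (kc : continuous k) (k0 : forall s, 0 <= k s)
  (Dd : forall s, is_derive s 1 D (2 * k s))
  (q0 : forall s, a < s <= b -> 0 < q s)
  (hi : mu.-integrable `[a, b] (EFin \o h))
  (hq : forall s, a <= s <= b -> q s = \int[mu]_(y in `[a, s]) h y)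
  (h0 : forall r, a < r -> 0 <= h r)
  (hd : forall r, a < r < b -> is_derive r 1 h (- (k r / q r)))
  (hb : forall r, b <= r -> h r = 0)
  (hc : forall r, a < r -> {for r, continuous h}).

Let ab_le : a <= b. Proof. exact: ltW. Qed.

Lemma h_anti r s : a < r -> r <= s -> h s <= h r.
Proof.
move=> ar rs; have [bs|sb] := leP b s; first by rewrite hb// h0.
move: rs; rewrite le_eqVlt => /predU1P[->//|rs].
rewrite -subr_ge0 -oppr_le0 opprB.
have [||c /andP[rc cs] ->] := @MVT_cc _ h (fun r => - (k r / q r)) r s rs.
- by move=> x /andP[rx xs]; apply: hd; rewrite (lt_trans ar rx) (lt_trans xs sb).
- apply: continuous_in_subspaceT => x /set_mem/=; rewrite in_itv/= => /andP[rx _].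
  by apply: hc; exact: lt_le_trans rx.
rewrite mulNr oppr_le0 mulr_ge0 ?subr_ge0 ?(ltW rs)// divr_ge0// ltW// q0//.
by rewrite (lt_trans ar rc) (le_trans (ltW cs) (ltW sb)).
Qed.

Lemma q_mono r s : a <= r -> r <= s -> s <= b -> q r <= q s.
Proof.
move=> ar rs sb; rewrite -subr_ge0 hq ?sb ?(le_trans ar)// hq ?ar ?(le_trans rs)//.
rewrite Rintegral_itvB ?bnd_simp//; last exact: integrable_ccS hi.
apply: Rintegral_ge0 => x /=; rewrite in_itv/= => /andP[rx _]; apply: h0.
exact: le_lt_trans ar rx.
Qed.

Lemma q_a : q a = 0.
Proof. by rewrite hq ?lexx// set_itv1 Rintegral_set1. Qed.

Lemma q_ge0 s : a <= s <= b -> 0 <= q s.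
Proof. by move=> /andP[as_ sb]; rewrite -q_a q_mono. Qed.

Lemma q_continuous : {within `[a, b], continuous q}.
Proof.
apply: (@subspace_eq_continuous _ _ _ (fun s => \int[mu]_(y in `[a, s]) h y)).
  by move=> y /set_mem/=; rewrite in_itv/= => yab; exact/esym/hq.
exact: integral_continuous.
Qed.

Lemma q_derive r : a < r < b -> is_derive r 1 q (h r).
Proof.
move=> arb; have /andP[ar rb] := arb.
apply: near_eq_is_derive (is_derive_integral hi arb (hc ar)).
near=> y; rewrite hq//; apply/andP; split; apply: ltW; near: y.
  exact: lt_nbhsr.
exact: lt_nbhsl.
Unshelve. all: by end_near. Qed.

Lemma fine_mu_oo c e : c <= e -> fine (mu `]c, e[%classic) = e - c.
Proof.
move=> ce; rewrite lebesgue_measure_itv/= lte_fin; move: ce; rewrite le_eqVlt => /predU1P[->|->].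
  by rewrite ltxx subrr.
by rewrite -EFinB.
Qed.

(** The supremum of this set is the generalised inverse of [2 h]. The point [a] keeps the set
    nonempty, so the profile takes the value [a] once [y] lies above all values of [2 h]; where [h]
    is constant the profile jumps. *)
Definition inv_profile_set y := [set s | s = a \/ (a < s < b /\ y < 2 * h s)].
Definition profile y := sup (inv_profile_set y).
Local Notation f := profile.

Let Sub y : ubound (inv_profile_set y) b.
Proof. by move=> s [->//|[/andP[_ /ltW]]]. Qed.

Let hS y : has_sup (inv_profile_set y).
Proof. by split; [exists a; left|exists b]. Qed.

Lemma profile_ge y : a <= f y.
Proof. by apply: ub_le_sup; [exists b|left]. Qed.

Lemma profile_le y : f y <= b.
Proof. by apply: ge_sup; [exists a; left|]. Qed.

(** The Galois connection from which the properties of the profile follow. Continuity of [h] allows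
    a move slightly to the right of [s] that keeps the strict inequality. *)
Lemma lt_profile y s : a < s < b -> (s < f y) = (y < 2 * h s).
Proof.
move=> asb; have /andP[as_ sb] := asb; apply/idP/idP => [sf|ys].
  have [s' Ss' ss'] := sup_gt (hS y).1 sf.
  case: Ss' => [E|[/andP[as' s'b] ys']]; first by move: as_ ss'; rewrite E => /ltW; rewrite leNgt => /negP.
  by apply: lt_le_trans ys' _; rewrite ler_pM2l// h_anti// ltW.
have ys2 : y / 2 < h s by rewrite ltr_pdivrMr// mulrC.
have H : nbhs s (fun x => y / 2 < h x) by apply: (cvgr_gt _ (hc as_) _ ys2).
case/nbhs_ballP: H => d /= d0 Hd.
pose s' := Num.min (s + d / 2) ((s + b) / 2).
have ss' : s < s' by rewrite /s' lt_min; apply/andP; split; lra.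
have s'1 : s' <= s + d / 2 by rewrite /s' ge_min lexx.
have s'2 : s' <= (s + b) / 2 by rewrite /s' ge_min lexx orbT.
apply: (lt_le_trans ss'); apply: ub_le_sup; first by exists b.
right; split; first by rewrite (lt_trans as_ ss'); lra.
have := Hd s'; rewrite /ball/= => /(_ ltac:(by rewrite ltr0_norm ?subr_lt0//; lra)).
by rewrite ltr_pdivrMr// mulrC.
Qed.

Lemma profile_anti y z : y <= z -> f z <= f y.
Proof.
move=> yz; apply: ge_sup; first by exists a; left.
move=> s [->|[asb zs]]; first exact: profile_ge.
by apply: ltW; rewrite lt_profile// (le_lt_trans yz).
Qed.

(** By continuity of [h], a strict inequality in either direction would persist at levels slightly
    below or above [profile y], against [lt_profile]. *)
Lemma profile_eq y : 0 <= y -> a < f y -> y = 2 * h (f y).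
Proof.
move=> y0 af; apply/eqP; rewrite eq_le; apply/andP; split.
  rewrite -ler_pdivrMl// leNgt; apply/negP => hy.
  have H : nbhs (f y) (fun x => h x < 2^-1 * y) by apply: (cvgr_lt _ (hc af) _ hy).
  case/nbhs_ballP: H => d /= d0 Hd.
  pose s := Num.max (f y - d / 2) ((a + f y) / 2).
  have s1 : f y - d / 2 <= s by rewrite /s le_max lexx.
  have s2 : (a + f y) / 2 <= s by rewrite /s le_max lexx orbT.
  have sf : s < f y by rewrite /s gt_max; apply/andP; split; lra.
  have := Hd s; rewrite /ball/= => /(_ ltac:(by rewrite gtr0_norm ?subr_gt0//; lra)).
  apply/negP; rewrite -leNgt ler_pdivrMl// ltW// -lt_profile//.
  by rewrite (lt_le_trans sf (profile_le y)) andbT; lra.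
have := profile_le y; rewrite le_eqVlt => /predU1P[->|fb]; first by rewrite hb// mulr0.
rewrite -ler_pdivlMl// leNgt; apply/negP => hy.
have H : nbhs (f y) (fun x => 2^-1 * y < h x) by apply: (cvgr_gt _ (hc af) _ hy).
case/nbhs_ballP: H => d /= d0 Hd.
pose s := Num.min (f y + d / 2) ((f y + b) / 2).
have s1 : s <= f y + d / 2 by rewrite /s ge_min lexx.
have s2 : s <= (f y + b) / 2 by rewrite /s ge_min lexx orbT.
have sf : f y < s by rewrite /s lt_min; apply/andP; split; lra.
have := Hd s; rewrite /ball/= => /(_ ltac:(by rewrite ltr0_norm ?subr_lt0//; lra)).
apply/negP; rewrite -leNgt ler_pdivlMl// leNgt -lt_profile ?(lt_trans af sf)/=; last by lra.
by rewrite -leNgt ltW.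
Qed.

(** Right-continuity comes from the strict inequality in [inv_profile_set]. From the left it fails
    at jumps, which is why the sequence is bounded below by [y]. *)
Lemma profile_right_cvg (y_ : nat -> R) y : (forall n, y <= y_ n) ->
  y_ n @[n --> \oo] --> y -> f (y_ n) @[n --> \oo] --> f y.
Proof.
move=> yy cy; apply/cvgrPdist_le => e e0.
have [fa|af] := leP (f y) a.
  near=> n; have := profile_anti (yy n); have := profile_ge (y_ n); have := profile_ge y => h1 h2 h3.
  by rewrite ger0_norm ?subr_ge0//; lra.
pose s := Num.max (f y - e) ((a + f y) / 2).
have s1 : f y - e <= s by rewrite /s le_max lexx.
have s2 : (a + f y) / 2 <= s by rewrite /s le_max lexx orbT.
have sf : s < f y by rewrite /s gt_max; apply/andP; split; lra.
have asb : a < s < b by rewrite (lt_le_trans sf (profile_le y)) andbT; lra.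
have ys : y < 2 * h s by rewrite -lt_profile.
near=> n; rewrite ger0_norm ?subr_ge0 ?profile_anti//.
rewrite lerBlDr -lerBlDl (le_trans s1)// ltW// lt_profile//.
by near: n; apply: (cvgr_lt _ cy).
Unshelve. all: by end_near. Qed.

Lemma measurable_profile : measurable_fun setT f.
Proof. by apply: nonincreasing_measurable => // x y; exact: profile_anti. Qed.

Lemma flux_anti_profile y z : y <= z -> q (f z) <= q (f y).
Proof. by move=> yz; rewrite q_mono ?profile_ge ?profile_le// profile_anti. Qed.

Lemma measurable_flux_profile : measurable_fun setT (q \o f).
Proof. by apply: nonincreasing_measurable => // x y; exact: flux_anti_profile. Qed.

Lemma flux_profile_bound y : 0 <= q (f y) <= q b.
Proof. by rewrite q_ge0 ?q_mono ?profile_ge ?profile_le. Qed.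

(** Extended by [0], so that for [y >= 0] the interval []a, profile y[] is a superlevel set of
    [2 h1] on the whole line. *)
Definition h1 := h \_ `]a, b].

Lemma h1_ge0 s : 0 <= h1 s.
Proof.
by rewrite /h1 patchE; case: ifPn => // /set_mem/=; rewrite in_itv/= => /andP[/h0].
Qed.

Lemma measurable_h1 : measurable_fun setT h1.
Proof.
apply/(measurable_restrictT _ (measurable_itv _)).
have i : mu.-integrable `]a, b] (EFin \o h).
  by apply: integrableS hi => //; apply: subset_itvr; rewrite bnd_simp.
by apply/measurable_EFinP; exact: measurable_int i.
Qed.

Lemma integrable_h1 : mu.-integrable setT (EFin \o h1).
Proof.
apply: integrable_restrictT => //.
by apply: integrableS hi => //; apply: subset_itvr; rewrite bnd_simp.
Qed.

Lemma lt_h1 y s : 0 <= y -> (y < 2 * h1 s) = (a < s < f y).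
Proof.
move=> y0; rewrite /h1 patchE; case: ifPn => [/set_mem/=|].
  rewrite in_itv/= => /andP[as_]; rewrite le_eqVlt => /predU1P[->|sb].
    by rewrite hb// mulr0 ltNge y0/= andbC ltNge profile_le.
  by rewrite as_/= lt_profile// as_.
rewrite notin_setE/= in_itv/= (_ : point = 0 :> R)// mulr0 [y < 0]ltNge y0/= => /negP sab.
apply/esym/negbTE; apply: contra sab => /andP[-> sf]/=.
by rewrite (le_trans (ltW sf))// profile_le.
Qed.

Lemma set_lt_h1 y : 0 <= y -> [set s | y < 2 * h1 s] = `]a, f y[%classic.
Proof. by move=> y0; apply/seteqP; split => s /=; rewrite lt_h1// in_itv. Qed.

(** Layer cake: profile and flux are superpositions, over the levels [s], of the indicators of
    [y < 2 h1 s], with weights [1] and [h1 s]. In this form the weak identity can be verified one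
    level at a time. *)
Lemma profile_layer y : 0 <= y -> f y - a = \int[mu]_s (\1_[set s | y < 2 * h1 s] s).
Proof.
move=> y0; rewrite set_lt_h1// /Rintegral integral_indic// setIT.
by apply/esym; apply: fine_mu_oo; exact: profile_ge.
Qed.

Lemma flux_layer y : 0 <= y -> q (f y) = \int[mu]_s (h1 s * \1_[set s | y < 2 * h1 s] s).
Proof.
move=> y0; rewrite hq ?profile_ge ?profile_le//.
have fi : mu.-integrable `[a, f y] (EFin \o h) by apply: integrable_ccS hi => //; exact: profile_le.
rewrite -Rintegral_itv_obnd_cbnd; last first.
  by apply: integrableS fi => //; apply: subset_itvr; rewrite bnd_simp.
rewrite -Rintegral_itv_bndo_bndc; last first.
  by apply: integrableS fi => //; apply: subset_itv; rewrite bnd_simp.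
rewrite set_lt_h1// Rintegral_mkcond; apply: eq_Rintegral => s _.
rewrite patchE indicE; case: ifPn => sf; last by rewrite mulr0.
rewrite mulr1 /h1 patchE mem_set//=; move: sf => /set_mem/=; rewrite !in_itv/= => /andP[-> sf].
by rewrite (le_trans (ltW sf))// profile_le.
Qed.

Lemma min_layer y c : 0 <= y -> 0 <= c ->
  \int[mu]_z (\1_(`]0, y]) z * \1_[set z | z < 2 * c] z) = Num.min y (2 * c).
Proof.
move=> y0 c0.
have -> : (fun z => \1_(`]0, y]) z * \1_[set z | z < 2 * c] z) = \1_(`]0, y] `&` `]-oo, (2 * c)[) :> (R -> R).
  apply/funext => z; rewrite !indicE in_setI; rewrite -natrM mulnb; congr (_%:R).
rewrite /Rintegral integral_indic ?setIT//; last exact: measurableI.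
have [yc|cy] := ltP y (2 * c).
  rewrite (_ : _ `&` _ = `]0, y]%classic); last first.
    by apply: setIidl => z /=; rewrite !in_itv/= => /andP[_ zy]; exact: le_lt_trans yc.
  by rewrite fine_mu_oc// subr0.
rewrite (_ : _ `&` _ = `]0, (2 * c)[%classic); last first.
  apply/seteqP; split => z /=; rewrite !in_itv/=; first by move=> [/andP[-> _] ->].
  by move=> /andP[-> zc]; rewrite (le_trans (ltW zc)).
by apply: etrans (fine_mu_oo _) _; rewrite ?subr0// mulr_ge0.
Qed.

Lemma integrable_indic_oc c e : mu.-integrable setT (EFin \o (\1_(`]c, e]) : R -> R)).
Proof.
have i : mu.-integrable setT (EFin \o (cst (1 : R) \_ `]c, e])).
  apply: integrable_restrictT => //; apply: (@integrable_bnd _ _ R mu _ _ 1) => // [|x _].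
    exact: lebesgue_oc_lty.
  by rewrite normr1.
by apply: eq_integrable i => // x _ /=; rewrite indicE patchE; case: ifPn.
Qed.

(** Fubini; for a fixed level the inner integral over [z] is the length of the part of []0, y]]
    below [2 h1 s]. *)
Lemma layer_integral (p : R -> R) y : mu.-integrable setT (EFin \o p) -> (forall s, 0 <= p s) ->
  0 <= y ->
  \int[mu]_(z in `]0, y]) (\int[mu]_s (p s * \1_[set s | z < 2 * h1 s] s)) =
  \int[mu]_s (p s * Num.min y (2 * h1 s)).
Proof.
move=> pi p0 y0; have mp : measurable_fun setT p by apply/measurable_EFinP; exact: measurable_int pi.
pose F (z : R * R) : R := p z.1 * (\1_(`]0, y]) z.2 * \1_[set z | z.2 < 2 * h1 z.1] z).
have iG : (mu \x mu)%E.-integrable setT (EFin \o (fun z : R * R => p z.1 * \1_(`]0, y]) z.2)).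
  by apply: (@integrable_tensor _ _ _ _ R mu mu p (\1_(`]0, y]))) => //; exact: integrable_indic_oc.
have mA : measurable [set z : R * R | z.2 < 2 * h1 z.1].
  apply: measurable_lt_set => //.
  apply: measurable_funM => //; apply: measurableT_comp measurable_fst => //; exact: measurable_h1.
have iF : (mu \x mu)%E.-integrable setT (EFin \o F).
  apply: integrable_dom iG _ => //.
    apply: measurable_funM; first exact: measurableT_comp measurable_fst.
    apply: measurable_funM => //.
    by apply: measurableT_comp measurable_snd; exact: measurable_indic.
  move=> z _; rewrite /F !normrM !(ger0_norm (p0 _)) ler_wpM2l//.
  by rewrite !indicE; do 2 case: (_ \in _); rewrite ?normr0 ?normr1 ?mulr0 ?mulr1 ?mul0r.
have E1 := Rfubini1 iF; have E2 := Rfubini2 iF.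
rewrite Rintegral_mkcond; transitivity (\int[mu]_z \int[mu]_s F (s, z)).
  apply: eq_Rintegral => z _; rewrite patchE; case: ifPn => [|].
    move=> zi; apply: eq_Rintegral => s _; rewrite /F/=.
    by rewrite !indicE zi mul1r; congr (_ * (nat_of_bool _)%:R); rewrite !inE.
  move=> zi; rewrite (_ : (fun s => _) = cst 0) ?Rintegral_0//.
  by apply/funext => s; rewrite /F/= !indicE (negbTE zi) mul0r mulr0.
rewrite E2 -E1; apply: eq_Rintegral => s _; rewrite /F/=.
rewrite -min_layer ?h1_ge0//.
have mI : measurable_fun setT (\1_[set z : R | z < 2 * h1 s] : R -> R).
  by apply: measurable_indic; exact: measurable_lt_set.
rewrite -RintegralZl//; last first.
  apply: (@mu_integrable_dom R setT _ (\1_(`]0, y]))) => //.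
  - exact: measurable_funM.
  - exact: integrable_indic_oc.
  - by move=> z _; rewrite !indicE; do 2 case: (_ \in _); rewrite ?normr0 ?normr1 ?mulr0 ?mulr1 ?mul0r ?normr0 ?normr1 ?lexx ?ler01.
Qed.

Lemma integrable_flux_profile y : mu.-integrable `]0, y] (EFin \o (q \o f)).
Proof.
apply: (@mu_integrable_dom R _ _ (cst (q b))) => //.
- by apply: measurable_funTS; exact: measurable_flux_profile.
- by apply: (@integrable_bnd _ _ R mu _ _ `|q b|) => //; exact: lebesgue_oc_lty.
- by move=> x _; have /andP[q1 q2] := flux_profile_bound x; rewrite ger0_norm.
Qed.

Lemma min_layer_integral y : 0 <= y ->
  \int[mu]_(z in `[0, y]) q (f z) = \int[mu]_s (h1 s * Num.min y (2 * h1 s)).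
Proof.
move=> y0; rewrite -Rintegral_itv_obnd_cbnd; last exact: integrable_flux_profile.
rewrite -(layer_integral integrable_h1 h1_ge0 y0).
by apply: eq_Rintegral => z /set_mem/=; rewrite in_itv/= => /andP[/ltW z0 _]; exact: flux_layer.
Qed.

(** Multiplication by [q] cancels the singular quotient in [h' = - k / q], which leaves a derivative
    free of [q]. *)
Lemma hq_derive r : a < r < b -> is_derive r 1 (fun s => 2 * h s * q s) (2 * h r ^+ 2 - 2 * k r).
Proof.
move=> arb; have /andP[ar rb] := arb.
have q0r : 0 < q r by rewrite q0// ar ltW.
apply: (is_derive_eq (isdM (isdZ 2 (hd arb)) (q_derive arb))).
by field; rewrite gt_eqF.
Qed.

Lemma hq_integral s : a < s <= b -> \int[mu]_(r in `[s, b]) (2 * h r ^+ 2 - 2 * k r) = - (2 * h s * q s).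
Proof.
move=> /andP[as_]; rewrite le_eqVlt => /predU1P[->|sb]; first by rewrite set_itv1 Rintegral_set1 hb// mulr0 mul0r oppr0.
have hcs : {within `[s, b], continuous h}.
  apply: continuous_in_subspaceT => x /set_mem/=; rewrite in_itv/= => /andP[sx _]; apply: hc; exact: lt_le_trans sx.
have qcs : {within `[s, b], continuous q} by apply: within_cc_sub q_continuous _ _ => //; exact: ltW.
have Hc : {within `[s, b], continuous (fun s => 2 * h s * q s)}.
  by apply: within_M qcs; exact: within_Z.
have gc : {within `[s, b], continuous (fun r => 2 * h r ^+ 2 - 2 * k r)}.
  apply: within_B; apply: within_Z; last exact: continuous_subspaceT.
  by rewrite (_ : (fun _ => _) = (fun r => h r * h r)); [exact: within_M|apply/funext => r; rewrite expr2].
rewrite /Rintegral (@continuous_FTC2 _ _ (fun s => 2 * h s * q s) s b) //.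
- by rewrite hb// mulr0 mul0r -EFinB/= sub0r.
- have /continuous_within_itvP := Hc; move=> /(_ sb) [_ H1 H2]; split=> //.
  by move=> x; rewrite in_itv/= => /andP[sx xb]; apply: isd_derivable (hq_derive _); rewrite (lt_trans as_ sx).
- move=> x; rewrite in_itv/= => /andP[sx xb]; apply: isd_derive1.
  by apply: hq_derive; rewrite (lt_trans as_ sx).
Qed.

Lemma D_integral s : a <= s <= b -> \int[mu]_(r in `[s, b]) (2 * k r) = D b - D s.
Proof.
move=> /andP[as_]; rewrite le_eqVlt => /predU1P[->|sb]; first by rewrite set_itv1 Rintegral_set1 subrr.
have Dc : continuous D by move=> x; exact: isd_cont (Dd x).
rewrite /Rintegral (@continuous_FTC2 _ _ D s b) //.
- by apply: within_Z; exact: continuous_subspaceT.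
- split; first by move=> x _; exact: isd_derivable (Dd x).
    by apply: cvg_at_right_filter; exact: Dc.
  by apply: cvg_at_left_filter; exact: Dc.
- by move=> x _; exact: isd_derive1 (Dd x).
Qed.

(** [hq_derive] integrated over [[profile y, b]], with [2 h = y] at the left end and [h b = 0].
    Integrability comes from the bound [2 h <= y] beyond the profile. *)
Lemma hh_integral y : 0 <= y ->
  mu.-integrable `[f y, b] (EFin \o (fun r => 2 * h r ^+ 2)) /\
  \int[mu]_(r in `[f y, b]) (2 * h r ^+ 2) = D b - D (f y) - y * q (f y).
Proof.
move=> y0; have fb := profile_le y; have af := profile_ge y.
have kci : mu.-integrable `[f y, b] (EFin \o (fun r => 2 * k r)).
  by apply: continuous_integrable_cc; apply: within_Z; exact: continuous_subspaceT.
have mh : measurable_fun `[f y, b] h.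
  apply: measurable_funS (_ : measurable_fun `[a, b] h) => //.
    by apply: subset_itvr; rewrite bnd_simp.
  by apply/measurable_EFinP; exact: measurable_int hi.
have hle r : f y < r -> r < b -> 2 * h r <= y.
  by move=> fr rb; rewrite leNgt -lt_profile -?leNgt ?(ltW fr)// (le_lt_trans af fr).
have hle' r : f y < r -> 2 * h r <= y.
  move=> fr; have [rb|rb] := ltP r b; first exact: hle.
  by rewrite hb// mulr0.
have hhi : mu.-integrable `[f y, b] (EFin \o (fun r => 2 * h r ^+ 2)).
  apply: integrable_oc_cc.
  apply: (@integrable_bnd _ _ R mu _ _ (y ^+ 2)) => //; first exact: lebesgue_oc_lty.
    apply: measurable_funM => //; apply: measurable_funX; apply: measurable_funS mh => //.
    by apply: subset_itvr; rewrite bnd_simp.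
  move=> r; rewrite /= in_itv/= => /andP[fr rb].
  have := hle' _ fr; have := h0 (le_lt_trans af fr) => hr0 hry.
  rewrite ger0_norm; nra.
split => //.
have gi : mu.-integrable `[f y, b] (EFin \o (fun r => 2 * h r ^+ 2 - 2 * k r)) by exact: integrable_sub.
suff E : \int[mu]_(r in `[f y, b]) (2 * h r ^+ 2 - 2 * k r) = - (y * q (f y)).
  move: E; rewrite RintegralB// D_integral ?af//; lra.
have [fa|] := leP (f y) a; last first.
  by move=> af'; rewrite hq_integral ?af'// -profile_eq.
have {fa} Ea : f y = a by apply/eqP; rewrite eq_le fa af.
rewrite Ea q_a mulr0 oppr0; rewrite Ea in gi hle' hle.
(* When [profile y = a], [h] need not be continuous at the left end: the identity is taken at
   [s_ n > a] and passes to the limit, since [2 h <= y] there and [q] tends to [0]. *)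
pose s_ (n : nat) := a + (b - a) / n.+1%:R.
have sab n : a < s_ n <= b.
  rewrite /s_ ltrDl divr_gt0 ?subr_gt0//= -lerBrDl ler_pdivrMr// ler_peMr ?subr_ge0//.
  by rewrite -[1]/(1%:R) ler_nat.
have s_cvg : s_ n @[n --> \oo] --> a.
  rewrite -[X in _ --> X]addr0; apply: cvgD; first exact: cvg_cst.
  by rewrite -[X in _ --> X](mulr0 (b - a)); apply: cvgM; [exact: cvg_cst|exact: cvg_harmonic].
have s_cvgr (g : R -> R) : {within `[a, b], continuous g} -> g (s_ n) @[n --> \oo] --> g a.
  move=> /continuous_within_itvP - /(_ ab)[_ ga _].
  by move/cvg_at_rightP: ga; apply; split => // n; have /andP[] := sab n.
have t1 := s_cvgr _ (tail_continuous ab_le gi).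
suff t2 : \int[mu]_(r in `[s_ n, b]) (2 * h r ^+ 2 - 2 * k r) @[n --> \oo] --> (0 : R).
  exact: cvg_unique t1 t2.
under eq_cvg do rewrite hq_integral//.
apply/cvgrPdist_le => e e0; have t3 := s_cvgr _ q_continuous.
rewrite q_a in t3; have t4 : y * q (s_ n) @[n --> \oo] --> y * 0 by apply: cvgM => //; exact: cvg_cst.
rewrite mulr0 in t4; move/cvgrPdist_le: t4 => /(_ _ e0); apply: filterS => n /=.
have /andP[an bn] := sab n.
rewrite !sub0r !normrN; apply: le_trans.
rewrite normrM [leRHS]normrM ler_wpM2r// ger0_norm ?(ger0_norm y0) ?mulr_ge0 ?h0//.
exact: hle'.
Qed.

(** The defining relation of the flux in integrated form, without differentiating the profile. By
    layer cake the integral is that of [h min(y, 2 h)]; below the level [profile y] this gives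
    [y q (profile y)], above it the integral of [2 h^2], and [hh_integral] adds the two. *)
Lemma profile_D y : 0 <= y -> D (f y) = D b - \int[mu]_(z in `[0, y]) q (f z).
Proof.
move=> y0; rewrite min_layer_integral//.
have fb := profile_le y; have af := profile_ge y.
have [hhi hhE] := hh_integral y0.
pose g r := h r * Num.min y (2 * h r).
rewrite (_ : (fun r => _) = g \_ `]a, b]); last first.
  by apply/funext => r; rewrite /h1 !patchE; case: ifP => // _; rewrite (_ : point = 0)// mul0r.
rewrite -Rintegral_mkcond.
have gi : mu.-integrable `[a, b] (EFin \o g).
  apply: integrable_oc_cc; apply: (@mu_integrable_dom R _ _ (fun r => y * h r)) => //.
  - have mh : measurable_fun `]a, b] h.
      apply: measurable_funS (_ : measurable_fun `[a, b] h) => //; last first.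
        by apply/measurable_EFinP; exact: measurable_int hi.
      by apply: subset_itvr; rewrite bnd_simp.
    by apply: measurable_funM => //; apply: measurable_minr => //; exact: measurable_funM.
  - apply: mu_integrable_scale => //; apply: integrableS hi => //.
    by apply: subset_itvr; rewrite bnd_simp.
  - move=> r; rewrite /= in_itv/= => /andP[ar _]; rewrite /g normrM mulrC.
    have hr := h0 ar; rewrite (ger0_norm hr) ler_wpM2r// ger0_norm ?ge_min ?lexx//.
    by rewrite le_min y0 mulr_ge0.
have := @tail_int _ g a b (f y) gi; rewrite af fb => /(_ isT).
rewrite [in X in D b - X]Rintegral_itv_obnd_cbnd; last first.
  by apply: integrableS gi => //; apply: subset_itvr; rewrite bnd_simp.
suff -> : \int[mu]_(z in `[f y, b]) g z = D b - D (f y) - y * q (f y).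
  suff -> : \int[mu]_(z in `[a, f y]) g z = y * q (f y) by lra.
  rewrite hq ?af//; have hfi : mu.-integrable `[a, f y] (EFin \o h) by exact: integrable_ccS hi.
  have gfi : mu.-integrable `[a, f y] (EFin \o g) by exact: integrable_ccS gi.
  rewrite -RintegralZl//.
  have i1 (u : R -> R) : mu.-integrable `[a, f y] (EFin \o u) -> \int[mu]_(z in `[a, f y]) u z = \int[mu]_(z in `]a, f y[) u z.
    move=> ui; rewrite -Rintegral_itv_obnd_cbnd; last first.
      by apply: integrableS ui => //; apply: subset_itvr; rewrite bnd_simp.
    rewrite -Rintegral_itv_bndo_bndc//.
    by apply: integrableS ui => //; apply: subset_itv; rewrite bnd_simp.
  rewrite i1// i1; last exact: mu_integrable_scale.
  apply: eq_Rintegral => r /set_mem/=; rewrite in_itv/= => /andP[ar rf].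
  have : y < 2 * h r by rewrite -lt_profile// ar (lt_le_trans rf fb).
  by rewrite /g => /ltW/min_idPl ->; rewrite mulrC.
rewrite -hhE -Rintegral_itv_obnd_cbnd; last first.
  by apply: integrableS gi => //; apply: subset_itvl || apply: subset_itv; rewrite bnd_simp.
rewrite -[RHS]Rintegral_itv_obnd_cbnd; last first.
  by apply: integrableS hhi => //; apply: subset_itvr; rewrite bnd_simp.
apply: eq_Rintegral => r /set_mem/=; rewrite in_itv/= => /andP[fr rb].
rewrite /g; have /min_idPr -> : 2 * h r <= y.
  move: rb; rewrite le_eqVlt => /predU1P[->|rb]; first by rewrite hb// mulr0.
  by rewrite leNgt -lt_profile -?leNgt ?(ltW fr)// (le_lt_trans af fr).
by rewrite mulrCA expr2.
Qed.

(** By layer cake the integrals over []0, n]] stay below the integral of [2 h1]. *)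
Lemma integrable_profile : mu.-integrable halfline (EFin \o (fun y => f y - a)).
Proof.
have i1 : mu.-integrable setT (EFin \o (cst (1 : R) \_ `]a, b])).
  apply: integrable_restrictT => //; apply: (@integrable_bnd _ _ R mu _ _ 1) => // [|x _].
    exact: lebesgue_oc_lty.
  by rewrite normr1.
have p0 s : 0 <= (cst (1 : R) \_ `]a, b]) s by rewrite patchE; case: ifP.
have mf : measurable_fun setT (fun y => f y - a) by apply: measurable_funB => //; exact: measurable_profile.
have ih : mu.-integrable setT (EFin \o (fun s => 2 * h1 s)) by apply: mu_integrable_scale => //; exact: integrable_h1.
apply: (@integrable_halfline_bound _ _ (\int[mu]_s (2 * h1 s))).
- exact: measurable_funTS.
- by move=> y _; rewrite subr_ge0 profile_ge.
- move=> n; apply: (@mu_integrable_dom R _ _ (cst (b - a))) => //.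
  + exact: measurable_funTS.
  + by apply: (@integrable_bnd _ _ R mu _ _ `|b - a|) => //; exact: lebesgue_oc_lty.
  + by move=> x _; rewrite ger0_norm ?subr_ge0 ?profile_ge// lerB// profile_le.
move=> n; apply: (@le_trans _ _ (\int[mu]_s ((cst (1 : R) \_ `]a, b]) s * Num.min n%:R (2 * h1 s)))).
  rewrite -layer_integral// le_eqVlt; apply/orP; left; apply/eqP.
  apply: eq_Rintegral => z /set_mem/=; rewrite in_itv/= => /andP[/ltW z0 _]; rewrite profile_layer//.
  rewrite set_lt_h1//; apply: eq_Rintegral => s _; rewrite !indicE.
  have [|_] := boolP (s \in `]a, f z[%classic); last by rewrite mulr0.
  rewrite mulr1 patchE => /set_mem/=; rewrite in_itv/= => /andP[as_ sf].
  by rewrite mem_set//= in_itv/= as_ (le_trans (ltW sf))// profile_le.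
have mm : measurable_fun setT (fun s => (cst (1 : R) \_ `]a, b]) s * Num.min n%:R (2 * h1 s)).
  apply: measurable_funM; first by apply/measurable_EFinP; exact: measurable_int i1.
  by apply: measurable_minr => //; apply: measurable_funM => //; exact: measurable_h1.
have bnd s : `|(cst (1 : R) \_ `]a, b]) s * Num.min n%:R (2 * h1 s)| <= 2 * h1 s.
  have h10 : 0 <= 2 * h1 s by rewrite mulr_ge0 ?h1_ge0.
  have m0 : 0 <= Num.min n%:R (2 * h1 s) by rewrite le_min h10 ler0n.
  rewrite patchE; case: ifP => _; last by rewrite (_ : point = 0)// mul0r normr0.
  by rewrite mul1r ger0_norm// ge_min lexx orbT.
apply: le_Rintegral => //.
  exact: (mu_integrable_dom _ mm ih).
by move=> s _; exact: le_trans (ler_norm _) (bnd s).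
Qed.

Lemma profile_D_bound : exists2 M : R, 0 <= M & forall y, 0 <= D (f y) - D a <= M * (f y - a).
Proof.
have [M M0 kM] := continuous_bounded_cc (@continuous_subspaceT _ _ `[a, b] _ kc).
exists (2 * M) => [|y]; first by rewrite mulr_ge0.
have := profile_ge y; rewrite le_eqVlt => /predU1P[<-|af]; first by rewrite !subrr mulr0 lexx.
have [c /andP[ac cf] ->] := MVT_all af Dd.
have cab : a <= c <= b by rewrite (ltW ac) (le_trans (ltW cf)) ?profile_le.
have := kM c cab; have := k0 c => kc0; rewrite ger0_norm// => kcM.
by rewrite mulr_ge0 ?mulr_ge0 ?subr_ge0 ?(ltW af)//= ler_wpM2r ?subr_ge0 ?(ltW af)// ler_wpM2l.
Qed.

(** [profile_D] bounds the integrals over []0, n]] by the total drop [D b - D a]. *)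
Lemma integrable_flux : mu.-integrable halfline (EFin \o (q \o f)).
Proof.
apply: (@integrable_halfline_bound _ _ (D b - D a)).
- by apply: measurable_funTS; exact: measurable_flux_profile.
- by move=> y _; have /andP[] := flux_profile_bound y.
- move=> n; exact: integrable_flux_profile.
move=> n; rewrite Rintegral_itv_obnd_cbnd; last exact: integrable_flux_profile.
have [M M0 DM] := profile_D_bound; have /andP[D1 _] := DM n%:R.
by have := @profile_D n%:R (ler0n _ n); lra.
Qed.

End profile.

Section profile_exists.
Context {R : realType}.
Local Notation mu := (@lebesgue_measure R).

(** The interface between the ordinary and the partial differential equation: what is handed over is
    the profile [f], the flux [Q] and the layer density [p], where [2 p] is the function whose
    generalised inverse is [f]. *)
Lemma profile_exists (a b : R) (k D : R -> R) : a < b -> continuous k -> (forall s, 0 <= k s) ->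
  (exists2 c, a < c < b & 0 < \int[mu]_(y in `[c, b]) k y) ->
  (forall s : R, is_derive s 1 D (2 * k s)) ->
  exists f Q p : R -> R, [/\ (forall y, a <= f y <= b) /\ (forall y z, y <= z -> f z <= f y),
    (exists C, forall y, 0 <= Q y <= C) /\ (forall y z, y <= z -> Q z <= Q y),
    (forall (y_ : nat -> R) y, (forall n, y <= y_ n) ->
      y_ n @[n --> \oo] --> y -> Q (y_ n) @[n --> \oo] --> Q y) /\
    (forall y, 0 <= y -> D (f y) = D b - prim Q y),
    mu.-integrable halfline (EFin \o (fun y => (D (f y) - D a) ^+ 2)) /\
      mu.-integrable halfline (EFin \o (fun y => Q y ^+ 2)) &
    [/\ mu.-integrable setT (EFin \o p), forall s, 0 <= p s, forall s, ~ (a < s <= b) -> p s = 0,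
      forall y, 0 <= y -> f y - a = \int[mu]_s (\1_[set s | y < 2 * p s] s) &
      forall y, 0 <= y -> Q y = \int[mu]_s (p s * \1_[set s | y < 2 * p s] s)]].
Proof.
move=> ab kc k0 kp Dd; have [q [h [q0 [hi hq] h0 hd [hb hc]]]] := ode_profile ab kc k0 kp.
have Dc : continuous D by move=> x; exact: isd_cont (Dd x).
pose f := profile a b h.
have fm : measurable_fun setT f by exact: (measurable_profile ab k0 q0 h0 hd hb hc).
have Qb y : 0 <= q (f y) <= q b by exact: (flux_profile_bound ab hi hq h0).
have Qm : measurable_fun setT (q \o f) by exact: (measurable_flux_profile ab k0 q0 hi hq h0 hd hb hc).
have [M M0 DM] := profile_D_bound h ab kc k0 Dd.
have fa y : a <= f y <= b by rewrite /f profile_ge// profile_le.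
have DM' y : 0 <= D (f y) - D a <= M * (b - a).
  have /andP[-> D2] := DM y; apply: le_trans D2 _; rewrite ler_wpM2l// lerB//.
  by have /andP[] := fa y.
have mD : measurable_fun setT (fun y => D (f y) - D a).
  apply: measurable_funB => //; apply: measurableT_comp fm.
  exact: continuous_measurable_fun.
have sq (g : R -> R) C : measurable_fun setT g -> (forall y, 0 <= g y <= C) ->
    mu.-integrable halfline (EFin \o g) -> mu.-integrable halfline (EFin \o (fun y => g y ^+ 2)).
  move=> mg gC gi; apply: (@mu_integrable_dom R _ _ (fun y => C * g y)).
  - exact: measurable_halfline.
  - by apply: measurable_funTS; exact: measurable_funX.
  - by apply: mu_integrable_scale gi; exact: measurable_halfline.
  - move=> y _; have /andP[g0 gy] := gC y.
    by rewrite ger0_norm ?sqr_ge0// expr2 ler_wpM2r.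
exists f, (q \o f), (h1 a b h); split.
- by split => // y z; exact: profile_anti.
- split => [|y z]; first by exists (q b).
  exact: (flux_anti_profile ab k0 q0 hi hq h0 hd hb hc).
- split; last exact: (profile_D ab kc k0 Dd q0 hi hq h0 hd hb hc).
  move=> y_ y yy cy; have := profile_right_cvg ab k0 q0 h0 hd hb hc yy cy.
  have /subspace_continuousP qc := q_continuous ab hi hq.
  have fab : `[a, b]%classic (f y) by rewrite /= in_itv/=.
  move=> fc; apply: (@cvg_comp _ _ _ (fun n => f (y_ n)) q _ (within `[a, b] (nbhs (f y)))); last exact: qc.
  move=> P PW; have : \forall n \near \oo, `[a, b]%classic (f (y_ n)) -> P (f (y_ n)) by exact: fc PW.
  by apply: filterS => n /=; apply; rewrite in_itv/=; exact: fa.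
- split.
    apply: (sq _ _ mD DM').
    apply: (@mu_integrable_dom R _ _ (fun y => M * (f y - a))).
    + exact: measurable_halfline.
    + exact: measurable_funTS.
    + apply: mu_integrable_scale; first exact: measurable_halfline.
      exact: (integrable_profile ab k0 q0 hi h0 hd hb hc).
    + by move=> y _; have /andP[D1 D2] := DM y; rewrite ger0_norm.
  apply: (sq _ _ Qm Qb).
  exact: (integrable_flux ab kc k0 Dd q0 hi hq h0 hd hb hc).
- split.
  + exact: (integrable_h1 hi).
  + exact: (h1_ge0 _ h0).
  + move=> s sab; rewrite /h1 patchE; case: ifPn => // /set_mem/=; by rewrite in_itv.
  + by move=> y y0; exact: (profile_layer ab k0 q0 h0 hd hb hc y0).
  + by move=> y y0; exact: (flux_layer ab k0 q0 hi hq h0 hd hb hc y0).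
Qed.

End profile_exists.

(** * Scaling of the half-line *)

Section scaling.
Context {R : realType}.
Local Notation mu := (@lebesgue_measure R).

Let scale (c : R) (x : measurableTypeR R) : measurableTypeR R := c * (x : R).

Lemma lebesgue_measure_scale (c : R) (A : set R) : 0 < c -> measurable A ->
  (mu A = c%:E * pushforward mu (scale c) A)%E.
Proof.
move=> c1 mA; have c0 : 0 <= c := ltW c1.
have mphi : measurable_fun setT (scale c) by apply: measurable_funM.
unshelve apply: (@lebesgue_measure_unique R (mscale (NngNum c0) (pushforward mu (scale c)))) => //=.
move=> _ [[u v]] _ <-; rewrite /mscale/= /pushforward.
rewrite (_ : _ @^-1` _ = `]u / c, v / c]%classic); last first.
  by apply/seteqP; split => x /=; rewrite !in_itv/= ltr_pdivrMr// ler_pdivlMr// mulrC.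
rewrite !lebesgue_measure_itv/= !lte_fin ltr_pM2r ?invr_gt0//.
case: ifPn => uv; last by rewrite mule0.
by rewrite -!EFinB -EFinM; congr EFin; field; rewrite gt_eqF.
Qed.

Lemma halfline_scale (g : R -> R) c : 0 < c -> measurable_fun setT g -> (forall x, 0 <= g x) ->
  mu.-integrable halfline (EFin \o g) ->
  mu.-integrable halfline (EFin \o (fun x => g (c * x))) /\
  \int[mu]_(x in halfline) g (c * x) = c^-1 * \int[mu]_(x in halfline) g x.
Proof.
move=> c1 mg g0 gi; have mH := @measurable_halfline R.
have c0 : 0 <= c := ltW c1.
have mg' : measurable_fun halfline (EFin \o g) by apply/measurable_EFinP; exact: measurable_funTS.
have mgc : measurable_fun halfline (fun x => g (c * x)).
  by apply: measurable_funTS; apply: (measurableT_comp mg); exact: measurable_funM.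
have E : (\int[mu]_(x in halfline) (g x)%:E = c%:E * \int[mu]_(x in halfline) (g (c * x)%R)%:E)%E.
  have mphi : measurable_fun setT (scale c) by apply: measurable_funM.
  transitivity (c%:E * \int[pushforward mu (scale c)]_(x in halfline) (g x)%:E)%E; last first.
    rewrite (ge0_integral_pushforward mphi)//; last by move=> x _; rewrite lee_fin.
    congr (_ * integral _ _ _)%E; apply/seteqP; split => x /=; rewrite /halfline/scale/= pmulr_rgt0//.
  apply: etrans; last first.
    by apply: (@ge0_integral_mscale _ _ _ _ _ _ (NngNum c0)) => // x _; rewrite lee_fin.
  by apply: eq_measure_integral => A mA _; exact: lebesgue_measure_scale.
have fin : (\int[mu]_(x in halfline) (g (c * x)%R)%:E < +oo)%E.
  have : (\int[mu]_(x in halfline) (g x)%:E < +oo)%E.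
    have /integrableP[_] := gi; apply: le_lt_trans; apply: ge0_le_integral => //.
    - by move=> x _; rewrite lee_fin.
    - by apply: measurableT_comp.
    - by move=> x _ /=; rewrite lee_fin ler_norm.
  rewrite E; apply: contraTT; rewrite !ltey !negbK => /eqP ->.
  by rewrite gt0_muley ?lte_fin.
have gci : mu.-integrable halfline (EFin \o (fun x => g (c * x))).
  apply/integrableP; split; first exact/measurable_EFinP.
  apply: le_lt_trans fin; apply: ge0_le_integral => //.
  - by apply: measurableT_comp => //; exact/measurable_EFinP.
  - exact/measurable_EFinP.
  - by move=> x _ /=; rewrite ger0_norm.
split => //.
have : (\int[mu]_(x in halfline) g x)%:E = (c * \int[mu]_(x in halfline) g (c * x))%:E.
  by rewrite EFinM EFin_Rintegral// EFin_Rintegral.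
by case=> ->; rewrite mulKf// gt_eqF.
Qed.

(** This is the singularity at the initial time both of the squared [L2] norm of the flux and of the
    change of variables on the parabolas. Monotone convergence from []e n, T]], with primitive
    [2 sqrt t]. *)
Lemma integrable_inv_sqrt (T : R) : 0 < T ->
  mu.-integrable `]0, T] (EFin \o (fun t => (Num.sqrt t)^-1)).
Proof.
move=> T0; pose e (n : nat) := T / n.+1%:R.
have e0 n : 0 < e n by rewrite divr_gt0.
have eT n : e n <= T by rewrite /e ler_pdivrMr// ler_peMr ?(ltW T0)// ler1n.
pose F n := (fun t => (Num.sqrt t)^-1) \_ `]e n, T].
have sc : continuous (@Num.sqrt R) := @sqrt_continuous R.
have ic n : {within `[e n, T], continuous (fun t : R => (Num.sqrt t)^-1)}.
  apply: continuous_in_subspaceT => t /set_mem/=; rewrite in_itv/= => /andP[et _].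
  by apply: cvgV; [rewrite gt_eqF// sqrtr_gt0 (lt_le_trans (e0 n))|exact: sc].
have ii n : mu.-integrable `]e n, T] (EFin \o (fun t => (Num.sqrt t)^-1)).
  by apply: integrableS (continuous_integrable_cc (ic n)) => //; apply: subset_itvr; rewrite bnd_simp.
have FE n : \int[mu]_(t in `]0, T]) F n t = 2 * Num.sqrt T - 2 * Num.sqrt (e n).
  rewrite /F -Rintegral_mkcondr (_ : _ `&` _ = `]e n, T]%classic); last first.
    by apply: setIidr; apply: subset_itvr; rewrite bnd_simp ltW.
  rewrite Rintegral_itv_obnd_cbnd//.
  have [->|eT'] := eqVneq (e n) T; first by rewrite set_itv1 Rintegral_set1 subrr.
  have {}eT' : e n < T by rewrite lt_neqAle eT' eT.
  rewrite /Rintegral (@continuous_FTC2 _ _ (fun t => 2 * Num.sqrt t) (e n) T) //.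
  - split.
    + by move=> t; rewrite in_itv/= => /andP[et _]; apply: isd_derivable (isdZ 2 (is_derive1_sqrt _)); exact: lt_trans et.
    + by apply: cvg_at_right_filter; apply: cvgM; [exact: cvg_cst|exact: sc].
    + by apply: cvg_at_left_filter; apply: cvgM; [exact: cvg_cst|exact: sc].
  - move=> t; rewrite in_itv/= => /andP[et _].
    have t0 : 0 < t by exact: lt_trans et.
    rewrite (isd_derive1 (isdZ 2 (is_derive1_sqrt t0))).
    by field; rewrite gt_eqF// sqrtr_gt0.
have mF : measurable `]0, T]%classic by [].
apply: (proj1 (@mu_mct R `]0, T] F _ (2 * Num.sqrt T) _ _ _ _ _ _)) => //.
- by move=> n; apply: (@integrableS _ _ _ _ setT) => //; apply: integrable_restrictT.
- by move=> n t _; rewrite /F patchE; case: ifP => // _; rewrite invr_ge0 sqrtr_ge0.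
- move=> t n m _ nm; rewrite /F !patchE; case: ifPn => [/set_mem/=|_]; last by case: ifP => // _; rewrite invr_ge0 sqrtr_ge0.
  rewrite in_itv/= => /andP[et tT]; rewrite mem_set//= in_itv/= tT andbT.
  by apply: le_lt_trans et; rewrite ler_wpM2l ?(ltW T0)// lef_pV2 ?posrE// ler_nat.
- move=> t /=; rewrite in_itv/= => /andP[t0 tT]; apply: cvg_near_cst.
  have : e n @[n --> \oo] --> (0 : R).
    by rewrite -(mulr0 T); apply: cvgM; [exact: cvg_cst|exact: cvg_harmonic].
  move=> /cvgr_lt /(_ _ t0); apply: filterS => n et.
  by rewrite /F patchE mem_set//= in_itv/= et.
- under eq_cvg do rewrite FE.
  suff : 2 * Num.sqrt T - 2 * Num.sqrt (e n) @[n --> \oo] --> 2 * Num.sqrt T - 2 * Num.sqrt 0.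
    by rewrite sqrtr0 mulr0 subr0.
  apply: cvgB; first exact: cvg_cst.
  apply: cvgM; first exact: cvg_cst.
  apply: continuous_cvg; first exact: sc.
  by rewrite -(mulr0 T); apply: cvgM; [exact: cvg_cst|exact: cvg_harmonic].
Qed.

End scaling.

(** * Measurability in the plane *)

Section plane.
Context {R : realType}.

(** An open set is a countable union of rectangles with rational corners, hence belongs to the
    product sigma-algebra. *)
Lemma open_plane_measurable (U : set (R * R)) : open U -> measurable U.
Proof.
move=> oU.
pose B (i : (rat * rat) * (rat * rat)) : set (R * R) :=
  `]ratr i.1.1, ratr i.1.2[ `*` `]ratr i.2.1, ratr i.2.2[.
rewrite (_ : U = \bigcup_(i in [set i | B i `<=` U]) B i); last first.
  apply/seteqP; split => [[x t] Uxt|p [i /= + Bp]]; last exact.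
  have : nbhs (x, t) U by exact: open_nbhs_nbhs.
  case=> -[V W] /= [/nbhs_ballP[e1 /= e10 V1] /nbhs_ballP[e2 /= e20 W1]] VW.
  have [q1] := @rat_in_itvoo R (x - e1) x ltac:(lra); rewrite in_itv/= => /andP[q11 q12].
  have [q2] := @rat_in_itvoo R x (x + e1) ltac:(lra); rewrite in_itv/= => /andP[q21 q22].
  have [q3] := @rat_in_itvoo R (t - e2) t ltac:(lra); rewrite in_itv/= => /andP[q31 q32].
  have [q4] := @rat_in_itvoo R t (t + e2) ltac:(lra); rewrite in_itv/= => /andP[q41 q42].
  exists ((q1, q2), (q3, q4)) => /=; last by split; rewrite /= in_itv/= ?q12 ?q32.
  move=> [y s] [/=]; rewrite !in_itv/= => /andP[y1 y2] /andP[s1 s2].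
  apply: VW; split => /=; [apply: V1|apply: W1]; rewrite /ball/= ltr_distlC; lra.
rewrite bigcup_mkcond; apply: countable_bigcupT_measurable; first exact: countableP.
by move=> i; case: ifP => // _; apply: measurableX.
Qed.

Lemma continuous_plane_measurable (U : set (R * R)) (g : R * R -> R) : open U ->
  (forall p, U p -> {for p, continuous g}) -> measurable_fun U g.
Proof.
move=> oU gc; apply: (measurability _ (RGenOInfty.measurableE R)) => //.
move=> _ [_ [c ->] <-]; apply: open_plane_measurable.
rewrite openE => p [Up] /=; rewrite in_itv/= andbT => cg.
have : \near p, U p by exact: open_nbhs_nbhs.
have : \forall q \near p, c < g q by apply: (cvgr_gt _ (gc p Up) _ cg).
by apply: filterS2 => q cq Uq; split => //=; rewrite in_itv/= andbT.
Qed.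

Lemma open_strip (T : R) : open (strip T).
Proof.
rewrite openE => -[x t] [/= x0 /andP[t0 tT]].
exists (`]0, +oo[%classic, `]0, T[%classic) => /=.
  split; apply: open_nbhs_nbhs; split => //=; rewrite in_itv/= ?x0 ?t0//.
by move=> [y s] [/=]; rewrite !in_itv/= andbT => y0 s0.
Qed.

Lemma measurable_strip (T : R) : measurable (strip T).
Proof. by apply: open_plane_measurable; exact: open_strip. Qed.

End plane.

(** * The self-similar solution *)

(** The integral of a nonnegative function is a supremum over simple functions below it, so
    monotonicity needs no measurability. This matters because [t |-> W12_norm (slice u t)] is not
    known to be measurable. *)
Lemma ge0_le_integral_nomeas {R : realType} (D : set R) (f1 f2 : R -> \bar R) :
  (forall x, D x -> (0 <= f1 x)%E) -> (forall x, D x -> (f1 x <= f2 x)%E) ->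
  (\int[@lebesgue_measure R]_(x in D) f1 x <= \int[@lebesgue_measure R]_(x in D) f2 x)%E.
Proof.
move=> f10 f12; have f20 x : D x -> (0 <= f2 x)%E by move=> Dx; exact: le_trans (f10 _ Dx) (f12 _ Dx).
rewrite !ge0_integralE//; apply: ereal_sup_le => _ [h hf <-]; exists h => // x.
apply: le_trans (hf x) _; rewrite !patchE; case: ifPn => // /set_mem; exact: f12.
Qed.

Section existence.
Context {R : realType}.
Local Notation mu := (@lebesgue_measure R).
Implicit Types (s x y z t : R).
Variables (T a b C : R) (D k what f Q : R -> R).
Hypotheses (T0 : 0 < T) (Dd : forall s, is_derive s 1 D (2 * k s)) (kc : continuous k)
  (DA : {homo D : x y / x <= y}) (fab : forall y, a <= f y <= b) (fA : forall y z, y <= z -> f z <= f y)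
  (QC : forall y, 0 <= Q y <= C) (QA : forall y z, y <= z -> Q z <= Q y)
  (Qr : forall (y_ : nat -> R) y, (forall n, y <= y_ n) ->
      y_ n @[n --> \oo] --> y -> Q (y_ n) @[n --> \oo] --> Q y)
  (DQ : forall y, 0 <= y -> D (f y) = D b - prim Q y)
  (D2i : mu.-integrable halfline (EFin \o (fun y => (D (f y) - D a) ^+ 2)))
  (Q2i : mu.-integrable halfline (EFin \o (fun y => Q y ^+ 2)))
  (what_smooth : smooth_halfline what) (what0 : what 0 = b)
  (what_far : forall x, 1 < x -> what x = a).

Let mf : measurable_fun setT f. Proof. exact: nonincreasing_measurable. Qed.
Let mQ : measurable_fun setT Q. Proof. exact: nonincreasing_measurable. Qed.
Let Dc : continuous D. Proof. by move=> x; exact: isd_cont (Dd x). Qed.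
Let mD : measurable_fun setT D. Proof. exact: continuous_measurable_fun. Qed.
Let mH := @measurable_halfline R.

Definition selfsim (p : R * R) : R := f (p.1 / Num.sqrt p.2).
(** The candidate for [D(w)_x]; the minus sign is there because [Q] stands for minus the derivative
    of [D o f]. *)
Definition selfsim_flux (p : R * R) : R := - ((Num.sqrt p.2)^-1 * Q (p.1 / Num.sqrt p.2)).
Local Notation w := selfsim.
Local Notation g := selfsim_flux.

Let omega x := D (what x).
Let domega x := 2 * k (what x) * derive1 what x.

Let what_derive x : 0 < x -> is_derive x 1 what (derive1 what x).
Proof.
move=> x0; have [/(_ 0%N x x0) wd _ _] := what_smooth.
by rewrite derive1E; apply: DeriveDef.
Qed.

Let omega_derive x : 0 < x -> is_derive x 1 omega (domega x).
Proof. by move=> x0; exact: isd_comp (Dd _) (what_derive x0). Qed.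

Let dwhat_cont x : 0 < x -> {for x, continuous (derive1 what)}.
Proof.
move=> x0; have [/(_ 1%N x x0) wd _ _] := what_smooth.
by apply: differentiable_continuous; apply/derivable1_diffP.
Qed.

Let domega_cont x : 0 < x -> {for x, continuous domega}.
Proof.
move=> x0; have wc : {for x, continuous what} := isd_cont (what_derive x0).
apply: cvgM; last exact: dwhat_cont.
apply: cvgM; first exact: cvg_cst.
by apply: continuous_cvg => //; exact: kc.
Qed.

Let what_cvg0 : what x @[x --> 0^'+] --> b.
Proof. by have [_ _] := what_smooth; rewrite what0. Qed.

Let domega0 : exists l : R, domega x @[x --> 0^'+] --> l.
Proof.
have [_ /(_ 1%N)[l wl] _] := what_smooth.
exists (2 * k b * l); apply: cvgM wl.
apply: cvgM; first exact: cvg_cst.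
by apply: continuous_cvg what_cvg0; exact: kc.
Qed.

Let domega_far x : 1 < x -> domega x = 0.
Proof.
move=> x1; suff H : is_derive x 1 what 0 by rewrite /domega (isd_derive1 H) mulr0.
apply: near_eq_is_derive (isd_cst x a).
by near=> y; rewrite what_far//; near: y; exact: lt_nbhsr.
Unshelve. all: by end_near. Qed.

(** [what] is smooth on the open half-line, with one-sided limits of its derivatives at [0]. Giving
    [domega] its limit as value at [0] makes the fundamental theorem of calculus applicable on
    [[0, J]]. *)
Let domega_ext J : 0 < J -> exists2 e : R -> R, {within `[0, J], continuous e} & forall x, 0 < x -> e x = domega x.
Proof.
move=> J0; have [l dl] := domega0; exists (fun x => if x <= 0 then l else domega x) => [|x x0]; last by rewrite leNgt x0.
apply/continuous_within_itvP => //; split.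
- move=> x; rewrite in_itv/= => /andP[x0 _].
  rewrite /prop_for/continuous_at leNgt x0/=.
  apply: cvg_trans (domega_cont x0); apply: near_eq_cvg; near=> y.
  by rewrite leNgt (_ : 0 < y)//; near: y; exact: lt_nbhsr.
- rewrite lexx; apply: cvg_trans dl; apply: near_eq_cvg; near=> y.
  by rewrite leNgt (_ : 0 < y).
- rewrite leNgt J0/=; apply: cvg_trans (cvg_at_left_filter (domega_cont J0)); apply: near_eq_cvg; near=> y.
  by rewrite leNgt (_ : 0 < y)//; near: y; exact: nbhs_left_gt.
Unshelve. all: by end_near. Qed.

Let domega_bound : exists M, forall x, 0 < x -> `|domega x| <= M.
Proof.
have [e ec eE] := @domega_ext 2 ltac:(by []); have [M M0 eM] := continuous_bounded_cc ec.
exists M => x x0; have [x2|x2] := leP x 2; first by rewrite -eE// eM// (ltW x0).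
by rewrite domega_far ?normr0//; lra.
Qed.

Let mdomega : measurable_fun halfline domega.
Proof.
apply: open_continuous_measurable_fun; first exact: open_halfline.
by move=> x /set_mem x0; exact: domega_cont.
Qed.

Let domega_int J : mu.-integrable `[0, J] (EFin \o domega).
Proof.
have [M dM] := domega_bound; apply: integrable_oc_cc.
apply: (@integrable_bnd _ _ R mu _ _ M) => //; first exact: lebesgue_oc_lty.
  by apply: measurable_funS mdomega => // x /=; rewrite in_itv/= => /andP[].
by move=> x /=; rewrite in_itv/= => /andP[x0 _]; exact: dM.
Qed.

Let omega0 : omega 0 = D b. Proof. by rewrite /omega what0. Qed.

Let omega_prim x : 0 < x -> omega x = D b + prim domega x.
Proof.
move=> x0; have [e ec eE] := domega_ext x0.
rewrite (prim_eq (g := e)); first last.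
- exact: continuous_integrable_cc.
- exact: domega_int.
- by move=> y y0 _; rewrite eE.
rewrite /prim /Rintegral (@continuous_FTC2 _ _ omega 0 x) //.
- by rewrite -EFinB/= omega0; lra.
- split.
  + by move=> y; rewrite in_itv/= => /andP[y0 _]; exact: isd_derivable (omega_derive y0).
  + by rewrite omega0; apply: continuous_cvg what_cvg0; exact: Dc.
  + by apply: cvg_at_left_filter; exact: isd_cont (omega_derive x0).
- by move=> y; rewrite in_itv/= => /andP[y0 _]; rewrite (isd_derive1 (omega_derive y0)) eE.
Qed.

Let L2_omega : L2_halfline (fun x => omega x - D a).
Proof.
have oc : {within `[0, 1], continuous omega}.
  apply/continuous_within_itvP => //; split.
  + by move=> y; rewrite in_itv/= => /andP[y0 _]; exact: isd_cont (omega_derive y0).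
  + by rewrite omega0; apply: continuous_cvg what_cvg0; exact: Dc.
  + by apply: cvg_at_left_filter; exact: isd_cont (omega_derive ltr01).
have [M M0 oM] := continuous_bounded_cc oc.
apply: (@L2_halfline_bounded _ _ 1 (M + `|D a|)).
- apply: measurable_funB => //; apply: open_continuous_measurable_fun; first exact: open_halfline.
  by move=> x /set_mem x0; exact: isd_cont (omega_derive x0).
- by move=> x _ x1; rewrite /omega what_far// subrr.
- move=> x x0; have [x1|x1] := leP x 1.
    by rewrite (le_trans (ler_normB _ _))// lerD2r oM// (ltW x0).
  by rewrite /omega what_far// subrr normr0 addr_ge0.
Qed.

Let L2_domega : L2_halfline domega.
Proof.
have [M dM] := domega_bound.
by apply: (@L2_halfline_bounded _ _ 1 M) => // x _; exact: domega_far.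
Qed.

Lemma bounded_weak_derivative_datum : exists2 m : R -> R,
  weak_derivative (fun x => D (what x)) m & exists M, forall x, 0 < x -> `|m x| <= M.
Proof. by exists domega; [exact: weak_derivative_prim omega_prim|exact: domega_bound]. Qed.

Let Q_int c J : mu.-integrable `[0, J] (EFin \o (fun y => Q (c * y))).
Proof.
apply: (@integrable_bnd _ _ R mu _ _ C) => //; first exact: lebesgue_itv_lty.
  by apply: measurable_funTS; apply: measurableT_comp => //; exact: measurable_funM.
by move=> x _; have /andP[Q0 Q1] := QC (c * x); rewrite ger0_norm.
Qed.

Let halfline_restrict (h : R -> R) x : mu.-integrable `[0, x] (EFin \o h) ->
  \int[mu]_(y in halfline) (h \_ `]0, x]) y = prim h x.
Proof.
move=> hi; rewrite -Rintegral_mkcondr (_ : _ `&` _ = `]0, x]%classic); last first.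
  by apply: setIidr => y /=; rewrite in_itv/= => /andP[].
rewrite Rintegral_itv_obnd_cbnd//.
by apply: integrableS hi => //; apply: subset_itvr; rewrite bnd_simp.
Qed.

Lemma prim_scale c x : 0 < c -> 0 < x -> prim Q (c * x) = c * prim (fun y => Q (c * y)) x.
Proof.
move=> c0 x0; have i1 (z : R) : mu.-integrable `[0, z] (EFin \o Q).
  apply: (@integrable_bnd _ _ R mu _ _ C) => //; first exact: lebesgue_itv_lty.
    exact: measurable_funTS.
  by move=> y _; have /andP[Q0 Q1] := QC y; rewrite ger0_norm.
have i2 : mu.-integrable `]0, c * x] (EFin \o Q).
  by apply: integrableS (i1 (c * x)) => //; apply: subset_itvr; rewrite bnd_simp.
have [|||_ E] := @halfline_scale _ (Q \_ `]0, c * x]) c c0.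
- by apply/(measurable_restrictT _ (measurable_itv _)); exact: measurable_funTS.
- by move=> y; rewrite patchE; case: ifP => // _; have /andP[] := QC y.
- by apply: (@integrableS _ _ _ _ setT) => //; exact: integrable_restrictT.
rewrite -(halfline_restrict (i1 _)) -(halfline_restrict (Q_int _ _)).
rewrite (_ : (fun y => Q (c * y)) \_ _ = fun y => (Q \_ `]0, c * x]) (c * y)); last first.
  apply/funext => y; rewrite !patchE; congr (if _ then _ else _).
  by apply/idP/idP; rewrite !inE/= !in_itv/= pmulr_rgt0// ler_pM2l.
by rewrite E mulVKf// gt_eqF.
Qed.

Section fixed_time.
Variable t : R.
Hypothesis t0 : 0 < t.
Let s0 : 0 < Num.sqrt t. Proof. by rewrite sqrtr_gt0. Qed.
Let c := (Num.sqrt t)^-1.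
Let c0 : 0 < c. Proof. by rewrite invr_gt0. Qed.

Let gE x : slice g t x = - c * Q (c * x).
Proof. by rewrite /slice/selfsim_flux/= (mulrC x) mulNr. Qed.

Let wE x : slice w t x = f (c * x).
Proof. by rewrite /slice/selfsim/= (mulrC x). Qed.

Lemma selfsim_prim x : 0 < x -> D (w (x, t)) = D b + prim (slice g t) x.
Proof.
move=> x0; rewrite -[w (x, t)]/(slice w t x) wE DQ ?mulr_ge0 ?ltW// prim_scale//.
congr (_ + _); rewrite (_ : slice g t = fun x => - c * Q (c * x)); last by apply/funext => y; exact: gE.
by rewrite /prim RintegralZl ?mulNr//; exact: Q_int.
Qed.

Lemma measurable_slice_flux : measurable_fun setT (slice g t).
Proof.
rewrite (_ : slice g t = fun x => - c * Q (c * x)); last by apply/funext => x; exact: gE.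
by apply: measurable_funM => //; apply: measurableT_comp => //; exact: measurable_funM.
Qed.

Lemma slice_flux_bound x : `|slice g t x| <= c * C.
Proof.
rewrite gE normrM normrN (gtr0_norm c0) ler_wpM2l ?(ltW c0)//.
by have /andP[Q0 Q1] := QC (c * x); rewrite ger0_norm.
Qed.

Lemma slice_flux_int J : mu.-integrable `[0, J] (EFin \o slice g t).
Proof.
apply: (@integrable_bnd _ _ R mu _ _ (c * C)) => //; first exact: lebesgue_itv_lty.
  by apply: measurable_funTS; exact: measurable_slice_flux.
by move=> x _; exact: slice_flux_bound.
Qed.

Lemma weak_dx_slice : weak_derivative (slice (D \o w) t) (slice g t).
Proof.
apply: (@weak_derivative_prim _ _ _ (D b)).
- by apply: measurable_funTS; exact: measurable_slice_flux.
- exact: slice_flux_int.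
- by move=> x x0; rewrite /slice/= selfsim_prim.
Qed.

Lemma L2_slice : L2_halfline (fun x => D (w (x, t)) - D a) /\
  \int[mu]_(x in halfline) (D (w (x, t)) - D a) ^+ 2 =
    Num.sqrt t * \int[mu]_(y in halfline) (D (f y) - D a) ^+ 2.
Proof.
have mDf : measurable_fun setT (fun y => D (f y) - D a).
  by apply: measurable_funB => //; exact: measurableT_comp.
have [|||i E] := @halfline_scale _ (fun y => (D (f y) - D a) ^+ 2) c c0 => //.
- exact: measurable_funX.
- by move=> y; exact: sqr_ge0.
rewrite (_ : (fun x => D (w (x, t)) - D a) = (fun x => D (f (c * x)) - D a)); last first.
  by apply/funext => x; rewrite -wE.
split.
  apply/L2_halflineP; split => //; apply: measurable_funTS.
  by apply: (measurableT_comp mDf); exact: measurable_funM.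
rewrite -[Num.sqrt t]invrK -E; apply: eq_Rintegral => x _.
by rewrite -[w (x, t)]/(slice w t x) wE.
Qed.

(** The square of the flux contributes [1 / t] and the substitution [sqrt t]; the resulting power
    [1 / sqrt t] is integrable in time. *)
Lemma L2_slice_flux : L2_halfline (slice g t) /\
  \int[mu]_(x in halfline) (slice g t x) ^+ 2 = c * \int[mu]_(y in halfline) Q y ^+ 2.
Proof.
have [|||i E] := @halfline_scale _ (fun y => Q y ^+ 2) c c0 => //.
- exact: measurable_funX.
- by move=> y; exact: sqr_ge0.
have gE2 x : slice g t x ^+ 2 = c ^+ 2 * Q (c * x) ^+ 2 by rewrite gE mulNr sqrrN exprMn.
split.
  apply/L2_halflineP; split; first by apply: measurable_funTS; exact: measurable_slice_flux.
  rewrite (_ : (fun x => _) = (fun x => c ^+ 2 * Q (c * x) ^+ 2)); last by apply/funext.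
  exact: mu_integrable_scale.
under eq_Rintegral do rewrite gE2.
rewrite RintegralZl// E mulrA; congr (_ * _).
by rewrite expr2 -mulrA mulfV ?mulr1// gt_eqF.
Qed.

(** [D(w)] and [D(what)] both start from [D b] at the boundary, so their difference is the primitive
    of a bounded square integrable function and [W12_0_of_prim] applies. *)
Lemma W12_0_slice : let h x := D (w (x, t)) - D (what x) in
  [/\ W12_0 h, weak_derivative h (fun x => slice g t x - domega x) & L2_halfline h].
Proof.
move=> h; have hE x : 0 < x -> h x = prim (fun x => slice g t x - domega x) x.
  move=> x0; rewrite /h selfsim_prim// -[D (what x)]/(omega x) (omega_prim x0) primB//; last exact: slice_flux_int.
  lra.
have mg' : measurable_fun halfline (fun x => slice g t x - domega x).
  by apply: measurable_funB => //; apply: measurable_funTS; exact: measurable_slice_flux.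
have Lh : L2_halfline h.
  have := L2_halflineB L2_slice.1 L2_omega; congr L2_halfline.
  by apply/funext => x; rewrite /h /omega; lra.
have Lg : L2_halfline (fun x => slice g t x - domega x) := L2_halflineB L2_slice_flux.1 L2_domega.
have [M dM] := domega_bound; split => //.
- apply: (W12_0_of_prim mg' (C := c * C + M)) => //.
  by move=> x x0; rewrite (le_trans (ler_normB _ _))// lerD ?slice_flux_bound ?dM.
- apply: (@weak_derivative_prim _ _ _ 0) => //; last by move=> x x0; rewrite hE// add0r.
  move=> J; apply: integrable_sub => //; exact: slice_flux_int.
Qed.

End fixed_time.


Let u t x := D (w (x, t)) - D (what x).

(** Keeps the sampled times in [[t / 4, t]], replacing the others by [t]. Times [s <= t] make
    [x / sqrt s] approach [x / sqrt t] from above, the side on which [Q] is continuous; [s >= t / 4]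
    gives [1 / sqrt s <= 2 / sqrt t], hence a common dominating function. *)
Let sample (t tau : R) : R := if (t / 4 <= tau) && (tau <= t) then tau else t.

(** Continuity of the slices from the left in time, by dominated convergence. In absolute value the
    flux at a sampled time is at most twice the flux at [t] and of the same sign, whence the factor
    [4] in the dominating function. *)
Let W12_norm_sample t (tau : nat -> R) : 0 < t -> tau n @[n --> \oo] --> t ->
  W12_norm (fun x => u t x - u (sample t (tau n)) x) @[n --> \oo] --> (0 : R).
Proof.
move=> t0 taut; pose s n := sample t (tau n).
have sE n : t / 4 <= s n /\ s n <= t.
  by rewrite /s /sample; case: ifP => [/andP[]//|_]; split; lra.
have sp n : 0 < s n by have [s1 _] := sE n; lra.
have s_cvg : s n @[n --> \oo] --> t.
  apply/cvgrPdist_le => e e0; move/cvgrPdist_le: taut => /(_ _ e0); apply: filterS => n te.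
  by rewrite /s /sample; case: ifP => // _; rewrite subrr normr0 ltW.
pose c := (Num.sqrt t)^-1; pose d n := (Num.sqrt (s n))^-1.
have c0 : 0 < c by rewrite invr_gt0 sqrtr_gt0.
have cd n : c <= d n by rewrite lef_pV2 ?posrE ?sqrtr_gt0// ler_wsqrtr// (sE n).2.
have dc n : d n <= 2 * c.
  rewrite -[2]invrK -invfM lef_pV2 ?posrE ?mulr_gt0 ?sqrtr_gt0 ?invr_gt0//.
  rewrite -[leLHS]ger0_norm ?mulr_ge0 ?sqrtr_ge0// -sqrtr_sqr ler_wsqrtr// exprMn sqr_sqrtr ?(ltW t0)//.
  by have [] := sE n; rewrite expr2; lra.
have d_cvg : d n @[n --> \oo] --> c.
  apply: cvgV; first by rewrite gt_eqF ?sqrtr_gt0.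
  by apply: continuous_cvg s_cvg; exact: sqrt_continuous.
pose F n x := (D (w (x, t)) - D (w (x, s n))) ^+ 2 + (slice g t x - slice g (s n) x) ^+ 2.
have NE n : W12_norm (fun x => u t x - u (s n) x) = Num.sqrt (\int[mu]_(x in halfline) F n x).
  have [_ w1 _] := W12_0_slice t0; have [_ w2 _] := W12_0_slice (sp n).
  rewrite (W12_norm_eq (weak_derivativeB w1 w2)); congr (Num.sqrt _).
  by apply: eq_Rintegral => x _; rewrite /F /u; congr (_ ^+ 2 + _ ^+ 2); lra.
under eq_cvg do rewrite NE.
suff : Num.sqrt (\int[mu]_(x in halfline) F n x) @[n --> \oo] --> Num.sqrt 0 by rewrite sqrtr0.
apply: continuous_cvg; first exact: sqrt_continuous.
have [/L2_halflineP[m1 i1] _] := L2_slice t0; have [/L2_halflineP[m2 i2] _] := L2_slice_flux t0.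
have mw tt : 0 < tt -> measurable_fun halfline (fun x => D (w (x, tt))).
  move=> tt0; have [/L2_halflineP[m _] _] := L2_slice tt0.
  rewrite (_ : (fun _ => _) = (fun x => (D (w (x, tt)) - D a) + D a)); last by apply/funext => x; rewrite subrK.
  by apply: measurable_funD.
have -> : 0 = \int[mu]_(x in halfline) (0 : R) by rewrite Rintegral_0.
apply: (@mu_dct _ _ _ _ (fun x => (D (w (x, t)) - D a) ^+ 2 + 4 * slice g t x ^+ 2)) => //.
- move=> n; apply: measurable_funD; apply: measurable_funX; apply: measurable_funB.
  + exact: mw.
  + exact: mw.
  + by apply: measurable_funTS; exact: measurable_slice_flux.
  + by apply: measurable_funTS; exact: measurable_slice_flux.
- by apply: integrable_add => //; exact: mu_integrable_scale.
- apply: aeW => x x0; have cx0 : 0 < c * x by rewrite mulr_gt0.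
  have dx_cvg : d n * x @[n --> \oo] --> c * x by apply: cvgM => //; exact: cvg_cst.
  have cv1 : D (w (x, s n)) @[n --> \oo] --> D (w (x, t)).
    have dE n : 0 <= d n * x by rewrite mulr_ge0 ?(ltW x0)// (le_trans (ltW c0) (cd n)).
    have E1 n : D (w (x, s n)) = D b - prim Q (d n * x) by rewrite -DQ// mulrC.
    have E2 : D (w (x, t)) = D b - prim Q (c * x) by rewrite -DQ ?(ltW cx0)// mulrC.
    rewrite E2; under eq_cvg do rewrite E1; apply: cvgB; first exact: cvg_cst.
    apply: continuous_cvg dx_cvg; apply: prim_continuous_at => // J.
    by have := Q_int 1 J; congr (mu.-integrable _ (EFin \o _)); apply/funext => y; rewrite mul1r.
  have cv2 : slice g (s n) x @[n --> \oo] --> slice g t x.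
    rewrite /slice/selfsim_flux/= !(mulrC x); apply: cvgN; apply: cvgM => //.
    have E n : Q (x * d n) = Q (d n * x) by rewrite mulrC.
    under eq_cvg do rewrite E.
    by apply: Qr => // n; rewrite ler_wpM2r ?cd// ltW.
  have H : F n x @[n --> \oo] --> (D (w (x, t)) - D (w (x, t))) * (D (w (x, t)) - D (w (x, t))) + (slice g t x - slice g t x) * (slice g t x - slice g t x).
    apply: cvgD.
      by under eq_cvg do rewrite expr2; apply: cvgM; (apply: cvgB => //; exact: cvg_cst).
    by under eq_cvg do rewrite expr2; apply: cvgM; (apply: cvgB => //; exact: cvg_cst).
  by rewrite !subrr mulr0 addr0 in H.
- move=> n x x0; rewrite /F ger0_norm; last by rewrite addr_ge0 ?sqr_ge0.
  have cdx : c * x <= d n * x by rewrite ler_wpM2r ?cd// ltW.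
  apply: lerD.
    have D1 : D a <= D (w (x, s n)) by apply: DA; have /andP[] := fab (x / Num.sqrt (s n)).
    have D2 : D (w (x, s n)) <= D (w (x, t)) by apply: DA; apply: fA; rewrite /= mulrC (mulrC x).
    by rewrite ler_sqr ?nnegrE; lra.
  have E tt : slice g tt x = - ((Num.sqrt tt)^-1 * Q ((Num.sqrt tt)^-1 * x)) by rewrite /slice/selfsim_flux/= (mulrC x).
  rewrite !E; have /andP[Q1 _] := QC (c * x); have /andP[Q2 _] := QC (d n * x).
  have Q3 := QA cdx; have d0 : 0 < d n by exact: lt_le_trans (cd n).
  rewrite -/c -/(d n) -[leRHS]/(4 * _) (_ : 4 = 2 ^+ 2) -?exprMn; last by ring.
  have P1 : 0 <= c * Q (c * x) by rewrite mulr_ge0// ltW.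
  have P2 : 0 <= d n * Q (d n * x) by rewrite mulr_ge0// ltW.
  have P3 : d n * Q (d n * x) <= 2 * (c * Q (c * x)).
    by rewrite mulrA; apply: ler_pM => //; exact: ltW.
  rewrite -subr_ge0; set p1 := c * _; set p2 := d n * _.
  rewrite (_ : _ - _ = (3 * p1 - p2) * (p1 + p2)); last by ring.
  by apply: mulr_ge0; rewrite /p1 /p2; lra.
Qed.

(** The first cell would be sampled at time [0], where no slice is available; [T] stands in for it.
    A given [t > 0] belongs to that cell for finitely many [n] only. *)
Let node (n i : nat) : R := if (i == 0)%N then T else i%:R * T / n.+1%:R.
Let cell (n i : nat) : set R := `[i%:R * T / n.+1%:R, i.+1%:R * T / n.+1%:R[%classic.
Let approx n t x := \sum_(i < n.+1) \1_(cell n i) t * u (node n i) x.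

Let node_gt0 n i : 0 < node n i.
Proof. by rewrite /node; case: eqP => // /eqP i0; rewrite divr_gt0// mulr_gt0// ltr0n lt0n. Qed.

Let approx_eq n t x : 0 < t < T -> approx n t x = u (node n (Num.truncn (n.+1%:R * t / T))) x.
Proof.
move=> /andP[t0 tT]; set m := Num.truncn _.
have z0 : 0 <= n.+1%:R * t / T by rewrite divr_ge0 ?mulr_ge0 ?ltW.
have /andP[m1 m2] := truncn_itv z0; rewrite -/m in m1 m2.
have mn : (m < n.+1)%N.
  rewrite -(ltr_nat R); apply: le_lt_trans m1 _.
  by rewrite ltr_pdivrMr// ltr_pM2l.
have cE i : (t \in cell n i) = (i == m).
  rewrite /cell; apply/idP/eqP => [/set_mem/=|->]; last first.
    by rewrite mem_set//= in_itv/= ler_pdivrMr// ltr_pdivlMr//; move: m1 m2; rewrite ler_pdivlMr// ltr_pdivrMr// !(mulrC t) => -> ->.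
  rewrite in_itv/= ler_pdivrMr// ltr_pdivlMr// !(mulrC t) => /andP[i1 i2].
  apply/eqP; rewrite eqn_leq; apply/andP; split; rewrite -ltnS -(ltr_nat R).
    by apply: le_lt_trans m2; rewrite ler_pdivlMr.
  by apply: le_lt_trans m1 _; rewrite ltr_pdivrMr.
rewrite /approx (bigD1 (Ordinal mn))//= indicE cE eqxx mul1r big1 ?addr0// => i im.
by rewrite indicE cE (negbTE (_ : nat_of_ord i != m)) ?mul0r//; apply: contra im => /eqP im; apply/eqP/val_inj.
Qed.

(** Strong measurability: sampling at the left ends of [n + 1] cells converges at every [t] by
    [W12_norm_sample]. Integrability: the squared norms are bounded by a constant plus a multiple of
    [1 / sqrt t]. *)
Lemma selfsim_bochner : L2_W12_0 T (fun p => D (w p) - D (what p.1)).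
Proof.
split.
- by apply: aeW => t /andP[t0 _]; have [] := W12_0_slice t0.
- exists approx; split.
    move=> n; exists n.+1, (fun i => cell n i), (fun i => u (node n i)); split => //.
      by move=> i; exact: measurable_itv.
    by move=> i; have [] := W12_0_slice (node_gt0 n i).
  apply: aeW => t tT; have /andP[t0 tT'] := tT.
  pose tau n := node n (Num.truncn (n.+1%:R * t / T)).
  have h0 : T / n.+1%:R @[n --> \oo] --> (0 : R).
    by rewrite -(mulr0 T); apply: cvgM; [exact: cvg_cst|exact: cvg_harmonic].
  have tau_near : \forall n \near \oo, `|t - tau n| <= T / n.+1%:R /\ tau n <= t.
    have : \forall n \near \oo, T / n.+1%:R < t by exact: (cvgr_lt _ h0 _ t0).
    apply: filterS => n nt.
    have z0 : 0 <= n.+1%:R * t / T by rewrite divr_ge0 ?mulr_ge0 ?ltW.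
    have z1 : 1 <= n.+1%:R * t / T.
      by rewrite ler_pdivlMr// mul1r mulrC -ler_pdivrMr// ltW.
    have := truncn_itv z0; rewrite /tau; set m := Num.truncn _ => /andP[m1 m2].
    have m0 : (m == 0)%N = false.
      by apply/negP => /eqP E; move: m2; rewrite E ltNge z1.
    rewrite /node m0; move: m1 m2; rewrite ler_pdivlMr// ltr_pdivrMr// => m1 m2.
    have a1 : m%:R * T / n.+1%:R <= t by rewrite ler_pdivrMr// [leRHS]mulrC.
    split => //; rewrite ger0_norm ?subr_ge0// lerBlDr -mulrDl ler_pdivlMr// mulrC.
    by apply: ltW; apply: lt_le_trans m2 _; rewrite -natr1; lra.
  have tau_cvg : tau n @[n --> \oo] --> t.
    apply/cvgrPdist_le => e e0.
    have he : \forall n \near \oo, T / n.+1%:R < e by exact: (cvgr_lt _ h0 _ e0).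
    by apply: filterS2 tau_near he => n [+ _] /ltW; exact: le_trans.
  apply: cvg_trans (W12_norm_sample t0 tau_cvg); apply: near_eq_cvg.
  near=> n; congr (W12_norm _); apply/funext => x /=.
  rewrite approx_eq// -/(tau n) /sample.
  have -> : tau n <= t by near: n; apply: filterS tau_near => n [].
  have -> : t / 4 <= tau n.
    by apply: ltW; near: n; apply: (cvgr_gt _ tau_cvg); lra.
  by [].
- pose A := \int[mu]_(y in halfline) (D (f y) - D a) ^+ 2; pose Q2 := \int[mu]_(y in halfline) Q y ^+ 2.
  pose B := \int[mu]_(y in halfline) (omega y - D a) ^+ 2; pose E := \int[mu]_(y in halfline) domega y ^+ 2.
  have A0 : 0 <= A by apply: Rintegral_ge0 => x _; exact: sqr_ge0.
  have Q20 : 0 <= Q2 by apply: Rintegral_ge0 => x _; exact: sqr_ge0.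
  pose K0 := 2 * Num.sqrt T * A + 2 * B + 2 * E.
  have bnd t : 0 < t < T -> W12_norm (slice (fun p => D (w p) - D (what p.1)) t) ^+ 2 <=
      K0 + 2 * Q2 * (Num.sqrt t)^-1.
    move=> /andP[t0 tT]; have [_ wd Lh] := W12_0_slice t0.
    have [L1 E1] := L2_slice t0; have [L2 E2] := L2_slice_flux t0.
    have /L2_halflineP[_ i0] := Lh; have /L2_halflineP[_ i0'] := L2_halflineB L2 L2_domega.
    have /L2_halflineP[_ i1] := L1; have /L2_halflineP[_ i2] := L2.
    have /L2_halflineP[_ i3] := L2_omega; have /L2_halflineP[_ i4] := L2_domega.
    rewrite (W12_norm_eq wd) sqr_sqrtr; last by apply: Rintegral_ge0 => x _; rewrite addr_ge0 ?sqr_ge0.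
    have I1 : mu.-integrable halfline (EFin \o (fun x => 2 * (D (w (x, t)) - D a) ^+ 2 + 2 * (omega x - D a) ^+ 2)).
      by apply: integrable_add => //; exact: mu_integrable_scale.
    have I2 : mu.-integrable halfline (EFin \o (fun x => 2 * slice g t x ^+ 2 + 2 * domega x ^+ 2)).
      by apply: integrable_add => //; exact: mu_integrable_scale.
    apply: (@le_trans _ _ (\int[mu]_(x in halfline) ((2 * (D (w (x, t)) - D a) ^+ 2 + 2 * (omega x - D a) ^+ 2) +
       (2 * slice g t x ^+ 2 + 2 * domega x ^+ 2)))).
      apply: le_Rintegral => //; [exact: integrable_add|exact: integrable_add|].
      move=> x _; apply: lerD; last by rewrite -subr_ge0 (_ : _ - _ = (slice g t x + domega x) ^+ 2) ?sqr_ge0//; ring.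
      rewrite /slice/= -[D (what x)]/(omega x) -subr_ge0.
      by rewrite (_ : _ - _ = (D (w (x, t)) + omega x - 2 * D a) ^+ 2) ?sqr_ge0//; ring.
    rewrite RintegralD// RintegralD ?RintegralD ?RintegralZl//; try exact: mu_integrable_scale.
    rewrite E1 E2 -/A -/Q2 -/B -/E.
    have st : Num.sqrt t <= Num.sqrt T by rewrite ler_wsqrtr// ltW.
    have : Num.sqrt t * A <= Num.sqrt T * A by rewrite ler_wpM2r.
    by rewrite /K0; nra.
  have iS : mu.-integrable `]0, T[ (EFin \o (fun t => K0 + 2 * Q2 * (Num.sqrt t)^-1)).
    apply: integrable_add => //.
      by apply: (@integrable_bnd _ _ R mu _ _ `|K0|) => //; rewrite /= lebesgue_measure_itv/=; case: ifP => // _; rewrite -EFinB ltry.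
    apply: mu_integrable_scale => //; apply: integrableS (integrable_inv_sqrt T0) => //.
    by apply: subset_itvl; rewrite bnd_simp.
  apply: (le_lt_trans (@ge0_le_integral_nomeas _ _ _ (fun t => (K0 + 2 * Q2 * (Num.sqrt t)^-1)%:E) _ _)).
  - by move=> t _; rewrite lee_fin sqr_ge0.
  - by move=> t; rewrite /= in_itv/= => tT; rewrite lee_fin bnd.
  - by rewrite -EFin_Rintegral// ltry.
Unshelve. all: by end_near.
Qed.

Lemma measurable_selfsim_var : measurable_fun (strip T) (fun p : R * R => p.1 / Num.sqrt p.2).
Proof.
apply: continuous_plane_measurable; first exact: open_strip.
move=> [x t] [/= x0 /andP[t0 _]]; apply: cvgM; first exact: cvg_fst.
apply: cvgV; first by rewrite gt_eqF ?sqrtr_gt0.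
by apply: continuous_cvg; [exact: sqrt_continuous|exact: cvg_snd].
Qed.

Lemma selfsim_weak_dx : weak_dx T (D \o w) g.
Proof.
split; last by apply: aeW => t /andP[t0 _]; exact: weak_dx_slice.
apply: measurableT_comp => //; apply: measurable_funM.
  apply: continuous_plane_measurable; first exact: open_strip.
  move=> [x t] [/= x0 /andP[t0 _]]; apply: cvgV; first by rewrite gt_eqF ?sqrtr_gt0.
  by apply: continuous_cvg; [exact: sqrt_continuous|exact: cvg_snd].
by apply: (measurableT_comp mQ); exact: measurable_selfsim_var.
Qed.

Lemma selfsim_Linfty : w \_ (strip T) \in Lfun (mu \x mu)%E +oo%E.
Proof.
rewrite inE; apply/andP; split; rewrite inE/=.
  apply/(measurable_restrictT _ (measurable_strip T)).
  by apply: (measurableT_comp mf); exact: measurable_selfsim_var.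
rewrite /finite_norm unlock; case: ifP => // _.
apply: (@le_lt_trans _ _ (`|a| + `|b|)%:E); last exact: ltry.
apply/ess_supP; apply: aeW => p /=; rewrite lee_fin patchE; case: ifP => _; last by rewrite normr0 addr_ge0.
by have /andP[wa wb] := fab (p.1 / Num.sqrt p.2); rewrite ler_norml; apply/andP; split; have := ler_norm a; have := ler_norm b; have := ler_norm (- a); have := ler_norm (- b); rewrite !normrN; have := normr_ge0 a; have := normr_ge0 b; rewrite /w; lra.
Qed.

End existence.

Section plane_measure.
Context {R : realType}.
Local Notation mu := (@lebesgue_measure R).

Lemma plane_sigma_finite : sigma_finite setT (mu \x mu)%E.
Proof.
have /sigma_finiteP[F [TF ndF Foo]] := @sigma_finiteT _ _ _ mu.
exists (fun n => F n `*` F n).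
  rewrite -setXTT {1}TF {1}TF predeqE => -[x y]; split.
    move=> [/= [n _ Fnx] [k _ Gky]]; exists (maxn n k) => //; split => /=.
    - by move: x Fnx; exact/subsetPset/ndF/leq_maxl.
    - by move: y Gky; exact/subsetPset/ndF/leq_maxr.
  by move=> [n _ []/= ? ?]; split; exists n.
move=> n; have [? ?] := Foo n.
split; first exact: measurableX.
by rewrite product_measure1E// lte_mul_pinfty// ge0_fin_numE.
Qed.

(** The product measure repackaged as a sigma-finite one, so that Fubini applies to pairs of a level
    [s] and a point of the plane. *)
Definition plane_measure : {sigma_finite_measure set (measurableTypeR R * measurableTypeR R)%type -> \bar R} :=
  HB.pack (mu \x mu)%E (Measure_isSigmaFinite.Build _ _ _ (mu \x mu)%E plane_sigma_finite).
End plane_measure.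

(** * The weak identity on parabolas *)

Section test_function.
Context {R : realType}.
Local Notation mu := (@lebesgue_measure R).
Implicit Types (x y s t c : R).

Lemma is_derive_slice_x (xi : R * R -> R) (p : R * R) (d : R) : is_derive p (1, 0) xi d ->
  is_derive p.1 1 (fun y => xi (y, p.2)) d.
Proof.
case=> dv <-; case: p dv => x t dv /=.
have E : (fun h : R => h^-1 *: (xi (h *: (1, 0) + (x, t)) - xi (x, t))) =
    (fun h : R => h^-1 *: ((fun y => xi (y, t)) (h *: 1 + x) - xi (x, t))).
  by apply/funext => h; congr (_ *: (xi _ - _)); congr pair; rewrite /= scaler0 add0r.
split; first by rewrite /derivable -E.
by rewrite /derive -E.
Qed.

Lemma is_derive_slice_t (xi : R * R -> R) (p : R * R) (d : R) : is_derive p (0, 1) xi d ->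
  is_derive p.2 1 (fun s => xi (p.1, s)) d.
Proof.
case=> dv <-; case: p dv => x t dv /=.
have E : (fun h : R => h^-1 *: (xi (h *: (0, 1) + (x, t)) - xi (x, t))) =
    (fun h : R => h^-1 *: ((fun s => xi (x, s)) (h *: 1 + t) - xi (x, t))).
  by apply/funext => h; congr (_ *: (xi _ - _)); congr pair; rewrite /= scaler0 add0r.
split; first by rewrite /derivable -E.
by rewrite /derive -E.
Qed.

Variables (T J : R) (xi gx gt : R * R -> R).
Hypotheses (T0 : 0 < T) (J0 : 0 < J)
  (xc : {within closed_strip T, continuous xi})
  (gxc : {within closed_strip T, continuous gx})
  (gtc : {within closed_strip T, continuous gt})
  (dxi : forall p, strip T p -> is_derive p (1, 0) xi (gx p) /\ is_derive p (0, 1) xi (gt p))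
  (xi0 : forall t, 0 < t < T -> xi (0, t) = 0)
  (xiT : forall x, 0 <= x -> xi (x, T) = 0)
  (xiJ : forall p, closed_strip T p -> J < p.1 -> xi p = 0).

Lemma within_curve (g : R * R -> R) (A : set R) (u v : R -> R) :
  {within closed_strip T, continuous g} -> continuous u -> continuous v ->
  (forall t, A t -> closed_strip T (u t, v t)) ->
  {within A, continuous (fun t => g (u t, v t))}.
Proof.
move=> /subspace_continuousP gc uc vc AS; apply/subspace_continuousP => t At.
apply: (@cvg_comp _ _ _ (fun t => (u t, v t)) g _ (within (closed_strip T) (nbhs (u t, v t)))); last exact/gc/AS.
move=> P PW.
have : \forall t' \near t, closed_strip T (u t', v t') -> P (u t', v t').
  have H : (u t', v t') @[t' --> t] --> (u t, v t) by exact: (@cvg_pair _ _ _ _ _ _ (nbhs_filter t) (nbhs_filter _) (nbhs_filter _) u v (uc t) (vc t)).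
  exact: H PW.
by apply: filterS => t' Pt' At'; apply: Pt'; exact: AS.
Qed.

Lemma slice_t_continuous (g : R * R -> R) x : {within closed_strip T, continuous g} -> 0 <= x ->
  {within `[0, T], continuous (fun t => g (x, t))}.
Proof.
move=> gc x0; apply: (within_curve (u := cst x) (v := id) gc); first by move=> ?; exact: cst_continuous.
  by move=> ?; exact: cvg_id.
by move=> t /=; rewrite in_itv/=.
Qed.

Lemma slice_x_continuous (g : R * R -> R) t K : {within closed_strip T, continuous g} -> 0 <= t <= T ->
  {within `[0, K], continuous (fun x => g (x, t))}.
Proof.
move=> gc tT; apply: (within_curve (u := id) (v := cst t) gc); first by move=> ?; exact: cvg_id.
  by move=> ?; exact: cst_continuous.
by move=> x /=; rewrite in_itv/= => /andP[x0 _].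
Qed.

Lemma test_FTC_t x t : 0 < x -> 0 <= t -> t < T ->
  \int[mu]_(s in `[t, T]) gt (x, s) = - xi (x, t).
Proof.
move=> x0 t0 tT.
have c1 := within_cc_sub (slice_t_continuous gtc (ltW x0)) t0 (lexx T).
have c2 := within_cc_sub (slice_t_continuous xc (ltW x0)) t0 (lexx T).
rewrite /Rintegral (@continuous_FTC2 _ _ (fun s => xi (x, s)) t T) //.
- by rewrite xiT ?(ltW x0)// -EFinB/= sub0r.
- have /continuous_within_itvP := c2; move=> /(_ tT)[_ H1 H2]; split => // s; rewrite in_itv/= => /andP[ts sT].
  have S : strip T (x, s) by split => //=; rewrite sT (le_lt_trans t0).
  by have [_ /is_derive_slice_t/=] := dxi S; exact: isd_derivable.
- move=> s; rewrite in_itv/= => /andP[ts sT].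
  have S : strip T (x, s) by split => //=; rewrite sT (le_lt_trans t0).
  by have [_ /is_derive_slice_t/=] := dxi S; exact: isd_derive1.
Qed.

Lemma test_FTC_x x t : 0 <= x -> 0 < t < T -> \int[mu]_(y in `[0, x]) gx (y, t) = xi (x, t).
Proof.
move=> x0 tT; have tT' : 0 <= t <= T by case/andP: tT => /ltW -> /ltW.
move: x0; rewrite le_eqVlt => /predU1P[<-|x0].
  by rewrite set_itv1 Rintegral_set1 xi0.
have c1 := slice_x_continuous (K := x) gxc tT'.
have c2 := slice_x_continuous (K := x) xc tT'.
rewrite /Rintegral (@continuous_FTC2 _ _ (fun y => xi (y, t)) 0 x) //.
- by rewrite xi0// -EFinB/= subr0.
- have /continuous_within_itvP := c2; move=> /(_ x0)[_ H1 H2]; split => // y; rewrite in_itv/= => /andP[y0 _].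
  have S : strip T (y, t) by split.
  by have [/is_derive_slice_x/= + _] := dxi S; exact: isd_derivable.
- move=> y; rewrite in_itv/= => /andP[y0 _].
  have S : strip T (y, t) by split.
  by have [/is_derive_slice_x/= + _] := dxi S; exact: isd_derive1.
Qed.

Lemma within_strip_measurable (g : R * R -> R) : {within closed_strip T, continuous g} ->
  measurable_fun (strip T) g.
Proof.
move=> /subspace_continuousP gc; apply: continuous_plane_measurable; first exact: open_strip.
move=> p Sp; have Cp : closed_strip T p by case: Sp => /ltW ? /andP[/ltW ? /ltW ?]; split => //; apply/andP.
apply: cvg_trans (gc p Cp) => P /=; rewrite /within/= !nbhs_simpl/=.
have : nbhs p (strip T) by apply: open_nbhs_nbhs; split => //; exact: open_strip.
rewrite nearE => SN; apply: filterS2 SN => q Sq; apply.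
by case: Sq => /ltW ? /andP[/ltW ? /ltW ?]; split => //; apply/andP.
Qed.

Lemma rectangle_bounded (g : R * R -> R) : {within closed_strip T, continuous g} ->
  exists2 M, 0 <= M & forall p, closed_strip T p -> p.1 <= J -> `|g p| <= M.
Proof.
move=> gc; pose K : set (R * R) := `[0, J] `*` `[0, T].
have Kc : compact K by apply: compact_setX; exact: segment_compact.
have gK : {within K, continuous g}.
  apply: continuous_subspaceW gc => -[x t] [/=]; rewrite !in_itv/= => /andP[x0 _] tT; by split.
have /compact_bounded[M [_ HM]] := continuous_compact gK Kc.
exists (`|M| + 1) => [|p [p0 pT] pJ]; first by rewrite addr_ge0.
apply: (HM (`|M| + 1)); first by rewrite (le_lt_trans (ler_norm _))// ltrDl.
by exists p => //; split; rewrite /= in_itv/= ?p0.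
Qed.

Lemma test_gx_far p : strip T p -> J < p.1 -> gx p = 0.
Proof.
move=> Sp Jp; have [/is_derive_slice_x H _] := dxi Sp.
suff H' : is_derive p.1 1 (fun y => xi (y, p.2)) 0 by rewrite -(isd_derive1 H) (isd_derive1 H').
case: Sp => p0 /andP[/ltW t0 /ltW t1].
apply: near_eq_is_derive (isd_cst _ 0); near=> y.
apply/esym; apply: xiJ => /=; last by near: y; exact: lt_nbhsr.
split => /=; last by rewrite t0.
by apply: ltW; near: y; exact: lt_nbhsr.
Unshelve. all: by end_near. Qed.

Lemma test_gt_far p : strip T p -> J < p.1 -> gt p = 0.
Proof.
move=> Sp Jp; have [_ /is_derive_slice_t H] := dxi Sp.
suff H' : is_derive p.2 1 (fun s => xi (p.1, s)) 0 by rewrite -(isd_derive1 H) (isd_derive1 H').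
case: Sp => p0 /andP[t0 t1]; apply: near_eq_is_derive (isd_cst _ 0); near=> s.
apply/esym; apply: xiJ => //=; split => /=; first exact: ltW.
by apply/andP; split; apply: ltW; near: s; [exact: lt_nbhsr|exact: lt_nbhsl].
Unshelve. all: by end_near. Qed.

Lemma test_bound : exists2 M, 0 <= M & forall p,
  [/\ strip T p -> `|gx p| <= M, strip T p -> `|gt p| <= M & closed_strip T p -> `|xi p| <= M].
Proof.
have [M1 M10 H1] := rectangle_bounded gxc; have [M2 M20 H2] := rectangle_bounded gtc.
have [M3 M30 H3] := rectangle_bounded xc.
have SC p : strip T p -> closed_strip T p.
  by case=> /ltW ? /andP[/ltW ? /ltW ?]; split => //; apply/andP.
exists (M1 + M2 + M3) => [|p]; first lra.
split=> Sp; have [pJ|pJ] := leP p.1 J.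
- by have := H1 p (SC _ Sp) pJ; lra.
- by rewrite test_gx_far// normr0; lra.
- by have := H2 p (SC _ Sp) pJ; lra.
- by rewrite test_gt_far// normr0; lra.
- by have := H3 p Sp pJ; lra.
- by rewrite xiJ// normr0; lra.
Qed.

Section parabola.
Variable c : R.
Hypothesis c0 : 0 < c.

Let phi x := xi (x, x ^+ 2 / c ^+ 2).
Let beta t := c / 2 * ((Num.sqrt t)^-1 * xi (c * Num.sqrt t, t)).

Let sq_cont : continuous (fun x : R => x ^+ 2 / c ^+ 2).
Proof. by move=> x; apply: cvgM; [exact: exprn_continuous|exact: cvg_cst]. Qed.

Let csqrt_cont : continuous (fun t : R => c * Num.sqrt t).
Proof. by move=> t; apply: cvgM; [exact: cvg_cst|exact: sqrt_continuous]. Qed.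

Lemma parabola_continuous : {within `[0, c * Num.sqrt T], continuous (fun x => xi (x, x ^+ 2 / c ^+ 2))}.
Proof.
apply: (within_curve (u := id) xc) => //; first by move=> ?; exact: cvg_id.
move=> x /=; rewrite in_itv/= => /andP[x0 xc']; split => //=.
rewrite divr_ge0 ?sqr_ge0//= ler_pdivrMr ?exprn_gt0// mulrC.
by rewrite -(sqr_sqrtr (ltW T0)) -exprMn ler_sqr ?nnegrE// mulr_ge0 ?sqrtr_ge0// ltW.
Qed.

Let xi_curve : {within `[0, T], continuous (fun t => xi (c * Num.sqrt t, t))}.
Proof.
apply: (within_curve (v := id) xc) => //; first by move=> ?; exact: cvg_id.
by move=> t /=; rewrite in_itv/= => tT; split => //=; rewrite mulr_ge0 ?sqrtr_ge0// ltW.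
Qed.

Lemma curve_integrable :
  mu.-integrable `[0, T] (EFin \o (fun t => c / 2 * ((Num.sqrt t)^-1 * xi (c * Num.sqrt t, t)))).
Proof.
have [M M0 HM] := test_bound; apply: integrable_oc_cc; apply: mu_integrable_scale => //.
apply: (@mu_integrable_dom R _ _ (fun t => (Num.sqrt t)^-1 * M)) => //.
- apply: measurable_funM.
    by apply/measurable_EFinP; exact: measurable_int (integrable_inv_sqrt T0).
  apply: measurable_funS (subspace_continuous_measurable_fun _ xi_curve) => //.
  by apply: subset_itvr; rewrite bnd_simp.
- by apply: mu_integrable_scaler => //; exact: integrable_inv_sqrt.
- move=> t; rewrite /= in_itv/= => /andP[t0 tT].
  rewrite normrM ger0_norm ?invr_ge0 ?sqrtr_ge0// ler_wpM2l ?invr_ge0 ?sqrtr_ge0//.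
  have [_ _] := HM (c * Num.sqrt t, t); apply; split => /=; last by rewrite (ltW t0).
  by rewrite mulr_ge0 ?sqrtr_ge0// ltW.
Qed.

(** Substitution [x = c sqrt t]. As [dx/dt] is unbounded at [t = 0], the two primitives are compared
    instead: their difference is continuous on [[0, T]] and has zero derivative inside. *)
Lemma parabola_substitution :
  \int[mu]_(x in `[0, c * Num.sqrt T]) xi (x, x ^+ 2 / c ^+ 2) =
  \int[mu]_(t in `[0, T]) (c / 2 * ((Num.sqrt t)^-1 * xi (c * Num.sqrt t, t))).
Proof.
have sT : 0 < Num.sqrt T by rewrite sqrtr_gt0.
have cT : 0 <= c * Num.sqrt T by rewrite mulr_ge0 ?ltW.
have phii := continuous_integrable_cc parabola_continuous.
pose A t := prim phi (c * Num.sqrt t); pose B t := prim beta t.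
have AB t : 0 < t < T -> is_derive t 1 (fun t => A t - B t) 0.
  move=> tT; have /andP[t0 tT'] := tT.
  have st : 0 < Num.sqrt t by rewrite sqrtr_gt0.
  have dB : is_derive t 1 B (beta t).
    apply: (is_derive_integral curve_integrable tT); apply: cvgM; first exact: cvg_cst.
    apply: cvgM; last exact: within_cc_interior xi_curve tT.
    by apply: cvgV; [rewrite gt_eqF|exact: sqrt_continuous].
  have cst' : 0 < c * Num.sqrt t < c * Num.sqrt T.
    by rewrite mulr_gt0//= ltr_pM2l// ltr_sqrt.
  have dphi : is_derive (c * Num.sqrt t) 1 (prim phi) (phi (c * Num.sqrt t)).
    by apply: (is_derive_integral phii cst'); exact: within_cc_interior parabola_continuous cst'.
  have dA := @isd_comp _ (prim phi) (fun t => c * Num.sqrt t) t _ _ dphi (isdZ c (is_derive1_sqrt t0)).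
  apply: (is_derive_eq (isdB dA dB)).
  rewrite /phi /beta exprMn sqr_sqrtr ?(ltW t0)// [c ^+ 2 * t]mulrC mulfK; last by rewrite gt_eqF// exprn_gt0.
  by field; rewrite gt_eqF.
have ABc : {within `[0, T], continuous (fun t => A t - B t)}.
  apply: within_B; last exact: prim_continuous (ltW T0) curve_integrable.
  have /subspace_continuousP pc := prim_continuous cT phii.
  apply/subspace_continuousP => t tT.
  have mem t' : `[0, T]%classic t' -> `[0, c * Num.sqrt T]%classic (c * Num.sqrt t').
    by rewrite /= !in_itv/= => /andP[t0 t1]; rewrite mulr_ge0 ?sqrtr_ge0 ?(ltW c0)//= ler_pM2l// ler_wsqrtr.
  apply: (@cvg_comp _ _ _ (fun t => c * Num.sqrt t) (prim phi) _ (within `[0, c * Num.sqrt T] (nbhs (c * Num.sqrt t)))); last exact/pc/mem.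
  move=> P PW; have : \forall t' \near t, `[0, c * Num.sqrt T]%classic (c * Num.sqrt t') -> P (c * Num.sqrt t').
    have H : c * Num.sqrt t' @[t' --> (t : R)] --> c * Num.sqrt t := @csqrt_cont t.
    exact: H PW.
  by apply: filterS => t' Pt' At'; apply: Pt'; exact: mem.
have [e _ E] := MVT_cc T0 AB ABc.
move: E; rewrite mul0r /A /B sqrtr0 mulr0 !(prim_le0 _ (lexx 0)) subrr subr0 => /eqP.
by rewrite subr_eq0 => /eqP.
Qed.

End parabola.

Local Notation mu2 := (mu \x mu)%E.
Let GT := gt \_ (strip T).
(** Extension by zero that also absorbs the factor [1 / sqrt t] of the flux. *)
Let GX := (fun p : R * R => (Num.sqrt p.2)^-1 * gx p) \_ (strip T).
Let Y := (fun p : R * R => p.1 / Num.sqrt p.2) \_ (strip T).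
Let mS := @measurable_strip R T.
Let parab c : set (R * R) := [set p | p.1 < c * Num.sqrt p.2].

Let mY : measurable_fun setT Y.
Proof. by apply/(measurable_restrictT _ mS); exact: measurable_selfsim_var. Qed.

Let mGT : measurable_fun setT GT.
Proof. by apply/(measurable_restrictT _ mS); exact: within_strip_measurable. Qed.

Let inv_sqrt_strip : measurable_fun (strip T) (fun p : R * R => (Num.sqrt p.2)^-1).
Proof.
apply: continuous_plane_measurable; first exact: open_strip.
move=> [x t] [/= x0 /andP[t0 _]]; apply: cvgV; first by rewrite gt_eqF ?sqrtr_gt0.
by apply: continuous_cvg; [exact: sqrt_continuous|exact: cvg_snd].
Qed.

Let mGX : measurable_fun setT GX.
Proof.
apply/(measurable_restrictT _ mS); apply: measurable_funM; first exact: inv_sqrt_strip.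
exact: within_strip_measurable.
Qed.

Let mparab c : measurable (parab c).
Proof.
apply: measurable_lt_set => //; apply: measurable_funM => //.
by apply: measurableT_comp measurable_snd; apply: continuous_measurable_fun; exact: sqrt_continuous.
Qed.

Let dominated (r : R -> R) : mu.-integrable `]0, T] (EFin \o r) ->
  mu2.-integrable setT (EFin \o (fun p : R * R => \1_(`]0, J]) p.1 * (r \_ `]0, T]) p.2)).
Proof.
move=> ri; apply: (@integrable_tensor _ _ _ _ R mu mu (\1_(`]0, J])) (r \_ `]0, T])).
  exact: integrable_indic_oc.
exact: integrable_restrictT.
Qed.

(** One integrable majorant for all the applications of Fubini below: [M + M / sqrt t] on the box
    []0, J] x ]0, T]]. *)
Let bounds : exists2 D : R * R -> R, mu2.-integrable setT (EFin \o D) &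
  forall p, `|GT p| <= D p /\ `|GX p| <= D p.
Proof.
have [M M0 HM] := test_bound.
have i1 : mu.-integrable `]0, T] (EFin \o (fun t => M + M * (Num.sqrt t)^-1)).
  apply: integrable_add => //.
    by apply: (@integrable_bnd _ _ R mu _ _ `|M|) => //; exact: lebesgue_oc_lty.
  by apply: mu_integrable_scale => //; exact: integrable_inv_sqrt.
exists (fun p : R * R => \1_(`]0, J]) p.1 * ((fun t => M + M * (Num.sqrt t)^-1) \_ `]0, T]) p.2).
  exact: dominated.
move=> p; have D0 : 0 <= \1_(`]0, J]) p.1 * ((fun t => M + M * (Num.sqrt t)^-1) \_ `]0, T]) p.2.
  rewrite mulr_ge0// patchE; case: ifP => // _.
  by rewrite addr_ge0// mulr_ge0// invr_ge0 sqrtr_ge0.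
rewrite /GT /GX !patchE; case: ifPn => [/set_mem Sp|_]; last by rewrite normr0.
have [p0 /andP[t0 tT]] := Sp.
have [pJ|pJ] := leP p.1 J; last by rewrite test_gx_far// test_gt_far// mulr0 normr0.
rewrite indicE !mem_set/= ?in_itv/= ?p0 ?t0 ?(ltW tT)// mul1r.
have [H1 H2 _] := HM p; have si : 0 <= (Num.sqrt p.2)^-1 by rewrite invr_ge0 sqrtr_ge0.
split.
  by rewrite (le_trans (H2 Sp))// lerDl mulr_ge0.
by rewrite normrM (ger0_norm si) mulrC (le_trans (ler_wpM2r si (H1 Sp)))// lerDr.
Qed.

Let indic_mul_int (A : set (R * R)) (G D : R * R -> R) : measurable A -> measurable_fun setT G ->
  mu2.-integrable setT (EFin \o D) -> (forall p, `|G p| <= D p) ->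
  mu2.-integrable setT (EFin \o (fun p => \1_A p * G p)).
Proof.
move=> mA mG Di GD; apply: integrable_dom Di _ => //.
  by apply: measurable_funM => //; exact: measurable_indic.
move=> p _; rewrite normrM; apply: le_trans (GD p); apply: ler_piMl => //.
by rewrite indicE; case: (_ \in _); rewrite ?normr1 ?normr0.
Qed.

(** For fixed [x] the region is entered at time [x^2 / c^2] and kept until [T], where [xi] vanishes:
    integrating in [t] leaves [- xi] on the parabola. *)
Let layer_t c : 0 < c ->
  \int[mu2]_p (\1_(parab c) p * GT p) = - \int[mu]_(x in `[0, c * Num.sqrt T]) xi (x, x ^+ 2 / c ^+ 2).
Proof.
move=> c0; have [D Di DG] := bounds.
have Fi : mu2.-integrable setT (EFin \o (fun p => \1_(parab c) p * GT p)).
  by apply: (indic_mul_int _ mGT Di) => // p; have [] := DG p.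
have cT : 0 <= c * Num.sqrt T by rewrite mulr_ge0 ?sqrtr_ge0// ltW.
pose phi x := xi (x, x ^+ 2 / c ^+ 2).
have phii : mu.-integrable `[0, c * Num.sqrt T] (EFin \o phi).
  exact: continuous_integrable_cc (parabola_continuous c0).
have phii' : mu.-integrable `]0, c * Num.sqrt T] (EFin \o phi).
  by apply: integrableS phii => //; apply: subset_itvr; rewrite bnd_simp.
have phii'' : mu.-integrable `]0, c * Num.sqrt T[ (EFin \o phi).
  by apply: integrableS phii => //; apply: subset_itv; rewrite bnd_simp.
rewrite -(Rfubini1 Fi) -Rintegral_itv_obnd_cbnd// -Rintegral_itv_bndo_bndc//.
rewrite -RintegralN// [RHS]Rintegral_mkcond; apply: eq_Rintegral => x _.
rewrite patchE; case: ifPn => [/set_mem/=|nx].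
  rewrite in_itv/= => /andP[x0 xcT].
  have c2 : 0 < c ^+ 2 by rewrite exprn_gt0.
  have t0 : 0 <= x ^+ 2 / c ^+ 2 by rewrite divr_ge0 ?sqr_ge0.
  have tT : x ^+ 2 / c ^+ 2 < T.
    rewrite ltr_pdivrMr// mulrC -[T in _ * T](sqr_sqrtr (ltW T0)) -exprMn ltr_sqr ?nnegrE//; exact: ltW.
  have gi : mu.-integrable `[x ^+ 2 / c ^+ 2, T] (EFin \o (fun t => gt (x, t))).
    by apply: continuous_integrable_cc; exact: within_cc_sub (slice_t_continuous gtc (ltW x0)) t0 (lexx T).
  rewrite -(test_FTC_t x0 t0 tT) -Rintegral_itv_obnd_cbnd; last first.
    by apply: integrableS gi => //; apply: subset_itvr; rewrite bnd_simp.
  rewrite -Rintegral_itv_bndo_bndc; last first.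
    by apply: integrableS gi => //; apply: subset_itv; rewrite bnd_simp.
  rewrite [RHS]Rintegral_mkcond; apply: eq_Rintegral => t _.
  rewrite /GT indicE !patchE.
  have [|] := boolP ((x, t) \in strip T) => [/set_mem[/= _ /andP[tt0 ttT]]|nS]; last first.
    rewrite mulr0; case: ifPn => // /set_mem/=; rewrite in_itv/= => /andP[t1 t2].
    exfalso; move/negP: nS; apply; rewrite inE; split => //=; rewrite t2 andbT; exact: le_lt_trans t1.
  have E : (x < c * Num.sqrt t) = (x ^+ 2 / c ^+ 2 < t).
    rewrite ltr_pdivrMr// -{2}(sqr_sqrtr (ltW tt0)) [_ * c ^+ 2]mulrC -exprMn ltr_sqr ?nnegrE ?(ltW x0)//.
    by rewrite mulr_ge0 ?sqrtr_ge0// ltW.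
  have [H|H] := ltP (x ^+ 2 / c ^+ 2) t.
    by rewrite !mem_set ?mul1r//= ?in_itv/= ?H// /parab/= E.
  by rewrite !memNset ?mul0r//= ?in_itv/= /parab/= ?E ltNge H.
rewrite (_ : (fun t => _) = cst 0) ?Rintegral_0//; apply/funext => t.
rewrite /GT indicE patchE; case: ifPn => [/set_mem[/= x0 /andP[t0 tT]]|_]; last by rewrite mulr0.
rewrite memNset ?mul0r// /parab/= => xc'; move/negP: nx; apply; rewrite inE/= in_itv/= x0/=.
by apply: lt_trans xc' _; rewrite ltr_pM2l// ltr_sqrt.
Qed.

(** For fixed [t] the region is [0 < x < c sqrt t], and [xi (0, t) = 0]: integrating in [x] leaves
    [xi] on the parabola. *)
Let layer_x c : 0 < c ->
  \int[mu2]_p (c / 2 * (\1_(parab c) p * GX p)) =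
  \int[mu]_(t in `[0, T]) (c / 2 * ((Num.sqrt t)^-1 * xi (c * Num.sqrt t, t))).
Proof.
move=> c0; have [D Di DG] := bounds.
have Fi : mu2.-integrable setT (EFin \o (fun p => c / 2 * (\1_(parab c) p * GX p))).
  apply: integrable_scale => //.
  by apply: (indic_mul_int _ mGX Di) => // p; have [] := DG p.
have bi := curve_integrable c0.
have bi' : mu.-integrable `]0, T] (EFin \o (fun t => c / 2 * ((Num.sqrt t)^-1 * xi (c * Num.sqrt t, t)))).
  by apply: integrableS bi => //; apply: subset_itvr; rewrite bnd_simp.
have bi'' : mu.-integrable `]0, T[ (EFin \o (fun t => c / 2 * ((Num.sqrt t)^-1 * xi (c * Num.sqrt t, t)))).
  by apply: integrableS bi => //; apply: subset_itv; rewrite bnd_simp.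
rewrite -(Rfubini2 Fi) -Rintegral_itv_obnd_cbnd// -Rintegral_itv_bndo_bndc//.
rewrite [RHS]Rintegral_mkcond; apply: eq_Rintegral => t _.
rewrite patchE; case: ifPn => [/set_mem/=|nt].
  rewrite in_itv/= => tT; have /andP[t0 tT'] := tT.
  have ct : 0 <= c * Num.sqrt t by rewrite mulr_ge0 ?sqrtr_ge0// ltW.
  have tTc : 0 <= t <= T by rewrite !ltW.
  have gi : mu.-integrable `[0, c * Num.sqrt t] (EFin \o (fun x => gx (x, t))).
    by apply: continuous_integrable_cc; exact: slice_x_continuous gxc tTc.
  have gi' : mu.-integrable `]0, c * Num.sqrt t[ (EFin \o (fun x => gx (x, t))).
    by apply: integrableS gi => //; apply: subset_itv; rewrite bnd_simp.
  rewrite -(test_FTC_x ct tT) -Rintegral_itv_obnd_cbnd; last first.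
    by apply: integrableS gi => //; apply: subset_itvr; rewrite bnd_simp.
  rewrite -Rintegral_itv_bndo_bndc//.
  rewrite mulrA -RintegralZl// [RHS]Rintegral_mkcond; apply: eq_Rintegral => x _.
  rewrite /GX indicE !patchE.
  have [|] := boolP ((x, t) \in strip T) => [/set_mem[/= x0 _]|nS]; last first.
    rewrite !mulr0; case: ifPn => // /set_mem/=; rewrite in_itv/= => /andP[x0 _].
    by exfalso; move/negP: nS; apply; rewrite inE; split.
  have [H|H] := ltP x (c * Num.sqrt t).
    by rewrite !mem_set ?mul1r ?mulrA//= ?in_itv/= ?x0 ?H.
  by rewrite !memNset ?mul0r ?mulr0//= ?in_itv/= ?x0 /parab/= ltNge H.
rewrite (_ : (fun x => _) = cst 0) ?Rintegral_0//; apply/funext => x.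
rewrite /GX patchE memNset ?mulr0//= => -[_ tT]; move/negP: nt; apply; rewrite inE/= in_itv/=.
exact: tT.
Qed.

(** Up to sign both integrals are the same curve integral of [xi] along the parabola, parametrised
    once by [x] and once by [t]. The weight [c / 2] comes from the Jacobian [c / (2 sqrt t)], and it
    is also the share of the level in the flux. *)
Let layer_balance c : 0 <= c ->
  \int[mu2]_p (\1_(parab c) p * GT p) + \int[mu2]_p (c / 2 * (\1_(parab c) p * GX p)) = 0.
Proof.
rewrite le_eqVlt => /predU1P[<-|c0]; last first.
  by rewrite layer_t// layer_x// parabola_substitution// addrC subrr.
rewrite (_ : (fun p => \1_(parab 0) p * GT p) = cst 0); last first.
  apply/funext => p; rewrite /GT patchE indicE; case: ifPn => [/set_mem[p0 _]|]; last by rewrite mulr0.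
  by rewrite memNset ?mul0r// /parab/= mul0r; apply/negP; rewrite -leNgt ltW.
rewrite (_ : (fun p => _ * _) = cst 0); last by apply/funext => p; rewrite mul0r mul0r.
by rewrite Rintegral_0 addr0.
Qed.

Section layers.
Variables (a b : R) (f Q q : R -> R).
Hypotheses (qi : mu.-integrable setT (EFin \o q)) (q0 : forall s, 0 <= q s)
  (qab : forall s, ~ (a < s <= b) -> q s = 0)
  (fq : forall y, 0 <= y -> f y - a = \int[mu]_s (\1_[set s | y < 2 * q s] s))
  (Qq : forall y, 0 <= y -> Q y = \int[mu]_s (q s * \1_[set s | y < 2 * q s] s)).

Let L : set (R * (R * R)) := [set z | Y z.2 < 2 * q z.1].

Let mL : measurable L.
Proof.
have mq : measurable_fun setT q by apply/measurable_EFinP; exact: measurable_int qi.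
apply: measurable_lt_set; first exact: measurableT_comp measurable_snd.
by apply: measurable_funM => //; exact: measurableT_comp measurable_fst.
Qed.

(** Here [q] is the layer density, and [2 q s] is the opening of the parabola at level [s]. Fubini
    reduces the claim to an integral over [s] of [layer_balance] with [c = 2 q s]. *)
Lemma layers_balance :
  \int[mu2]_p ((f (Y p) - a) * GT p + Q (Y p) * GX p) = 0.
Proof.
have [D Di DG] := bounds.
have mq : measurable_fun setT q by apply/measurable_EFinP; exact: measurable_int qi.
pose F1 (z : R * (R * R)) := \1_L z * GT z.2.
pose F2 (z : R * (R * R)) := q z.1 * (\1_L z * GX z.2).
have D0 p : 0 <= D p by have [+ _] := DG p; apply: le_trans.
have iT (r : R -> R) : mu.-integrable setT (EFin \o r) ->
    (mu \x mu2)%E.-integrable setT (EFin \o (fun z => r z.1 * D z.2)).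
  by move=> ri; exact: (@integrable_tensor _ _ _ _ R mu plane_measure r D ri Di).
have mGT' : measurable_fun setT (fun z : R * (R * R) => GT z.2) by exact: measurableT_comp measurable_snd.
have mGX' : measurable_fun setT (fun z : R * (R * R) => GX z.2) by exact: measurableT_comp measurable_snd.
have i1 : (mu \x mu2)%E.-integrable setT (EFin \o F1).
  apply: (@integrable_dom _ _ R (mu \x plane_measure)%E setT _ _ _ _ (iT _ (integrable_indic_oc a b))) => //.
    by apply: measurable_funM => //; exact: measurable_indic.
  move=> [s p] _; rewrite /F1/= normrM; have [H1 _] := DG p.
  rewrite !indicE; have [|] := boolP (s \in `]a, b]%classic) => [_|/negP sab].
    rewrite mul1r; apply: le_trans H1; apply: ler_piMl => //.
    by case: (_ \in _); rewrite ?normr1 ?normr0.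
  (* Outside []a, b]] the density vanishes while [Y p >= 0] on the strip, so the indicator of the
     layer is [0] there; this confines [F1] to levels in []a, b]]. *)
  have E : q s = 0 by apply: qab => H; apply: sab; rewrite inE/= in_itv.
  rewrite mul0r /GT patchE; case: ifPn => [/[dup] iS /set_mem[p0 /andP[t0 _]]|]; last by rewrite normr0 mulr0.
  rewrite memNset ?normr0 ?mul0r// /L/= E mulr0 /Y patchE iS; apply/negP; rewrite -leNgt.
  by rewrite divr_ge0 ?sqrtr_ge0// ltW.
have i2 : (mu \x mu2)%E.-integrable setT (EFin \o F2).
  apply: (@integrable_dom _ _ R (mu \x plane_measure)%E setT _ _ _ _ (iT _ qi)) => //.
    apply: measurable_funM; first exact: measurableT_comp measurable_fst.
    by apply: measurable_funM => //; exact: measurable_indic.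
  move=> [s p] _; rewrite /F2/= normrM (ger0_norm (q0 s)) ler_wpM2l// normrM; have [_ H1] := DG p.
  apply: le_trans H1; apply: ler_piMl => //.
  by rewrite indicE; case: (_ \in _); rewrite ?normr1 ?normr0.
have i12 : (mu \x mu2)%E.-integrable setT (EFin \o (fun z => F1 z + F2 z)).
  exact: (@integrable_add _ _ R (mu \x plane_measure)%E setT F1 F2 measurableT i1 i2).
transitivity (\int[mu2]_p \int[mu]_s (F1 (s, p) + F2 (s, p))).
  apply: eq_Rintegral => p _; rewrite /F1 /F2/=.
  have [Sp|nSp] := boolP (p \in strip T); last first.
    rewrite /GT /GX !patchE (negbTE nSp); under eq_Rintegral do rewrite !mulr0 addr0.
    by rewrite Rintegral_0 !mulr0 addr0.
  have Y0 : 0 <= Y p.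
    by rewrite /Y patchE Sp; move/set_mem: Sp => [/ltW p0 _]; rewrite divr_ge0 ?sqrtr_ge0.
  rewrite fq// Qq//.
  have LE s : \1_L (s, p) = \1_[set s | Y p < 2 * q s] s :> R.
    by rewrite !indicE; congr (nat_of_bool _)%:R; apply/idP/idP; rewrite !inE.
  under [RHS]eq_Rintegral do rewrite LE (mulrA (q _)).
  have mI : measurable_fun setT (\1_[set s | Y p < 2 * q s] : R -> R).
    by apply: measurable_indic; apply: measurable_lt_set => //; exact: measurable_funM.
  have j1 : mu.-integrable setT (EFin \o (\1_[set s | Y p < 2 * q s] : R -> R)).
    apply: (mu_integrable_dom _ mI (integrable_indic_oc a b)) => // s _.
    rewrite !indicE; have [|] := boolP (s \in `]a, b]%classic) => [_|/negP sab].
      by case: (_ \in _); rewrite ?normr1 ?normr0.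
    have E : q s = 0 by apply: qab => H; apply: sab; rewrite inE/= in_itv.
    by rewrite memNset ?normr0// /= E mulr0; apply/negP; rewrite -leNgt.
  have j2 : mu.-integrable setT (EFin \o (fun s => q s * \1_[set s | Y p < 2 * q s] s)).
    apply: (mu_integrable_dom _ _ qi) => //; first exact: measurable_funM.
    move=> s _; rewrite normrM (ger0_norm (q0 s)); apply: ler_piMr => //.
    by rewrite indicE; case: (_ \in _); rewrite ?normr1 ?normr0.
  rewrite RintegralD//; last 2 first.
  - exact: mu_integrable_scaler.
  - exact: mu_integrable_scaler.
  by rewrite !RintegralZr.
have E1 := @Rfubini1 _ _ _ _ R mu plane_measure _ i12.
have E2 := @Rfubini2 _ _ _ _ R mu plane_measure _ i12; rewrite E2 -E1.
rewrite -[RHS](Rintegral_0 mu setT); apply: eq_Rintegral => s _.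
rewrite -(layer_balance (c := 2 * q s)); last by rewrite mulr_ge0.
have LP p (G : R * R -> R) : \1_L (s, p) * (G \_ (strip T)) p = \1_(parab (2 * q s)) p * (G \_ (strip T)) p.
  rewrite !patchE; case: ifPn => [|]; last by rewrite !mulr0.
  move=> iS; have [p0 /andP[t0 _]] := set_mem iS.
  rewrite !indicE; congr ((nat_of_bool _)%:R * _); apply/idP/idP; rewrite !inE /L /parab/= /Y patchE iS.
    by rewrite ltr_pdivrMr// sqrtr_gt0.
  by rewrite ltr_pdivrMr// sqrtr_gt0.
have k1 : mu2.-integrable setT (EFin \o (fun p => \1_(parab (2 * q s)) p * GT p)).
  by apply: (indic_mul_int _ mGT Di) => // p; have [] := DG p.
have k2 : mu2.-integrable setT (EFin \o (fun p => \1_(parab (2 * q s)) p * GX p)).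
  by apply: (indic_mul_int _ mGX Di) => // p; have [] := DG p.
rewrite -RintegralD//; last exact: integrable_scale.
apply: eq_Rintegral => p _; rewrite /F1 /F2/= /GT /GX !LP; congr (_ + _).
by rewrite (mulrC 2) mulfK.
Qed.

Hypotheses (mf : measurable_fun setT f) (mQ : measurable_fun setT Q)
  (fab : forall y, a <= f y <= b) (C : R) (QC : forall y, 0 <= Q y <= C).

Let trace_integrable : mu.-integrable halfline (EFin \o (fun x => xi (x, 0))).
Proof.
have [M M0 HM] := test_bound.
have zT : 0 <= (0 : R) <= T by rewrite lexx ltW.
apply: (@mu_integrable_dom R _ _ (cst M \_ `]0, J])).
- exact: measurable_halfline.
- apply: open_continuous_measurable_fun; first exact: open_halfline.
  move=> x /set_mem x0.
  apply: (within_cc_interior (slice_x_continuous (K := x + 1) xc zT)).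
  by rewrite /halfline/= in x0; rewrite x0/=; lra.
- apply: (@integrableS _ _ _ _ setT) => //; first exact: measurable_halfline.
  apply: integrable_restrictT => //; apply: (@integrable_bnd _ _ R mu _ _ `|M|) => //.
  exact: lebesgue_oc_lty.
- move=> x x0; have Cx : closed_strip T (x, 0) by split => //=; exact: ltW.
  rewrite patchE; case: ifPn => [_|nx]; first by have [_ _] := HM (x, 0); apply.
  rewrite xiJ ?normr0//=; move: nx; rewrite notin_setE/= in_itv/= => /negP.
  by rewrite negb_and -!ltNge => /orP[|//]; rewrite -leNgt => x0'; have := lt_le_trans (x0 : 0 < x) x0'; rewrite ltxx.
Qed.

Let GTi : mu2.-integrable setT (EFin \o GT).
Proof.
have [D Di DG] := bounds; apply: integrable_dom Di _ => // p _.
by have [] := DG p.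
Qed.

Let gt_integral : \int[mu2]_p GT p = - \int[mu]_(x in halfline) xi (x, 0).
Proof.
have mH := @measurable_halfline R.
rewrite -(Rfubini1 GTi) -RintegralN// [RHS]Rintegral_mkcond; apply: eq_Rintegral => x _.
rewrite patchE; case: ifPn => [/set_mem x0|nx]; last first.
  rewrite (_ : (fun t => _) = cst 0) ?Rintegral_0//; apply/funext => t.
  by rewrite /GT patchE memNset// => -[x0 _]; move/negP: nx; apply; rewrite inE.
have x0' : 0 <= x := ltW x0.
have gi : mu.-integrable `[0, T] (EFin \o (fun t => gt (x, t))).
  by apply: continuous_integrable_cc; exact: slice_t_continuous.
rewrite -(test_FTC_t x0 (lexx 0) T0) -Rintegral_itv_obnd_cbnd; last first.
  by apply: integrableS gi => //; apply: subset_itvr; rewrite bnd_simp.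
rewrite -Rintegral_itv_bndo_bndc; last first.
  by apply: integrableS gi => //; apply: subset_itv; rewrite bnd_simp.
rewrite [RHS]Rintegral_mkcond; apply: eq_Rintegral => t _.
rewrite /GT !patchE; congr (if _ then _ else _); apply/idP/idP; rewrite !inE/= in_itv/=; first by case.
by split.
Qed.

(** Split [f = a + (f - a)]: the constant part integrates to [- a] times the integral of the initial
    trace of [xi] and cancels the initial datum; the rest is [layers_balance]. *)
Lemma selfsim_weak_identity :
  \int[mu]_(x in halfline) (a * xi (x, 0)) + \int[mu2]_(p in strip T) (selfsim f p * gt p) =
  \int[mu2]_(p in strip T) (selfsim_flux Q p * gx p).
Proof.
have [D Di DG] := bounds; have mH := @measurable_halfline R.
have i1 : mu2.-integrable setT (EFin \o (fun p => (f (Y p) - a) * GT p)).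
  apply: (@integrable_dom _ _ R mu2 _ _ (fun p => (b - a) * D p)) => //.
  - apply: measurable_funM => //; apply: measurable_funB => //; exact: measurableT_comp mY.
  - exact: integrable_scale.
  - move=> p _; rewrite normrM; have [H _] := DG p; have /andP[f1 f2] := fab (Y p).
    by apply: ler_pM => //; rewrite ger0_norm; lra.
have i2 : mu2.-integrable setT (EFin \o (fun p => Q (Y p) * GX p)).
  apply: (@integrable_dom _ _ R mu2 _ _ (fun p => C * D p)) => //.
  - apply: measurable_funM => //; exact: measurableT_comp mY.
  - exact: integrable_scale.
  - move=> p _; rewrite normrM; have [_ H] := DG p; have /andP[f1 f2] := QC (Y p).
    by apply: ler_pM => //; rewrite ger0_norm; lra.
rewrite RintegralZl// [X in _ + X = _]Rintegral_mkcond [RHS]Rintegral_mkcond.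
rewrite (_ : (fun p => selfsim f p * gt p) \_ _ = fun p => (f (Y p) - a) * GT p + a * GT p); last first.
  apply/funext => p; rewrite /GT /Y !patchE /selfsim; case: ifP => _; last by rewrite !mulr0 addr0.
  by rewrite mulrBl subrK.
rewrite (_ : (fun p => selfsim_flux Q p * gx p) \_ _ = fun p => - (Q (Y p) * GX p)); last first.
  apply/funext => p; rewrite /GX /Y !patchE /selfsim_flux; case: ifP => _; last by rewrite !mulr0 oppr0.
  by rewrite mulNr mulrAC mulrC.
have i3 : mu2.-integrable setT (EFin \o (fun p => a * GT p)) by exact: integrable_scale.
have := layers_balance; rewrite RintegralD// RintegralD// RintegralN// RintegralZl// gt_integral.
by lra.
Qed.

End layers.

End test_function.

(** * The diffusion coefficient *)

Section diffusion.
Context {R : realType}.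
Local Notation mu := (@lebesgue_measure R).
Implicit Types (r s x t : R).
Variables (eps : R) (phi : R -> R).
Hypotheses (eps0 : 0 <= eps) (phi_adm : admissible phi).

(** Gives the single formula [D s = P s - eps P(- s)]. [P] is [C1] across the origin because [phi]
    and its derivative vanish there. *)
Let P s := phi (Num.max s 0).
Let dP s := derive1 phi (Num.max s 0).
Definition diffusion_rate s : R := (dP s + eps * dP (- s)) / 2.
Local Notation D := (Dfun eps phi).

Let phi0 : phi 0 = 0. Proof. by case: phi_adm => _ _ _ _ []. Qed.
Let dphi0 : derive1 phi 0 = 0. Proof. by case: phi_adm => _ _ _ _ []. Qed.

Let dphi s : is_derive s 1 phi (derive1 phi s).
Proof. by case: phi_adm => -[/(_ s) pd _ _] _ _ _ _; rewrite derive1E; apply: DeriveDef. Qed.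

Let dphi_cont : continuous (derive1 phi).
Proof.
case: phi_adm => -[_ pd _] _ _ _ _ s.
by apply: differentiable_continuous; apply/derivable1_diffP; exact: pd.
Qed.

Let dphi_ge0 s : 0 <= s -> 0 <= derive1 phi s.
Proof.
case: phi_adm => _ _ inc _ _; rewrite le_eqVlt => /predU1P[<-|s0]; first by rewrite dphi0.
by rewrite -dphi0 ltW// inc// in_itv/= ?lexx// ltW.
Qed.

Let max0_cont : continuous (fun s : R => Num.max s 0).
Proof. by move=> s; apply: continuous_max; [exact: cvg_id|exact: cvg_cst]. Qed.

Let P_derive s : is_derive s 1 P (dP s).
Proof.
have [s0|s0|->] := ltgtP s 0.
- rewrite /dP max_r ?ltW// dphi0; apply: near_eq_is_derive (isd_cst s 0); near=> y.
  by rewrite /P max_r ?phi0// ltW//; near: y; exact: lt_nbhsl.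
- rewrite /dP max_l ?ltW//; apply: near_eq_is_derive (dphi s); near=> y.
  by rewrite /P max_l// ltW//; near: y; exact: lt_nbhsr.
- rewrite /dP maxxx dphi0; apply/isd_epsP => e e0.
  have /isd_epsP/(_ e e0)[d d0 H] := dphi 0; exists d => // h hd.
  have := H h hd; rewrite dphi0 /P maxxx !phi0 !add0r !mul0r !subr0.
  have [h0|h0] := leP h 0; first by rewrite phi0 normr0 => _; rewrite mulr_ge0// ltW.
  by [].
Unshelve. all: by end_near. Qed.

Let DP s : D s = P s - eps * P (-1 * s + 0).
Proof.
rewrite /Dfun /P addr0 mulN1r.
have [s0|s0] := boolP (0 <= s).
  have -> : Num.max s 0 = s by apply/max_idPl.
  have -> : Num.max (- s) 0 = 0 by apply/max_idPr; rewrite oppr_le0.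
  by rewrite phi0 mulr0 subr0.
move: s0; rewrite -ltNge => s0.
have -> : Num.max s 0 = 0 by apply/max_idPr/ltW.
have -> : Num.max (- s) 0 = - s by apply/max_idPl; rewrite oppr_ge0 ltW.
by rewrite phi0 sub0r mulNr.
Qed.

Lemma Dfun_derive s : is_derive s 1 D (2 * diffusion_rate s).
Proof.
rewrite (_ : D = fun s => P s - eps * P (-1 * s + 0)); last by apply/funext => x; exact: DP.
apply: (is_derive_eq (isdB (P_derive s) (isdZ eps (isd_affine (P_derive (-1 * s + 0)))))).
by rewrite /diffusion_rate addr0 mulN1r; field.
Qed.

Lemma diffusion_rate_cont : continuous diffusion_rate.
Proof.
have dPc : continuous dP by move=> s; apply: continuous_cvg; [exact: dphi_cont|exact: max0_cont].
move=> s; apply: cvgM; last exact: cvg_cst.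
apply: cvgD; first exact: dPc.
apply: cvgM; first exact: cvg_cst.
by apply: continuous_cvg; [exact: dPc|apply: cvgN; exact: cvg_id].
Qed.

Lemma diffusion_rate_ge0 s : 0 <= diffusion_rate s.
Proof.
have dP0 r : 0 <= dP r by apply: dphi_ge0; rewrite le_max lexx orbT.
by rewrite divr_ge0// addr_ge0// mulr_ge0.
Qed.

Lemma Dfun_homo : {homo D : x y / x <= y}.
Proof.
move=> x y; rewrite le_eqVlt => /predU1P[->//|xy].
have [c _ E] := MVT_all xy Dfun_derive.
rewrite -subr_ge0 E mulr_ge0 ?subr_ge0 ?(ltW xy)// mulr_ge0//.
exact: diffusion_rate_ge0.
Qed.

(** Over [[0, b]] the integral of [D'] is [phi b], whatever [eps]. This makes [c = 0] a valid choice
    in the nondegeneracy condition of the boundary value problem, also for [eps = 0]. *)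
Lemma diffusion_rate_int b : 0 < b -> 0 < \int[mu]_(s in `[0, b]) diffusion_rate s.
Proof.
move=> b0; have Dc : continuous D by move=> x; exact: isd_cont (Dfun_derive x).
have ki : mu.-integrable `[0, b] (EFin \o diffusion_rate).
  by apply: continuous_integrable_cc; apply: continuous_subspaceT; exact: diffusion_rate_cont.
have E : 2 * \int[mu]_(s in `[0, b]) diffusion_rate s = phi b.
  rewrite -RintegralZl// (D_integral (a := 0) (b := b) diffusion_rate_cont Dfun_derive).
  - by rewrite /Dfun lexx (ltW b0) phi0 subr0.
  - by rewrite lexx ltW.
have : 0 < phi b by case: phi_adm => _ _ _ /(_ _ b0).
lra.
Qed.

End diffusion.

(** * Existence of a weak solution *)

Section existence_theorem.
Context {R : realType}.

Lemma test_strip_far (T J : R) (xi : R * R -> R) :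
  closure [set p | closed_strip T p /\ xi p != 0] `<=` [set p | 0 <= p.1 <= J /\ 0 <= p.2 <= T] ->
  forall p, closed_strip T p -> J < p.1 -> xi p = 0.
Proof.
move=> H p Cp Jp; apply/eqP/negPn/negP => xp.
have [] := H p (subset_closure (conj Cp xp)) => /andP[_].
by rewrite leNgt Jp.
Qed.

Theorem weak_solution_exists (T U0 V0 eps : R) (phi what : R -> R) :
  0 < T -> 0 < U0 -> 0 < V0 -> 0 <= eps -> admissible phi ->
  smooth_halfline what -> what 0 = U0 -> (forall x, 1 < x -> what x = - V0) ->
  exists w, weak_solution T (Dfun eps phi) (fun=> - V0) what w.
Proof.
move=> T0 U00 V00 eps0 adm ws w0 wf.
have kc : continuous (diffusion_rate eps phi) by exact: diffusion_rate_cont.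
have Dd (s : R) : is_derive s 1 (Dfun eps phi) (2 * diffusion_rate eps phi s) by exact: Dfun_derive.
have ab : - V0 < U0 by lra.
have kp : exists2 c, - V0 < c < U0 & 0 < \int[@lebesgue_measure R]_(y in `[c, U0]) diffusion_rate eps phi y.
  by exists 0; [rewrite U00 oppr_lt0 V00|exact: diffusion_rate_int].
have [f [Q [q [[fab fA] [[C QC] QA] [Qr DQ] [D2 Q2] [qi q0 qab fq Qq]]]]] :=
  profile_exists ab kc (diffusion_rate_ge0 eps0 adm) kp Dd.
exists (selfsim f); split.
- exact: (selfsim_Linfty T fab fA).
- exact: (selfsim_bochner T0 Dd kc
    (Dfun_homo eps0 adm) fab fA QC QA Qr DQ D2 Q2 ws w0 wf).
exists (selfsim_flux Q).
  exact: (selfsim_weak_dx T QC QA DQ).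
move=> xi [[xc [gx [gt [gxc gtc dxi]]]] xi0 xiT [J J0 /test_strip_far xiJ]].
have mf : measurable_fun setT f by exact: nonincreasing_measurable.
have mQ : measurable_fun setT Q by exact: nonincreasing_measurable.
have := selfsim_weak_identity T0 xc gxc gtc dxi xi0 xiT xiJ qi q0 qab fq Qq mf mQ fab QC.
move=> E; apply: etrans (etrans E _); first congr (_ + _).
  by apply: eq_Rintegral => p /set_mem Sp; have [_ [_ dt']] := dxi p Sp; rewrite /dt dt'.
by apply: eq_Rintegral => p /set_mem Sp; have [[_ dx'] _] := dxi p Sp; rewrite /dx dx'.
Qed.

End existence_theorem.

(** * Uniqueness *)

Section marginals.
Context d1 d2 (T1 : measurableType d1) (T2 : measurableType d2) (R : realType).
Variables (m1 : {sigma_finite_measure set T1 -> \bar R}) (m2 : {sigma_finite_measure set T2 -> \bar R}).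
Implicit Type f : T1 * T2 -> R.

(** Integrability is not assumed: Tonelli handles the positive and the negative part, and [fine] is
    measurable on the extended reals. *)
Lemma Rintegral_marginal_measurable f : measurable_fun setT f ->
  measurable_fun setT (fun x => \int[m2]_y f (x, y)).
Proof.
move=> mf; have me : measurable_fun setT (EFin \o f) by exact/measurable_EFinP.
rewrite (_ : (fun x => _) = fine \o (fun x => \int[m2]_y (f (x, y))%:E)%E)//.
apply: measurableT_comp => //.
rewrite (_ : (fun x => _) = (fun x => \int[m2]_y (EFin \o f)^\+ (x, y) - \int[m2]_y (EFin \o f)^\- (x, y))%E); last first.
  apply/funext => x; rewrite integralE; congr (_ - _)%E; apply: eq_integral => y _.
    by rewrite !funeposE.
  by rewrite !funenegE.
apply: emeasurable_funB.
  apply: (@measurable_fun_fubini_tonelli_F _ _ _ _ R m2 (funepos (EFin \o f))); [exact: measurable_funepos|by []].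
apply: (@measurable_fun_fubini_tonelli_F _ _ _ _ R m2 (funeneg (EFin \o f))); [exact: measurable_funeneg|by []].
Qed.

Lemma integrable_marginal1 f : (m1 \x m2)%E.-integrable setT (EFin \o f) ->
  m1.-integrable setT (EFin \o (fun x => \int[m2]_y f (x, y))).
Proof.
move=> fi; have /integrableP[mF] := integrable_fubini_F fi.
have mf : measurable_fun setT f by apply/measurable_EFinP; exact: measurable_int fi.
have mR := Rintegral_marginal_measurable mf.
move=> H; apply/integrableP; split; first exact/measurable_EFinP.
apply: le_lt_trans H; apply: ge0_le_integral => //.
- by apply: measurableT_comp => //; exact/measurable_EFinP.
- exact: measurableT_comp.
- move=> x _; rewrite /= /Rintegral /fubini_F; case: (integral _ _ _) => [r||] //=.
  1,2: by rewrite normr0 leey.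
Qed.

Lemma integrable_marginal2 f : (m1 \x m2)%E.-integrable setT (EFin \o f) ->
  m2.-integrable setT (EFin \o (fun y => \int[m1]_x f (x, y))).
Proof.
move=> fi; have mG := measurable_fubini_G fi.
have mf := measurable_int _ fi.
have mR : measurable_fun setT (fun y => \int[m1]_x f (x, y)) by exact: measurableT_comp mG.
have H : (\int[m2]_y \int[m1]_x `|(EFin \o f) (x, y)| < +oo)%E by apply/integrable21ltyP.
apply/integrableP; split; first exact/measurable_EFinP.
apply: le_lt_trans H; apply: ge0_le_integral => //.
- by apply: measurableT_comp => //; exact/measurable_EFinP.
- have mabs : measurable_fun setT (abse \o (EFin \o f)) by exact: measurableT_comp.
  exact: (@measurable_fun_fubini_tonelli_G _ _ _ _ R m1 _ mabs (fun=> abse_ge0 _)).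
- move=> y _.
  have := le_abse_integral m1 measurableT (measurableT_comp mf (pair2_measurable y)).
  rewrite /= /Rintegral; case: (integral _ _ _) => [r||] //= _.
  1,2: by rewrite normr0; exact: integral_ge0.
Qed.

End marginals.

(** * Smooth ramps and their piecewise linear limits *)

Section ramp.
Context {R : realType}.
Local Notation mu := (@lebesgue_measure R).
Implicit Types (x y t c : R) (n : nat).

(** A smooth substitute for the positive part of [x], from which it differs by at most [1]. *)
Definition ramp x : R := \int[mu]_(z in `[-1, x]) step z.

Lemma ramp_derive x : is_derive x 1 ramp (step x).
Proof.
apply: (is_derive_primitive_left0 (e := 0)) => //; first exact: smooth_continuous smooth_step.
by move=> y /ltW; exact: step_le0.
Qed.

Lemma smooth_ramp : smooth ramp.
Proof. by apply: smooth_primitive ramp_derive; exact: smooth_step. Qed.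

Lemma ramp_le0 x : x <= 0 -> ramp x = 0.
Proof.
move=> x0; rewrite /ramp -(@Rintegral_0 _ _ _ mu `[-1, x]); apply: eq_Rintegral => y /set_mem/=.
by rewrite in_itv/= => /andP[_ yx]; rewrite step_le0// (le_trans yx).
Qed.

Lemma ramp_bound x : Num.max x 0 - 1 <= ramp x <= Num.max x 0.
Proof.
have [x0|x0] := leP x 0; first by rewrite ramp_le0//; apply/andP; split; lra.
have r0 := ramp_le0 (lexx 0).
have [c /andP[c0 cx] E] := MVT_all x0 ramp_derive; rewrite r0 !subr0 in E.
have up : ramp x <= x by rewrite E ler_piMl ?step_le1// ltW.
rewrite up andbT; have [x1|x1] := leP x 1.
  by rewrite (@le_trans _ _ 0)//; [lra|rewrite E mulr_ge0 ?step_ge0// ltW].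
have [c1 /andP[c10 _] E1] := MVT_all x1 ramp_derive.
have [c2 _ E2] := MVT_all (ltr01 : 0 < 1 :> R) ramp_derive.
rewrite step_ge1 ?(ltW c10)// in E1; rewrite r0 !subr0 mulr1 in E2.
have := step_ge0 c2; lra.
Qed.

Lemma ramp_affine x c : 0 <= c -> c + 1 <= x -> ramp x - ramp (x - c) = c.
Proof.
rewrite le_eqVlt => /predU1P[<-|c0] cx; first by rewrite subr0 subrr.
have lt : x - c < x by lra.
have [e /andP[e1 e2] ->] := MVT_all lt ramp_derive; rewrite step_ge1; first by lra.
lra.
Qed.

(** The primitive of [step_itv] that vanishes to the left of [a]. The factor [1 / (n + 1)] undoes
    the dilation and shrinks the error of [ramp_bound], so the limit is the piecewise linear ramp
    between [a] and [b]. *)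
Definition ramp_itv n a b x : R :=
  (n.+1%:R)^-1 * (ramp (n.+1%:R * x + - (n.+1%:R * a)) - ramp (n.+1%:R * x + - (n.+1%:R * b))).

Lemma ramp_itv_derive n a b x : is_derive x 1 (ramp_itv n a b) (step_itv n a b x).
Proof.
apply: (is_derive_eq (isdZ _ (isdB (isd_affine (ramp_derive _)) (isd_affine (ramp_derive _))))).
by rewrite /step_itv -mulrBl mulrCA mulVf ?mulr1.
Qed.

Lemma smooth_ramp_itv n a b : smooth (ramp_itv n a b).
Proof.
by apply: smoothZ; apply: smoothB; apply: smooth_affine; exact: smooth_ramp.
Qed.

Lemma ramp_itv_far n a b x : a <= b -> b + 1 <= x -> ramp_itv n a b x = b - a.
Proof.
move=> ab bx; rewrite /ramp_itv.
have -> : n.+1%:R * x + - (n.+1%:R * b) = (n.+1%:R * x + - (n.+1%:R * a)) - n.+1%:R * (b - a) by ring.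
rewrite ramp_affine ?mulr_ge0 ?subr_ge0//; first by rewrite mulKf.
rewrite -mulrN -mulrDr -subr_ge0 (_ : _ - _ = n.+1%:R * (x - b) - 1); last by ring.
have : 1 <= n.+1%:R :> R by rewrite ler1n.
nra.
Qed.

Lemma ramp_itv_near n a b x : a <= b -> x <= a -> ramp_itv n a b x = 0.
Proof.
move=> ab xa; have H c : x <= c -> n.+1%:R * x + - (n.+1%:R * c) <= 0.
  by move=> xc; rewrite subr_le0 ler_wpM2l.
by rewrite /ramp_itv !ramp_le0 ?subr0 ?mulr0// H// (le_trans xa).
Qed.

Lemma ramp_itv_bound n a b x :
  `|ramp_itv n a b x - (Num.max (x - a) 0 - Num.max (x - b) 0)| <= n.+1%:R^-1.
Proof.
have n0 : 0 < n.+1%:R :> R by [].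
have H c : n.+1%:R * Num.max (x - c) 0 = Num.max (n.+1%:R * x + - (n.+1%:R * c)) 0.
  by rewrite maxr_pMr ?ltW// mulr0 mulrBr.
have -> : ramp_itv n a b x - (Num.max (x - a) 0 - Num.max (x - b) 0) =
    n.+1%:R^-1 * ((ramp (n.+1%:R * x + - (n.+1%:R * a)) - n.+1%:R * Num.max (x - a) 0) -
      (ramp (n.+1%:R * x + - (n.+1%:R * b)) - n.+1%:R * Num.max (x - b) 0)).
  by rewrite /ramp_itv !mulrBr !mulKf//; ring.
rewrite normrM gtr0_norm ?invr_gt0// ler_piMr ?invr_ge0// !H.
have /andP[A1 A2] := ramp_bound (n.+1%:R * x + - (n.+1%:R * a)).
have /andP[B1 B2] := ramp_bound (n.+1%:R * x + - (n.+1%:R * b)).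
by rewrite ler_norml; apply/andP; split; lra.
Qed.

Lemma ramp_itv_cvg a b x :
  ramp_itv n a b x @[n --> \oo] --> Num.max (x - a) 0 - Num.max (x - b) 0.
Proof.
apply/cvgrPdist_le => e e0.
have := @cvg_harmonic R => /cvgr_lt /(_ _ e0); apply: filterS => n /ltW ne.
by rewrite distrC; exact: le_trans (ramp_itv_bound n a b x) ne.
Qed.

End ramp.

(** * The flux accumulated in time *)

Section energy.
Context {R : realType}.
Local Notation mu := (@lebesgue_measure R).
Local Notation mu2 := (mu \x mu)%E.
Implicit Types (x y s t r tau J : R) (p : R * R) (n : nat).
Variables (T M : R) (z d g : R * R -> R).
Hypotheses (T0 : 0 < T)
  (mz : measurable_fun setT z) (md : measurable_fun setT d) (mg : measurable_fun setT g)
  (zM : forall p, `|z p| <= M)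
  (zS : forall p, ~ strip T p -> z p = 0) (dS : forall p, ~ strip T p -> d p = 0)
  (gS : forall p, ~ strip T p -> g p = 0)
  (d2 : mu2.-integrable setT (EFin \o (fun p => d p ^+ 2)))
  (g2 : mu2.-integrable setT (EFin \o (fun p => g p ^+ 2)))
  (gx2 : forall x, mu.-integrable setT (EFin \o (fun t => g (x, t) ^+ 2)))
  (zd_ge0 : forall p, 0 <= z p * d p) (zd_eq0 : forall p, z p * d p = 0 -> d p = 0)
  (dg : {ae mu, forall t, 0 < t < T ->
    {ae mu, forall x, 0 < x -> d (x, t) = prim (fun y => g (y, t)) x}})
  (weak : forall psi theta J, smooth psi -> smooth theta -> psi 0 = 0 ->
    (forall x, J <= x -> psi x = 0) -> theta T = 0 ->
    \int[mu2]_p (z p * (psi p.1 * derive1 theta p.2)) =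
    \int[mu2]_p (g p * (derive1 psi p.1 * theta p.2))).

Let mgx x : measurable_fun setT (fun s => g (x, s)).
Proof. exact: measurableT_comp mg (pair1_measurable x). Qed.
Let mgt t : measurable_fun setT (fun y => g (y, t)).
Proof. exact: measurableT_comp mg (pair2_measurable t). Qed.
Let mzt t : measurable_fun setT (fun y => z (y, t)).
Proof. exact: measurableT_comp mz (pair2_measurable t). Qed.

Let sq_integrable_cc (h : R -> R) a b : measurable_fun setT h ->
  mu.-integrable setT (EFin \o (fun s => h s ^+ 2)) -> mu.-integrable `[a, b] (EFin \o h).
Proof.
move=> mh hi; apply: (@mu_integrable_dom R _ _ (fun s => 1 + h s ^+ 2)) => //.
- exact: measurable_funTS.
- apply: integrable_add => //.
    by apply: (@integrable_bnd _ _ R mu _ _ 1) => // [|? _]; [exact: lebesgue_itv_lty|rewrite normr1].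
  by apply: integrableS hi.
- by move=> s _; rewrite ler_norml; apply/andP; split; nra.
Qed.

Let gx_int x a b : mu.-integrable `[a, b] (EFin \o (fun s => g (x, s))).
Proof. exact: sq_integrable_cc. Qed.

Let gam x := \int[mu]_t (g (x, t) ^+ 2).
(** The flux accumulated up to time [t]. Integrating the equation in time will make it, up to a
    constant, the primitive [Z] of [z (., t)]. *)
Let G x t := prim (fun s => g (x, s)) t.
Let Z y t := prim (fun y => z (y, t)) y.

Let gam_ge0 x : 0 <= gam x.
Proof. by apply: Rintegral_ge0 => s _; exact: sqr_ge0. Qed.

Let gam_int : mu.-integrable setT (EFin \o gam).
Proof. exact: (integrable_marginal1 g2). Qed.

Let indic_integral a b : a <= b -> \int[mu]_s (\1_(`]a, b]) s : R) = b - a.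
Proof. by move=> ab; rewrite /Rintegral integral_indic// setIT; exact: fine_mu_oc. Qed.

(* [2 r |g| <= r^2 + g^2] under the integral. *)
Let G_mul_bound x t r : 0 <= r -> `|G x t| * r <= (T * r ^+ 2 + gam x) / 2.
Proof.
move=> r0; have [t0|t0] := leP t 0.
  by rewrite /G prim_le0// normr0 mul0r divr_ge0// addr_ge0// mulr_ge0 ?sqr_ge0// ltW.
have gi : mu.-integrable `[0, t] (EFin \o (fun s => `|g (x, s)|)).
  by apply: (mu_integrable_dom _ _ (integrable_norm (gx_int x 0 t))) => //; [apply: measurableT_comp; exact: measurable_funTS|move=> s _; rewrite normr_id].
pose h s := (r ^+ 2 * \1_(`]0, T]) s + g (x, s) ^+ 2) / 2.
have hi : mu.-integrable setT (EFin \o h).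
  apply: mu_integrable_scaler => //; apply: integrable_add => //.
  by apply: mu_integrable_scale => //; exact: integrable_indic_oc.
have hE : \int[mu]_s h s = (T * r ^+ 2 + gam x) / 2.
  rewrite /h RintegralZr//; last first.
    by apply: integrable_add => //; apply: mu_integrable_scale => //; exact: integrable_indic_oc.
  rewrite RintegralD//; last by apply: mu_integrable_scale => //; exact: integrable_indic_oc.
  rewrite RintegralZl//; last exact: integrable_indic_oc.
  by rewrite indic_integral ?ltW// subr0 (mulrC (r ^+ 2)).
apply: (le_trans (ler_wpM2r r0 (prim_bound (ltW t0) (gx_int x 0 t)))).
rewrite -hE /prim -RintegralZr//.
rewrite [leLHS]Rintegral_mkcond; apply: le_Rintegral => //.
  apply: integrable_restrictT => //; exact: mu_integrable_scaler.
move=> s _; rewrite patchE; case: ifPn => [_|_]; last first.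
  by rewrite /h divr_ge0// addr_ge0 ?sqr_ge0// mulr_ge0 ?sqr_ge0.
rewrite /h indicE; have [|sT] := boolP (s \in `]0, T]%classic) => [_|]; last first.
  rewrite gS ?normr0 ?mul0r ?mulr0 ?add0r ?divr_ge0 ?sqr_ge0//= => -[_ /andP[s0 s1]].
  by move/negP: sT; apply; rewrite inE/= in_itv/= s0 ltW.
rewrite mulr1 -[g (x, s) ^+ 2]real_normK ?num_real//.
by have := sqr_ge0 (r - `|g (x, s)|); nra.
Qed.

Let G_bound x t : `|G x t| <= (T + gam x) / 2.
Proof. by have := G_mul_bound x t ler01; rewrite mulr1 expr1n mulr1. Qed.

(** [G] is the integral over [s] of a measurable function of [((x, t), s)], restricted to
    [0 < s < t] by indicators. *)
Let mG : measurable_fun setT (fun p => G p.1 p.2).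
Proof.
pose F (w : (R * R) * R) := \1_[set w : (R * R) * R | 0 < w.2] w * (\1_[set w : (R * R) * R | w.2 < w.1.2] w * g (w.1.1, w.2)).
have m11 : measurable_fun setT (fun w : (R * R) * R => w.1.1) by exact: measurableT_comp measurable_fst measurable_fst.
have m12 : measurable_fun setT (fun w : (R * R) * R => w.1.2) by exact: measurableT_comp measurable_snd measurable_fst.
have mF : measurable_fun setT F.
  apply: measurable_funM; first by apply: measurable_indic; exact: measurable_lt_set.
  apply: measurable_funM; first by apply: measurable_indic; exact: measurable_lt_set.
  by apply: (measurableT_comp mg); exact: measurable_fun_pair.
have := @Rintegral_marginal_measurable _ _ _ _ R mu F mF.
congr (measurable_fun _ _); apply/funext => -[x t]; rewrite /G /prim /=.
rewrite -Rintegral_itv_obnd_cbnd; last first.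
  by apply: integrableS (gx_int x 0 t) => //; apply: subset_itvr; rewrite bnd_simp.
rewrite -Rintegral_itv_bndo_bndc; last first.
  by apply: integrableS (gx_int x 0 t) => //; apply: subset_itv; rewrite bnd_simp.
rewrite [RHS]Rintegral_mkcond; apply: eq_Rintegral => s _.
rewrite /F patchE !indicE.
have [|] := boolP (s \in `]0, t[%classic) => [/set_mem/=|/negP st].
  by rewrite in_itv/= => /andP[s0 st]; rewrite !mem_set// !mul1r.
have [s0|s0] := ltP 0 s; last by rewrite memNset ?mul0r//= => /lt_le_trans/(_ s0); rewrite ltxx.
have [st'|st'] := ltP s t; last first.
  have -> : (((x, t), s) \in [set w : (R * R) * R | w.2 < w.1.2]) = false.
    by apply: memNset => /= /lt_le_trans/(_ st'); rewrite ltxx.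
  by rewrite mul0r mulr0.
by exfalso; apply: st; rewrite inE/= in_itv/= s0.
Qed.

Let fine_mu_cc (c e : R) : c <= e -> fine (mu `[c, e]%classic) = e - c.
Proof.
move=> ce; rewrite lebesgue_measure_itv/= lte_fin; move: ce; rewrite le_eqVlt => /predU1P[->|->].
  by rewrite ltxx subrr.
by rewrite -EFinB.
Qed.

Let box_integrable (J : R) (u : R -> R) : mu.-integrable setT (EFin \o u) ->
  mu2.-integrable setT (EFin \o (fun p => u p.1 * \1_(`]0, T]) p.2)).
Proof.
move=> ui; apply: (@integrable_tensor _ _ _ _ R mu mu u (\1_(`]0, T]))) => //.
exact: integrable_indic_oc.
Qed.

(** [G_mul_bound] with [r = |h p|]. The majorant combines [h^2] with [gam], which is integrable in
    [x] and enters on a bounded time interval only. *)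
Let Gd_dominated (h : R * R -> R) : measurable_fun setT h -> (forall p, ~ strip T p -> h p = 0) ->
  mu2.-integrable setT (EFin \o (fun p => h p ^+ 2)) ->
  exists2 E : R * R -> R, mu2.-integrable setT (EFin \o E) &
    forall p, `|G p.1 p.2 * h p| <= E p.
Proof.
move=> mh hS h2; exists (fun p => 2^-1 * (T * h p ^+ 2 + gam p.1 * \1_(`]0, T]) p.2)).
  apply: integrable_scale => //; apply: integrable_add => //; first exact: integrable_scale.
  exact: (box_integrable T gam_int).
move=> p; have [Sp|nS] := pselect (strip T p); last first.
  rewrite hS// mulr0 normr0 mulr_ge0// addr_ge0// mulr_ge0 ?sqr_ge0 ?gam_ge0 ?ler0n//; exact: ltW.
rewrite indicE mem_set/= ?in_itv/=; last by case: Sp => _ /andP[-> /ltW].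
rewrite mulr1 normrM; have := G_mul_bound p.1 p.2 (normr_ge0 (h p)).
by rewrite real_normK ?num_real// [2^-1 * _]mulrC.
Qed.

(** Two ramps of the same height [x], one of slope [1] on [[0, x]], the other of slope [x] on
    [[0, 1]]; their difference vanishes at [0] and far away. Testing with it compares the integral
    over [[0, x]] with [x] times the integral over [[0, 1]], which detects constants. *)
Let psiL x y : R := (Num.max (y - 0) 0 - Num.max (y - x) 0) - x * (Num.max (y - 0) 0 - Num.max (y - 1) 0).
Let rhoL x y : R := \1_(`]0, x]) y - x * \1_(`]0, 1]) y.
(** For [tau <= T] this is the positive part of [tau - t] on [[0, T]]: it vanishes at [T] and has
    slope [- 1] up to [tau]. *)
Let thL tau t : R := (Num.max (T - 0) 0 - Num.max (T - tau) 0) - (Num.max (t - 0) 0 - Num.max (t - tau) 0).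

Let dct2 (F : nat -> R * R -> R) (f h : R * R -> R) : (forall n, measurable_fun setT (F n)) ->
  measurable_fun setT f -> mu2.-integrable setT (EFin \o h) ->
  (forall p, F n p @[n --> \oo] --> f p) -> (forall n p, `|F n p| <= h p) ->
  \int[mu2]_p F n p @[n --> \oo] --> \int[mu2]_p f p.
Proof.
move=> mF mf hi Ff Fh; apply: (@Rintegral_dct _ _ R mu2 setT F f h) => //.
by apply: aeW => p _; exact: Ff.
Qed.

Let ramp_itv_le n x y : 0 <= x -> `|ramp_itv n 0 x y| <= x + 1.
Proof.
move=> x0; have H := ramp_itv_bound n 0 x y.
have n1 : n.+1%:R^-1 <= 1 :> R by rewrite invf_le1// ler1n.
have : 0 <= Num.max (y - 0) 0 - Num.max (y - x) 0 <= x.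
  by have [a1|a1] := leP (y - 0) 0; have [a2|a2] := leP (y - x) 0; apply/andP; split; lra.
have {}H := le_trans H n1; move: H; set m := Num.max _ _ - _; rewrite !ler_norml => /andP[H1 H2] /andP[H3 H4]; apply/andP; split; lra.
Qed.

Let box_integrable2 (K C : R) : mu2.-integrable setT
  (EFin \o (fun p : R * R => C * (\1_(`]0, K]) p.1 * \1_(`]0, T]) p.2))).
Proof. by apply: integrable_scale => //; apply: (box_integrable T); exact: integrable_indic_oc. Qed.

Let box_dominated (h : R * R -> R) (u v : R -> R) (K A B : R) : (forall p, ~ strip T p -> h p = 0) ->
  (forall y, y <= 0 \/ K <= y -> u y = 0) -> (forall y, `|u y| <= A) -> (forall t, `|v t| <= B) ->
  forall p, `|h p * (u p.1 * v p.2)| <= `|h p| * (A * B * (\1_(`]0, K]) p.1 * \1_(`]0, T]) p.2)).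
Proof.
move=> hS u0 uA vB [y t] /=; have A0 := le_trans (normr_ge0 _) (uA 0); have B0 := le_trans (normr_ge0 _) (vB 0).
have [Sp|nS] := pselect (strip T (y, t)); last by rewrite hS// mul0r normr0 mul0r.
rewrite normrM ler_wpM2l//; rewrite [in leRHS]indicE; have [|/negP yK] := boolP (y \in `]0, K]%classic) => [_|]; last first.
    rewrite u0 ?mul0r ?normr0 ?mulr0//; have [|y0] := leP y 0; [by left|right].
    by rewrite leNgt; apply/negP => yK'; apply: yK; rewrite inE/= in_itv/= y0 ltW.
  rewrite indicE mem_set/=; last by case: Sp => /= _ /andP[t0 tT]; rewrite in_itv/= t0 ltW.
  by rewrite !mulr1 normrM ler_pM.
Qed.

(** [ramp_itv] and [step_itv] approximate the limit test functions pointwise and boundedly; the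
    factors in [x] are supported in a fixed interval and the data in the strip, so dominated
    convergence applies on both sides. *)
Let weak_limit x tau : 0 < x -> 0 < tau <= T ->
  \int[mu2]_p (z p * (psiL x p.1 * - \1_(`]0, tau]) p.2)) =
  \int[mu2]_p (g p * (rhoL x p.1 * thL tau p.2)).
Proof.
move=> x0 /andP[tau0 tauT]; have x0' := ltW x0; have tau0' := ltW tau0.
pose psi n y := ramp_itv n 0 x y - x * ramp_itv n 0 1 y.
pose rho n y := step_itv n 0 x y - x * step_itv n 0 1 y.
pose th n t := ramp_itv n 0 tau T - ramp_itv n 0 tau t.
have dpsi n y : is_derive y 1 (psi n) (rho n y).
  exact: isdB (ramp_itv_derive _ _ _ _) (isdZ _ (ramp_itv_derive _ _ _ _)).
have dth n t : is_derive t 1 (th n) (- step_itv n 0 tau t).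
  by apply: (is_derive_eq (isdB (isd_cst _ _) (ramp_itv_derive n 0 tau t))); rewrite sub0r.
have W n : \int[mu2]_p (z p * (psi n p.1 * - step_itv n 0 tau p.2)) = \int[mu2]_p (g p * (rho n p.1 * th n p.2)).
  have := @weak (psi n) (th n) (x + 2).
  have -> : derive1 (psi n) = rho n by apply/funext => y; exact: isd_derive1.
  have -> : derive1 (th n) = (fun t => - step_itv n 0 tau t) by apply/funext => y; exact: isd_derive1.
  apply.
  - by apply: smoothB; [exact: smooth_ramp_itv|apply: smoothZ; exact: smooth_ramp_itv].
  - by apply: smoothB; [exact: smooth_cst|exact: smooth_ramp_itv].
  - by rewrite /psi !ramp_itv_near// mulr0 subrr.
  - move=> y xy; rewrite /psi !ramp_itv_far//; try lra.
  - by rewrite /th subrr.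
have psi0 n y : y <= 0 \/ x + 2 <= y -> psi n y = 0.
  move=> [y0|xy]; first by rewrite /psi !ramp_itv_near// mulr0 subrr.
  rewrite /psi !ramp_itv_far//; lra.
have rho0 n y : y <= 0 \/ x + 2 <= y -> rho n y = 0.
  by move=> yx; rewrite /rho !step_itv_eq0 ?mulr0 ?subrr//; move: yx => [|yx]; [by left|by right; lra|by left|by right; lra].
have psiB n y : `|psi n y| <= x + 1 + x * 2.
  apply: le_trans (ler_normB _ _) _; apply: lerD; first exact: ramp_itv_le.
  by rewrite normrM ger0_norm// ler_wpM2l//; have := ramp_itv_le n y ler01; lra.
have rhoB n y : `|rho n y| <= 1 + x.
  apply: le_trans (ler_normB _ _) _; apply: lerD; first exact: step_itv_bound.
  by rewrite normrM ger0_norm// ler_piMr// step_itv_bound.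
have thB n t : `|th n t| <= (tau + 1) + (tau + 1).
  by apply: le_trans (ler_normB _ _) _; apply: lerD; exact: ramp_itv_le.
have m1 (u : R -> R) : measurable_fun setT u -> measurable_fun setT (fun p : R * R => u p.1).
  by move=> mu'; exact: measurableT_comp measurable_fst.
have m2 (u : R -> R) : measurable_fun setT u -> measurable_fun setT (fun p : R * R => u p.2).
  by move=> mu'; exact: measurableT_comp measurable_snd.
have mramp n a' b' : measurable_fun setT (ramp_itv n a' b' : R -> R).
  by apply: continuous_measurable_fun; exact: smooth_continuous (smooth_ramp_itv n a' b').
have mstep n a' b' : measurable_fun setT (step_itv n a' b' : R -> R) by exact: measurable_step_itv.
have mpsi n : measurable_fun setT (psi n) by apply: measurable_funB => //; exact: measurable_funM.
have mrho n : measurable_fun setT (rho n) by apply: measurable_funB => //; exact: measurable_funM.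
have mth n : measurable_fun setT (th n) by exact: measurable_funB.
have mmax (c : R) : measurable_fun setT (fun y : R => Num.max (y - c) 0).
  by apply: measurable_maxr => //; exact: measurable_funB.
have c1 : \int[mu2]_p (z p * (psi n p.1 * - step_itv n 0 tau p.2)) @[n --> \oo] -->
    \int[mu2]_p (z p * (psiL x p.1 * - \1_(`]0, tau]) p.2)).
  apply: (@dct2 _ _ (fun p => M * ((x + 1 + x * 2) * 1 * (\1_(`]0, x + 2]) p.1 * \1_(`]0, T]) p.2)))).
  - move=> n; apply: measurable_funM => //; apply: measurable_funM; first exact: m1.
    by apply: (m2 (fun t => - step_itv n 0 tau t)); exact: measurableT_comp.
  - apply: measurable_funM => //; apply: measurable_funM.
      apply: (m1 (psiL x)); apply: measurable_funB; first exact: measurable_funB.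
      by apply: measurable_funM => //; exact: measurable_funB.
    by apply: (m2 (fun t => - \1_(`]0, tau]) t)); apply: measurableT_comp => //; exact: measurable_indic.
  - by apply: integrable_scale => //; exact: box_integrable2.
  - move=> p; apply: cvgM; first exact: cvg_cst.
    apply: cvgM; last by apply: cvgN; exact: step_itv_cvg.
    apply: cvgB; first exact: ramp_itv_cvg.
    by apply: cvgM; [exact: cvg_cst|exact: ramp_itv_cvg].
  - move=> n p.
    have sB t : `|- step_itv n 0 tau t| <= 1 by rewrite normrN; exact: step_itv_bound.
    apply: le_trans (box_dominated zS (psi0 n) (psiB n) sB p) _.
    by rewrite ler_wpM2r// !mulr_ge0//; lra.
have c2 : \int[mu2]_p (g p * (rho n p.1 * th n p.2)) @[n --> \oo] -->
    \int[mu2]_p (g p * (rhoL x p.1 * thL tau p.2)).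
  have C0 : 0 <= (1 + x) * ((tau + 1) + (tau + 1)) by rewrite mulr_ge0// !addr_ge0.
  pose C := (1 + x) * ((tau + 1) + (tau + 1)).
  apply: (@dct2 _ _ (fun p => C * (\1_(`]0, x + 2]) p.1 * \1_(`]0, T]) p.2) + C * g p ^+ 2)).
  - by move=> n; apply: measurable_funM => //; apply: measurable_funM; [exact: (m1 (rho n))|exact: (m2 (th n))].
  - apply: measurable_funM => //; apply: measurable_funM.
      by apply: (m1 (rhoL x)); apply: measurable_funB => //; apply: measurable_funM.
    by apply: (m2 (thL tau)); apply: measurable_funB => //; exact: measurable_funB.
  - by apply: integrable_add => //; (exact: box_integrable2 || exact: integrable_scale).
  - move=> p; apply: cvgM; first exact: cvg_cst.
    apply: cvgM.
      apply: cvgB; first exact: step_itv_cvg.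
      by apply: cvgM; [exact: cvg_cst|exact: step_itv_cvg].
    by apply: cvgB; exact: ramp_itv_cvg.
  - move=> n p; apply: le_trans (box_dominated gS (rho0 n) (rhoB n) (thB n) p) _.
    rewrite -/C; set b := _ * \1__ _; have b01 : 0 <= b <= 1.
      by rewrite /b !indicE; do 2 case: (_ \in _); rewrite ?mulr1 ?mulr0 ?lexx ?ler01.
    have := sqr_ge0 (`|g p| - 1); rewrite -[g p ^+ 2]real_normK ?num_real//.
    have := normr_ge0 (g p); set r := `|g p| => r0 sq; case/andP: b01 => b0 b1.
    rewrite mulrCA -mulrDr ler_wpM2l//; nra.
have W' : (fun n => \int[mu2]_p (z p * (psi n p.1 * - step_itv n 0 tau p.2))) =
    (fun n => \int[mu2]_p (g p * (rho n p.1 * th n p.2))) by apply/funext.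
by rewrite W' in c1; exact: cvg_unique c1 c2.
Qed.

Let prim_indic_min c y : 0 <= c -> 0 <= y -> prim (\1_(`]0, c]) : R -> R) y = Num.min c y.
Proof.
move=> c0 y0; rewrite /prim -Rintegral_itv_obnd_cbnd; last first.
  by apply: (@integrableS _ _ _ _ setT) => //; exact: integrable_indic_oc.
rewrite /Rintegral integral_indic//= (_ : _ `&` _ = `]0, Num.min c y]%classic); last first.
  apply/seteqP; split => s /=; rewrite !in_itv/=; first by move=> [/andP[-> sc] /andP[_ sy]]; rewrite le_min sc sy.
  by move=> /andP[-> sm]; move: sm; rewrite le_min => /andP[-> ->].
by apply: etrans (fine_mu_oc _) _; rewrite ?subr0// le_min c0 y0.
Qed.

Let rhoL_int x J : mu.-integrable `[0, J] (EFin \o rhoL x).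
Proof.
apply: (@integrableS _ _ _ _ setT) => //; apply: integrable_sub => //; first exact: integrable_indic_oc.
by apply: mu_integrable_scale => //; exact: integrable_indic_oc.
Qed.

Let prim_rhoL x y : 0 <= x -> 0 <= y -> prim (rhoL x) y = psiL x y.
Proof.
move=> x0 y0; rewrite /rhoL primB; last 2 first.
- by apply: (@integrableS _ _ _ _ setT) => //; exact: integrable_indic_oc.
- apply: (@integrableS _ _ _ _ setT) => //; apply: mu_integrable_scale => //; exact: integrable_indic_oc.
rewrite [X in _ - X = _](_ : _ = x * prim (\1_(`]0, 1]) : R -> R) y); last first.
  rewrite /prim RintegralZl//; apply: (@integrableS _ _ _ _ setT) => //; exact: integrable_indic_oc.
rewrite !prim_indic_min// /psiL subr0 (max_idPl y0).
congr (_ - x * _).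
  by have [|] := leP x y; have [|] := leP (y - x) 0; lra.
by have [|] := leP 1 y; have [|] := leP (y - 1) 0; lra.
Qed.

Let zt_int t J : mu.-integrable `[0, J] (EFin \o (fun y => z (y, t))).
Proof.
apply: (@integrable_bnd _ _ R mu _ _ M) => //; first exact: lebesgue_itv_lty.
exact: measurable_funTS (mzt t).
Qed.

Let G_int t J : mu.-integrable `[0, J] (EFin \o (fun y => G y t)).
Proof.
apply: (@mu_integrable_dom R _ _ (fun y => (T + gam y) / 2)) => //.
- by apply: measurable_funTS; exact: measurableT_comp mG (pair2_measurable t).
- apply: mu_integrable_scaler => //; apply: integrable_add => //.
    by apply: (@integrable_bnd _ _ R mu _ _ `|T|) => //; exact: lebesgue_itv_lty.
  exact: integrableS gam_int.
Qed.

Let Z_int t J : mu.-integrable `[0, J] (EFin \o (fun y => Z y t)).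
Proof.
have [J0|J0] := leP 0 J; last by rewrite set_itv_ge ?bnd_simp -?ltNge//; exact: integrable_set0.
apply: continuous_integrable_cc; apply: prim_continuous => //; exact: zt_int.
Qed.

(** The pairing of [G - Z] with [rhoL x]; if it vanishes for all [x > 0], then [G - Z] is almost
    everywhere constant in [y]. *)
Let Phi x t := \int[mu]_(y in `[0, x]) (G y t - Z y t) - x * \int[mu]_(y in `[0, 1]) (G y t - Z y t).

Let rhoL_mul (h : R -> R) x J : 0 < x -> x <= J -> 1 <= J -> mu.-integrable `[0, J] (EFin \o h) ->
  \int[mu]_(y in `[0, J]) (rhoL x y * h y) = \int[mu]_(y in `[0, x]) h y - x * \int[mu]_(y in `[0, 1]) h y.
Proof.
move=> x0 xJ J1 hi.
have part c : 0 <= c -> c <= J -> mu.-integrable `[0, J] (EFin \o (fun y => \1_(`]0, c]) y * h y)) /\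
    \int[mu]_(y in `[0, J]) (\1_(`]0, c]) y * h y) = \int[mu]_(y in `[0, c]) h y.
  move=> c0 cJ; split.
    apply: (mu_integrable_dom _ _ (integrable_norm hi)) => //.
      by apply: measurable_funM; [apply: measurable_funTS; exact: measurable_indic|apply/measurable_EFinP; exact: measurable_int hi].
    by move=> y _; rewrite normrM ler_piMl// indicE; case: (_ \in _); rewrite ?normr1 ?normr0.
  have hc : mu.-integrable `]0, c] (EFin \o h).
    by apply: integrableS hi => //; apply: subset_itv; rewrite bnd_simp.
  rewrite -[RHS]Rintegral_itv_obnd_cbnd// [LHS]Rintegral_mkcond [RHS]Rintegral_mkcond; apply: eq_Rintegral => y _.
  rewrite !patchE indicE; have [|_] := boolP (y \in `]0, c]%classic); last by rewrite mul0r; case: ifP.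
  by move=> /set_mem/=; rewrite in_itv/= => /andP[y0 yc]; rewrite mul1r mem_set//= in_itv/= ltW// (le_trans yc).
have [i1 E1] := part x (ltW x0) xJ; have [i2 E2] := part 1 ler01 J1.
transitivity (\int[mu]_(y in `[0, J]) (\1_(`]0, x]) y * h y - x * (\1_(`]0, 1]) y * h y))).
  by apply: eq_Rintegral => y _; rewrite /rhoL; ring.
by rewrite RintegralB ?RintegralZl ?E1 ?E2//; exact: mu_integrable_scale.
Qed.

Let z_psi x t J : 0 < x -> x + 1 <= J ->
  \int[mu]_y (z (y, t) * psiL x y) = - \int[mu]_(y in `[0, J]) (rhoL x y * Z y t).
Proof.
move=> x0 xJ.
have J0 : 0 <= J by lra.
have psiJ y : J <= y -> psiL x y = 0.
  move=> Jy; rewrite /psiL !(max_idPl _); lra.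
have psi0 y : y <= 0 -> psiL x y = 0.
  move=> Jy; rewrite /psiL !(max_idPr _); lra.
have := prim_ibp (zt_int t J) (rhoL_int x J); rewrite (prim_rhoL (ltW x0) J0) (psiJ _ (lexx J)) mulr0 sub0r.
move=> E; transitivity (- \int[mu]_(x0 in `[0, J]) (prim (fun y => z (y, t)) x0 * rhoL x x0)); last first.
  by congr (- _); apply: eq_Rintegral => y _; rewrite mulrC.
rewrite -E [RHS]Rintegral_mkcond; apply: eq_Rintegral => y _; rewrite patchE.
have [|nJ] := boolP (y \in `[0, J]%classic) => [/set_mem/=|]; first by rewrite in_itv/= => /andP[y0 _]; rewrite (prim_rhoL (ltW x0) y0).
have [y0|y0] := leP y 0; first by rewrite psi0// mulr0.
have [Jy|Jy] := leP J y; first by rewrite psiJ// mulr0.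
by exfalso; move/negP: nJ; apply; rewrite inE/= in_itv/= !ltW.
Qed.

(** Integration by parts in time: the linear decay of [thL tau] turns [g] into the integral of its
    primitive. *)
Let g_th x tau : 0 < tau <= T -> \int[mu]_t (g (x, t) * thL tau t) = \int[mu]_(t in `[0, tau]) G x t.
Proof.
move=> /andP[tau0 tauT].
have c1 : mu.-integrable `[0, tau] (EFin \o (cst (1 : R))).
  by apply: (@integrable_bnd _ _ R mu _ _ 1) => // [|? _]; [exact: lebesgue_itv_lty|rewrite normr1].
have p1 t : 0 <= t -> prim (cst 1) t = t.
  move=> t0; rewrite /prim -Rintegral_itv_obnd_cbnd; last first.
    by apply: (@integrable_bnd _ _ R mu _ _ 1) => // [|? _]; [exact: lebesgue_oc_lty|rewrite normr1].
  rewrite Rintegral_cst//= mul1r; apply: etrans (fine_mu_oc t0) _; exact: subr0.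
have := prim_ibp c1 (gx_int x 0 tau); rewrite p1 ?ltW// => E.
transitivity (\int[mu]_(t in `[0, tau]) (1 * prim (fun s => g (x, s)) t)); last first.
  by apply: eq_Rintegral => t _; rewrite mul1r.
have gi' : mu.-integrable `[0, tau] (EFin \o (fun t => t * g (x, t))).
  apply: (mu_integrable_dom _ _ (mu_integrable_scale tau _ (integrable_norm (gx_int x 0 tau)))) => //.
    by apply: measurable_funM => //; exact: measurable_funTS.
  by move=> t; rewrite /= in_itv/= => /andP[t0 tt]; rewrite normrM ger0_norm// ler_wpM2r.
rewrite E /prim -RintegralZl//.
rewrite [X in _ - X](_ : _ = \int[mu]_(t in `[0, tau]) (t * g (x, t))); last first.
  by apply: eq_Rintegral => t /set_mem/=; rewrite in_itv/= => /andP[t0 _]; rewrite -[X in X * _]/(prim (cst 1) t) p1.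
rewrite -RintegralB//; last exact: mu_integrable_scale.
rewrite [RHS]Rintegral_mkcond; apply: eq_Rintegral => t _; rewrite patchE.
have [Sp|nS] := pselect (strip T (x, t)); last by rewrite gS// !mulr0 mul0r subrr; case: ifP.
case: Sp => /= _ /andP[t0 tT].
rewrite /thL !subr0 (max_idPl (ltW T0)) (max_idPl (ltW t0)) (max_idPl (_ : 0 <= T - tau)) ?subr_ge0//.
have [|] := boolP (t \in `[0, tau]%classic) => [/set_mem/=|/negP nt].
  by rewrite in_itv/= => /andP[_ tt]; rewrite (max_idPr _) ?subr_le0//; ring.
have tt : tau < t by rewrite ltNge; apply/negP => tt; apply: nt; rewrite inE/= in_itv/= tt ltW.
rewrite (max_idPl _) ?subr_ge0 ?ltW//; rewrite (_ : point = 0)//; ring.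
Qed.

Let max_diff c y : 0 <= c -> 0 <= Num.max (y - 0) 0 - Num.max (y - c) 0 <= c.
Proof.
by move=> c0; have [a1|a1] := leP (y - 0) 0; have [a2|a2] := leP (y - c) 0; apply/andP; split; lra.
Qed.

Let psiL_far x y : 0 < x -> y <= 0 \/ x + 2 <= y -> psiL x y = 0.
Proof.
move=> x0 [y0|yx]; first by rewrite /psiL !(max_idPr _); lra.
by rewrite /psiL !(max_idPl _); lra.
Qed.

Let psiL_bound x y : 0 < x -> `|psiL x y| <= x + x.
Proof.
move=> x0; have /andP[a1 a2] := max_diff y (ltW x0); have /andP[b1 b2] := max_diff y ler01.
by rewrite /psiL ler_norml; apply/andP; split; nra.
Qed.

Let rhoL_far x y : 0 < x -> y <= 0 \/ x + 2 <= y -> rhoL x y = 0.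
Proof.
move=> x0 yx; rewrite /rhoL !indicE !memNset ?mulr0 ?subrr//= in_itv/= => /andP[y1 y2]; case: yx; lra.
Qed.

Let rhoL_bound x y : 0 < x -> `|rhoL x y| <= 1 + x.
Proof.
move=> x0; apply: le_trans (ler_normB _ _) _; rewrite normrM (gtr0_norm x0) !indicE.
by do 2 case: (_ \in _); rewrite ?normr1 ?normr0; lra.
Qed.

Let rhoL_measurable x : measurable_fun setT (rhoL x).
Proof. by apply: measurable_funB => //; exact: measurable_funM. Qed.

Let FZ x tau p := z p * (psiL x p.1 * - \1_(`]0, tau]) p.2).
Let Fg x tau p := g p * (rhoL x p.1 * thL tau p.2).
Let FG x tau p := rhoL x p.1 * (\1_(`]0, tau]) p.2 * G p.1 p.2).

Let m1 (u : R -> R) : measurable_fun setT u -> measurable_fun setT (fun p : R * R => u p.1).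
Proof. by move=> mu'; exact: measurableT_comp measurable_fst. Qed.
Let m2 (u : R -> R) : measurable_fun setT u -> measurable_fun setT (fun p : R * R => u p.2).
Proof. by move=> mu'; exact: measurableT_comp measurable_snd. Qed.
Let mmax (c : R) : measurable_fun setT (fun y : R => Num.max (y - c) 0).
Proof. by apply: measurable_maxr => //; exact: measurable_funB. Qed.

Let thL_bound tau t : 0 < tau -> `|thL tau t| <= tau + tau.
Proof.
move=> tau0; apply: le_trans (ler_normB _ _) _; apply: lerD.
  by have /andP[b1 b2] := max_diff T (ltW tau0); rewrite ger0_norm.
by have /andP[b1 b2] := max_diff t (ltW tau0); rewrite ger0_norm.
Qed.

Let mFZ x tau : measurable_fun setT (FZ x tau).
Proof.
apply: measurable_funM => //; apply: measurable_funM.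
  apply: (@m1 (psiL x)); apply: measurable_funB; first exact: measurable_funB.
  by apply: measurable_funM => //; exact: measurable_funB.
by apply: (@m2 (fun t => - \1_(`]0, tau]) t)); apply: measurableT_comp => //; exact: measurable_indic.
Qed.

Let mFg x tau : measurable_fun setT (Fg x tau).
Proof.
apply: measurable_funM => //; apply: measurable_funM; first exact: (@m1 (rhoL x)).
by apply: (@m2 (thL tau)); apply: measurable_funB => //; exact: measurable_funB.
Qed.

Let mFG x tau : measurable_fun setT (FG x tau).
Proof.
apply: measurable_funM; first exact: (@m1 (rhoL x)).
by apply: measurable_funM => //; apply: (@m2 (\1_(`]0, tau]))); exact: measurable_indic.
Qed.

Let FZ_int x tau : 0 < x -> mu2.-integrable setT (EFin \o FZ x tau).
Proof.
move=> x0; apply: (@integrable_dom _ _ R mu2 setT _ (fun p => M * ((x + x) * 1 * (\1_(`]0, x + 2]) p.1 * \1_(`]0, T]) p.2)))) => //.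
- exact: mFZ.
- by apply: integrable_scale => //; exact: box_integrable2.
- move=> p _; have sB t : `|- \1_(`]0, tau]) t : R| <= 1.
    by rewrite normrN indicE; case: (_ \in _); rewrite ?normr1 ?normr0.
  apply: le_trans (box_dominated zS (fun y => @psiL_far x y x0) (fun y => @psiL_bound x y x0) sB p) _.
  by rewrite ler_wpM2r// !mulr_ge0//; lra.
Qed.

Let Fg_int x tau : 0 < x -> 0 < tau <= T -> mu2.-integrable setT (EFin \o Fg x tau).
Proof.
move=> x0 /andP[tau0 tauT].
have thB t : `|thL tau t| <= tau + tau by exact: thL_bound.
have C0 : 0 <= (1 + x) * (tau + tau) by rewrite mulr_ge0; lra.
pose C := (1 + x) * (tau + tau).
apply: (@integrable_dom _ _ R mu2 setT _ (fun p => C * (\1_(`]0, x + 2]) p.1 * \1_(`]0, T]) p.2) + C * g p ^+ 2)) => //.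
- exact: mFg.
- by apply: integrable_add => //; (exact: box_integrable2 || exact: integrable_scale).
- move=> p _; apply: le_trans (box_dominated gS (fun y => @rhoL_far x y x0) (fun y => @rhoL_bound x y x0) thB p) _.
  rewrite -/C; set b := _ * \1__ _; have b01 : 0 <= b <= 1.
    by rewrite /b !indicE; do 2 case: (_ \in _); rewrite ?mulr1 ?mulr0 ?lexx ?ler01.
  have := sqr_ge0 (`|g p| - 1); rewrite -[g p ^+ 2]real_normK ?num_real//.
  have := normr_ge0 (g p); set r := `|g p| => r0 sq; case/andP: b01 => b0 b1.
  rewrite mulrCA -mulrDr ler_wpM2l//; nra.
Qed.

Let FG_int x tau : 0 < x -> tau <= T -> mu2.-integrable setT (EFin \o FG x tau).
Proof.
move=> x0 tauT.
have ui : mu.-integrable setT (EFin \o (fun y => (1 + x) / 2 * (T * \1_(`]0, x + 2]) y + gam y))).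
  apply: mu_integrable_scale => //; apply: integrable_add => //.
  by apply: mu_integrable_scale => //; exact: integrable_indic_oc.
apply: integrable_dom (box_integrable T ui) _ => //.
  exact: mFG.
move=> [y t] _; rewrite /FG/=.
have [yb|yb] := pselect (y <= 0 \/ x + 2 <= y).
  rewrite rhoL_far// mul0r normr0; apply: mulr_ge0; last exact: ler0n.
  apply: mulr_ge0; first by rewrite divr_ge0//; lra.
  by rewrite addr_ge0// mulr_ge0 ?ler0n// ltW.
rewrite normrM (_ : \1_(`]0, x + 2]) y = 1); last first.
  rewrite indicE mem_set//= in_itv/=; apply/andP; split.
    by rewrite ltNge; apply/negP => y0; apply: yb; left.
  by rewrite leNgt; apply/negP => y0; apply: yb; right; exact: ltW.
rewrite mulr1 [leRHS]mulrAC -mulrA mulrAC -!mulrA; apply: ler_pM => //; first exact: rhoL_bound.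
rewrite normrM; apply: ler_pM => //.
rewrite !indicE; have [/set_mem/=|_] := boolP (t \in `]0, tau]%classic); last by rewrite normr0.
by rewrite in_itv/= => /andP[t0 tt]; rewrite normr1 mem_set//= in_itv/= t0 (le_trans tt).
Qed.

Let Phi_eq x tau t : 0 < x ->
  \1_(`]0, tau]) t * Phi x t = \int[mu]_y FG x tau (y, t) - \int[mu]_y FZ x tau (y, t).
Proof.
move=> x0.
have Gi := G_int t (x + 2); have Zi := Z_int t (x + 2).
have mi (h : R -> R) : mu.-integrable `[0, x + 2] (EFin \o h) -> mu.-integrable `[0, x + 2] (EFin \o (fun y => rhoL x y * h y)).
  move=> hi; apply: (mu_integrable_dom _ _ (mu_integrable_scale (1 + x) _ (integrable_norm hi))) => //.
    by apply: measurable_funM; [exact: measurable_funTS|apply/measurable_EFinP; exact: measurable_int hi].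
  by move=> y _; rewrite normrM ler_wpM2r// rhoL_bound.
have E1 : \int[mu]_y FG x tau (y, t) = \1_(`]0, tau]) t * \int[mu]_(y in `[0, x + 2]) (rhoL x y * G y t).
  rewrite -RintegralZl//; last exact: mi.
  rewrite [RHS]Rintegral_mkcond; apply: eq_Rintegral => y _; rewrite /FG/= patchE mulrCA.
  case: ifPn => // /negP yJ; rewrite rhoL_far ?mul0r ?mulr0//.
  have [|y0] := leP y 0; [by left|right]; rewrite leNgt; apply/negP => yx; apply: yJ.
  by rewrite inE/= in_itv/= !ltW.
have E2 : \int[mu]_y FZ x tau (y, t) = \1_(`]0, tau]) t * \int[mu]_(y in `[0, x + 2]) (rhoL x y * Z y t).
  have := @z_psi x t (x + 2) x0; rewrite (_ : x + 1 <= x + 2); last lra.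
  move=> /(_ isT)/(congr1 (fun r => - \1_(`]0, tau]) t * r)); rewrite mulrNN => <-.
  rewrite -RintegralZl//; first by apply: eq_Rintegral => y _; rewrite /FZ/=; ring.
  apply: (@mu_integrable_dom R _ _ (fun y => M * (x + x) * \1_(`]0, x + 2]) y)) => //.
  - apply: measurable_funM => //; apply: measurable_funB; first exact: measurable_funB.
    by apply: measurable_funM => //; exact: measurable_funB.
  - by apply: mu_integrable_scale => //; exact: integrable_indic_oc.
  - move=> y _; have M0 := le_trans (normr_ge0 _) (zM (y, t)).
    have [yb|yb] := pselect (y <= 0 \/ x + 2 <= y).
      by rewrite psiL_far// mulr0 normr0 !mulr_ge0//; lra.
    rewrite indicE mem_set ?mulr1; last first.
      rewrite /= in_itv/=; apply/andP; split.
        by rewrite ltNge; apply/negP => y0; apply: yb; left.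
      by rewrite leNgt; apply/negP => y0; apply: yb; right; exact: ltW.
    by rewrite normrM ler_pM// psiL_bound.
rewrite E1 E2 -mulrBr; congr (_ * _); apply/esym.
rewrite -RintegralB//; [|exact: mi|exact: mi].
transitivity (\int[mu]_(y in `[0, x + 2]) (rhoL x y * (G y t - Z y t))).
  by apply: eq_Rintegral => y _; rewrite mulrBr.
apply: (@rhoL_mul (fun y => G y t - Z y t) x (x + 2) x0).
- by rewrite lerDl.
- by apply: ler_wpDl; [exact: ltW|rewrite ler1n].
- by apply: integrable_sub.
Qed.

(** [weak_limit] after integration by parts, in [y] for the term with [z] and in [t] for the term
    with [g]. As [tau] varies, this determines [Phi x t] for almost every [t]. *)
Let Phi_facts x tau : 0 < x -> 0 < tau <= T ->
  mu.-integrable `[0, tau] (EFin \o Phi x) /\ \int[mu]_(t in `[0, tau]) Phi x t = 0.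
Proof.
move=> x0 tT; have /andP[tau0 tauT] := tT.
have iG := integrable_marginal2 (FG_int x0 tauT); have iZ := integrable_marginal2 (FZ_int tau x0).
have PE : Phi x \_ `]0, tau] = fun t => \int[mu]_y FG x tau (y, t) - \int[mu]_y FZ x tau (y, t).
  by apply/funext => t; rewrite -Phi_eq// patchE indicE; case: ifP => _; rewrite ?mul1r ?mul0r.
have Pi : mu.-integrable `]0, tau] (EFin \o Phi x).
  apply/mu_integrable_mkcond => //; rewrite PE; exact: integrable_sub.
split; first exact: integrable_oc_cc.
rewrite -Rintegral_itv_obnd_cbnd// Rintegral_mkcond PE RintegralB//.
rewrite (Rfubini2 (FG_int x0 tauT)) (Rfubini2 (FZ_int tau x0)).
have -> : \int[mu2]_p FZ x tau p = \int[mu2]_p Fg x tau p by exact: weak_limit.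
rewrite -(Rfubini1 (FG_int x0 tauT)) -(Rfubini1 (Fg_int x0 tT)).
apply/eqP; rewrite subr_eq0; apply/eqP; apply: eq_Rintegral => y _.
have gi : mu.-integrable `]0, tau] (EFin \o G y).
  apply: (@integrable_bnd _ _ R mu _ _ ((T + gam y) / 2)) => //; first exact: lebesgue_oc_lty.
  by apply: measurable_funTS; exact: measurableT_comp mG (pair1_measurable y).
transitivity (rhoL x y * \int[mu]_(t in `[0, tau]) G y t).
  rewrite -Rintegral_itv_obnd_cbnd// -RintegralZl// [RHS]Rintegral_mkcond; apply: eq_Rintegral => t _.
  by rewrite /FG/= patchE indicE; case: ifP => _; rewrite ?mul1r// mul0r mulr0.
rewrite -(g_th y tT) -RintegralZl//; last first.
  apply: (@mu_integrable_dom R setT _ (fun t => (tau + tau) * (\1_(`]0, T]) t + g (y, t) ^+ 2))) => //.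
  - by apply: measurable_funM => //; apply: measurable_funB => //; exact: measurable_funB.
  - by apply: mu_integrable_scale => //; apply: integrable_add => //; exact: integrable_indic_oc.
  - move=> t _; have [Sp|nS] := pselect (strip T (y, t)); last first.
      by rewrite gS// mul0r normr0 mulr_ge0 ?addr_ge0 ?sqr_ge0 ?ler0n// ltW.
    rewrite indicE mem_set/=; last by case: Sp => /= _ /andP[t0 tT']; rewrite in_itv/= t0 ltW.
    rewrite normrM mulrC; apply: ler_pM => //; first exact: thL_bound.
    rewrite -[g (y, t) ^+ 2]real_normK ?num_real//.
    by have := sqr_ge0 (`|g (y, t)| - 1); set r := `|_|; nra.
by apply: eq_Rintegral => t _; rewrite /Fg/=; ring.
Qed.

(** The null set of times depends on [x], so [x] is first restricted to the positive rationals.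
    Continuity of the primitive extends [prim K x = x c] to every [x > 0], and [ae0_itv] then gives
    [K = c] almost everywhere. *)
Let ae_const : {ae mu, forall t, 0 < t < T -> exists c, {ae mu, forall y, 0 < y -> G y t = c + Z y t}}.
Proof.
have q0 (m n : nat) : 0 < m.+1%:R / n.+1%:R :> R by rewrite divr_gt0.
have H (m n : nat) : {ae mu, forall t, 0 <= t <= T -> Phi (m.+1%:R / n.+1%:R) t = 0}.
  apply: ae0_itv.
    by have [] := @Phi_facts (m.+1%:R / n.+1%:R) T (q0 _ _); rewrite ?T0 ?lexx.
  by move=> tau tT; have [] := @Phi_facts (m.+1%:R / n.+1%:R) tau (q0 _ _) tT.
have {H} : {ae mu, forall t, forall m n, 0 <= t <= T -> Phi (m.+1%:R / n.+1%:R) t = 0}.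
  by apply: ae_foralln => m; apply: ae_foralln => n.
apply: mu_ae_imp => t Ht /andP[t0 tT].
have {}Ht m n : Phi (m.+1%:R / n.+1%:R) t = 0 by apply: Ht; rewrite !ltW.
pose K y := G y t - Z y t; pose c := \int[mu]_(y in `[0, 1]) K y.
have Ki J : mu.-integrable `[0, J] (EFin \o K) by exact: integrable_sub.
exists c.
have PK x : 0 < x -> prim K x = x * c.
  (* Rational approximation of [x] from above with denominator [n + 1]; the numerator is a
     successor, hence positive, as [Ht] requires. *)
  move=> x0; pose x_ n := (Num.truncn (n.+1%:R * x)).+1%:R / n.+1%:R : R.
  have xc : x_ n @[n --> \oo] --> x.
    apply/cvgrPdist_le => e e0.
    have := @cvg_harmonic R => /cvgr_lt /(_ _ e0); apply: filterS => n /ltW ne; apply: le_trans ne.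
    have z0 : 0 <= n.+1%:R * x by rewrite mulr_ge0 ?ltW.
    have /andP[a1 a2] := truncn_itv z0.
    rewrite distrC ger0_norm; last by rewrite subr_ge0 ler_pdivlMr// mulrC ltW.
    rewrite lerBlDr ler_pdivrMr// mulrDl [harmonic n * _]mulVf// -natr1 (mulrC x).
    by rewrite addrC lerD2l.
  have l1 : prim K (x_ n) @[n --> \oo] --> prim K x.
    by apply: continuous_cvg xc; exact: prim_continuous_at.
  have l2 : x_ n * c @[n --> \oo] --> x * c by apply: cvgM => //; exact: cvg_cst.
  have E : (fun n => prim K (x_ n)) = (fun n => x_ n * c).
    apply/funext => n; apply/eqP; rewrite -subr_eq0; apply/eqP; exact: Ht.
  by rewrite E in l1; exact: cvg_unique l1 l2.
have A n : {ae mu, forall y, 0 <= y <= n%:R -> K y - c = 0}.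
  have ci J : mu.-integrable `[0, J] (EFin \o (cst c)).
    by apply: (@integrable_bnd _ _ R mu _ _ `|c|) => //; exact: lebesgue_itv_lty.
  apply: ae0_itv; first by apply: integrable_sub.
  move=> x /andP[x0 _]; rewrite RintegralB// -/(prim K x) PK// Rintegral_cst//=.
  have -> : fine (mu `[0, x]%classic) = x by apply: etrans (fine_mu_cc (ltW x0)) _; rewrite subr0.
  by rewrite mulrC subrr.
have := ae_foralln A; apply: mu_ae_imp => y Hy y0.
have := Hy (Num.truncn y).+1; rewrite (ltW y0)/= ltW ?truncnS_gt// => /(_ isT).
by rewrite /K; lra.
Qed.

Lemma flux_measurable : measurable_fun setT (fun p => prim (fun s => g (p.1, s)) p.2).
Proof. exact: mG. Qed.

Lemma flux_dominated (h : R * R -> R) : measurable_fun setT h -> (forall p, ~ strip T p -> h p = 0) ->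
  mu2.-integrable setT (EFin \o (fun p => h p ^+ 2)) ->
  exists2 E : R * R -> R, mu2.-integrable setT (EFin \o E) &
    forall p, `|prim (fun s => g (p.1, s)) p.2 * h p| <= E p.
Proof. exact: Gd_dominated. Qed.

Lemma flux_potential : {ae mu, forall t, 0 < t < T -> exists c, {ae mu, forall y, 0 < y ->
  prim (fun s => g (y, s)) t = c + prim (fun y => z (y, t)) y}}.
Proof. exact: ae_const. Qed.

End energy.

(** * The weighted energy identity on a slice *)

Section line_uniqueness.
Context {R : realType}.
Local Notation mu := (@lebesgue_measure R).
Implicit Types (f g z e : R -> R) (x y c N : R).

Lemma continuous_ae_eq0 f : (forall x, 0 < x -> {for x, continuous f}) ->
  {ae mu, forall x, 0 < x -> f x = 0} -> forall x, 0 < x -> f x = 0.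
Proof.
move=> cf f0 x x0; apply: contrapT => /eqP fx.
have : \forall y \near x, 0 < y /\ f y != 0.
  have n1 := lt_nbhsr x0; have n2 : \forall y \near x, f y != 0 by exact: cvgr_neq0 (cf x x0) fx.
  exact: filterS2 n1 n2.
move=> /nbhs_ballP[e /= e0 He].
have s : ball x e `<=` ~` [set y | 0 < y -> f y = 0] by move=> y /He[y0 fy] /(_ y0)/eqP; exact/negP.
have : mu (ball x e) = 0%E by apply: measure_negligible; [exact: measurable_ball|exact: negligibleS f0].
rewrite lebesgue_measure_ball ?(ltW e0)// => /eqP; rewrite eqe mulrn_eq0/= gt_eqF//.
Qed.

(** A primitive is continuous and starts from [0], so a constant value must be [0]; the density is
    then null by [ae0_itv]. *)
Lemma prim_ae_cst g c : (forall J, mu.-integrable `[0, J] (EFin \o g)) ->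
  {ae mu, forall x, 0 < x -> prim g x = c} -> c = 0 /\ {ae mu, forall x, 0 < x -> g x = 0}.
Proof.
move=> gi gc.
have H x : 0 < x -> prim g x = c.
  move=> x0; apply/eqP; rewrite -subr_eq0; apply/eqP; apply: (@continuous_ae_eq0 (fun x => prim g x - c)) x0.
    by move=> y y0; apply: cvgB; [exact: prim_continuous_at|exact: cvg_cst].
  by apply: mu_ae_imp gc => y gy /gy ->; rewrite subrr.
have c0 : c = 0.
  have [_ + _] := (continuous_within_itvP _ ltr01).1 (prim_continuous ler01 (gi 1)).
  rewrite prim_le0// => l0; have l1 : prim g y @[y --> 0^'+] --> c.
    apply: cvg_near_cst; apply: filterS (nbhs_right_gt 0) => y y0; exact: H.
  by rewrite (cvg_unique _ l1 l0).
split=> //; have A n : {ae mu, forall x, 0 <= x <= n%:R -> g x = 0}.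
  by apply: ae0_itv => // x /andP[x0 _]; rewrite -/(prim g x) H.
have := ae_foralln A; apply: mu_ae_imp => y Hy y0.
by apply: (Hy (Num.truncn y).+1); rewrite (ltW y0)/= ltW ?truncnS_gt.
Qed.

Lemma integrable_mul_prim f g N : 0 <= N -> mu.-integrable `[0, N] (EFin \o f) ->
  mu.-integrable `[0, N] (EFin \o g) -> mu.-integrable `[0, N] (EFin \o (fun y => f y * prim g y)).
Proof.
move=> N0 fi gi; have gi' := integrable_norm gi.
have pb y : 0 <= y <= N -> `|prim g y| <= prim (fun y => `|g y|) N.
  move=> /andP[y0 yN]; have giy : mu.-integrable `[0, y] (EFin \o g).
    by apply: integrableS gi => //; apply: subset_itvl; rewrite bnd_simp.
  apply: le_trans (prim_bound y0 giy) _; exact: prim_homo.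
apply: (mu_integrable_dom _ _ (mu_integrable_scale (prim (fun y => `|g y|) N) _ (integrable_norm fi))) => //.
  apply: measurable_funM; first by apply/measurable_EFinP; exact: measurable_int fi.
  by apply: subspace_continuous_measurable_fun => //; exact: prim_continuous.
by move=> y /=; rewrite in_itv/= => yN; rewrite normrM mulrC; apply: ler_pM => //; exact: pb.
Qed.

Lemma prim1 y : 0 <= y -> prim (cst 1) y = y.
Proof.
move=> t0; rewrite /prim -Rintegral_itv_obnd_cbnd; last first.
  by apply: (@integrable_bnd _ _ R mu _ _ 1) => // [|? _]; [exact: lebesgue_oc_lty|rewrite normr1].
rewrite Rintegral_cst//= mul1r; apply: etrans (fine_mu_oc t0) _; exact: subr0.
Qed.

(* [(c + prim z) prim g] is the primitive of [z prim g + (c + prim z) g], and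
   integrating twice produces the weight [N - y]. *)
Lemma weighted_energy z g c N : 0 <= N ->
  mu.-integrable `[0, N] (EFin \o z) -> mu.-integrable `[0, N] (EFin \o g) ->
  \int[mu]_(y in `[0, N]) ((N - y) * (z y * prim g y + (c + prim z y) * g y)) =
  \int[mu]_(y in `[0, N]) ((c + prim z y) * prim g y).
Proof.
move=> N0 zi gi; pose q y := z y * prim g y + (c + prim z y) * g y.
have sub (h : R -> R) x : x <= N -> mu.-integrable `[0, N] (EFin \o h) -> mu.-integrable `[0, x] (EFin \o h).
  by move=> xN; apply: integrableS => //; apply: subset_itvl; rewrite bnd_simp.
have i1 := integrable_mul_prim N0 zi gi.
have i2 : mu.-integrable `[0, N] (EFin \o (fun y => prim z y * g y)).
  by apply: eq_integrable (integrable_mul_prim N0 gi zi) => // y _; rewrite /= mulrC.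
have i3 := mu_integrable_scale c (measurable_itv _) gi.
have i4 : mu.-integrable `[0, N] (EFin \o (fun y => (c + prim z y) * g y)).
  by apply: eq_integrable (integrable_add _ i3 i2) => // y _ /=; rewrite mulrDl.
have qi : mu.-integrable `[0, N] (EFin \o q) by exact: integrable_add.
have c1 : mu.-integrable `[0, N] (EFin \o (cst (1 : R))).
  by apply: (@integrable_bnd _ _ R mu _ _ 1) => // [|? _]; [exact: lebesgue_itv_lty|rewrite normr1].
have primq x : 0 <= x -> x <= N -> prim q x = (c + prim z x) * prim g x.
  move=> x0 xN; rewrite /prim RintegralD//; [|exact: sub|exact: sub].
  rewrite (prim_ibp (sub _ _ xN zi) (sub _ _ xN gi)).
  have -> : \int[mu]_(y in `[0, x]) ((c + prim z y) * g y) = c * prim g x + \int[mu]_(y in `[0, x]) (prim z y * g y).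
    rewrite /prim -RintegralZl//; last exact: sub.
    rewrite -RintegralD//; [|exact: sub|exact: sub].
    by apply: eq_Rintegral => y _; rewrite mulrDl.
  by rewrite -/(prim g x) -/(prim z x); ring.
have E := prim_ibp c1 qi; rewrite prim1// in E.
have i5 : mu.-integrable `[0, N] (EFin \o (fun y => y * q y)).
  apply: (mu_integrable_dom _ _ (mu_integrable_scale N _ (integrable_norm qi))) => //.
    by apply: measurable_funM => //; apply/measurable_EFinP; exact: measurable_int qi.
  by move=> y /=; rewrite in_itv/= => /andP[y0 yN]; rewrite normrM ger0_norm// ler_wpM2r.
transitivity (\int[mu]_(y in `[0, N]) (cst 1 y * prim q y)); last first.
  by apply: eq_Rintegral => y /set_mem/=; rewrite in_itv/= => /andP[y0 yN]; rewrite mul1r primq.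
rewrite E; transitivity (N * prim q N - \int[mu]_(y in `[0, N]) (y * q y)).
  rewrite /prim -RintegralZl// -RintegralB//; last exact: mu_integrable_scale.
  by apply: eq_Rintegral => y _; rewrite -mulrBl.
congr (_ - _); apply: eq_Rintegral => y /set_mem/=; rewrite in_itv/= => /andP[y0 yN].
by rewrite prim1.
Qed.

End line_uniqueness.

Section ae_slices.
Context {R : realType}.
Local Notation mu := (@lebesgue_measure R).
Local Notation mu2 := (mu \x mu)%E.
Variable f : R * R -> R.
Hypotheses (fi : mu2.-integrable setT (EFin \o f)) (f0 : forall p, 0 <= f p).

(** Together with its companions this exchanges null sets between slices in [x] and slices in [t]:
    the passage goes through the vanishing of the double integral. *)
Lemma ae_slice2 : \int[mu2]_p f p = 0 -> {ae mu, forall t, {ae mu, forall x, f (x, t) = 0}}.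
Proof.
rewrite -Rfubini2// => H; have fi2 := integrable_marginal2 fi.
have : {ae mu, forall t, setT t -> \int[mu]_x f (x, t) = 0}.
  by apply: mu_Rintegral0_ae => // t _; exact: Rintegral_ge0.
have := ae_integrable2 fi; apply: mu_ae_imp2 => t fti /(_ I) ft0.
have : {ae mu, forall x, setT x -> f (x, t) = 0} by apply: mu_Rintegral0_ae => //; exact: fti.
by apply: mu_ae_imp => x; exact.
Qed.

Lemma ae_slice1 : \int[mu2]_p f p = 0 -> {ae mu, forall x, {ae mu, forall t, f (x, t) = 0}}.
Proof.
rewrite -Rfubini1// => H; have fi2 := integrable_marginal1 fi.
have : {ae mu, forall x, setT x -> \int[mu]_t f (x, t) = 0}.
  by apply: mu_Rintegral0_ae => // t _; exact: Rintegral_ge0.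
have := ae_integrable1 fi; apply: mu_ae_imp2 => t fti /(_ I) ft0.
have : {ae mu, forall x, setT x -> f (t, x) = 0} by apply: mu_Rintegral0_ae => //; exact: fti.
by apply: mu_ae_imp => x; exact.
Qed.

Lemma ae_slice2_int0 : {ae mu, forall t, {ae mu, forall x, f (x, t) = 0}} -> \int[mu2]_p f p = 0.
Proof.
move=> H; have mf : measurable_fun setT f by apply/measurable_EFinP; exact: measurable_int fi.
rewrite -Rfubini2// -[RHS](Rintegral_0 mu setT).
apply: (@ae_eq_Rintegral _ _ R mu) => //.
  have := integrable_marginal2 fi => /measurable_int /measurable_EFinP; exact.
apply: mu_ae_imp H => t H _; rewrite -[RHS](Rintegral_0 mu setT).
apply: (@ae_eq_Rintegral _ _ R mu) => //.
  exact: measurableT_comp mf (pair2_measurable t).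
by apply: mu_ae_imp H.
Qed.

End ae_slices.

(** * Energy estimate and vanishing of the difference *)

Section energy_method.
Context {R : realType}.
Local Notation mu := (@lebesgue_measure R).
Local Notation mu2 := (mu \x mu)%E.
Implicit Types (x y s t r tau J : R) (p : R * R) (n : nat).
Variables (T M : R) (z d g : R * R -> R).
Hypotheses (T0 : 0 < T)
  (mz : measurable_fun setT z) (md : measurable_fun setT d) (mg : measurable_fun setT g)
  (zM : forall p, `|z p| <= M)
  (zS : forall p, ~ strip T p -> z p = 0) (dS : forall p, ~ strip T p -> d p = 0)
  (gS : forall p, ~ strip T p -> g p = 0)
  (d2 : mu2.-integrable setT (EFin \o (fun p => d p ^+ 2)))
  (g2 : mu2.-integrable setT (EFin \o (fun p => g p ^+ 2)))
  (gx2 : forall x, mu.-integrable setT (EFin \o (fun t => g (x, t) ^+ 2)))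
  (zd_ge0 : forall p, 0 <= z p * d p) (zd_eq0 : forall p, z p * d p = 0 -> d p = 0)
  (dg : {ae mu, forall t, 0 < t < T ->
    {ae mu, forall x, 0 < x -> d (x, t) = prim (fun y => g (y, t)) x}})
  (weak : forall psi theta J, smooth psi -> smooth theta -> psi 0 = 0 ->
    (forall x, J <= x -> psi x = 0) -> theta T = 0 ->
    \int[mu2]_p (z p * (psi p.1 * derive1 theta p.2)) =
    \int[mu2]_p (g p * (derive1 psi p.1 * theta p.2))).

Let G x t := prim (fun s => g (x, s)) t.
(** The positive part of [N - y] restricted to [y > 0], the weight left by the double integration in
    space. *)
Let wt N y : R := (N - y) * \1_(`]0, N]) y.
Let F1 N p := wt N p.1 * (z p * d p).
Let F2 N p := wt N p.1 * (G p.1 p.2 * g p).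
Let F3 N p := \1_(`]0, N]) p.1 * (G p.1 p.2 * d p).

Let mG : measurable_fun setT (fun p => G p.1 p.2). Proof. exact: flux_measurable. Qed.

Let mwt N : measurable_fun setT (wt N).
Proof. by apply: measurable_funM => //; exact: measurable_funB. Qed.

Let m1 (u : R -> R) : measurable_fun setT u -> measurable_fun setT (fun p : R * R => u p.1).
Proof. by move=> mu'; exact: measurableT_comp measurable_fst. Qed.

Let wt_ge0 N y : 0 <= wt N y.
Proof.
rewrite /wt indicE; have [/set_mem/=|_] := boolP (y \in `]0, N]%classic); last by rewrite mulr0.
by rewrite in_itv/= => /andP[_ yN]; rewrite mulr1 subr_ge0.
Qed.

Let wt_le N y : 0 <= N -> wt N y <= N.
Proof.
move=> N0; rewrite /wt indicE; have [/set_mem/=|_] := boolP (y \in `]0, N]%classic); last by rewrite mulr0.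
by rewrite in_itv/= => /andP[y0 yN]; rewrite mulr1; lra.
Qed.

Let box_integrable (u : R -> R) : mu.-integrable setT (EFin \o u) ->
  mu2.-integrable setT (EFin \o (fun p => u p.1 * \1_(`]0, T]) p.2)).
Proof.
move=> ui; apply: (@integrable_tensor _ _ _ _ R mu mu u (\1_(`]0, T]))) => //.
exact: integrable_indic_oc.
Qed.

Let M0 : 0 <= M. Proof. exact: le_trans (normr_ge0 _) (zM 0). Qed.

Let strip2 p : strip T p -> \1_(`]0, T]) p.2 = 1 :> R.
Proof. by move=> [_ /andP[t0 tT]]; rewrite indicE mem_set//= in_itv/= t0 ltW. Qed.

(* On the strip [z d] is dominated by [M (1 + d^2)]. *)
Let zd_dominated N : 0 <= N -> mu2.-integrable setT (EFin \o (fun p => \1_(`]0, N]) p.1 * (z p * d p))).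
Proof.
move=> N0; apply: (@integrable_dom _ _ R mu2 setT _ (fun p => M * (\1_(`]0, N]) p.1 * \1_(`]0, T]) p.2 + d p ^+ 2))) => //.
- by apply: measurable_funM; [exact: (@m1 (\1_(`]0, N])))|exact: measurable_funM].
- apply: integrable_scale => //; apply: integrable_add => //; apply: box_integrable; exact: integrable_indic_oc.
move=> p _; have [Sp|nS] := pselect (strip T p); last first.
  by rewrite dS// !mulr0 normr0 mulr_ge0// expr0n addr0 mulr_ge0.
rewrite strip2// mulr1 indicE; have [_|_] := boolP (_ \in _); last first.
  by rewrite mul0r normr0 mulr_ge0// add0r sqr_ge0.
rewrite mul1r normrM; apply: ler_pM => //.
by rewrite -[d p ^+ 2]real_normK ?num_real//=; have := sqr_ge0 (`|d p| - 1); set r := `|_|; nra.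
Qed.

Let F1_int N : 0 <= N -> mu2.-integrable setT (EFin \o F1 N).
Proof.
move=> N0; have i := integrable_scale N measurableT (zd_dominated N0).
apply: (@integrable_dom _ _ R mu2 setT _ (fun p => N * (\1_(`]0, N]) p.1 * (z p * d p)))) => //.
  by apply: measurable_funM; [exact: (@m1 (wt N))|exact: measurable_funM].
move=> p _; rewrite ger0_norm; last by apply: mulr_ge0; [exact: wt_ge0|exact: zd_ge0].
rewrite mulrA ler_wpM2r ?zd_ge0// /wt indicE; have [/set_mem/=|_] := boolP (_ \in _); last by rewrite !mulr0.
by rewrite in_itv/= => /andP[y0 _]; rewrite !mulr1; lra.
Qed.

Let F2_int N : 0 <= N -> mu2.-integrable setT (EFin \o F2 N).
Proof.
move=> N0; have [E Ei EB] := flux_dominated T0 mg gS g2 gx2 mg gS g2.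
apply: (@integrable_dom _ _ R mu2 setT _ (fun p => N * E p)) => //.
- by apply: measurable_funM; [exact: (@m1 (wt N))|exact: measurable_funM].
- exact: integrable_scale.
- by move=> p _; rewrite normrM ger0_norm//; apply: ler_pM; [exact: wt_ge0|exact: normr_ge0|exact: wt_le|exact: EB].
Qed.

(** A single integrable majorant on the whole plane bounds [F3 N] for every [N]. The conclusion
    rests on this independence of [N]. *)
Let F3_bound : exists2 C, 0 <= C & forall N, mu2.-integrable setT (EFin \o F3 N) /\ \int[mu2]_p F3 N p <= C.
Proof.
have [E Ei EB] := flux_dominated T0 mg gS g2 gx2 md dS d2.
exists (\int[mu2]_p E p).
  by apply: Rintegral_ge0 => p _; exact: le_trans (EB p).
have F3E N p : `|F3 N p| <= E p.
  apply: le_trans (EB p); rewrite /F3 normrM indicE; case: (_ \in _); rewrite ?normr1 ?mul1r// normr0 mul0r//.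
move=> N; have i3 : mu2.-integrable setT (EFin \o F3 N).
  apply: (@integrable_dom _ _ R mu2 setT _ E) => //.
  by apply: measurable_funM; [exact: (@m1 (\1_(`]0, N])))|exact: measurable_funM].
split=> //; apply: le_Rintegral => // p _; exact: le_trans (ler_norm _) (F3E N p).
Qed.

(** For fixed [x], integration by parts in time turns the integral of [G g] over [[0, T]] into half
    of the square of [G x T]. *)
Let F2_ge0 N : 0 <= N -> 0 <= \int[mu2]_p F2 N p.
Proof.
move=> N0; rewrite -Rfubini1//; last exact: F2_int.
apply: Rintegral_ge0 => x _.
have gi : mu.-integrable `[0, T] (EFin \o (fun s => g (x, s))).
  apply: (@mu_integrable_dom R _ _ (fun s => 1 + g (x, s) ^+ 2)) => //.
  - by apply: measurable_funTS; exact: measurableT_comp mg (pair1_measurable x).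
  - apply: integrable_add => //.
      by apply: (@integrable_bnd _ _ R mu _ _ 1) => // [|? _]; [exact: lebesgue_itv_lty|rewrite normr1].
    by apply: integrableS (gx2 x).
  - by move=> s _; rewrite ler_norml; apply/andP; split; nra.
have -> : \int[mu]_t F2 N (x, t) = wt N x * \int[mu]_(t in `[0, T]) (g (x, t) * prim (fun s => g (x, s)) t).
  rewrite -RintegralZl//; last by apply: integrable_mul_prim => //; exact: ltW.
  rewrite [RHS]Rintegral_mkcond; apply: eq_Rintegral => t _; rewrite patchE /F2/= (mulrC (G x t)).
  case: ifPn => // /negP tT; rewrite gS ?mul0r ?mulr0// => -[_ /= /andP[t0 t1]]; apply: tT.
  by rewrite inE/= in_itv/= !ltW.
apply: mulr_ge0 => //; have := prim_ibp gi gi.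
rewrite [X in _ - X](_ : _ = \int[mu]_(t in `[0, T]) (g (x, t) * prim (fun s => g (x, s)) t)); last first.
  by apply: eq_Rintegral => t _; rewrite mulrC.
have := sqr_ge0 (prim (fun s => g (x, s)) T); rewrite expr2; lra.
Qed.

Let slice_facts : {ae mu, forall t, 0 < t < T ->
  (forall J, mu.-integrable `[0, J] (EFin \o (fun y => g (y, t)))) /\
  {ae mu, forall x, 0 < x -> d (x, t) = prim (fun y => g (y, t)) x}}.
Proof.
have := ae_integrable2 g2; move: dg; apply: mu_ae_imp2 => t dt gt t0; split; last exact: dt.
move=> J; apply: (@mu_integrable_dom R _ _ (fun y => 1 + g (y, t) ^+ 2)) => //.
- by apply: measurable_funTS; exact: measurableT_comp mg (pair2_measurable t).
- apply: integrable_add => //.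
    by apply: (@integrable_bnd _ _ R mu _ _ 1) => // [|? _]; [exact: lebesgue_itv_lty|rewrite normr1].
  by apply: integrableS gt.
- by move=> s _; rewrite ler_norml; apply/andP; split; nra.
Qed.

Let z_int t J : mu.-integrable `[0, J] (EFin \o (fun y => z (y, t))).
Proof.
apply: (@integrable_bnd _ _ R mu _ _ M) => //; first exact: lebesgue_itv_lty.
by apply: measurable_funTS; exact: measurableT_comp mz (pair2_measurable t).
Qed.

(** [weighted_energy] on almost every slice, where [d] is the primitive of [g] and [G] a constant
    plus the primitive of [z]. The endpoint [0] lies outside the strip, where [z], [d] and [g] are
    zero. *)
Let slice_identity N : 0 <= N -> {ae mu, forall t,
  \int[mu]_y F1 N (y, t) + \int[mu]_y F2 N (y, t) = \int[mu]_y F3 N (y, t)}.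
Proof.
move=> N0; have I12 : {ae mu, forall t, mu.-integrable setT (EFin \o (fun y => F1 N (y, t))) /\
    mu.-integrable setT (EFin \o (fun y => F2 N (y, t)))}.
  by have := ae_integrable2 (F2_int N0); have := ae_integrable2 (F1_int N0); apply: mu_ae_imp2.
have pot := flux_potential T0 mz mg zM zS gS g2 gx2 weak.
have pot' : {ae mu, forall t, 0 < t < T -> (exists c, {ae mu, forall y, 0 < y -> G y t = c + prim (fun y => z (y, t)) y}) /\
    (forall J, mu.-integrable `[0, J] (EFin \o (fun y => g (y, t)))) /\
    {ae mu, forall x, 0 < x -> d (x, t) = prim (fun y => g (y, t)) x}}.
  by have := slice_facts; move: pot; apply: mu_ae_imp2 => t pt ft tT; split; [exact: pt|exact: ft].
move: I12 pot'; apply: mu_ae_imp2 => t [i1 i2] ft; rewrite -RintegralD//.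
have [tT|tT] := pselect (0 < t < T); last first.
  have nS y : ~ strip T (y, t) by move=> [].
  by apply: eq_Rintegral => y _; rewrite /F1 /F2 /F3 zS// gS// dS// !(mul0r, mulr0) addr0.
have [[c Hc] [gi dx]] := ft tT.
have mz' : measurable_fun `[0, N] (fun y => z (y, t)) by apply: measurable_funTS; exact: measurableT_comp mz (pair2_measurable t).
have mg' : measurable_fun `[0, N] (fun y => g (y, t)) by apply: measurable_funTS; exact: measurableT_comp mg (pair2_measurable t).
have md' : measurable_fun `[0, N] (fun y => d (y, t)) by apply: measurable_funTS; exact: measurableT_comp md (pair2_measurable t).
have mG' : measurable_fun `[0, N] (fun y => G y t) by apply: measurable_funTS; exact: measurableT_comp mG (pair2_measurable t).
have mp (h : R -> R) : mu.-integrable `[0, N] (EFin \o h) -> measurable_fun `[0, N] (prim h).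
  by move=> hi; apply: subspace_continuous_measurable_fun => //; exact: prim_continuous.
have mpz := mp _ (z_int t N); have mpg := mp _ (gi N).
have edge y : `[0, N]%classic y -> 0 < y \/ y = 0.
  by rewrite /= in_itv/= le_eqVlt => /andP[/predU1P[<-|y0] _]; [right|left].
have n0 : ~ strip T (0, t) by move=> [/=]; rewrite ltxx.
have oc y (r : R) : (y = 0 -> r = 0) -> \1_(`]0, N]) y * r = ((fun=> r) \_ `[0, N]) y.
  move=> r0; rewrite patchE indicE; have [y0|y0] := ltP 0 y.
    have [yN|yN] := leP y N; first by rewrite !mem_set ?mul1r//= in_itv/= ?y0 ?(ltW y0).
    by rewrite !memNset ?mul0r//= in_itv/= [y <= N]leNgt yN andbF.
  rewrite memNset ?mul0r//=; last by rewrite in_itv/= ltNge y0.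
  by case: ifP => // /set_mem/=; rewrite in_itv/= => /andP[y1 _]; rewrite r0//; apply/eqP; rewrite eq_le y0.
transitivity (\int[mu]_(y in `[0, N]) ((N - y) * (z (y, t) * d (y, t) + G y t * g (y, t)))).
  rewrite [RHS]Rintegral_mkcond; apply: eq_Rintegral => y _.
  transitivity (\1_(`]0, N]) y * ((N - y) * (z (y, t) * d (y, t) + G y t * g (y, t)))); first by rewrite /F1 /F2/= /wt; ring.
  by rewrite oc ?patchE// => ->; rewrite zS// gS// !(mul0r, mulr0) addr0 mulr0.
transitivity (\int[mu]_(y in `[0, N]) (G y t * d (y, t))); last first.
  rewrite [LHS]Rintegral_mkcond; apply: eq_Rintegral => y _.
  by rewrite /F3/= oc ?patchE// => ->; rewrite dS// mulr0.
transitivity (\int[mu]_(y in `[0, N]) ((N - y) * (z (y, t) * prim (fun y => g (y, t)) y + (c + prim (fun y => z (y, t)) y) * g (y, t)))).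
  apply: (@ae_eq_Rintegral _ _ R mu) => //.
  - apply: measurable_funM; first exact: measurable_funB.
    by apply: measurable_funD; exact: measurable_funM.
  - apply: measurable_funM; first exact: measurable_funB.
    by apply: measurable_funD; [exact: measurable_funM|apply: measurable_funM => //; exact: measurable_funD].
  move: Hc dx; apply: mu_ae_imp2 => y Hc dx /edge[y0|->]; first by rewrite Hc// dx.
  by rewrite zS// gS// !(mul0r, mulr0).
rewrite (weighted_energy c N0 (z_int t N) (gi N)).
apply: (@ae_eq_Rintegral _ _ R mu) => //.
- by apply: measurable_funM => //; exact: measurable_funD.
- exact: measurable_funM.
move: Hc dx; apply: mu_ae_imp2 => y Hc dx /edge[y0|->]; first by rewrite Hc// dx.
by rewrite dS// [prim _ 0]prim_le0// [X in _ * X]prim_le0// !mulr0.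
Qed.

(** On []0, J]] the weight for [N = J + L] is at least [L], and [F2] contributes nonnegatively; so
    [L] times the integral is at most the same constant [C] for every [L >= 0]. *)
Let potential_energy J : 0 <= J -> \int[mu2]_p (\1_(`]0, J]) p.1 * (z p * d p)) = 0.
Proof.
move=> J0; have [C C0 HC] := F3_bound.
have E1 N : 0 <= N -> \int[mu2]_p F1 N p <= C.
  move=> N0; have [i3 F3C] := HC N; apply: le_trans F3C.
  rewrite -(Rfubini2 i3) -(Rfubini2 (F1_int N0)).
  have -> : \int[mu]_t \int[mu]_y F3 N (y, t) = \int[mu]_t (\int[mu]_y F1 N (y, t) + \int[mu]_y F2 N (y, t)).
    apply: (@ae_eq_Rintegral _ _ R mu) => //.
    - by apply/measurable_EFinP; exact: measurable_int (integrable_marginal2 i3).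
    - by apply: measurable_funD; apply/measurable_EFinP; [exact: measurable_int (integrable_marginal2 (F1_int N0))|exact: measurable_int (integrable_marginal2 (F2_int N0))].
    by have := slice_identity N0; apply: mu_ae_imp.
  rewrite RintegralD//; [|exact: (integrable_marginal2 (F1_int N0))|exact: (integrable_marginal2 (F2_int N0))].
  by rewrite lerDl (Rfubini2 (F2_int N0)) F2_ge0.
have iJ := zd_dominated J0; set I := Rintegral _ _ _.
have I0 : 0 <= I by apply: Rintegral_ge0 => p _; rewrite mulr_ge0 ?zd_ge0// indicE.
have LI L : 0 <= L -> L * I <= C.
  move=> L0; have JL0 : 0 <= J + L by rewrite addr_ge0.
  apply: le_trans (E1 _ JL0); rewrite /I -RintegralZl//.
  apply: le_Rintegral => //; [exact: integrable_scale|exact: F1_int|move=> p _].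
  rewrite mulrA; apply: ler_wpM2r; first exact: zd_ge0.
  rewrite indicE; have [/set_mem/=|_] := boolP (_ \in _); last by rewrite mulr0 wt_ge0.
  rewrite in_itv/= => /andP[y0 yJ]; rewrite /wt indicE mem_set/=; first lra.
  by rewrite in_itv/= y0; lra.
apply/eqP; rewrite eq_le I0 andbT leNgt; apply/negP => Ip.
(* For a positive [I] this choice of [L] gives [C + 1 <= C]. *)
have := LI ((C + 1) / I); rewrite divfK ?gt_eqF// divr_ge0 ?addr_ge0// => /(_ isT); lra.
Qed.

Let zd_slices : {ae mu, forall t, {ae mu, forall x, 0 < x -> d (x, t) = 0}}.
Proof.
have A (n : nat) : {ae mu, forall t, {ae mu, forall x, \1_(`]0, n%:R]) x * (z (x, t) * d (x, t)) = 0}}.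
  apply: (@ae_slice2 R (fun p => \1_(`]0, n%:R]) p.1 * (z p * d p))).
  - exact: zd_dominated.
  - by move=> p; rewrite mulr_ge0.
  - exact: potential_energy.
have := ae_foralln A; apply: mu_ae_imp => t At; have := ae_foralln At; apply: mu_ae_imp => x Ax x0.
apply: zd_eq0; have := Ax (Num.truncn x).+1; rewrite indicE mem_set ?mul1r//=.
by rewrite in_itv/= x0 ltW ?truncnS_gt.
Qed.

Let g_slices : {ae mu, forall t, {ae mu, forall x, g (x, t) ^+ 2 = 0}}.
Proof.
have := zd_slices; have := slice_facts; apply: mu_ae_imp2 => t ft dt.
have [tT|tT] := pselect (0 < t < T); last first.
  by apply: aeW => x; rewrite gS ?expr0n// => -[].
have [gi dx] := ft tT.
have : {ae mu, forall x, 0 < x -> prim (fun y => g (y, t)) x = 0}.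
  by move: dt dx; apply: mu_ae_imp2 => x d0 dx x0; rewrite -dx// d0.
move=> /(prim_ae_cst gi)[_]; apply: mu_ae_imp => x gx.
by have [x0|x0] := pselect (0 < x); [rewrite gx ?expr0n|rewrite gS ?expr0n// => -[]].
Qed.

(** [g_slices] speaks of almost every [t], while [G x] integrates over time at fixed [x]; the double
    integral converts one into the other. *)
Let G_eq0 : {ae mu, forall x, forall t, G x t = 0}.
Proof.
have I0 := ae_slice2_int0 g2 g_slices.
have := ae_slice1 g2 (fun p => sqr_ge0 (g p)) I0; apply: mu_ae_imp => x gx t.
rewrite /G /prim -[RHS](Rintegral_0 mu `[0, t]); apply: (@ae_eq_Rintegral _ _ R mu) => //.
  by apply: measurable_funTS; exact: measurableT_comp mg (pair1_measurable x).
by apply: mu_ae_imp gx => s /eqP; rewrite sqrf_eq0 => /eqP.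
Qed.

(** With [G = 0] the potential relation says that the primitive of [z (., t)] is constant, so
    [prim_ae_cst] applies. *)
Let z_slices : {ae mu, forall t, {ae mu, forall x, z (x, t) = 0}}.
Proof.
have := flux_potential T0 mz mg zM zS gS g2 gx2 weak; apply: mu_ae_imp => t pt.
have [tT|tT] := pselect (0 < t < T); last by apply: aeW => x; rewrite zS// => -[].
have [c Hc] := pt tT.
have : {ae mu, forall x, 0 < x -> prim (fun y => z (y, t)) x = - c}.
  move: Hc G_eq0; apply: mu_ae_imp2 => x Hx Gx x0; have := Hx x0; rewrite [prim _ _](Gx t); lra.
move=> /(prim_ae_cst (@z_int t))[_]; apply: mu_ae_imp => x gx.
by have [x0|x0] := pselect (0 < x); [exact: gx|rewrite zS// => -[]].
Qed.

Lemma energy_uniqueness : {ae mu2, forall p, z p = 0}.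
Proof.
have A (n : nat) : ae_eq mu2 setT (fun p => \1_(`]0, n%:R]) p.1 * z p ^+ 2) (cst 0).
  have i : mu2.-integrable setT (EFin \o (fun p => \1_(`]0, n%:R]) p.1 * z p ^+ 2)).
    apply: (@integrable_dom _ _ R mu2 setT _ (fun p => M ^+ 2 * (\1_(`]0, n%:R]) p.1 * \1_(`]0, T]) p.2))) => //.
    - by apply: measurable_funM; [exact: (@m1 (\1_(`]0, n%:R])))|exact: measurable_funX].
    - apply: integrable_scale => //; apply: box_integrable; exact: integrable_indic_oc.
    move=> p _; have [Sp|nS] := pselect (strip T p); last first.
      by rewrite zS// expr0n mulr0 normr0 mulr_ge0// sqr_ge0.
    rewrite strip2// mulr1 mulrC normrM; apply: ler_pM => //.
      by rewrite ger0_norm ?sqr_ge0// -[z p ^+ 2]real_normK ?num_real// lerXn2r ?nnegrE.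
    by rewrite ger0_norm// indicE.
  have f0 p : setT p -> 0 <= \1_(`]0, n%:R]) p.1 * z p ^+ 2 by move=> _; rewrite mulr_ge0 ?sqr_ge0// indicE.
  apply: Rintegral0_ae_eq0 => //; apply: ae_slice2_int0 => //.
  by have := z_slices; apply: mu_ae_imp => t; apply: mu_ae_imp => x zx; rewrite zx expr0n mulr0.
have := ae_foralln A; apply: filterS => p Hp.
have [Sp|nS] := pselect (strip T p); last exact: zS.
have := Hp (Num.truncn p.1).+1 I; rewrite indicE mem_set/=.
  by rewrite mul1r => /eqP; rewrite sqrf_eq0 => /eqP.
by case: Sp => p1 _; rewrite in_itv/= p1 ltW ?truncnS_gt.
Qed.

End energy_method.

(** * Products as test functions *)

Section tensor_test.
Context {R : realType}.
Implicit Types (psi theta : R -> R) (p : R * R).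

Lemma tensor_derive_x psi theta p : smooth psi ->
  is_derive p (1, 0) (fun q => psi q.1 * theta q.2) (derive1 psi p.1 * theta p.2).
Proof.
case: p => x t sp /=; have H : is_derive x 1 (fun y => psi y * theta t) (derive1 psi x * theta t).
  apply: (is_derive_eq (isdM (smooth_is_derive x sp) (isd_cst x (theta t)))).
  by rewrite mulr0 ?add0r ?addr0.
have E : (fun h : R => h^-1 *: ((fun q => psi q.1 * theta q.2) (h *: (1, 0) + (x, t)) - psi x * theta t)) =
    (fun h : R => h^-1 *: ((fun y => psi y * theta t) (h *: 1 + x) - psi x * theta t)).
  by apply/funext => h; rewrite /= scaler0 add0r.
by case: H => dv dl; split; [rewrite /derivable E|rewrite /derive E].
Qed.

Lemma tensor_derive_t psi theta p : smooth theta ->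
  is_derive p (0, 1) (fun q => psi q.1 * theta q.2) (psi p.1 * derive1 theta p.2).
Proof.
case: p => x t sp /=; have H : is_derive t 1 (fun s => psi x * theta s) (psi x * derive1 theta t).
  exact: isdZ (smooth_is_derive t sp).
have E : (fun h : R => h^-1 *: ((fun q => psi q.1 * theta q.2) (h *: (0, 1) + (x, t)) - psi x * theta t)) =
    (fun h : R => h^-1 *: ((fun s => psi x * theta s) (h *: 1 + t) - psi x * theta t)).
  by apply/funext => h; rewrite /= scaler0 add0r.
by case: H => dv dl; split; [rewrite /derivable E|rewrite /derive E].
Qed.

Lemma tensor_continuous psi theta : continuous psi -> continuous theta ->
  continuous (fun p : R * R => psi p.1 * theta p.2).
Proof.
by move=> cp ct p; apply: cvgM; apply: continuous_cvg; [exact: cp|exact: cvg_fst|exact: ct|exact: cvg_snd].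
Qed.

Lemma tensor_test_strip (T J : R) psi theta : smooth psi -> smooth theta -> psi 0 = 0 ->
  (forall x, J <= x -> psi x = 0) -> theta T = 0 -> test_strip T (fun p => psi p.1 * theta p.2).
Proof.
move=> sp st psi0 psiJ thT; have cp := smooth_continuous sp; have ct := smooth_continuous st.
have cdp := smooth_continuous (smooth_derive1 sp); have cdt := smooth_continuous (smooth_derive1 st).
split.
- split; first by apply: continuous_subspaceT; exact: tensor_continuous.
  exists (fun p => derive1 psi p.1 * theta p.2), (fun p => psi p.1 * derive1 theta p.2); split.
  + by apply: continuous_subspaceT; exact: (tensor_continuous cdp ct).
  + by apply: continuous_subspaceT; exact: (tensor_continuous cp cdt).
  + by move=> p _; split; [exact: tensor_derive_x|exact: tensor_derive_t].
- by move=> t _ /=; rewrite psi0 mul0r.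
- by move=> x _ /=; rewrite thT mulr0.
(* [J] is arbitrary here and may be nonpositive, while the bound on the support has to be
   positive. *)
- exists (`|J| + 1); first by rewrite ltr_wpDl.
  pose K : set (R * R) := `[0, `|J| + 1] `*` `[0, T].
  have Kc : closed K by apply: compact_closed; [exact: norm_hausdorff|apply: compact_setX; exact: segment_compact].
  suff s : [set p | closed_strip T p /\ psi p.1 * theta p.2 != 0] `<=` K.
    by move=> p /(closureS s); rewrite -(closure_id K).1// => -[/=]; rewrite !in_itv.
  move=> p [[p1 p2] xp]; split; rewrite /= in_itv/= ?p1//=.
  rewrite leNgt; apply/negP => Jp; move: xp; rewrite psiJ ?mul0r ?eqxx//.
  by apply: ltW; apply: le_lt_trans (ler_norm J) _; lra.
Qed.

End tensor_test.

(** * The data of a weak solution *)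

Section solution_data.
Context {R : realType}.
Local Notation mu := (@lebesgue_measure R).
Local Notation mu2 := (mu \x mu)%E.
Implicit Types (x t : R) (p : R * R).

Lemma mu2_ae_imp (P Q : R * R -> Prop) : (forall p, P p -> Q p) ->
  {ae mu2, forall p, P p} -> {ae mu2, forall p, Q p}.
Proof. by move=> PQ; apply: filterS => //; exact: (ae_filter_ringOfSetsType mu2). Qed.

Lemma mu2_ae_imp2 (P1 P2 Q : R * R -> Prop) : (forall p, P1 p -> P2 p -> Q p) ->
  {ae mu2, forall p, P1 p} -> {ae mu2, forall p, P2 p} -> {ae mu2, forall p, Q p}.
Proof. by move=> PQ; apply: filterS2 => //; exact: (ae_filter_ringOfSetsType mu2). Qed.

Lemma Lfun_oo_ess_bound (A : set (R * R)) (w : R * R -> R) : measurable A -> w \_ A \in Lfun mu2 +oo%E ->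
  measurable_fun A w /\ exists M, {ae mu2, forall p, A p -> `|w p| <= M}.
Proof.
move=> mA; rewrite inE => /andP[]; rewrite !inE/= => mw.
rewrite /finite_norm unlock => wfin; split; first exact/(measurable_restrictT _ mA).
move: wfin; case: ifPn => [_|m0 _]; last first.
  exists 0; have E : mu2 [set: R * R] = 0%E by apply/eqP; rewrite eq_le measure_ge0 leNgt m0.
  by exists setT; split => //; exact: E.
set e := ess_sup _ _ => efin; have H : {ae mu2, forall p, (`|(w \_ A) p|%:E <= e)%E} by exact: ess_sup_ge.
exists (fine e); apply: mu2_ae_imp H => p /= H Ap; move: H; rewrite patchE mem_set//.
by move: efin; case: e => // r _; rewrite lee_fin.
Qed.

(** By Tonelli the slice integral [F t] is measurable, and off a null set it equals the squared
    norm, which itself may fail to be measurable. So [F] is put to [0] on that null set and then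
    compared pointwise. *)
Lemma square_integrable_bochner (T : R) (u0 g0 : R * R -> R) :
  measurable_fun (strip T) u0 -> measurable_fun (strip T) g0 ->
  {ae mu, forall t, 0 < t < T -> weak_derivative (slice u0 t) (slice g0 t)} ->
  {ae mu, forall t, 0 < t < T -> L2_halfline (slice u0 t) /\ L2_halfline (slice g0 t)} ->
  (\int[mu]_(t in `]0%R, T[) ((W12_norm (slice u0 t)) ^+ 2)%:E < +oo)%E ->
  mu2.-integrable setT (EFin \o (fun p => (u0 \_ (strip T)) p ^+ 2 + (g0 \_ (strip T)) p ^+ 2)).
Proof.
move=> mu0 mg0 wd L2 fin; have mH := @measurable_halfline R; have mSt := measurable_strip T.
set u := u0 \_ _; set g := g0 \_ _.
have mu' : measurable_fun setT u by exact/(measurable_restrictT _ mSt).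
have mg : measurable_fun setT g by exact/(measurable_restrictT _ mSt).
have uS p : ~ strip T p -> u p = 0 by move=> nS; rewrite /u patchE memNset.
have gS p : ~ strip T p -> g p = 0 by move=> nS; rewrite /g patchE memNset.
pose S p := u p ^+ 2 + g p ^+ 2; have S0 p : 0 <= S p by rewrite addr_ge0 ?sqr_ge0.
have mS : measurable_fun setT (EFin \o S) by apply/measurable_EFinP; apply: measurable_funD; exact: measurable_funX.
apply/integrable21ltyP => //; pose F t := (\int[mu]_x (S (x, t))%:E)%E.
have -> : (\int[mu]_t \int[mu]_x `|(EFin \o S) (x, t)| = \int[mu]_t F t)%E.
  by apply: eq_integral => t _; apply: eq_integral => x _; rewrite /= ger0_norm.
have mF : measurable_fun setT F.
  by apply: (@measurable_fun_fubini_tonelli_G _ _ _ _ R mu (EFin \o S)) => // p; rewrite /= lee_fin.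
have F0 t : (0 <= F t)%E by apply: integral_ge0 => x _; rewrite lee_fin.
have FW : {ae mu, forall t, 0 < t < T -> F t = ((W12_norm (slice u0 t)) ^+ 2)%:E}.
  move: wd L2; apply: mu_ae_imp2 => t wd L2 tT; have [/L2_halflineP[_ i1] /L2_halflineP[_ i2]] := L2 tT.
  rewrite (W12_norm_eq (wd tT)) sqr_sqrtr; last by apply: Rintegral_ge0 => x _; rewrite addr_ge0 ?sqr_ge0.
  rewrite EFin_Rintegral//; last exact: integrable_add.
  rewrite [RHS]integral_mkcond; apply: eq_integral => x _; rewrite patchE; case: ifPn => [/set_mem xH|/negP xH].
    by rewrite /S /u /g !patchE mem_set//; split.
  have nS : ~ strip T (x, t) by move=> [/= x0 _]; apply: xH; rewrite inE.
  by rewrite /S uS// gS// expr0n addr0.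
have -> : (\int[mu]_t F t = \int[mu]_(t in `]0%R, T[) F t)%E.
  rewrite [RHS]integral_mkcond; apply: eq_integral => t _; rewrite patchE; case: ifPn => // /negP tT.
  apply: integral0_eq => x _; have nS : ~ strip T (x, t) by move=> [/= _ t0]; apply: tT; rewrite inE/= in_itv.
  by rewrite /S uS// gS// expr0n addr0.
move: FW => [A [mA A0 AF]].
have -> : (\int[mu]_(t in `]0%R, T[) F t = \int[mu]_(t in `]0%R, T[) (F \_ (~` A)) t)%E.
  apply: ae_eq_integral => //; first exact: measurable_funTS.
    have mcA := measurableC mA; apply: measurable_funTS; apply/(measurable_restrictT _ mcA); exact: measurable_funTS.
  exists A; split => // t /= H; apply: contrapT => nA; apply: H => _.
  by rewrite patchE mem_set.
apply: le_lt_trans fin; apply: ge0_le_integral_nomeas => t; first by move=> _; rewrite patchE; case: ifP.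
rewrite /= in_itv/= patchE => tT; case: ifPn => [tA|_]; last by rewrite lee_fin sqr_ge0.
have : (0 < t < T -> F t = ((W12_norm (slice u0 t)) ^+ 2)%:E) by apply: contrapT => /AF; move/set_mem: tA.
by move=> ->.
Qed.

Variables (T : R) (D what m w0 : R -> R) (w : R * R -> R).
Hypotheses (T0 : 0 < T) (Dc : continuous D) (Dm : weak_derivative (fun x => D (what x)) m)
  (ws : weak_solution T D w0 what w).

Let u := (fun p => D (w p) - D (what p.1)) \_ (strip T).

(** A solution reduced to what uniqueness uses: [u] is [D(w) - D(what)] and [gam] its derivative in
    [x], both extended by [0] off the strip. Subtracting the datum makes the zero trace available,
    so that [u] is the primitive of [gam]. *)
Lemma weak_solution_data : measurable_fun (strip T) w /\ (exists M, {ae mu2, forall p, strip T p -> `|w p| <= M}) /\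
  exists gam : R * R -> R,
  [/\ measurable_fun setT u, measurable_fun setT gam, forall p, ~ strip T p -> gam p = 0,
     mu2.-integrable setT (EFin \o (fun p => u p ^+ 2 + gam p ^+ 2)) &
     {ae mu, forall t, 0 < t < T -> (forall J, mu.-integrable `[0, J] (EFin \o slice gam t)) /\
       {ae mu, forall x, 0 < x -> u (x, t) = prim (slice gam t) x}}] /\
  forall psi theta J, smooth psi -> smooth theta -> psi 0 = 0 ->
    (forall x, J <= x -> psi x = 0) -> theta T = 0 ->
    \int[mu]_(x in halfline) (w0 x * (psi x * theta 0)) +
    \int[mu2]_(p in strip T) (w p * (psi p.1 * derive1 theta p.2)) =
    \int[mu2]_(p in strip T) ((gam p + m p.1) * (derive1 psi p.1 * theta p.2)).
Proof.
have mS := measurable_strip T; have mH := @measurable_halfline R.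
have [Lw [Wu _ fin] [gw [mgw wd] wid]] := ws; have [mw wM] := Lfun_oo_ess_bound mS Lw.
have [[mo _ _] [mm _ _] _] := Dm.
split => //; split => //; exists ((fun p => gw p - m p.1) \_ (strip T)); set gam := _ \_ _.
have S1 p : strip T p -> gam p = gw p - m p.1 by move=> Sp; rewrite /gam patchE mem_set.
have S0 p : ~ strip T p -> gam p = 0 by move=> Sp; rewrite /gam patchE memNset.
have U1 p : strip T p -> u p = D (w p) - D (what p.1) by move=> Sp; rewrite /u patchE mem_set.
have U0 p : ~ strip T p -> u p = 0 by move=> Sp; rewrite /u patchE memNset.
have mst (h : R -> R) : measurable_fun halfline h -> measurable_fun (strip T) (fun p => h p.1).
  by move=> mh; apply: (measurable_comp mH _ mh); [move=> _ [p [p1 _] <-]|exact: measurable_funTS].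
have mu' : measurable_fun setT u.
  apply/(measurable_restrictT _ mS); apply: measurable_funB; last exact: (mst (fun x => D (what x))).
  by apply: measurableT_comp mw; exact: continuous_measurable_fun.
have mgam : measurable_fun setT gam.
  by apply/(measurable_restrictT _ mS); apply: measurable_funB => //; exact: mst.
pose u0 p := D (w p) - D (what p.1); pose g0 p := gw p - m p.1.
have mu0 : measurable_fun (strip T) u0 by apply/(measurable_restrictT _ mS).
have mg0 : measurable_fun (strip T) g0 by apply/(measurable_restrictT _ mS).
have wd0 : {ae mu, forall t, 0 < t < T -> weak_derivative (slice u0 t) (slice g0 t)}.
  by apply: mu_ae_imp wd => t wd tT; exact: weak_derivativeB (wd tT) Dm.
have facts : {ae mu, forall t, 0 < t < T -> [/\ L2_halfline (slice u0 t), L2_halfline (slice g0 t) &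
    {ae mu, forall x, 0 < x -> slice u0 t x = prim (slice g0 t) x}]}.
  by move: Wu wd0; apply: mu_ae_imp2 => t Wu wd0 tT; apply: W12_0_prim; [exact: Wu|exact: wd0].
split; first split => //.
- apply: square_integrable_bochner => //.
  by apply: mu_ae_imp facts => t ft /ft[].
- apply: mu_ae_imp facts => t ft tT; have [_ L2g up] := ft tT.
  have gE x : 0 < x -> slice gam t x = slice g0 t x by move=> x0; rewrite /slice S1//; split.
  have gi J : mu.-integrable `[0, J] (EFin \o slice gam t).
    suff E : slice gam t \_ halfline = slice g0 t \_ halfline by apply: L2_integrable_cc; rewrite /L2_halfline E.
    apply/funext => x; by rewrite !patchE; case: ifP => // /set_mem x0; rewrite gE.
  split=> //; apply: mu_ae_imp up => x up x0; rewrite U1; last by split.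
  rewrite -[LHS]/(slice u0 t x) up//; apply: prim_eq => //; first by move=> y y0 _; rewrite gE.
  exact: L2_integrable_cc.
move=> psi theta J sp st psi0 psiJ thT.
apply: etrans (etrans (wid _ (tensor_test_strip sp st psi0 psiJ thT)) _); first congr (_ + _).
  by apply: eq_Rintegral => p _; congr (_ * _); have [_ E] := tensor_derive_t psi p st; exact: esym E.
apply: eq_Rintegral => p /set_mem Sp; rewrite S1// subrK; congr (_ * _).
by have [_ E] := tensor_derive_x theta p sp; exact: E.
Qed.
End solution_data.

(** * Comparison of two weak solutions *)

Section uniqueness.
Context {R : realType}.
Local Notation mu := (@lebesgue_measure R).
Local Notation mu2 := (mu \x mu)%E.
Implicit Types (x t : R) (p : R * R).

(** A solution is bounded only almost everywhere, whereas the energy argument asks for a bound at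
    every point. Truncation provides it and, for [M > 0], preserves signs and zeros. *)
Definition clamp (M r : R) : R := Num.max (- M) (Num.min r M).

Lemma measurable_clamp M (E : set (R * R)) (f : R * R -> R) :
  measurable_fun E f -> measurable_fun E (fun p => clamp M (f p)).
Proof. by move=> mf; apply: measurable_maxr => //; exact: measurable_minr. Qed.

Lemma clamp_bound M r : 0 <= M -> `|clamp M r| <= M.
Proof.
by move=> M0; rewrite ler_norml le_max lexx/= ge_max ge_min lexx orbT andbT; lra.
Qed.

Lemma clampE M r : `|r| <= M -> clamp M r = r.
Proof. by rewrite /clamp ler_norml => /andP[r1 r2]; rewrite (min_idPl r2) (max_idPr r1). Qed.

Lemma clamp_ge0 M r : 0 <= M -> 0 <= r -> 0 <= clamp M r.
Proof. by move=> M0 r0; rewrite /clamp le_max le_min r0 M0 orbT. Qed.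

Lemma clamp_le0 M r : 0 <= M -> r <= 0 -> clamp M r <= 0.
Proof. by move=> M0 r0; rewrite /clamp ge_max ge_min r0/= andbT oppr_le0. Qed.

Lemma clamp_eq0 M r : 0 < M -> clamp M r = 0 -> r = 0.
Proof.
rewrite /clamp => M0; have [rM|rM] := leP r M; last by rewrite max_r; lra.
by have [rM'|rM'] := leP (- M) r; lra.
Qed.

Lemma sqrB_le (r s : R) : (r - s) ^+ 2 <= 2 * (r ^+ 2 + s ^+ 2).
Proof. by have := sqr_ge0 (r + s); nra. Qed.

Lemma norm_le_1sqr (r : R) : `|r| <= 1 + r ^+ 2.
Proof.
rewrite -[r ^+ 2]real_normK ?num_real//; have := sqr_ge0 (`|r| - 1).
by have := normr_ge0 r; set s := `|r|; nra.
Qed.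

Lemma tensor_box_bound (T J : R) (psi theta : R -> R) : continuous psi -> continuous theta ->
  (forall x, J < x -> psi x = 0) ->
  exists2 C, 0 <= C & forall p, strip T p ->
    `|psi p.1 * theta p.2| <= C * (\1_(`]0, J]) p.1 * \1_(`]0, T]) p.2).
Proof.
move=> cp ct pJ.
have [A A0 HA] := continuous_bounded_cc (continuous_subspaceT cp : {within `[0, J], continuous psi}).
have [B B0 HB] := continuous_bounded_cc (continuous_subspaceT ct : {within `[0, T], continuous theta}).
exists (A * B) => [|p [p1 /andP[p20 p2T]]]; first exact: mulr_ge0.
have [pJ'|pJ'] := leP p.1 J; last by rewrite pJ// mul0r normr0 !mulr_ge0// indicE.
rewrite !indicE !mem_set/= ?in_itv/= ?p1 ?p20 ?(ltW p2T)//.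
by rewrite !mulr1 normrM; apply: ler_pM => //; [apply: HA; rewrite (ltW p1)|apply: HB; rewrite (ltW p20) (ltW p2T)].
Qed.

Lemma tensor_strip_integrable (T J C : R) (f k : R * R -> R) :
  measurable_fun (strip T) f -> measurable_fun (strip T) k -> 0 <= C ->
  (forall p, strip T p -> `|k p| <= C * (\1_(`]0, J]) p.1 * \1_(`]0, T]) p.2)) ->
  (exists2 h : R * R -> R, mu2.-integrable (strip T) (EFin \o h) &
    exists2 B, 0 <= B & forall p, strip T p -> `|f p| <= B + h p) ->
  mu2.-integrable (strip T) (EFin \o (fun p => f p * k p)).
Proof.
move=> mf mk C0 kC [h hi [B B0 fB]]; have mS := measurable_strip T.
have bi : mu2.-integrable setT (EFin \o (fun p : R * R => \1_(`]0, J]) p.1 * \1_(`]0, T]) p.2)).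
  by apply: (@integrable_tensor _ _ _ _ R mu mu (\1_(`]0, J])) (\1_(`]0, T]))); exact: integrable_indic_oc.
have bi' : mu2.-integrable (strip T) (EFin \o (fun p : R * R => \1_(`]0, J]) p.1 * \1_(`]0, T]) p.2)).
  exact: integrableS bi.
have hn := integrable_norm hi.
apply: (@integrable_dom _ _ R mu2 (strip T) _ (fun p => C * (B * (\1_(`]0, J]) p.1 * \1_(`]0, T]) p.2) + `|h p|))) => //.
- exact: measurable_funM.
- apply: integrable_scale => //; apply: integrable_add => //; exact: integrable_scale.
move=> p Sp; have := kC p Sp; have := fB p Sp; set b : R := \1_(`]0, J]) p.1 * \1_(`]0, T]) p.2 => H1 H2.
have b01 : 0 <= b <= 1 by rewrite /b !indicE; do 2 case: (_ \in _); rewrite ?mulr1 ?mulr0 ?lexx ?ler01.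
case/andP: b01 => b0 b1; rewrite normrM.
apply: (@le_trans _ _ ((B + `|h p|) * (C * b))).
  by apply: ler_pM => //; apply: le_trans H1 _; rewrite lerD2l ler_norm.
have := normr_ge0 (h p); set r := `|h p| => r0.
rewrite mulrCA ler_wpM2l// mulrDl lerD2l ler_piMr//.
Qed.

Variables (T Mm : R) (D what m w0 : R -> R) (w1 w2 : R * R -> R).
Hypotheses (T0 : 0 < T) (Dc : continuous D) (DA : {homo D : x y / x <= y})
  (Dm : weak_derivative (fun x => D (what x)) m) (mM : forall x, 0 < x -> `|m x| <= Mm)
  (ws1 : weak_solution T D w0 what w1) (ws2 : weak_solution T D w0 what w2).

(** The energy argument asks for pointwise properties of the differences. These are secured by
    changes on null sets, truncation for [z] and removal of bad slices for [g], which the integrals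
    in the weak identity do not notice. *)
Theorem weak_solution_unique : ae_eq mu2 (strip T) w1 w2.
Proof.
have mS := measurable_strip T.
have [mw1 [[M1 HM1] [g1 [[mu1 mg1 g1S i1 s1] W1]]]] := weak_solution_data Dc Dm ws1.
have [mw2 [[M2 HM2] [g2 [[mu2' mg2 g2S i2 s2] W2]]]] := weak_solution_data Dc Dm ws2.
move: mu1 i1 s1; set u1 := _ \_ _ => mu1 i1 s1; move: mu2' i2 s2; set u2 := _ \_ _ => mu2' i2 s2.
pose M := `|M1| + `|M2| + 1; have M0 : 0 < M by rewrite ltr_wpDl// addr_ge0.
pose cl := clamp M.
pose z0 := (fun p => w1 p - w2 p) \_ (strip T); pose z p := cl (z0 p).
have z0S p : ~ strip T p -> z0 p = 0 by move=> nS; rewrite /z0 patchE memNset.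
have z0E p : strip T p -> z0 p = w1 p - w2 p by move=> Sp; rewrite /z0 patchE mem_set.
have mz0 : measurable_fun setT z0 by apply/(measurable_restrictT _ mS); exact: measurable_funB.
have mz : measurable_fun setT z by exact: measurable_clamp.
have zM p : `|z p| <= M by apply: clamp_bound; exact: ltW.
have zS p : ~ strip T p -> z p = 0 by move=> nS; rewrite /z z0S// /cl clampE ?normr0// ltW.
pose d p := u1 p - u2 p.
have dS p : ~ strip T p -> d p = 0 by move=> nS; rewrite /d /u1 /u2 !patchE memNset// subrr.
have dE p : strip T p -> d p = D (w1 p) - D (w2 p) by move=> Sp; rewrite /d /u1 /u2 !patchE mem_set//; ring.
have md : measurable_fun setT d by exact: measurable_funB.
have sum2 := integrable_add measurableT i1 i2.
have d2 : mu2.-integrable setT (EFin \o (fun p => d p ^+ 2)).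
  apply: (@integrable_dom _ _ R mu2 setT _ (fun p => 2 * ((u1 p ^+ 2 + g1 p ^+ 2) + (u2 p ^+ 2 + g2 p ^+ 2)))) => //.
  - exact: measurable_funX.
  - exact: integrable_scale.
  - by move=> p _; rewrite ger0_norm ?sqr_ge0//; apply: le_trans (sqrB_le _ _) _; rewrite ler_wpM2l// lerD// lerDl sqr_ge0.
pose h p := g1 p - g2 p.
have hS p : ~ strip T p -> h p = 0 by move=> nS; rewrite /h g1S// g2S// subrr.
have mh : measurable_fun setT h by exact: measurable_funB.
have h2 : mu2.-integrable setT (EFin \o (fun p => h p ^+ 2)).
  apply: (@integrable_dom _ _ R mu2 setT _ (fun p => 2 * ((u1 p ^+ 2 + g1 p ^+ 2) + (u2 p ^+ 2 + g2 p ^+ 2)))) => //.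
  - exact: measurable_funX.
  - exact: integrable_scale.
  - by move=> p _; rewrite ger0_norm ?sqr_ge0//; apply: le_trans (sqrB_le _ _) _; rewrite ler_wpM2l// lerD// lerDr sqr_ge0.
(* [A] is a null set containing every [x] for which [h (x, .)] is not square integrable. Setting
   [g = 0] over [A] gives square integrability in time for every [x], and [g] still equals [h]
   almost everywhere. *)
have [A [mA A0 HA]] := ae_integrable1 h2.
have mcA := measurableC mA.
pose g p := \1_(~` A) p.1 * h p.
have gA p : ~ A p.1 -> g p = h p by move=> nA; rewrite /g indicE mem_set ?mul1r.
have gA' p : A p.1 -> g p = 0 by move=> Ap; rewrite /g indicE memNset ?mul0r.
have mg : measurable_fun setT g.
  apply: measurable_funM => //; apply: (measurableT_comp (f := \1_(~` A) : R -> R)) => //; exact: measurable_indic.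
have gS p : ~ strip T p -> g p = 0 by move=> nS; rewrite /g hS// mulr0.
have gh p : `|g p| <= `|h p|.
  by rewrite /g normrM indicE; case: (_ \in _); rewrite ?normr1 ?mul1r// normr0 mul0r.
have g2h p : g p ^+ 2 <= h p ^+ 2 by rewrite -[g p ^+ 2]real_normK ?num_real// -[h p ^+ 2]real_normK ?num_real// lerXn2r ?nnegrE.
have gi2 : mu2.-integrable setT (EFin \o (fun p => g p ^+ 2)).
  apply: (@integrable_dom _ _ R mu2 setT _ (fun p => h p ^+ 2)) => //; first exact: measurable_funX.
  by move=> p _; rewrite ger0_norm ?sqr_ge0.
have gx2 x : mu.-integrable setT (EFin \o (fun t => g (x, t) ^+ 2)).
  have [Ax|nA] := pselect (A x).
    rewrite (_ : (fun t => _) = cst 0); last by apply/funext => t; rewrite gA' ?expr0n.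
    exact: integrable0.
  rewrite (_ : (fun t => _) = (fun t => h (x, t) ^+ 2)); last by apply/funext => t; rewrite gA.
  by apply: contrapT => H; apply: nA; apply: HA => H'; apply: H; exact: H'.
have g_slice t : {ae mu, forall x, h (x, t) = g (x, t)}.
  by exists A; split => // x /= H; apply: contrapT => nA; apply: H; rewrite gA.
have gh_ae : {ae mu2, forall p, g p = h p}.
  have fi : mu2.-integrable setT (EFin \o (fun p => (g p - h p) ^+ 2)).
    apply: (@integrable_dom _ _ R mu2 setT _ (fun p => 2 * (h p ^+ 2 + h p ^+ 2))) => //.
    - by apply: measurable_funX; exact: measurable_funB.
    - by apply: integrable_scale => //; exact: integrable_add.
    - move=> p _; rewrite ger0_norm ?sqr_ge0//; apply: le_trans (sqrB_le _ _) _.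
      by rewrite ler_wpM2l// lerD2r; exact: g2h.
  have H : ae_eq mu2 setT (fun p => (g p - h p) ^+ 2) (cst 0).
    apply: Rintegral0_ae_eq0 => //; first by move=> p _; exact: sqr_ge0.
    apply: ae_slice2_int0 => //; apply: aeW => t.
    by apply: mu_ae_imp (g_slice t) => x ->; rewrite subrr expr0n.
  by apply: mu2_ae_imp H => p /(_ I)/eqP; rewrite /= sqrf_eq0 subr_eq0 => /eqP.
have zd_ge0 p : 0 <= z p * d p.
  have [Sp|nS] := pselect (strip T p); last by rewrite zS// mul0r.
  rewrite /z z0E// dE//; have [w12|/ltW w12] := leP (w1 p) (w2 p).
    by apply: mulr_le0; [apply: clamp_le0; [exact: ltW|]; rewrite subr_le0|rewrite subr_le0; exact: DA].
  by apply: mulr_ge0; [apply: clamp_ge0; [exact: ltW|]; rewrite subr_ge0|rewrite subr_ge0; exact: DA].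
have zd_eq0 p : z p * d p = 0 -> d p = 0.
  move=> /eqP; rewrite mulf_eq0 => /orP[/eqP|/eqP//].
  have [Sp|nS] := pselect (strip T p); last by move=> _; exact: dS.
  by move=> /(clamp_eq0 M0); rewrite z0E// dE// => /eqP; rewrite subr_eq0 => /eqP ->; rewrite subrr.
have dg : {ae mu, forall t, 0 < t < T -> {ae mu, forall x, 0 < x -> d (x, t) = prim (fun y => g (y, t)) x}}.
  move: s1 s2; apply: mu_ae_imp2 => t s1 s2 tT; have [ig1 e1] := s1 tT; have [ig2 e2] := s2 tT.
  move: e1 e2; apply: mu_ae_imp2 => x e1 e2 x0; rewrite /d e1// e2// -primB//.
  apply: (@ae_eq_Rintegral _ _ R mu) => //.
  - by apply: measurable_funTS; exact: measurableT_comp mh (pair2_measurable t).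
  - by apply: measurable_funTS; exact: measurableT_comp mg (pair2_measurable t).
  - by apply: mu_ae_imp (g_slice t) => y gy _.
have zz0 : {ae mu2, forall p, strip T p -> z p = w1 p - w2 p}.
  move: HM1 HM2; apply: mu2_ae_imp2 => p H1 H2 Sp; rewrite /z z0E// /cl clampE//.
  apply: le_trans (ler_normB _ _) _; rewrite -[leLHS]addr0; apply: lerD => //.
  by apply: lerD; [exact: le_trans (H1 Sp) (ler_norm _)|exact: le_trans (H2 Sp) (ler_norm _)].
have weak psi theta J : smooth psi -> smooth theta -> psi 0 = 0 ->
    (forall x, J <= x -> psi x = 0) -> theta T = 0 ->
    \int[mu2]_p (z p * (psi p.1 * derive1 theta p.2)) =
    \int[mu2]_p (g p * (derive1 psi p.1 * theta p.2)).
  move=> sp st psi0 psiJ thT; have cp := smooth_continuous sp; have ct := smooth_continuous st.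
  have cdp := smooth_continuous (smooth_derive1 sp); have cdt := smooth_continuous (smooth_derive1 st).
  have psiJ' x : J < x -> psi x = 0 by move=> /ltW; exact: psiJ.
  have dpsiJ x : J < x -> derive1 psi x = 0.
    move=> Jx; apply: isd_derive1; apply: near_eq_is_derive (isd_cst x 0).
    by near=> y; rewrite psiJ'//; near: y; exact: lt_nbhsr.
  pose k1 p := psi p.1 * derive1 theta p.2; pose k2 p := derive1 psi p.1 * theta p.2.
  have [C1 C10 K1] : exists2 C, 0 <= C & forall p, strip T p ->
      `|k1 p| <= C * (\1_(`]0, J]) p.1 * \1_(`]0, T]) p.2) := tensor_box_bound T cp cdt psiJ'.
  have [C2 C20 K2] : exists2 C, 0 <= C & forall p, strip T p ->
      `|k2 p| <= C * (\1_(`]0, J]) p.1 * \1_(`]0, T]) p.2) := tensor_box_bound T cdp ct dpsiJ.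
  have mt (a b : R -> R) : continuous a -> continuous b -> measurable_fun setT (fun p => a p.1 * b p.2).
    move=> ca cb; apply: measurable_funM.
      by apply: (measurableT_comp (continuous_measurable_fun ca)).
    by apply: (measurableT_comp (continuous_measurable_fun cb)).
  have mk1 : measurable_fun setT k1 by exact: mt.
  have mk2 : measurable_fun setT k2 by exact: mt.
  have mk1' : measurable_fun (strip T) k1 by exact: measurable_funTS.
  have mk2' : measurable_fun (strip T) k2 by exact: measurable_funTS.
  have off (f k : R * R -> R) : (forall p, ~ strip T p -> f p = 0) ->
      \int[mu2]_p (f p * k p) = \int[mu2]_(p in strip T) (f p * k p).
    move=> f0; rewrite [RHS]Rintegral_mkcond; apply: eq_Rintegral => p _; rewrite patchE.
    by case: ifPn => // /negP nS; rewrite f0 ?mul0r// => Sp; apply: nS; rewrite inE.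
  (* Truncated solutions are bounded, hence integrable against the compactly supported [k1], and
     they agree almost everywhere with the original ones; this permits subtracting the two
     identities. *)
  have bounded_part (w : R * R -> R) (Mw : R) : Mw <= M -> measurable_fun (strip T) w ->
      {ae mu2, forall p, strip T p -> `|w p| <= Mw} ->
      [/\ mu2.-integrable (strip T) (EFin \o (fun p => cl (w p) * k1 p)),
          {ae mu2, forall p, strip T p -> cl (w p) = w p} &
          \int[mu2]_(p in strip T) (w p * k1 p) = \int[mu2]_(p in strip T) (cl (w p) * k1 p)].
    move=> MwM mw wM; have mclw := measurable_clamp M mw.
    have e : {ae mu2, forall p, strip T p -> cl (w p) = w p}.
      by apply: mu2_ae_imp wM => p wp Sp; rewrite /cl clampE// (le_trans (wp Sp)).
    split => //.
    - apply: (tensor_strip_integrable mclw mk1' C10 K1); exists (cst 0); first exact: integrable0.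
      by exists M => [|p _]; [exact: ltW|rewrite addr0; apply: clamp_bound; exact: ltW].
    - apply: (@ae_eq_Rintegral _ _ R mu2) => //; [exact: measurable_funM|exact: measurable_funM|].
      by apply: mu2_ae_imp e => p ep Sp; rewrite ep.
  have M1M : M1 <= M by apply: le_trans (ler_norm _) _; rewrite /M -addrA lerDl addr_ge0.
  have M2M : M2 <= M by apply: le_trans (ler_norm _) _; rewrite /M (addrC `|M1|) -addrA lerDl addr_ge0.
  have [j1 e1 E1] := bounded_part w1 M1 M1M mw1 HM1.
  have [j2 e2 E2] := bounded_part w2 M2 M2M mw2 HM2.
  have [_ [mm _ _] _] := Dm.
  have mms : measurable_fun (strip T) (fun p => m p.1).
    have mH := @measurable_halfline R; apply: (measurable_comp mH _ mm); [by move=> _ [p [p1 _] <-]; exact: p1|exact: measurable_funTS].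
  have Mm0 : 0 <= Mm by exact: le_trans (normr_ge0 _) (mM ltr01).
  have flux_part (u q : R * R -> R) : measurable_fun setT q ->
      mu2.-integrable setT (EFin \o (fun p => u p ^+ 2 + q p ^+ 2)) ->
      mu2.-integrable (strip T) (EFin \o (fun p => (q p + m p.1) * k2 p)).
    move=> mq iq; apply: (@tensor_strip_integrable T J C2 _ k2) => //.
      by apply: measurable_funD; [exact: measurable_funTS|exact: mms].
    exists (fun p => u p ^+ 2 + q p ^+ 2); first exact: integrableS iq.
    exists (1 + Mm) => [|p [p1 _]]; first by rewrite addr_ge0.
    apply: le_trans (ler_normD _ _) _; apply: (@le_trans _ _ ((1 + q p ^+ 2) + Mm)).
      by apply: lerD; [exact: norm_le_1sqr|exact: mM].
    by rewrite addrAC lerD2l lerDr sqr_ge0.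
  have f1 := flux_part u1 g1 mg1 i1; have f2 := flux_part u2 g2 mg2 i2.
  have L : \int[mu2]_p (z p * k1 p) = \int[mu2]_(p in strip T) (w1 p * k1 p) - \int[mu2]_(p in strip T) (w2 p * k1 p).
    rewrite off// E1 E2 -RintegralB//; apply: (@ae_eq_Rintegral _ _ R mu2) => //.
    - by apply: measurable_funM => //; exact: measurable_funTS.
    - by apply: measurable_funB; apply: measurable_funM => //; exact: measurable_clamp.
    have e12 : {ae mu2, forall p, strip T p -> cl (w1 p) = w1 p /\ cl (w2 p) = w2 p}.
      by move: e1 e2; apply: mu2_ae_imp2 => p e1 e2 Sp; split; [exact: e1|exact: e2].
    move: e12 zz0; apply: mu2_ae_imp2 => p e12 zz Sp; have [-> ->] := e12 Sp.
    by rewrite zz// mulrBl.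
  have Q : \int[mu2]_p (g p * k2 p) = \int[mu2]_(p in strip T) ((g1 p + m p.1) * k2 p) - \int[mu2]_(p in strip T) ((g2 p + m p.1) * k2 p).
    transitivity (\int[mu2]_p (h p * k2 p)).
      apply: (@ae_eq_Rintegral _ _ R mu2) => //; [exact: measurable_funM|exact: measurable_funM|].
      by apply: mu2_ae_imp gh_ae => p ->.
    rewrite off// -RintegralB//; apply: eq_Rintegral => p _; rewrite /h; ring.
  apply: (etrans L); apply: (etrans _ (esym Q)).
  (* [B] is the term with the initial datum. It is the same for both solutions, so it cancels
     without being evaluated. *)
  have [B [B1 B2]] : exists B,
      B + \int[mu2]_(p in strip T) (w1 p * k1 p) = \int[mu2]_(p in strip T) ((g1 p + m p.1) * k2 p) /\
      B + \int[mu2]_(p in strip T) (w2 p * k1 p) = \int[mu2]_(p in strip T) ((g2 p + m p.1) * k2 p).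
    by eexists; split; [exact: W1 psi theta J sp st psi0 psiJ thT|exact: W2 psi theta J sp st psi0 psiJ thT].
  by rewrite -B1 -B2 opprD addrACA subrr add0r.
have := energy_uniqueness T0 mz md mg zM zS dS gS d2 gi2 gx2 zd_ge0 zd_eq0 dg weak.
move: zz0; apply: mu2_ae_imp2 => p zz z00 Sp; apply/eqP; rewrite -subr_eq0 -zz// z00//.
Unshelve. all: by end_near. Qed.

End uniqueness.

Theorem theorem4p7 (R : realType) (T U0 V0 eps : R) (phi what : R -> R)
    (T_gt0 : 0 < T) (U0_gt0 : 0 < U0) (V0_gt0 : 0 < V0) (eps_ge0 : 0 <= eps)
    (phi_adm : admissible phi)
    (what_smooth : smooth_halfline what) (what0 : what 0 = U0)
    (what_far : forall x, 1 < x -> what x = - V0) :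
  exists2 w : R * R -> R,
    weak_solution T (Dfun eps phi) (fun=> - V0) what w &
    forall w' : R * R -> R,
      weak_solution T (Dfun eps phi) (fun=> - V0) what w' ->
      ae_eq (lebesgue_measure \x lebesgue_measure)%E (strip T) w' w.
Proof.
have [w ws] := weak_solution_exists T_gt0 U0_gt0 V0_gt0 eps_ge0 phi_adm what_smooth what0 what_far.
exists w => // w' ws'.
have Dd (s : R) : is_derive s 1 (Dfun eps phi) (2 * diffusion_rate eps phi s) by exact: Dfun_derive.
have Dc : continuous (Dfun eps phi) by move=> s; exact: isd_cont (Dd s).
have kc : continuous (diffusion_rate eps phi) by exact: diffusion_rate_cont.
have [m Dm [Mm mM]] := bounded_weak_derivative_datum Dd kc what_smooth what0 what_far.
exact: (weak_solution_unique T_gt0 Dc (Dfun_homo eps_ge0 phi_adm) Dm mM ws' ws).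
Qed.
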